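(* Let $\kappa$ be a Mahlo cardinal and let $G$ be a $\mathrm{Coll}(\omega,<\kappa)$-generic filter over $\mathbf{V}$. Let $E$ be a vector space over $\mathbb{F}_2$ of dimension $\aleph_0$ with a fixed Hamel basis $(e_n)_{n<\omega}$. If $\mathcal{H}\in\mathbf{V}[G]$ is a selective coideal on $E^{[\infty]}$ and $\mathcal{X}\in L(\mathbb{R})^{\mathbf{V}[G]}$ is a subset of $E^{[\infty]}$, then $\mathcal{X}$ is $\mathcal{H}$-Ramsey.
   Context: $\mathrm{Coll}(\omega,<\kappa)$ is the Lévy collapse. For $x=\sum_n\lambda_n e_n$, $\mathrm{supp}(x)=\{n:\lambda_n\ne0\}$; for nonzero $x,y$, $x<y$ iff $\max\mathrm{supp}(x)<\min\mathrm{supp}(y)$. A block sequence is a $<$-increasing sequence of nonzero vectors; $E^{[\infty]}$ ($E^{[<\infty]}$) is the set of infinite (finite) block sequences. For a block sequence $A=(x_n)$, $\langle A\rangle=\mathrm{span}\{x_n\}$, $r_n(A)=(x_i)_{i<n}$, $A/N=(x_n)_{n\ge N}$. For $A,B\in E^{[\infty]}$: $A\le B$ iff $\langle A\rangle\subseteq\langle B\rangle$; $A\le^*B$ iff $A/N\le B$ for some $N$. For $d$ a finite-dimensional... (not needed). A semicoideal is a set $\mathcal{H}\subseteq E^{[\infty]}$ that is $\le^*$-upward closed; $\mathcal{H}\restriction A=\{B\in\mathcal{H}:B\le A\}$. $\mathcal{H}$ is a coideal if it is a semicoideal and for every $Y\subseteq E$ and $A\in\mathcal{H}$ there is $B\in\mathcal{H}\restriction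 A$ with $\langle B\rangle\subseteq Y$ or $\langle B\rangle\subseteq E\setminus Y$. For $A\in E^{[\infty]}$ and a finite block sequence $a$, $d_A(a)=\min\{N:\max\mathrm{supp}(a)<\min\mathrm{supp}(y)\text{ for every term }y\text{ of }A/N\}$, where $\mathrm{supp}(a)$ is the union of the supports of the terms of $a$. If $A\in\mathcal{H}$ and $(A_n)_{n<\omega}$ is a $\le$-decreasing sequence in $\mathcal{H}$ with $A_0\le A$, then $B\in\mathcal{H}\restriction A$ diagonalises $(A_n)$ within $A$ if $B/n\le A_{d_A(r_n(B))}$ for all $n$; $\mathcal{H}$ is selective if every such sequence has such a diagonalisation in $\mathcal{H}$ (for every $A\in\mathcal{H}$). A selective coideal is a coideal that is selective. For $A\in E^{[\infty]}$, $E^{[<\infty]}\restriction A$ is the set of finite block sequences $a$ with $\langle a\rangle\subseteq\langle A\rangle$; for such $a$, $[a,A]=\{B\in E^{[\infty]}:B\le A\text{ and } a=r_n(B)\text{ for some }n\}$ and $\mathcal{H}\restriction[a,A]=\mathcal{H}\cap[a,A]$. A set $\mathcal{X}\subseteq E^{[\infty]}$ is $\mathcal{H}$-Ramsey if for every $A\in\mathcal{H}$ and $a\in E^{[<\infty]}\restriction A$ there is $B\in\mathcal{H}\restriction[a,A]$ with $[a,B]\subseteq\mathcal{X}$ or $[a,B]\subseteq E^{[\infty]}\setminus\mathcal{X}$. *)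

(* Defs.v *)
(* ZFC theorems about V[G] are stated for an arbitrary (possibly ill-founded)
   first-order model N of ZFC playing the role of V[G], with a transitive
   submodel playing the role of V.  Every set-theoretic notion below is a
   first-order property whose quantifiers range over a given structure. *)

Set Implicit Arguments.
Unset Strict Implicit.

Record structure : Type := Structure {
  carrier :> Type;
  mem : carrier -> carrier -> Prop
}.

Notation "x ∈ y" := (mem x y) (at level 70, no associativity).

Definition restrict (S : structure) (C : S -> Prop) : structure :=
  @Structure {x : S | C x} (fun a b => proj1_sig a ∈ proj1_sig b).

(* De Bruijn formulas of the language of set theory. *)
Inductive formula : Type :=
| fMem (i j : nat)
| fEq (i j : nat)
| fNot (f : formula)
| fAnd (f g : formula)
| fAll (f : formula).

Definition scons (T : Type) (x : T) (v : nat -> T) (i : nat) : T :=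
  match i with 0 => x | S j => v j end.

Fixpoint sat (S : structure) (v : nat -> S) (f : formula) : Prop :=
  match f with
  | fMem i j => v i ∈ v j
  | fEq i j => v i = v j
  | fNot g => ~ sat v g
  | fAnd g h => sat v g /\ sat v h
  | fAll g => forall x : S, sat (scons x v) g
  end.

Section SetTheory.
Variable S : structure.
Implicit Types a b c d f g k m n p q s t u v w x y z : S.

Definition subset x y := forall z, z ∈ x -> z ∈ y.
Definition is_empty x := forall z, ~ z ∈ x.
Definition is_succ y x := forall z, z ∈ y <-> z ∈ x \/ z = x.
Definition is_power q a := forall z, z ∈ q <-> subset z a.
Definition is_upair u x y := forall z, z ∈ u <-> z = x \/ z = y.
Definition is_opair p x y :=
  exists u v, is_upair u x x /\ is_upair v x y /\ is_upair p u v.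

Definition ax_extensionality :=
  forall x y, (forall z, z ∈ x <-> z ∈ y) -> x = y.
Definition ax_foundation :=
  forall a, (exists x, x ∈ a) -> exists x, x ∈ a /\ forall y, y ∈ a -> ~ y ∈ x.
Definition ax_pairing := forall x y, exists u, is_upair u x y.
Definition ax_union :=
  forall a, exists u, forall z, z ∈ u <-> exists y, y ∈ a /\ z ∈ y.
Definition ax_power := forall a, exists q, is_power q a.
Definition ax_infinity :=
  exists w, (exists z, is_empty z /\ z ∈ w) /\
    forall x, x ∈ w -> exists y, is_succ y x /\ y ∈ w.
Definition ax_separation :=
  forall (phi : formula) (e : nat -> S) a,
    exists b, forall x, x ∈ b <-> x ∈ a /\ sat (scons x e) phi.
Definition ax_replacement :=
  forall (phi : formula) (e : nat -> S) a,
    (forall x, x ∈ a -> exists! y, sat (scons y (scons x e)) phi) ->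
    exists b, forall y,
      y ∈ b <-> exists x, x ∈ a /\ sat (scons y (scons x e)) phi.
Definition ax_choice :=
  forall a,
    (forall x, x ∈ a -> exists z, z ∈ x) ->
    (forall x y z, x ∈ a -> y ∈ a -> z ∈ x -> z ∈ y -> x = y) ->
    exists c, forall x, x ∈ a -> exists! z, z ∈ x /\ z ∈ c.

Definition ZF :=
  ax_extensionality /\ ax_foundation /\ ax_pairing /\ ax_union /\ ax_power /\
  ax_infinity /\ ax_separation /\ ax_replacement.
Definition ZFC := ZF /\ ax_choice.

Definition app f x y := exists p, is_opair p x y /\ p ∈ f.
Definition is_fun f a b :=
  (forall p, p ∈ f -> exists x y, x ∈ a /\ y ∈ b /\ is_opair p x y) /\
  (forall x, x ∈ a -> exists! y, app f x y).
Definition is_surj f a b :=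
  is_fun f a b /\ forall y, y ∈ b -> exists x, app f x y.

Definition transitive x := forall y, y ∈ x -> subset y x.
Definition ordinal x := transitive x /\ forall y, y ∈ x -> transitive y.
Definition limit_ordinal x :=
  ordinal x /\ (exists y, y ∈ x) /\
  forall y, y ∈ x -> exists z, is_succ z y /\ z ∈ x.
Definition is_omega w :=
  limit_ordinal w /\ forall x, x ∈ w -> ~ limit_ordinal x.
Definition natural n := exists w, is_omega w /\ n ∈ w.
Definition finite x := exists n f, natural n /\ is_surj f n x.

Definition cardinal k :=
  ordinal k /\ forall a, a ∈ k -> ~ exists f, is_surj f a k.
Definition regular k :=
  cardinal k /\ limit_ordinal k /\
  forall a f, a ∈ k -> is_fun f a k ->
    exists b, b ∈ k /\ forall x y, app f x y -> y ∈ b.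
Definition strong_limit k :=
  forall a, a ∈ k -> exists q b f, is_power q a /\ b ∈ k /\ is_surj f b q.
Definition inaccessible k :=
  regular k /\ strong_limit k /\ exists w, is_omega w /\ w ∈ k.
Definition club c k :=
  subset c k /\
  (forall a, a ∈ k -> exists b, b ∈ c /\ a ∈ b) /\
  (forall a, a ∈ k -> limit_ordinal a ->
     (forall x, x ∈ a -> exists y, y ∈ c /\ y ∈ a /\ x ∈ y) -> a ∈ c).
Definition Mahlo k :=
  inaccessible k /\ forall c, club c k -> exists a, a ∈ c /\ regular a.

(* Conditions of Coll(ω,<k): finite partial functions p on k × ω with
   p(alpha, n) < alpha, ordered by reverse inclusion. *)
Definition collapse k p :=
  finite p /\
  (forall z, z ∈ p -> exists alpha n beta q,
     alpha ∈ k /\ natural n /\ beta ∈ alpha /\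
     is_opair q alpha n /\ is_opair z q beta) /\
  (forall x y z, app p x y -> app p x z -> y = z).
Definition collapse_dense k D :=
  (forall p, p ∈ D -> collapse k p) /\
  (forall p, collapse k p -> exists q, q ∈ D /\ subset p q).

(* x is the evaluation t_G = { s_G : (s,p) ∈ t for some p ∈ G } of the name t,
   witnessed by a function f defined on a transitive set d containing t. *)
Definition is_val G t x :=
  exists d b f,
    transitive d /\ t ∈ d /\ is_fun f d b /\
    (forall s y, app f s y -> forall z,
       z ∈ y <-> exists r p q, p ∈ G /\ is_opair q r p /\ q ∈ s /\ app f r z) /\
    app f t x.

End SetTheory.

Section Classes.
Variable N : structure.

Definition transitive_class (C : N -> Prop) :=
  forall x y : N, C y -> x ∈ y -> C x.

(* L(R) is the smallest transitive model of ZF containing all ordinals and all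
   reals (subsets of ω). *)
Definition in_LR (x : N) :=
  forall W : N -> Prop,
    transitive_class W ->
    ZF (restrict W) ->
    (forall a : N, ordinal a -> W a) ->
    (forall w r : N, is_omega w -> subset r w -> W r) ->
    W x.

Variable V : N -> Prop.

Definition collapse_generic (k : restrict V) (G : N) :=
  (forall p : N, p ∈ G -> exists c : restrict V, proj1_sig c = p /\ collapse k c) /\
  (exists p : N, p ∈ G) /\
  (forall p q : restrict V, proj1_sig p ∈ G -> collapse k q -> subset q p ->
     proj1_sig q ∈ G) /\
  (forall p q : N, p ∈ G -> q ∈ G ->
     exists r : N, r ∈ G /\ subset p r /\ subset q r) /\
  (forall D : restrict V, collapse_dense k D ->
     exists p : restrict V, p ∈ D /\ proj1_sig p ∈ G).

(* N = V[G] *)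
Definition is_extension (G : N) :=
  ZFC N /\ transitive_class V /\ ZFC (restrict V) /\
  forall x : N, exists t : N, V t /\ is_val G t x.

End Classes.

Section BlockSequences.
Variable S : structure.
Variables E add e : S.
Implicit Types a b c d f g k m n p q s t u v w x y z A B C F H X Y : S.

Definition plus x y z := exists p, is_opair p x y /\ app add p z.
Definition is_zero z := z ∈ E /\ plus z z z.

(* Over F_2 the scalar action is determined by the group: 0x = 0, 1x = x, and
   it is a vector space structure iff x + x = 0 for all x. *)
Definition F2_space :=
  (forall p, p ∈ add -> exists x y q z,
     x ∈ E /\ y ∈ E /\ z ∈ E /\ is_opair q x y /\ is_opair p q z) /\
  (forall x y, x ∈ E -> y ∈ E -> exists! z, plus x y z) /\
  (forall x y z, plus x y z -> plus y x z) /\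
  (forall x y z u v w, plus x y u -> plus u z w -> plus y z v -> plus x v w) /\
  exists o, o ∈ E /\ (forall x, x ∈ E -> plus x o x) /\
            (forall x, x ∈ E -> plus x x o).

(* x = sum of e_n for n in the finite set s ⊆ ω; g is the sequence of partial
   sums and k a bound for s. *)
Definition is_sum s x :=
  exists w g k,
    is_omega w /\ is_fun g w E /\ k ∈ w /\ subset s k /\
    (forall n u, is_empty n -> app g n u -> is_zero u) /\
    (forall n m u v, n ∈ w -> is_succ m n -> app g n u -> app g m v ->
       (n ∈ s -> exists b, app e n b /\ plus u b v) /\
       (~ n ∈ s -> v = u)) /\
    app g k x.

Definition hamel_basis :=
  (exists w, is_omega w /\ is_fun e w E) /\
  forall x, x ∈ E -> exists! s, is_sum s x.

Definition in_supp n x := exists s, is_sum s x /\ n ∈ s.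
(* max supp(x) < min supp(y), for nonzero x and y *)
Definition block_lt x y :=
  forall m n, in_supp m x -> in_supp n y -> m ∈ n.

Definition block_seq d A :=
  is_fun A d E /\
  (forall n x, app A n x -> ~ is_zero x) /\
  (forall m n x y, m ∈ n -> app A m x -> app A n y -> block_lt x y).
Definition inf_block A := exists w, is_omega w /\ block_seq w A.
Definition fin_block a := exists n, natural n /\ block_seq n a.

Definition subspace Y :=
  subset Y E /\ (forall z, is_zero z -> z ∈ Y) /\
  (forall x y z, x ∈ Y -> y ∈ Y -> plus x y z -> z ∈ Y).
Definition span (P : S -> Prop) x :=
  forall Y, subspace Y -> (forall y, P y -> y ∈ Y) -> x ∈ Y.

Definition terms A x := exists n, app A n x.
(* the terms of A/k *)
Definition tail A k x := exists n, ~ n ∈ k /\ app A n x.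
(* a is r_n(A) *)
Definition is_initial a A n :=
  forall p, p ∈ a <-> p ∈ A /\ exists i x, i ∈ n /\ is_opair p i x.

Definition span_le (P Q : S -> Prop) := forall x, span P x -> span Q x.
Definition le A B := span_le (terms A) (terms B).
Definition le_star A B :=
  exists k, natural k /\ span_le (tail A k) (terms B).

Definition semicoideal H :=
  (forall A, A ∈ H -> inf_block A) /\
  (forall A B, A ∈ H -> inf_block B -> le_star A B -> B ∈ H).

(* Homogeneity is required of the nonzero vectors of <B> only: 0 lies in every
   span, so Y = {0} would otherwise rule out every nonempty H. *)
Definition coideal H :=
  semicoideal H /\
  forall Y A, subset Y E -> A ∈ H ->
    exists B, B ∈ H /\ le B A /\
      ((forall x, span (terms B) x -> ~ is_zero x -> x ∈ Y) \/
       (forall x, span (terms B) x -> ~ is_zero x -> ~ x ∈ Y)).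

Definition beyond A a k :=
  natural k /\ forall x y, terms a x -> tail A k y -> block_lt x y.
(* k = d_A(a) *)
Definition is_depth A a k :=
  beyond A a k /\ forall m, beyond A a m -> ~ m ∈ k.

Definition diagonalises H A F B :=
  B ∈ H /\ le B A /\
  forall n a k C, natural n -> is_initial a B n -> is_depth A a k -> app F k C ->
    span_le (tail B n) (terms C).
Definition selective H :=
  forall A F,
    A ∈ H ->
    (exists w, is_omega w /\ is_fun F w H) ->
    (forall m n B C, m ∈ n -> app F m B -> app F n C -> le C B) ->
    (forall n B, is_empty n -> app F n B -> le B A) ->
    exists B, diagonalises H A F B.
Definition selective_coideal H := coideal H /\ selective H.

(* B ∈ [a,A] *)
Definition in_box a A B :=
  inf_block B /\ le B A /\ exists n, natural n /\ is_initial a B n.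

Definition is_Ramsey H X :=
  forall A a, A ∈ H -> fin_block a -> span_le (terms a) (terms A) ->
    exists B, B ∈ H /\ in_box a A B /\
      ((forall C, in_box a B C -> C ∈ X) \/
       (forall C, in_box a B C -> ~ C ∈ X)).

End BlockSequences.

(* Main.v *)
(* Let SW be the class of all values of names of V at stages (Q,y), where Q is a poset of
   V_kappa^V and y in N is V-generic for Q.  Forcing over the site of these stages shows that
   SW is a transitive model of ZF; it contains all ordinals and all reals, hence X.

   Replacing vectors by their supports, H becomes a family of subsets of the set FIN of finite
   nonempty sets of naturals and X a set X' of infinite block sets, still in SW.  Mahloness
   gives a regular alpha < kappa such that the trace of H on V[G_alpha] belongs to V[G_alpha]
   and is selective there.  Let T be the iteration of Coll(omega,<alpha) and the Mathias forcing
   of this trace.  V has only countably many dense subsets of T as seen from N, so selectivity of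
   H yields B in H all of whose block subsets C are T-generic over V.  By the truth lemma of
   the site "C in X'" is decided by a condition compatible with C, so X' is relatively open on
   the block subsets of B, and the open Ramsey theorem (accepting and rejecting finite blocks)
   finishes the proof. *)
From Stdlib Require Import Classical ClassicalEpsilon FunctionalExtensionality PropExtensionality Setoid Arith Lia.
Require Import Defs.

Set Implicit Arguments.
Unset Strict Implicit.

Notation fext := functional_extensionality.
Notation cid := constructive_indefinite_description.

(** [in_LR] asks for membership in every transitive model of ZF with all ordinals and reals, so one
    such model made of names suffices. Its members come from different generic objects, hence
    forcing over a site: a condition is a poset with one of its elements, an arrow is a name for one
    generic inside the extension by another. Lifting a generic along an arrow takes the place of
    factoring the collapse; it works because N sees only countably many dense sets of each small
    poset. The coideal is an arbitrary element of V[G] and may lie outside the model, so it enters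
    only through its trace on V[G_alpha]. Mahloness makes that trace usable: statements about H with
    witnesses in N get witnesses in V[G_alpha], and regularity of alpha bounds the names of small
    sets below alpha. As N may be ill-founded, each induction, recursion or genericity argument runs
    on predicates definable in the model concerned; hence the apparatus of [Def], and the habit of
    coding classes of V as sets before N speaks of them. *)

Definition up (r : nat -> nat) (i : nat) : nat :=
 match i with 0 => 0 | S j => S (r j) end.

Fixpoint ren (r : nat -> nat) (f : formula) : formula :=
 match f with
 | fMem i j => fMem (r i) (r j)
 | fEq i j => fEq (r i) (r j)
 | fNot g => fNot (ren r g)
 | fAnd g h => fAnd (ren r g) (ren r h)
 | fAll g => fAll (ren (up r) g)
 end.

Lemma sat_ren (S : structure) f : forall r (v : nat -> S),
 sat v (ren r f) <-> sat (fun i => v (r i)) f.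
Proof.
induction f as [i j|i j|f IH|f IHf g IHg|f IH];intros r v;simpl;try tauto.
- now rewrite IH.
- now rewrite IHf, IHg.
- assert (E : forall x, (fun i => scons x v (up r i)) = scons x (fun i => v (r i)))
 by (intro x;apply fext;now intros []).
 split;intros H x;specialize (H x).
 + apply IH in H. now rewrite E in H.
 + apply IH. now rewrite E.
Qed.

(** * Definability in a structure *)
Section Definability.
Variable S : structure.
Notation env := (nat -> S).

(* A variable of a formula is read either from the environment or as a
 parameter of the model. *)
Definition inst (s : nat -> nat + S) (v : env) (i : nat) : S :=
 match s i with inl j => v j | inr c => c end.

Definition Def (P : env -> Prop) : Prop :=
 exists phi s, forall v, P v <-> sat (inst s v) phi.
Definition DT (t : env -> S) : Prop := Def (fun v => v 0 = t (fun i => v (Datatypes.S i))).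

Lemma Def_ext (P Q : env -> Prop) : (forall v, P v <-> Q v) -> Def P -> Def Q.
Proof.
intros E (f&s&H). exists f, s. intro v. now rewrite <- E.
Qed.

Lemma Def_atom_mem (a b : nat + S) :
 Def (fun v => inst (fun _ => a) v 0 ∈ inst (fun _ => b) v 0).
Proof.
exists (fMem 0 1), (fun i => match i with 0 => a | _ => b end). intro v;reflexivity.
Qed.

Lemma Def_atom_eq (a b : nat + S) :
 Def (fun v => inst (fun _ => a) v 0 = inst (fun _ => b) v 0).
Proof.
exists (fEq 0 1), (fun i => match i with 0 => a | _ => b end). intro v;reflexivity.
Qed.

Lemma Def_not (P : env -> Prop) : Def P -> Def (fun v => ~ P v).
Proof. intros (f&s&H). exists (fNot f), s. intro v. simpl. now rewrite H. Qed.

(** The two formulas come with separate assignments [s] and [t]. Sending the variables of the first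
    to even indices and those of the second to odd ones lets a single assignment serve both. *)
Lemma Def_and (P Q : env -> Prop) : Def P -> Def Q -> Def (fun v => P v /\ Q v).
Proof.
intros (f&s&Hf) (g&t&Hg).
pose (ev := fun i => Nat.add i i). pose (od := fun i => Datatypes.S (Nat.add i i)).
exists (fAnd (ren ev f) (ren od g)).
exists (fun i => if Nat.even i then s (Nat.div2 i) else t (Nat.div2 i)).
intro v. simpl. rewrite !sat_ren, Hf, Hg.
assert (E1 : forall i, Nat.even (i + i) = true /\ Nat.div2 (i + i) = i /\
 Nat.even (Datatypes.S (i + i)) = false /\ Nat.div2 (Datatypes.S (i + i)) = i).
{ induction i as [|i (A&B&C&D)];[now repeat split|].
 rewrite <- plus_n_Sm. repeat split.
 - exact A. - simpl in *. now rewrite B.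
 - exact C. - change (Datatypes.S (Nat.div2 (Datatypes.S (i + i))) = Datatypes.S i). now rewrite D. }
assert (Ea : (fun i => inst (fun i => if Nat.even i then s (Nat.div2 i) else t (Nat.div2 i)) v (ev i)) = inst s v).
{ apply fext. intro i. unfold inst, ev.
 destruct (E1 i) as (A&B&_). now rewrite A, B. }
assert (Eb : (fun i => inst (fun i => if Nat.even i then s (Nat.div2 i) else t (Nat.div2 i)) v (od i)) = inst t v).
{ apply fext. intro i. unfold inst, od.
 destruct (E1 i) as (_&_&A&B). now rewrite A, B. }
now rewrite Ea, Eb.
Qed.

(** Several variables of [f] may read position 0 of the environment. The renaming sends all of them
    to the quantified variable and shifts every other one, parameters included, past the binder. *)
Lemma Def_all (Q : S -> env -> Prop) :
 Def (fun v => Q (v 0) (fun i => v (Datatypes.S i))) -> Def (fun v => forall x, Q x v).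
Proof.
intros (f&s&H).
exists (fAll (ren (fun i => match s i with inl 0 => 0 | _ => Datatypes.S i end) f)).
exists (fun i => match s i with inl (Datatypes.S j) => inl j | inl 0 => inl 0 | inr c => inr c end).
intro v. simpl.
assert (E : forall x, Q x v <-> sat (inst s (scons x v)) f).
{ intro x. rewrite <- (H (scons x v)). simpl.
 replace (fun i => v i) with v by (apply fext;reflexivity). reflexivity. }
split;intros A x;specialize (A x).
- apply sat_ren. apply E in A.
 match goal with |- sat ?w _ => replace w with (inst s (scons x v));[exact A|] end.
 apply fext. intro i. unfold inst.
 destruct (s i) as [[|j]|c] eqn:Es;simpl;[reflexivity| |];now rewrite Es.
- apply E. rewrite sat_ren in A.
 match type of A with sat ?w _ => replace (inst s (scons x v)) with w;[exact A|] end.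
 apply fext. intro i. unfold inst.
 destruct (s i) as [[|j]|c] eqn:Es;simpl;[reflexivity| |];now rewrite Es.
Qed.

Lemma Def_ex (Q : S -> env -> Prop) :
 Def (fun v => Q (v 0) (fun i => v (Datatypes.S i))) -> Def (fun v => exists x, Q x v).
Proof.
intro H. apply Def_ext with (P := fun v => ~ forall x, ~ Q x v).
- intro v. split.
 + intro A. apply NNPP. intro B. apply A. intros x C. apply B. now exists x.
 + intros [x C] A. exact (A x C).
- apply Def_not, Def_all, Def_not, H.
Qed.

Lemma Def_or (P Q : env -> Prop) : Def P -> Def Q -> Def (fun v => P v \/ Q v).
Proof.
intros HP HQ. apply Def_ext with (P := fun v => ~ (~ P v /\ ~ Q v)).
- intro v. tauto.
- now apply Def_not, Def_and;apply Def_not.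
Qed.

Lemma Def_imp (P Q : env -> Prop) : Def P -> Def Q -> Def (fun v => P v -> Q v).
Proof.
intros HP HQ. apply Def_ext with (P := fun v => ~ (P v /\ ~ Q v)).
- intro v. tauto.
- now apply Def_not, Def_and;[|apply Def_not].
Qed.

Lemma Def_iff (P Q : env -> Prop) : Def P -> Def Q -> Def (fun v => P v <-> Q v).
Proof. intros HP HQ. now apply Def_and;apply Def_imp. Qed.

(** A proposition of the metatheory is classically true or false, hence equivalent to a trivial
    formula or its negation. This lets the search treat any subterm free of object variables as a
    constant. *)
Lemma Def_const (P : Prop) : Def (fun _ => P).
Proof.
destruct (classic P) as [H|H].
- exists (fEq 0 0), (fun _ => inl 0). intro v. simpl. tauto.
- exists (fNot (fEq 0 0)), (fun _ => inl 0). intro v. simpl. tauto.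
Qed.

Lemma Def_ren (r : nat -> nat) (P : env -> Prop) : Def P -> Def (fun v => P (fun i => v (r i))).
Proof.
intros (f&s&H). exists f, (fun i => match s i with inl j => inl (r j) | inr c => inr c end).
intro v. rewrite H.
replace (inst (fun i => match s i with inl j => inl (r j) | inr c => inr c end) v)
 with (inst s (fun i => v (r i)));[reflexivity|].
apply fext. intro i. unfold inst. now destruct (s i).
Qed.

Lemma DT_var k : DT (fun v => v k).
Proof. exact (Def_atom_eq (inl 0) (inl (Datatypes.S k))). Qed.

Lemma DT_const (c : S) : DT (fun _ => c).
Proof. exact (Def_atom_eq (inl 0) (inr c)). Qed.

Lemma DT_ren (r : nat -> nat) (t : env -> S) : DT t -> DT (fun v => t (fun i => v (r i))).
Proof.
intro H. unfold DT in *.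
exact (@Def_ren (fun i => match i with 0 => 0 | Datatypes.S j => Datatypes.S (r j) end) _ H).
Qed.

Lemma Def_subst (Q : S -> env -> Prop) (t : env -> S) :
 DT t -> Def (fun v => Q (v 0) (fun i => v (Datatypes.S i))) -> Def (fun v => Q (t v) v).
Proof.
intros Ht HQ. apply Def_ext with (P := fun v => exists y, y = t v /\ Q y v).
- intro v. split;[intros (y&->&H);exact H|intro H;now exists (t v)].
- apply Def_ex. now apply Def_and.
Qed.

Definition Def1 (P : S -> Prop) := Def (fun v => P (v 0)).
Definition Def2 (P : S -> S -> Prop) := Def (fun v => P (v 0) (v 1)).
Definition Def3 (P : S -> S -> S -> Prop) := Def (fun v => P (v 0) (v 1) (v 2)).
Definition DF1 (F : S -> S) := DT (fun v => F (v 0)).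
Definition DF2 (F : S -> S -> S) := DT (fun v => F (v 0) (v 1)).

Lemma Def_app1 P (t : env -> S) : Def1 P -> DT t -> Def (fun v => P (t v)).
Proof.
intros HP Ht. refine (@Def_subst (fun x _ => P x) t Ht _). exact HP.
Qed.

Lemma Def_app2 P (t u : env -> S) : Def2 P -> DT t -> DT u -> Def (fun v => P (t v) (u v)).
Proof.
intros HP Ht Hu. refine (@Def_subst (fun x v => P x (u v)) t Ht _).
refine (@Def_subst (fun y v => P (v 0) y) _ (@DT_ren Datatypes.S _ Hu) _).
exact (@Def_ren (fun i => match i with 0 => 1 | Datatypes.S j => 0 end) _ HP).
Qed.

Lemma Def_app3 P (t u w : env -> S) : Def3 P -> DT t -> DT u -> DT w ->
 Def (fun v => P (t v) (u v) (w v)).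
Proof.
intros HP Ht Hu Hw. refine (@Def_subst (fun x v => P x (u v) (w v)) t Ht _).
refine (@Def_subst (fun y v => P (v 0) y (w (fun i => v (Datatypes.S i)))) _ (@DT_ren Datatypes.S _ Hu) _).
refine (@Def_subst (fun z v => P (v 1) (v 0) z) _ (@DT_ren (fun i => Datatypes.S (Datatypes.S i)) _ Hw) _).
exact (@Def_ren (fun i => match i with 0 => 2 | 1 => 1 | _ => 0 end) _ HP).
Qed.

Lemma Def_sat (f : formula) : forall t : nat -> env -> S, (forall i, DT (t i)) -> Def (fun v => sat (fun i => t i v) f).
Proof.
induction f as [i j|i j|g IH|g IHg h IHh|g IH];intros t Ht;cbn [sat].
- refine (@Def_app2 (fun x y => x ∈ y) _ _ _ (Ht i) (Ht j)). exact (Def_atom_mem (inl 0) (inl 1)).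
- refine (@Def_app2 (fun x y => x = y) _ _ _ (Ht i) (Ht j)). exact (Def_atom_eq (inl 0) (inl 1)).
- now apply Def_not, IH.
- now apply Def_and;[apply IHg|apply IHh].
- refine (@Def_all (fun x v => sat (scons x (fun i => t i v)) g) _).
 refine (Def_ext _ (IH (fun i => match i with 0 => fun v => v 0 | Datatypes.S i => fun v => t i (fun j => v (Datatypes.S j)) end) _)).
 + intro v. match goal with |- sat ?a _ <-> sat ?b _ => replace b with a;[reflexivity|] end.
 apply fext. now intros [].
 + intros [|i];[apply DT_var|exact (@DT_ren Datatypes.S _ (Ht i))].
Qed.

Lemma Def_mem (t u : env -> S) : DT t -> DT u -> Def (fun v => t v ∈ u v).
Proof. intros. apply (@Def_app2 (fun x y => x ∈ y));trivial. exact (Def_atom_mem (inl 0) (inl 1)). Qed.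

Lemma Def_eq (t u : env -> S) : DT t -> DT u -> Def (fun v => t v = u v).
Proof. intros. apply (@Def_app2 (fun x y => x = y));trivial. exact (Def_atom_eq (inl 0) (inl 1)). Qed.

Lemma DT_app1 F (t : env -> S) : DF1 F -> DT t -> DT (fun v => F (t v)).
Proof.
intros HF Ht. unfold DT.
refine (@Def_app2 (fun y x => y = F x) (fun v => v 0) _ _ (DT_var 0) (@DT_ren Datatypes.S _ Ht)).
exact HF.
Qed.

Lemma DT_app2 F (t u : env -> S) : DF2 F -> DT t -> DT u -> DT (fun v => F (t v) (u v)).
Proof.
intros HF Ht Hu. unfold DT.
refine (@Def_app3 (fun y x z => y = F x z) (fun v => v 0) _ _ _ (DT_var 0) (@DT_ren Datatypes.S _ Ht) (@DT_ren Datatypes.S _ Hu)).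
exact HF.
Qed.

Lemma Def_fun P w : Def P -> Def (fun v => P (fun i => match i with 0 => v 0 | Datatypes.S j => w j end)).
Proof.
intros (f&s&H).
exists f, (fun i => match s i with inl 0 => inl 0 | inl (Datatypes.S j) => inr (w j) | inr c => inr c end).
intro v. rewrite H.
match goal with |- sat ?a _ <-> sat ?b _ => replace a with b;[reflexivity|] end.
apply fext. intro i. unfold inst. now destruct (s i) as [[|j]|].
Qed.

Lemma Def_param (Q : S -> env -> Prop) (w : env) :
 Def (fun v => Q (v 0) (fun i => v (Datatypes.S i))) -> Def1 (fun x => Q x w).
Proof. intro H. exact (@Def_fun _ w H). Qed.

Lemma Def_param2 (Q : S -> S -> env -> Prop) (w : env) :
 Def (fun v => Q (v 0) (v 1) (fun i => v (Datatypes.S (Datatypes.S i)))) -> Def2 (fun x y => Q x y w).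
Proof.
intros (f&s&H).
exists f, (fun i => match s i with inl 0 => inl 0 | inl 1 => inl 1 | inl (Datatypes.S (Datatypes.S j)) => inr (w j) | inr c => inr c end).
intro v.
pose proof (H (fun i => match i with 0 => v 0 | 1 => v 1 | Datatypes.S (Datatypes.S j) => w j end)) as E.
simpl in E. replace (fun i => w i) with w in E by (apply fext;reflexivity).
rewrite E.
match goal with |- sat ?a _ <-> sat ?b _ => replace a with b;[reflexivity|] end.
apply fext. intro i. unfold inst. now destruct (s i) as [[|[|j]]|].
Qed.

(** The axiom schemes expect parameters in the environment and not in an assignment, so the
    constants of [s] move into [e]. The point [a] stands for all further variables, on whose values
    [P] does not depend. *)
Lemma Def1_sat (P : S -> Prop) (a : S) : Def1 P -> exists f e, forall x, P x <-> sat (scons x e) f.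
Proof.
intros (f&s&H).
exists (ren (fun i => match s i with inl 0 => 0 | _ => Datatypes.S i end) f), (fun i => match s i with inr c => c | _ => a end).
intro x. rewrite (H (scons x (fun _ => a))), sat_ren.
match goal with |- sat ?a _ <-> sat ?b _ => replace b with a;[reflexivity|] end.
apply fext. intro i. unfold inst.
destruct (s i) as [[|j]|c] eqn:E;simpl;trivial;now rewrite E.
Qed.

Lemma separation (P : S -> Prop) : ax_separation S -> Def1 P ->
 forall a, exists b, forall x, x ∈ b <-> x ∈ a /\ P x.
Proof.
intros Hs HP a. destruct (Def1_sat a HP) as (f&e&H). destruct (Hs f e a) as [b Hb].
exists b. intro x. now rewrite Hb, H.
Qed.

Lemma replacement (F : S -> S) : ax_replacement S -> DF1 F ->
 forall a, exists b, forall y, y ∈ b <-> exists x, x ∈ a /\ y = F x.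
Proof.
intros Hs (f&s&H) a.
set (g := ren (fun i => match s i with inl 0 => 0 | inl 1 => 1 | _ => Datatypes.S (Datatypes.S i) end) f).
set (e := fun i => match s i with inr c => c | _ => a end).
assert (E : forall x y, sat (scons y (scons x e)) g <-> y = F x).
{ intros x y. rewrite (H (scons y (scons x (fun _ => a)))). unfold g. rewrite sat_ren.
 match goal with |- sat ?a _ <-> sat ?b _ => replace b with a;[reflexivity|] end.
 apply fext. intro i. unfold inst, e.
 destruct (s i) as [[|[|j]]|c] eqn:E;simpl;trivial;now rewrite E. }
destruct (Hs g e a) as [b Hb].
- intros x _. exists (F x). split;[now apply E|]. intros y Hy. symmetry. now apply E.
- exists b. intro y. rewrite Hb. split;intros (x&Hx&Hy);exists x;split;trivial;now apply E.
Qed.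

End Definability.

(** Extension point of the syntax-directed search for definability proofs: later redefinitions teach
    it new set operations and fall back on the previous hook. *)
Ltac def_hook := fail.
Ltac def_step :=
 lazymatch goal with
 | |- Def (fun v => @?A v /\ @?B v) => refine (@Def_and _ A B _ _)
 | |- Def (fun v => @?A v \/ @?B v) => refine (@Def_or _ A B _ _)
 | |- Def (fun v => @?A v <-> @?B v) => refine (@Def_iff _ A B _ _)
 | |- Def (fun v => ~ @?A v) => refine (@Def_not _ A _)
 | |- Def (fun v => ex (@?A v)) => refine (@Def_ex _ (fun x v => A v x) _)
 | |- @Def ?S (fun v => forall x : carrier ?S, @?A v x) => refine (@Def_all _ (fun x v => A v x) _)
 | |- Def (fun v => @?A v -> @?B v) => refine (@Def_imp _ A B _ _)
 | |- Def (fun v => @?A v = @?B v) => first [refine (@Def_eq _ A B _ _)]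
 | |- Def (fun v => mem (@?A v) (@?B v)) => refine (@Def_mem _ A B _ _)
 | |- DT (fun v => v ?k) => exact (@DT_var _ k)
 | _ => first
 [ match goal with
 | H : DT ?t |- DT (fun v => ?t (fun i => v (@?r i))) => exact (DT_ren r H)
 | H : Def ?P |- Def (fun v => ?P (fun i => v (@?r i))) => exact (Def_ren r H)
 | H : Def1 ?P |- Def (fun v => ?P (@?t v)) => refine (@Def_app1 _ P t H _)
 | H : Def2 ?P |- Def (fun v => ?P (@?t v) (@?u v)) => refine (@Def_app2 _ P t u H _ _)
 | H : Def3 ?P |- Def (fun v => ?P (@?t v) (@?u v) (@?w v)) => refine (@Def_app3 _ P t u w H _ _ _)
 | H : DF1 ?F |- DT (fun v => ?F (@?t v)) => refine (@DT_app1 _ F t H _)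
 | H : DF2 ?F |- DT (fun v => ?F (@?t v) (@?u v)) => refine (@DT_app2 _ F t u H _ _)
 end
 | def_hook
 | match goal with H : Def _ |- _ => exact H | H : DT _ |- _ => exact H end
 | lazymatch goal with |- DT (fun v => ?c) => exact (@DT_const _ c) end
 | lazymatch goal with |- Def (fun v => ?c) => exact (@Def_const _ c) end ]
 end.
Ltac def0 := unfold Def1, Def2, Def3, DF1, DF2;repeat (cbv beta;def_step).
Ltac def := solve [def0].
Ltac sp := repeat match goal with |- _ /\ _ => split end.

Ltac spt := split;trivial.
Ltac spa := sp;trivial.

(** * Elementary set theory inside a model of ZF *)

Class ZFm (M : structure) : Prop := zfm : ZF M.

Lemma ZF_inh (M : structure) : ZF M -> inhabited M.
Proof. intros (_&_&_&_&_&(w&_)&_). exact (inhabits w). Qed.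

(** Without a witness the value is arbitrary, so each use is accompanied by an existence proof or,
    as in [pf], by a default clause. *)
Definition the (M : structure) {Z : ZFm M} (P : M -> Prop) : M := epsilon (ZF_inh Z) P.

Section Sets.
Context {M : structure} {Z : ZFm M}.
Implicit Types a b c d f g k m n p q s u x y z : M.

Lemma the_spec (P : M -> Prop) : (exists x, P x) -> P (the P).
Proof. apply epsilon_spec. Qed.

Lemma ext x y : (forall z, z ∈ x <-> z ∈ y) -> x = y.
Proof. apply Z. Qed.

Lemma the_eq (P : M -> Prop) x : P x -> (forall y, P y -> y = x) -> the P = x.
Proof. intros H U. apply U, the_spec. now exists x. Qed.

Lemma DT_the (Q : M -> (nat -> M) -> Prop) :
 (forall w, exists! y, Q y w) -> Def (fun v => Q (v 0) (fun i => v (S i))) ->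
 DT (fun v => the (fun y => Q y v)).
Proof.
intros E H. refine (Def_ext _ H). intro v.
destruct (E (fun i => v (S i))) as (y&Hy&U). split.
- intro A. rewrite (the_eq (P := fun y0 => Q y0 (fun i => v (S i))) (x := y));trivial.
 + symmetry. now apply U.
 + intros z Hz. symmetry. now apply U.
- intros ->. apply (@the_spec (fun y0 => Q y0 (fun i => v (S i)))). now exists y.
Qed.

(** By extensionality the graph of [t] is expressed through the membership condition [Q], so it is
    enough that membership in the value be definable. *)
Lemma DT_set (Q : M -> (nat -> M) -> Prop) (t : (nat -> M) -> M) :
 (forall v x, x ∈ t v <-> Q x v) -> Def (fun v => Q (v 0) (fun i => v (S i))) -> DT t.
Proof.
intros E H. unfold DT.
apply Def_ext with (P := fun v => forall x, x ∈ v 0 <-> Q x (fun i => v (S i))).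
- intro v. split.
 + intro A. apply ext. intro x. now rewrite A, E.
 + intros -> x. apply E.
- assert (H' := @Def_ren _ (fun i => match i with 0 => 0 | S j => S (S j) end) _ H).
 cbv beta iota in H'. def.
Qed.

Definition sep a (P : M -> Prop) := the (fun b => forall x, x ∈ b <-> x ∈ a /\ P x).
Lemma in_sep a P x : Def1 P -> (x ∈ sep a P <-> x ∈ a /\ P x).
Proof.
intro H. revert x. apply (@the_spec (fun b => forall x, x ∈ b <-> x ∈ a /\ P x)).
apply separation;trivial. apply Z.
Qed.
Lemma DT_sep (t : (nat -> M) -> M) (P : M -> (nat -> M) -> Prop) :
 DT t -> Def (fun v => P (v 0) (fun i => v (S i))) -> DT (fun v => sep (t v) (fun x => P x v)).
Proof.
intros Ht HP. apply DT_set with (Q := fun x v => x ∈ t v /\ P x v).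
- intros v x. apply in_sep. exact (Def_param v HP).
- def.
Qed.

Definition repl a (F : M -> M) := the (fun b => forall y, y ∈ b <-> exists x, x ∈ a /\ y = F x).
Lemma in_repl a F y : DF1 F -> (y ∈ repl a F <-> exists x, x ∈ a /\ y = F x).
Proof.
intro H. revert y. apply (@the_spec (fun b => forall y, y ∈ b <-> exists x, x ∈ a /\ y = F x)).
apply replacement;trivial. apply Z.
Qed.

Lemma DT_param (F : M -> (nat -> M) -> M) (w : nat -> M) :
 DT (fun v => F (v 0) (fun i => v (S i))) -> DF1 (fun x => F x w).
Proof.
intro H.
assert (G := @Def_param2 M (fun y x w => y = F x w) w H). exact G.
Qed.

Lemma DT_repl (t : (nat -> M) -> M) (F : M -> (nat -> M) -> M) :
 DT t -> DT (fun v => F (v 0) (fun i => v (S i))) -> DT (fun v => repl (t v) (fun x => F x v)).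
Proof.
intros Ht HF. apply DT_set with (Q := fun y v => exists x, x ∈ t v /\ y = F x v).
- intros v x. apply in_repl. exact (DT_param v HF).
- assert (H' := @DT_ren _ (fun i => match i with 0 => 0 | S j => S (S j) end) _ HF).
 cbv beta iota in H'. def.
Qed.

Definition upair x y := the (fun u => is_upair u x y).
Lemma in_upair x y z : z ∈ upair x y <-> z = x \/ z = y.
Proof. revert z. apply (@the_spec (fun u => is_upair u x y)). apply Z. Qed.
Definition sing x := upair x x.
Lemma in_sing x z : z ∈ sing x <-> z = x.
Proof. unfold sing. rewrite in_upair. tauto. Qed.
Definition opair x y := upair (sing x) (upair x y).

Definition bU a := the (fun u => forall z, z ∈ u <-> exists y, y ∈ a /\ z ∈ y).
Lemma in_bU a z : z ∈ bU a <-> exists y, y ∈ a /\ z ∈ y.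
Proof. revert z. apply (@the_spec (fun u => forall z, z ∈ u <-> exists y, y ∈ a /\ z ∈ y)). apply Z. Qed.
Definition cup x y := bU (upair x y).
Lemma in_cup x y z : z ∈ cup x y <-> z ∈ x \/ z ∈ y.
Proof.
unfold cup. rewrite in_bU. split.
- intros (u&Hu&Hz). apply in_upair in Hu as [->| ->];tauto.
- intros [H|H];[exists x|exists y];rewrite in_upair;tauto.
Qed.
Definition pow a := the (fun q => is_power q a).
Lemma in_pow a z : z ∈ pow a <-> subset z a.
Proof. revert z. apply (@the_spec (fun q => is_power q a)). apply Z. Qed.
Definition emp : M := sep (the (fun _ => True)) (fun _ => False).
Lemma in_emp z : ~ z ∈ emp.
Proof. unfold emp. rewrite in_sep;[tauto|def]. Qed.
Definition succ x := cup x (sing x).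
Lemma in_succ x z : z ∈ succ x <-> z ∈ x \/ z = x.
Proof. unfold succ. now rewrite in_cup, in_sing. Qed.

Lemma is_upair_eq u x y : is_upair u x y <-> u = upair x y.
Proof.
split;[intro H;apply ext;intro z;now rewrite in_upair|intros -> z;apply in_upair].
Qed.
Lemma is_opair_eq p x y : is_opair p x y <-> p = opair x y.
Proof.
unfold is_opair. split.
- intros (u&v&Hu&Hv&Hp). apply is_upair_eq in Hu, Hv, Hp. now subst.
- intros ->. exists (sing x), (upair x y). now rewrite !is_upair_eq.
Qed.
Lemma is_succ_eq y x : is_succ y x <-> y = succ x.
Proof.
split;[intro H;apply ext;intro z;now rewrite in_succ|intros -> z;apply in_succ].
Qed.
Lemma is_power_eq q a : is_power q a <-> q = pow a.
Proof.
split;[intro H;apply ext;intro z;now rewrite in_pow|intros -> z;apply in_pow].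
Qed.
Lemma is_empty_eq x : is_empty x <-> x = emp.
Proof.
split;[intro H;apply ext;intro z;split;intro A;[now apply H in A|now apply in_emp in A]
 |intros -> z;apply in_emp].
Qed.

Lemma sing_inj x y : sing x = sing y -> x = y.
Proof. intro H. apply in_sing. rewrite <- H. now apply in_sing. Qed.

Lemma opair_inj x y x' y' : opair x y = opair x' y' -> x = x' /\ y = y'.
Proof.
unfold opair. intro H.
assert (A : x = x').
{ assert (A : sing x ∈ upair (sing x') (upair x' y')) by (rewrite <- H, in_upair;tauto).
 apply in_upair in A as [A|A];[now apply sing_inj|].
 symmetry. apply in_sing. rewrite A. apply in_upair. tauto. }
subst x'. spt.
assert (B : upair x y ∈ upair (sing x) (upair x y')) by (rewrite <- H, in_upair;tauto).
assert (C : upair x y' ∈ upair (sing x) (upair x y)) by (rewrite H, in_upair;tauto).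
apply in_upair in B, C.
assert (Y : y ∈ upair x y) by (apply in_upair;tauto).
assert (Y' : y' ∈ upair x y') by (apply in_upair;tauto).
destruct B as [B|B];rewrite B in Y.
- apply in_sing in Y. subst y. destruct C as [C|C];rewrite C in Y'.
 + now apply in_sing in Y'. + apply in_upair in Y'. intuition congruence.
- apply in_upair in Y as [-> |Y];[|trivial].
 destruct C as [C|C];rewrite C in Y';[apply in_sing in Y'|apply in_upair in Y'];
 intuition congruence.
Qed.

Lemma app_eq f x y : app f x y <-> opair x y ∈ f.
Proof.
unfold app. split.
- intros (p&Hp&H). apply is_opair_eq in Hp. now subst.
- intro H. exists (opair x y). now rewrite is_opair_eq.
Qed.

Lemma DT_upair (t u : (nat -> M) -> M) : DT t -> DT u -> DT (fun v => upair (t v) (u v)).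
Proof.
intros. apply DT_set with (Q := fun x v => x = t v \/ x = u v);[intros;apply in_upair|def].
Qed.
Lemma DT_bU (t : (nat -> M) -> M) : DT t -> DT (fun v => bU (t v)).
Proof.
intros. apply DT_set with (Q := fun x v => exists y, y ∈ t v /\ x ∈ y);[intros;apply in_bU|def].
Qed.
Lemma DT_pow (t : (nat -> M) -> M) : DT t -> DT (fun v => pow (t v)).
Proof.
intros. apply DT_set with (Q := fun x v => subset x (t v));[intros;apply in_pow|unfold subset;def].
Qed.
End Sets.

Ltac def_hook0 :=
 lazymatch goal with
 | |- DT (fun v => sep (@?t v) (@?Q v)) => refine (@DT_sep _ _ t (fun x v => Q v x) _ _)
 | |- DT (fun v => repl (@?t v) (@?Q v)) => refine (@DT_repl _ _ t (fun x v => Q v x) _ _)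
 | |- DT (fun v => upair (@?t v) (@?u v)) => refine (@DT_upair _ _ t u _ _)
 | |- DT (fun v => bU (@?t v)) => refine (@DT_bU _ _ t _)
 | |- DT (fun v => pow (@?t v)) => refine (@DT_pow _ _ t _)
 | |- DT (fun v => sing _) => unfold sing
 | |- DT (fun v => opair _ _) => unfold opair, sing
 | |- DT (fun v => cup _ _) => unfold cup
 | |- DT (fun v => succ _) => unfold succ
 | |- Def (fun v => subset _ _) => unfold subset
 | |- Def (fun v => is_empty _) => unfold is_empty
 | |- Def (fun v => is_succ _ _) => unfold is_succ
 | |- Def (fun v => is_power _ _) => unfold is_power
 | |- Def (fun v => is_upair _ _ _) => unfold is_upair
 | |- Def (fun v => is_opair _ _ _) => unfold is_opair
 | |- Def (fun v => app _ _ _) => unfold app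
 | |- Def (fun v => is_fun _ _ _) => unfold is_fun
 | |- Def (fun v => is_surj _ _ _) => unfold is_surj
 | |- Def (fun v => unique _ _) => unfold unique
 | |- Def (fun v => transitive _) => unfold transitive
 | |- Def (fun v => ordinal _) => unfold ordinal
 | |- Def (fun v => limit_ordinal _) => unfold limit_ordinal
 | |- Def (fun v => is_omega _) => unfold is_omega
 | |- Def (fun v => natural _) => unfold natural
 | |- Def (fun v => finite _) => unfold finite
 | |- Def (fun v => cardinal _) => unfold cardinal
 | |- Def (fun v => regular _) => unfold regular
 | |- Def (fun v => collapse _ _) => unfold collapse
 end.
Ltac def_hook ::= def_hook0.

(** * Ordinals and natural numbers *)

Section Ordinals.
Context {M : structure} {Z : ZFm M}.
Implicit Types a b c d f g k m n p q s u x y z : M.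

Lemma foundation_set (P : M -> Prop) a : Def1 P -> (exists x, x ∈ a /\ P x) ->
 exists x, x ∈ a /\ P x /\ forall y, y ∈ a -> y ∈ x -> ~ P y.
Proof.
intros HP (x&Hx&Px).
destruct (proj1 (proj2 (zfm (M := M))) (sep a P)) as (y&Hy&U).
- exists x. now apply in_sep.
- apply in_sep in Hy as [Hy Py];trivial. exists y. repeat spt.
 intros w Hw Hwy Pw. apply (U w);trivial. now apply in_sep.
Qed.

Lemma mem_irrefl x : ~ x ∈ x.
Proof.
intro H. destruct (foundation_set (P := fun _ => True) (a := sing x)) as (y&Hy&_&U).
- def. - exists x. now rewrite in_sing.
- apply in_sing in Hy. subst y. apply (U x);trivial. now apply in_sing.
Qed.
Lemma mem_asym x y : x ∈ y -> ~ y ∈ x.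
Proof.
intros H H'. destruct (foundation_set (P := fun _ => True) (a := upair x y)) as (w&Hw&_&U).
- def. - exists x. rewrite in_upair. tauto.
- apply in_upair in Hw as [->| ->].
 + apply (U y);trivial. rewrite in_upair;tauto.
 + apply (U x);trivial. rewrite in_upair;tauto.
Qed.

Lemma ord_mem x y : ordinal x -> y ∈ x -> ordinal y.
Proof.
intros [T H] Hy. split;[now apply H|]. intros u Hu. apply H. now apply (T y).
Qed.
Lemma ord_trans x y z : ordinal z -> x ∈ y -> y ∈ z -> x ∈ z.
Proof. intros [T _] H H'. now apply (T y). Qed.
Lemma ord_emp : ordinal (emp (M := M)).
Proof. split;intros y Hy;now apply in_emp in Hy. Qed.
Lemma ord_succ x : ordinal x -> ordinal (succ x).
Proof.
intros [T H]. split;intros y Hy;apply in_succ in Hy as [Hy| ->];trivial.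
- intros u Hu. apply in_succ. left. now apply (T y).
- intros u Hu. apply in_succ. now left.
- now apply H.
Qed.

(** Take a minimal [a] incomparable with some ordinal and then a minimal [b] incomparable with [a].
    Elements of [a] compare with everything and elements of [b] compare with [a], which forces
    [a = b]. *)
Lemma ord_tri x y : ordinal x -> ordinal y -> x ∈ y \/ x = y \/ y ∈ x.
Proof.
intros Ox Oy. apply NNPP. intro C.
destruct (foundation_set (P := fun x => ordinal x /\ exists y, ordinal y /\ ~ (x ∈ y \/ x = y \/ y ∈ x))
 (a := succ x)) as (a&_&(Oa&b0&Ob0&Hab0)&Ua);[def| |].
{ exists x. rewrite in_succ. split;[tauto|]. spt. now exists y. }
assert (Ua' : forall u v, u ∈ a -> ordinal v -> u ∈ v \/ u = v \/ v ∈ u).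
{ intros u w Hu Ow. apply NNPP. intro D.
 destruct (classic (u ∈ succ x)) as [E|E].
 - apply (Ua u);trivial. split;[now apply (ord_mem Oa)|]. now exists w.
 - destruct (foundation_set (P := fun x => exists y, ordinal y /\ ~ (x ∈ y \/ x = y \/ y ∈ x)) (a := a))
 as (a'&Ha'&(b'&Ob'&D')&Ua'');[def| now exists u;split;[|exists w]|].
 clear u w Hu Ow D E.
 destruct (foundation_set (P := fun y => ~ (a' ∈ y \/ a' = y \/ y ∈ a')) (a := succ b'))
 as (b&Hb&D&Ub);[def|exists b';rewrite in_succ;tauto|].
 assert (Ob : ordinal b) by (apply (ord_mem (ord_succ Ob') Hb)).
 apply D. right;left. apply ext. intro u. split;intro Hu.
 + destruct (classic (u ∈ b \/ u = b \/ b ∈ u)) as [[E|[E|E]]|E];trivial.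
 * subst u. exfalso. tauto.
 * exfalso. apply D. right;right. now apply (ord_trans (ord_mem Oa Ha') E).
 * exfalso. apply (Ua'' u);[now apply (ord_trans Oa Hu)|trivial|now exists b].
 + destruct (classic (a' ∈ u \/ a' = u \/ u ∈ a')) as [[E|[E|E]]|E];trivial.
 * exfalso. apply D. left. now apply (ord_trans Ob E).
 * subst u. exfalso. tauto.
 * exfalso. apply (Ub u);trivial. now apply (ord_trans (ord_succ Ob') Hu). }
destruct (foundation_set (P := fun y => ~ (a ∈ y \/ a = y \/ y ∈ a)) (a := succ b0))
 as (b&Hb&D&Ub);[def|exists b0;rewrite in_succ;tauto|].
assert (Ob : ordinal b) by (apply (ord_mem (ord_succ Ob0) Hb)).
apply D. right;left. apply ext. intro u. split;intro Hu.
- destruct (Ua' u b Hu Ob) as [E|[E|E]];trivial.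
 + subst u. exfalso. tauto.
 + exfalso. apply D. right;right. now apply (ord_trans Oa E).
- destruct (classic (a ∈ u \/ a = u \/ u ∈ a)) as [[E|[E|E]]|E];trivial.
 + exfalso. apply D. left. now apply (ord_trans Ob E).
 + subst u. exfalso. tauto.
 + exfalso. apply (Ub u);trivial. now apply (ord_trans (ord_succ Ob0) Hu).
Qed.

Lemma ord_sub x y : ordinal x -> ordinal y -> subset x y -> x ∈ y \/ x = y.
Proof.
intros Ox Oy H. destruct (ord_tri Ox Oy) as [A|[A|A]];[tauto|tauto|].
exfalso. exact (mem_irrefl (H _ A)).
Qed.

Lemma ord_le_lt x y z : ordinal z -> ordinal x -> subset x y -> ordinal y -> y ∈ z -> x ∈ z.
Proof.
intros Oz Ox H Oy Hy. destruct (ord_sub Ox Oy H) as [A| ->];trivial. now apply (ord_trans Oz A).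
Qed.

Lemma ord_least (P : M -> Prop) a : Def1 P -> ordinal a -> P a ->
 exists b, ordinal b /\ P b /\ forall c, ordinal c -> P c -> b = c \/ b ∈ c.
Proof.
intros HP Oa Pa.
destruct (foundation_set (P := P) (a := succ a)) as (b&Hb&Pb&U);trivial.
- exists a. rewrite in_succ. tauto.
- assert (Ob := ord_mem (ord_succ Oa) Hb). exists b. split;[exact Ob|split;[exact Pb|]].
 intros c Oc Pc. destruct (ord_tri Ob Oc) as [A|[A|A]];try tauto.
 exfalso. apply (U c);trivial. now apply (ord_trans (ord_succ Oa) A).
Qed.

(** A description of the naturals that does not mention ω, so that ω can be separated from any
    inductive set; [is_omega_eq] shows agreement with the official notion. *)
Definition natO n := ordinal n /\ forall m, m ∈ succ n -> m = emp \/ exists k, m = succ k.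
Lemma natO_mem n m : natO n -> m ∈ n -> natO m.
Proof.
intros [O H] Hm. split;[now apply (ord_mem O)|].
intros k Hk. apply H. apply in_succ. left. apply in_succ in Hk as [Hk| ->];trivial.
now apply (ord_trans O Hk).
Qed.
Lemma natO_emp : natO emp.
Proof.
split;[apply ord_emp|]. intros m Hm. apply in_succ in Hm as [Hm| ->];[now apply in_emp in Hm|now left].
Qed.
Lemma natO_succ n : natO n -> natO (succ n).
Proof.
intros [O H]. split;[now apply ord_succ|]. intros m Hm. apply in_succ in Hm as [Hm| ->];auto.
right. now exists n.
Qed.

Definition om : M := sep (the (fun w => (exists z, is_empty z /\ z ∈ w) /\
 forall x, x ∈ w -> exists y, is_succ y x /\ y ∈ w)) natO.
Lemma in_om n : n ∈ om <-> natO n.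
Proof.
unfold om. set (w := the _).
assert (Hw : (exists z, is_empty z /\ z ∈ w) /\ forall x, x ∈ w -> exists y, is_succ y x /\ y ∈ w)
 by (apply the_spec, Z).
rewrite in_sep by (unfold natO;def). split;[tauto|]. intro Hn. spt.
apply NNPP. intro C.
destruct (foundation_set (P := fun m => ~ m ∈ w) (a := succ n)) as (m&Hm&D&U);
 [def|exists n;rewrite in_succ;tauto|].
destruct Hw as [(e&He&Hew) Hs]. apply is_empty_eq in He. subst e.
destruct (proj2 Hn m Hm) as [->|[k ->]];[tauto|].
assert (Hk : k ∈ succ k) by (rewrite in_succ;tauto).
assert (K : k ∈ w).
{ apply NNPP. apply U;trivial.
 apply in_succ. left. apply in_succ in Hm as [Hm|Hm].
 - now apply (ord_trans (proj1 Hn) Hk). - now rewrite <- Hm. }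
destruct (Hs k K) as (y&Hy&Hyw). apply is_succ_eq in Hy. now subst.
Qed.
Lemma om_emp : emp ∈ om. Proof. apply in_om, natO_emp. Qed.
Lemma om_succ n : n ∈ om -> succ n ∈ om.
Proof. rewrite !in_om. apply natO_succ. Qed.
Lemma om_mem n m : n ∈ om -> m ∈ n -> m ∈ om.
Proof. rewrite !in_om. apply natO_mem. Qed.
Lemma om_ord n : n ∈ om -> ordinal n.
Proof. rewrite in_om. now intros []. Qed.
Lemma ord_om : ordinal om.
Proof.
split.
- intros n Hn m Hm. now apply (om_mem Hn).
- intros n Hn. now apply om_ord.
Qed.
Lemma om_ind (P : M -> Prop) : Def1 P -> P emp -> (forall n, n ∈ om -> P n -> P (succ n)) ->
 forall n, n ∈ om -> P n.
Proof.
intros HP P0 PS n Hn. apply NNPP. intro C.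
destruct (foundation_set (P := fun m => ~ P m) (a := succ n)) as (m&Hm&D&U);
 [def|exists n;rewrite in_succ;tauto|].
apply in_om in Hn. destruct (proj2 Hn m Hm) as [->|[k ->]];[tauto|].
assert (Hk : k ∈ succ k) by (rewrite in_succ;tauto).
apply D, PS.
- apply in_om. apply in_succ in Hm as [Hm|Hm];[apply (natO_mem (natO_mem Hn Hm) Hk)|].
 apply (natO_mem Hn). now rewrite <- Hm.
- apply NNPP. apply U;trivial. apply in_succ. left. apply in_succ in Hm as [Hm|Hm].
 + now apply (ord_trans (proj1 Hn) Hk). + now rewrite <- Hm.
Qed.

Lemma ord_succ_le x y : ordinal y -> x ∈ y -> succ x ∈ y \/ succ x = y.
Proof.
intros Oy H. apply ord_sub;trivial.
- apply ord_succ. now apply (ord_mem Oy).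
- intros z Hz. apply in_succ in Hz as [Hz| ->];trivial. now apply (ord_trans Oy Hz).
Qed.

Lemma is_limit_eq x : limit_ordinal x <-> ordinal x /\ x <> emp /\ forall y, y ∈ x -> succ y ∈ x.
Proof.
unfold limit_ordinal. split;intros (O&H1&H2);spt;split.
- destruct H1 as [y Hy]. intros ->. now apply in_emp in Hy.
- intros y Hy. destruct (H2 y Hy) as (u&Hu&Hux). apply is_succ_eq in Hu. now subst.
- apply NNPP. intro C. apply H1. apply is_empty_eq. intros u Hu. apply C. now exists u.
- intros y Hy. exists (succ y). split;[now apply is_succ_eq|auto].
Qed.

Lemma is_omega_eq (w : M) : is_omega w <-> w = om.
Proof.
split.
- intros [Lw Hw]. apply is_limit_eq in Lw as (Ow&Nw&Sw). apply ext. intro n. split.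
 + intro Hn. apply in_om. split;[now apply (ord_mem Ow)|].
 intros m Hm. assert (Hmw : m ∈ w)
 by (apply in_succ in Hm as [Hm| ->];trivial;now apply (ord_trans Ow Hm)).
 assert (Om := ord_mem Ow Hmw).
 destruct (classic (m = emp)) as [E|E];[now left|right].
 apply NNPP. intro C. apply (Hw m Hmw). apply is_limit_eq. split;[exact Om|split;[exact E|]].
 intros k Hk. destruct (ord_succ_le Om Hk) as [A|A];trivial. exfalso. apply C. now exists k.
 + revert n. apply om_ind;[def| |auto].
 destruct (ord_tri Ow ord_emp) as [A|[A|A]];trivial;[now apply in_emp in A|tauto].
- intros ->. split.
 + apply is_limit_eq. split;[apply ord_om|]. split;[|intros y;apply om_succ].
 intro E. apply (in_emp (z := emp)). rewrite <- E at 2. apply om_emp.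
 + intros n Hn L. apply is_limit_eq in L as (On&Nn&Sn).
 apply in_om in Hn. destruct (proj2 Hn n) as [E|[k E]];[rewrite in_succ;tauto|tauto|].
 apply (mem_irrefl (x := n)). rewrite E at 1. apply Sn. rewrite E, in_succ. tauto.
Qed.
Lemma natural_eq n : natural n <-> n ∈ om.
Proof.
unfold natural. split.
- intros (w&Hw&H). apply is_omega_eq in Hw. now subst.
- intro H. exists om. now rewrite is_omega_eq.
Qed.
Lemma om_limit : limit_ordinal om.
Proof. now apply is_omega_eq. Qed.
End Ordinals.

(** * Functions, pairs and products *)

Section Functions.
Context {M : structure} {Z : ZFm M}.
Implicit Types a b c d f g k m n p q s u x y z : M.

Definition functional f := forall x y z, opair x y ∈ f -> opair x z ∈ f -> y = z.
(** The union of the set of values at [x]: the value itself when there is exactly one, and the empty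
    set when there is none. *)
Definition ap f x := bU (sep (bU (bU f)) (fun y => opair x y ∈ f)).
Lemma in_UU f x y : opair x y ∈ f -> x ∈ bU (bU f) /\ y ∈ bU (bU f).
Proof.
intro H. split;apply in_bU;exists (upair x y);rewrite in_upair;(split;[|tauto]);
apply in_bU;exists (opair x y);(spt);unfold opair;rewrite in_upair;tauto.
Qed.
Lemma ap_val f x y : opair x y ∈ f -> (forall z, opair x z ∈ f -> z = y) -> ap f x = y.
Proof.
intros H U. unfold ap. apply ext. intro z. rewrite in_bU. split.
- intros (u&Hu&Hz). apply in_sep in Hu as [_ Hu];[|def]. apply U in Hu. now subst.
- intro Hz. exists y. spt. apply in_sep;[def|]. spt. now apply in_UU in H.
Qed.
Lemma ap_fun f x y : functional f -> opair x y ∈ f -> ap f x = y.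
Proof. intros F H. apply ap_val;trivial. intros z Hz. now apply (F x). Qed.

Definition pfst p := bU (sep (bU p) (fun x => exists y, p = opair x y)).
Definition psnd p := bU (sep (bU p) (fun y => exists x, p = opair x y)).
Lemma pfst_eq x y : pfst (opair x y) = x.
Proof.
unfold pfst. apply ext. intro z. rewrite in_bU. split.
- intros (u&Hu&Hz). apply in_sep in Hu as [_ [w Hu]];[|def]. apply opair_inj in Hu as [-> _]. trivial.
- intro Hz. exists x. spt. apply in_sep;[def|]. split;[|now exists y].
 apply in_bU. exists (sing x). unfold opair. rewrite in_upair, in_sing. tauto.
Qed.
Lemma psnd_eq x y : psnd (opair x y) = y.
Proof.
unfold psnd. apply ext. intro z. rewrite in_bU. split.
- intros (u&Hu&Hz). apply in_sep in Hu as [_ [w Hu]];[|def]. apply opair_inj in Hu as [_ ->]. trivial.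
- intro Hz. exists y. spt. apply in_sep;[def|]. split;[|now exists x].
 apply in_bU. exists (upair x y). unfold opair. rewrite !in_upair. tauto.
Qed.

Definition prod a b := bU (repl a (fun x => repl b (fun y => opair x y))).
Lemma in_prod a b p : p ∈ prod a b <-> exists x y, x ∈ a /\ y ∈ b /\ p = opair x y.
Proof.
unfold prod. rewrite in_bU. split.
- intros (u&Hu&Hp). apply in_repl in Hu as (x&Hx&->);[|def].
 apply in_repl in Hp as (y&Hy&->);[|def]. now exists x, y.
- intros (x&y&Hx&Hy&->). exists (repl b (fun y => opair x y)). split.
 + apply in_repl;[def|]. now exists x. + apply in_repl;[def|]. now exists y.
Qed.
Lemma in_prod2 a b x y : opair x y ∈ prod a b <-> x ∈ a /\ y ∈ b.
Proof.
rewrite in_prod. split.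
- intros (x'&y'&Hx&Hy&E). apply opair_inj in E as [-> ->]. tauto.
- intros []. now exists x, y.
Qed.

Definition lam a (F : M -> M) := repl a (fun x => opair x (F x)).
Lemma in_lam a F p : DF1 F -> (p ∈ lam a F <-> exists x, x ∈ a /\ p = opair x (F x)).
Proof. intro H. unfold lam. apply in_repl. def. Qed.
Lemma in_lam2 a F x y : DF1 F -> (opair x y ∈ lam a F <-> x ∈ a /\ y = F x).
Proof.
intro H. rewrite in_lam by trivial. split.
- intros (x'&Hx&E). apply opair_inj in E as [-> ->]. tauto.
- intros [Hx ->]. now exists x.
Qed.
Lemma lam_functional a F : DF1 F -> functional (lam a F).
Proof. intros H x y z. rewrite !in_lam2 by trivial. intuition congruence. Qed.
Lemma ap_lam a F x : DF1 F -> x ∈ a -> ap (lam a F) x = F x.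
Proof. intros H Hx. apply ap_fun;[now apply lam_functional|]. now apply in_lam2. Qed.

Lemma is_fun_eq f a b : is_fun f a b <->
 (forall p, p ∈ f -> exists x y, x ∈ a /\ y ∈ b /\ p = opair x y) /\
 functional f /\ forall x, x ∈ a -> exists y, opair x y ∈ f.
Proof.
unfold is_fun. split.
- intros [H1 H2]. split;[|split].
 + intros p Hp. destruct (H1 p Hp) as (x&y&Hx&Hy&E). apply is_opair_eq in E. now exists x, y.
 + intros x y z Hy Hz. destruct (H1 _ Hy) as (x'&y'&Hx&_&E).
 apply is_opair_eq, opair_inj in E as [-> _]. destruct (H2 x' Hx) as (u&_&U).
 rewrite <- (U y), <- (U z);trivial;now apply app_eq.
 + intros x Hx. destruct (H2 x Hx) as (y&Hy&_). exists y. now apply app_eq.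
- intros (H1&H2&H3). split.
 + intros p Hp. destruct (H1 p Hp) as (x&y&Hx&Hy&->). exists x, y. now rewrite is_opair_eq.
 + intros x Hx. destruct (H3 x Hx) as [y Hy]. exists y. split;[now apply app_eq|].
 intros z Hz. apply app_eq in Hz. now apply (H2 x).
Qed.
Lemma fun_ap f a b x : is_fun f a b -> x ∈ a -> ap f x ∈ b /\ opair x (ap f x) ∈ f.
Proof.
rewrite is_fun_eq. intros (H1&H2&H3) Hx. destruct (H3 x Hx) as [y Hy].
rewrite (ap_fun H2 Hy). spt. destruct (H1 _ Hy) as (x'&y'&_&Hy'&E).
apply opair_inj in E as [_ ->]. trivial.
Qed.
Lemma fun_app f a b x y : is_fun f a b -> (app f x y <-> x ∈ a /\ y = ap f x).
Proof.
intro H. rewrite app_eq. split.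
- intro Hp. pose proof H as H'. apply is_fun_eq in H' as (H1&H2&_). split;[|symmetry;now apply ap_fun].
 destruct (H1 _ Hp) as (x'&y'&Hx&_&E). apply opair_inj in E as [-> _]. trivial.
- intros [Hx ->]. now apply (fun_ap H).
Qed.
Lemma lam_fun a b F : DF1 F -> (forall x, x ∈ a -> F x ∈ b) -> is_fun (lam a F) a b.
Proof.
intros H HF. apply is_fun_eq. split;[|split].
- intros p Hp. apply in_lam in Hp as (x&Hx&->);trivial. exists x, (F x). auto.
- now apply lam_functional.
- intros x Hx. exists (F x). now apply in_lam2.
Qed.

(** The default [emp] off the domain of [R] makes the description total, so that [DT_the] applies
    and the partial function becomes a definable term. *)
Definition pf (R : M -> M -> Prop) u :=
 the (fun y => R u y \/ (~ (exists z, R u z) /\ y = emp)).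
Lemma pf_eq R u y : (forall y z, R u y -> R u z -> y = z) -> R u y -> pf R u = y.
Proof.
intros U H. apply the_eq;[now left|]. intros z [Hz|[C _]];[now apply U|].
exfalso. apply C. now exists y.
Qed.
Lemma DF_pf R : (forall u y z, R u y -> R u z -> y = z) -> Def2 R -> DF1 (pf R).
Proof.
intros U H. unfold DF1, pf. apply DT_the with (Q := fun y v => R (v 0) y \/ (~ (exists z, R (v 0) z) /\ y = emp)).
- intro v. destruct (classic (exists z, R (v 0) z)) as [[z Hz]|C].
 + exists z. split;[tauto|]. intros y [Hy|[C _]];[now apply (U (v 0))|exfalso;eauto].
 + exists emp. split;[tauto|]. intros y [Hy|[_ E]];[exfalso;eauto|congruence].
- def.
Qed.
End Functions.

Ltac def_hook1 :=
 lazymatch goal with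
 | |- DT (fun v => ap _ _) => unfold ap
 | |- DT (fun v => pfst _) => unfold pfst
 | |- DT (fun v => psnd _) => unfold psnd
 | |- DT (fun v => prod _ _) => unfold prod
 | |- DT (fun v => lam _ _) => unfold lam
 | |- Def (fun v => functional _) => unfold functional
 | |- Def (fun v => natO _) => unfold natO
 | _ => def_hook0
 end.
Ltac def_hook ::= def_hook1.

(** * Recursion on ω and on membership *)

Section Recursion.
Context {M : structure} {Z : ZFm M}.
Implicit Types a b c d f g k m n p q s u x y z : M.

Section OmegaRec.
Variables (G : M -> M -> M) (x0 : M).
Hypothesis HG : DF2 G.
Definition om_att f n := functional f /\ opair emp x0 ∈ f /\
 (forall m y, m ∈ n -> opair m y ∈ f -> opair (succ m) (G m y) ∈ f) /\
 (forall p, p ∈ f -> exists m y, m ∈ succ n /\ p = opair m y).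
Definition om_rel n y := n ∈ om /\ exists f, om_att f n /\ opair n y ∈ f.
Lemma om_att_def : Def2 om_att.
Proof. unfold om_att. def. Qed.
Lemma om_att_uniq n n' f g : om_att f n -> om_att g n' -> n ∈ om -> n' ∈ om -> forall m, m ∈ om -> m ∈ succ n -> m ∈ succ n' ->
 exists y, forall z, (opair m z ∈ f <-> z = y) /\ (opair m z ∈ g <-> z = y).
Proof.
intros (F1&F2&F3&F4) (G1&G2&G3&G4) Hn Hn'. apply (om_ind (P := fun m => m ∈ succ n -> m ∈ succ n' ->
 exists y, forall z, (opair m z ∈ f <-> z = y) /\ (opair m z ∈ g <-> z = y))).
- def.
- intros _ _. exists x0. intro z. split;(split;[|now intros ->]);intro H;
 [now apply (F1 emp)|now apply (G1 emp)].
- intros m Hm IH A B.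
 assert (K : forall n, n ∈ om -> succ m ∈ succ n -> m ∈ n).
 { intros k Hk Hs. apply in_succ in Hs as [Hs|Hs].
 - apply (ord_trans (om_ord Hk) (y := succ m));trivial. rewrite in_succ;tauto.
 - rewrite <- Hs, in_succ. tauto. }
 destruct IH as [y Hy];try (apply in_succ;left;auto).
 exists (G m y). intro z. destruct (Hy y) as [Y1 Y2].
 assert (A1 : opair (succ m) (G m y) ∈ f) by (apply F3;[auto|now apply Y1]).
 assert (B1 : opair (succ m) (G m y) ∈ g) by (apply G3;[auto|now apply Y2]).
 split;(split;[intro H|now intros ->]);[now apply (F1 (succ m))|now apply (G1 (succ m))].
Qed.
Lemma om_rel_fun u y z : om_rel u y -> om_rel u z -> y = z.
Proof.
intros (Hu&f&Hf&Hy) (_&g&Hg&Hz).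
destruct (om_att_uniq Hf Hg Hu Hu (m := u)) as [w Hw];trivial;try (rewrite in_succ;tauto).
destruct (Hw y) as [Y _]. destruct (Hw z) as [_ Y']. rewrite (proj1 Y Hy). symmetry. now apply Y'.
Qed.
Lemma om_rel_def : Def2 om_rel.
Proof. unfold om_rel. pose proof om_att_def. def. Qed.
Definition om_rec := pf om_rel.
Lemma DF_om_rec : DF1 om_rec.
Proof. apply DF_pf;[apply om_rel_fun|apply om_rel_def]. Qed.
Lemma om_att_0 : om_att (sing (opair emp x0)) emp.
Proof.
repeat split.
- intros x y z H H'. apply in_sing in H, H'. rewrite <- H' in H. now apply opair_inj in H.
- now apply in_sing.
- intros m y Hm. now apply in_emp in Hm.
- intros p Hp. apply in_sing in Hp. exists emp, x0. rewrite in_succ. tauto.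
Qed.
Lemma om_att_S n f y : n ∈ om -> om_att f n -> opair n y ∈ f ->
 om_att (cup f (sing (opair (succ n) (G n y)))) (succ n).
Proof.
intros Hn (F1&F2&F3&F4) Hy.
assert (N : forall z, ~ opair (succ n) z ∈ f).
{ intros z Hz. destruct (F4 _ Hz) as (m&w&Hm&E). apply opair_inj in E as [E _]. rewrite <- E in Hm.
 now apply mem_irrefl in Hm. }
repeat split.
- intros a b c. rewrite !in_cup, !in_sing. intros [A|A] [B|B].
 + now apply (F1 a). + apply opair_inj in B as [-> _]. now apply N in A.
 + apply opair_inj in A as [-> _]. now apply N in B.
 + rewrite <- B in A. now apply opair_inj in A.
- rewrite in_cup. tauto.
- intros m z Hm. rewrite !in_cup, !in_sing. intros [H|H].
 + apply in_succ in Hm as [Hm| ->];[left;auto|]. right. now rewrite (F1 _ _ _ H Hy).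
 + apply opair_inj in H as [-> _]. now apply mem_irrefl in Hm.
- intros p Hp. apply in_cup in Hp as [Hp|Hp].
 + destruct (F4 p Hp) as (m&z&Hm&->). exists m, z. rewrite in_succ. tauto.
 + apply in_sing in Hp. exists (succ n), (G n y). rewrite in_succ. tauto.
Qed.
Lemma om_rel_ex n : n ∈ om -> exists y, om_rel n y.
Proof.
revert n. apply om_ind.
- pose proof om_rel_def. def.
- exists x0. split;[apply om_emp|]. exists (sing (opair emp x0)). split;[apply om_att_0|now apply in_sing].
- intros n Hn (y&_&f&Hf&Hy). exists (G n y). split;[now apply om_succ|].
 exists (cup f (sing (opair (succ n) (G n y)))). split;[now apply om_att_S|].
 rewrite in_cup, in_sing. tauto.
Qed.
Lemma om_rec_0 : om_rec emp = x0.
Proof.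
apply pf_eq;[apply om_rel_fun|]. split;[apply om_emp|]. exists (sing (opair emp x0)).
split;[apply om_att_0|now apply in_sing].
Qed.
Lemma om_rec_S n : n ∈ om -> om_rec (succ n) = G n (om_rec n).
Proof.
intro Hn. destruct (om_rel_ex Hn) as [y Hy].
unfold om_rec. rewrite (pf_eq (u := n) (y := y));[|intros ? ?;apply om_rel_fun|trivial].
apply pf_eq;[apply om_rel_fun|]. destruct Hy as (_&f&Hf&Hy).
split;[now apply om_succ|]. exists (cup f (sing (opair (succ n) (G n y)))).
split;[now apply om_att_S|]. rewrite in_cup, in_sing. tauto.
Qed.
End OmegaRec.

Lemma trans_ex x : exists t : M, transitive t /\ subset x t.
Proof.
pose (G := fun _ y : M => bU y). assert (HG : DF2 G) by (unfold G;def).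
assert (HF := DF_om_rec x HG). exists (bU (repl om (om_rec G x))). split.
- intros y Hy z Hz. apply in_bU in Hy as (u&Hu&Hy). apply in_repl in Hu as (n&Hn&->);trivial.
 apply in_bU. exists (om_rec G x (succ n)). split.
 + apply in_repl;trivial. exists (succ n). spt. now apply om_succ.
 + rewrite om_rec_S by trivial. apply in_bU. now exists y.
- intros y Hy. apply in_bU. exists x. spt. apply in_repl;trivial. exists emp.
 split;[apply om_emp|]. symmetry. now apply om_rec_0.
Qed.

Definition tc x := the (fun t => forall u, u ∈ t <-> forall t', transitive t' -> subset x t' -> u ∈ t').
Lemma in_tc x u : u ∈ tc x <-> forall t', transitive t' -> subset x t' -> u ∈ t'.
Proof.
revert u. apply (@the_spec M Z (fun t => forall u, u ∈ t <-> forall t', transitive t' -> subset x t' -> u ∈ t')).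
destruct (trans_ex x) as (t&Ht&Hx).
exists (sep t (fun u => forall t', transitive t' -> subset x t' -> u ∈ t')). intro u.
rewrite in_sep by def. split;[tauto|]. intro H. split;auto.
Qed.
Lemma tc_sub x : subset x (tc x).
Proof. intros y Hy. apply in_tc. auto. Qed.
Lemma tc_trans x : transitive (tc x).
Proof. intros y Hy z Hz. apply in_tc. intros t Ht Hx. apply (Ht y);trivial. revert t Ht Hx. now apply in_tc. Qed.
Lemma tc_min x y : transitive y -> subset x y -> subset (tc x) y.
Proof. intros H1 H2 u Hu. exact (proj1 (in_tc _ _) Hu y H1 H2). Qed.
Lemma DT_tc (t : (nat -> M) -> M) : DT t -> DT (fun v => tc (t v)).
Proof.
intro H. apply DT_set with (Q := fun u v => forall t', transitive t' -> subset (t v) t' -> u ∈ t').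
- intros;apply in_tc. - def.
Qed.
Lemma tc_unfold x u : u ∈ tc x <-> u ∈ x \/ exists y, y ∈ x /\ u ∈ tc y.
Proof.
split.
- assert (HT : DT (fun v : nat -> M => tc (v 0))) by (apply DT_tc;def).
 assert (HT1 : DF1 tc) by exact HT.
 intro Hu.
 assert (K : u ∈ cup x (bU (repl x tc))).
 { revert Hu. apply tc_min;[|intros y Hy;apply in_cup;tauto].
 intros y Hy z Hz. apply in_cup in Hy as [Hy|Hy];apply in_cup;right;apply in_bU.
 - exists (tc y). split;[apply in_repl;trivial;now exists y|now apply tc_sub].
 - apply in_bU in Hy as (w&Hw&Hy). exists w. spt.
 apply in_repl in Hw as (y'&Hy'&->);trivial. now apply (tc_trans Hy). }
 apply in_cup in K as [K|K];[tauto|right]. apply in_bU in K as (w&Hw&K).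
 apply in_repl in Hw as (y'&Hy'&->);trivial. now exists y'.
- intros [H|(y&Hy&H)];[now apply tc_sub|].
 revert H. apply tc_min;[apply tc_trans|]. intros z Hz. apply (tc_trans (tc_sub Hy) Hz).
Qed.

Lemma mem_ind (P : M -> Prop) : Def1 P -> (forall x, (forall y, y ∈ x -> P y) -> P x) -> forall x, P x.
Proof.
intros HP IH x. apply NNPP. intro C.
destruct (foundation_set (P := fun y => ~ P y) (a := tc (sing x))) as (y&Hy&D&U).
- def. - exists x. spt. apply tc_sub. now apply in_sing.
- apply D, IH. intros z Hz. apply NNPP. apply U;trivial. now apply (tc_trans Hy).
Qed.

End Recursion.

Ltac def_hook2 :=
 lazymatch goal with
 | |- DT (fun v => tc (@?t v)) => refine (@DT_tc _ _ t _)
 | _ => def_hook1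
 end.
Ltac def_hook ::= def_hook2.

Section SetRec.
Context {M : structure} {Z : ZFm M}.
Implicit Types a b c d f g k m n p q s u x y z : M.
Variable G : M -> M -> M.
Hypothesis HG : DF2 G.

Definition rst f x := sep f (fun p => exists u z, u ∈ x /\ p = opair u z).
Definition att f := functional f /\
 forall x y, opair x y ∈ f -> (forall u, u ∈ x -> exists z, opair u z ∈ f) /\ y = G x (rst f x).
Lemma rst_ext f g x : (forall u z, u ∈ x -> (opair u z ∈ f <-> opair u z ∈ g)) -> rst f x = rst g x.
Proof.
intro E. apply ext. intro p. unfold rst. rewrite !in_sep by def.
split;intros (H&u&z&Hu&->);(split;[apply (E u z Hu)|exists u, z];tauto).
Qed.
Lemma att_def : Def1 att.
Proof. unfold att, rst. def. Qed.
Definition rec_rel x y := exists f, att f /\ opair x y ∈ f.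
Lemma rec_rel_fun x y z : rec_rel x y -> rec_rel x z -> y = z.
Proof.
intros (f&Hf&Hy) (g&Hg&Hz). revert x y z Hy Hz.
apply (mem_ind (P := fun x => forall y z, opair x y ∈ f -> opair x z ∈ g -> y = z));[def|].
intros x IH y z Hy Hz. destruct Hf as [Ff Hf], Hg as [Fg Hg].
destruct (Hf _ _ Hy) as [Df ->], (Hg _ _ Hz) as [Dg ->]. f_equal.
apply rst_ext. intros u w Hu. destruct (Df u Hu) as [a Ha], (Dg u Hu) as [b Hb].
assert (E := IH u Hu a b Ha Hb). subst b.
split;intro H;[now rewrite (Ff _ _ _ H Ha)|now rewrite (Fg _ _ _ H Hb)].
Qed.
Lemma rec_rel_def : Def2 rec_rel.
Proof. unfold rec_rel. pose proof att_def. def. Qed.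
Definition rec0 := pf rec_rel.
Lemma DF_rec0 : DF1 rec0.
Proof. apply DF_pf;[apply rec_rel_fun|apply rec_rel_def]. Qed.
Lemma att_tc f x y : att f -> opair x y ∈ f -> forall u, u ∈ tc x -> opair u (rec0 u) ∈ f.
Proof.
intros [Ff Hf] Hx u Hu. apply tc_min with (y := sep (bU (bU f)) (fun u => exists z, opair u z ∈ f)) in Hu.
- apply in_sep in Hu as [_ [z Hz]];[|def]. unfold rec0. rewrite (pf_eq (y := z));trivial.
 + intros ? ?;apply rec_rel_fun. + now exists f.
- intros a Ha b Hb. apply in_sep in Ha as [_ [z Hz]];[|def].
 destruct (Hf _ _ Hz) as [D _]. destruct (D b Hb) as [w Hw]. apply in_sep;[def|].
 split;[now apply in_UU in Hw|now exists w].
- intros b Hb. destruct (Hf _ _ Hx) as [D _]. destruct (D b Hb) as [w Hw]. apply in_sep;[def|].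
 split;[now apply in_UU in Hw|now exists w].
Qed.
Lemma rec_rel_ex x : exists y, rec_rel x y.
Proof.
revert x. apply mem_ind;[pose proof rec_rel_def;def|]. intros x IH.
pose proof DF_rec0 as HR.
assert (T : forall u, u ∈ tc x -> rec_rel u (rec0 u)).
{ intros u Hu. apply tc_unfold in Hu as [Hu|(y&Hy&Hu)].
 - destruct (IH u Hu) as [y Hy]. unfold rec0. rewrite (pf_eq (y := y));trivial. intros ? ?;apply rec_rel_fun.
 - destruct (IH y Hy) as (z&f&Hf&Hz). exists f. spt. now apply (att_tc Hf Hz). }
assert (A : att (lam (tc x) rec0)).
{ split;[now apply lam_functional|]. intros u y Hu. apply in_lam2 in Hu as [Hu ->];trivial. split.
 - intros w Hw. exists (rec0 w). apply in_lam2;trivial. spt. now apply (tc_trans Hu).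
 - destruct (T u Hu) as (f&Hf&Hfu). destruct (proj2 Hf _ _ Hfu) as [D E]. rewrite E at 1. f_equal.
 apply rst_ext. intros w z Hw. rewrite in_lam2 by trivial.
 assert (K := att_tc Hf Hfu (tc_sub Hw)). split.
 + intro H. split;[now apply (tc_trans Hu)|]. now apply (proj1 Hf w).
 + intros [_ ->]. trivial. }
set (f := lam (tc x) rec0) in *. set (y := G x (rst f x)).
assert (Nx : ~ x ∈ tc x).
{ assert (N : forall x, ~ x ∈ tc x).
 { apply mem_ind;[def|]. intros u IHu Hu. apply tc_unfold in Hu as [Hu|(w&Hw&Hu)].
 - now apply mem_irrefl in Hu.
 - apply (IHu w Hw). apply (tc_trans Hu). trivial. }
 apply N. }
assert (Nf : forall z, ~ opair x z ∈ f).
{ intros z Hz. apply in_lam2 in Hz;trivial. tauto. }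
assert (Rs : forall u, u ∈ tc x \/ u = x -> rst (cup f (sing (opair x y))) u = rst f u).
{ intros u Hu. apply rst_ext. intros w z Hw. rewrite in_cup, in_sing. split;[|tauto].
 intros [H|H];trivial. apply opair_inj in H as [-> _]. exfalso. destruct Hu as [Hu| ->].
 - apply Nx. now apply (tc_trans Hu). - now apply mem_irrefl in Hw. }
exists y, (cup f (sing (opair x y))). split;[|rewrite in_cup, in_sing;tauto]. split.
- intros a b c. rewrite !in_cup, !in_sing. intros [H1|H1] [H2|H2].
 + now apply (proj1 A a). + apply opair_inj in H2 as [-> _]. now apply Nf in H1.
 + apply opair_inj in H1 as [-> _]. now apply Nf in H2.
 + rewrite <- H2 in H1. now apply opair_inj in H1.
- intros a b H. apply in_cup in H as [H|H].
 + destruct (proj2 A _ _ H) as [D E]. split.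
 * intros u Hu. destruct (D u Hu) as [z Hz]. exists z. rewrite in_cup. tauto.
 * rewrite Rs;trivial. apply in_lam2 in H;tauto.
 + apply in_sing, opair_inj in H as [-> ->]. split;[|now rewrite Rs by tauto].
 intros u Hu. exists (rec0 u). rewrite in_cup. left. apply in_lam2;trivial. spt. now apply tc_sub.
Qed.
Lemma rec0_eq x : rec0 x = G x (lam x rec0).
Proof.
pose proof DF_rec0 as HR.
destruct (rec_rel_ex x) as (y&f&Hf&Hy). unfold rec0 at 1.
rewrite (pf_eq (y := y));[|intros ? ?;apply rec_rel_fun|now exists f].
destruct (proj2 Hf _ _ Hy) as [D E]. rewrite E. f_equal. apply ext. intro p.
unfold rst. rewrite in_sep by def. rewrite in_lam by trivial. split.
- intros (Hp&u&z&Hu&->). exists u. spt. f_equal.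
 apply (proj1 Hf u);trivial. apply (att_tc Hf Hy). now apply tc_sub.
- intros (u&Hu&->). split;[|now exists u, (rec0 u)]. apply (att_tc Hf Hy). now apply tc_sub.
Qed.
End SetRec.

Section StrongRec.
Context {M : structure} {Z : ZFm M}.
Implicit Types a b c d f g k m n p q s u x y z : M.
Variable G : M -> M -> M.
Hypothesis HG : DF2 G.
(** Computes by plain recursion on membership the whole history [lam (tc x) srec]. Evaluating names
    needs it: a subname occurs in a name only inside a pair, hence in its transitive closure and in
    general not among its elements. *)
Definition hist_step x h := bU (repl x (fun y => cup (ap h y) (sing (opair y (G y (ap h y)))))).
Lemma hist_step_def : DF2 hist_step.
Proof. unfold hist_step. def. Qed.
Definition srec x := G x (rec0 hist_step x).
Lemma DF_srec : DF1 srec.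
Proof. unfold srec. pose proof (DF_rec0 hist_step_def). def. Qed.
Lemma srec_eq x : srec x = G x (lam (tc x) srec).
Proof.
pose proof DF_srec as HS. pose proof (DF_rec0 hist_step_def) as HR.
unfold srec at 1. f_equal. revert x. apply mem_ind;[def|]. intros x IH.
rewrite rec0_eq by apply hist_step_def. unfold hist_step at 1. apply ext. intro p.
rewrite in_bU, in_lam by trivial. split.
- intros (u&Hu&Hp). apply in_repl in Hu as (y&Hy&->);[|def].
 rewrite ap_lam in Hp by trivial. rewrite IH in Hp by trivial. apply in_cup in Hp as [Hp|Hp].
 + apply in_lam in Hp as (w&Hw&->);trivial. exists w. spt. apply tc_unfold. right. now exists y.
 + apply in_sing in Hp. subst p. exists y. split;[now apply tc_sub|]. unfold srec. now rewrite IH.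
- intros (w&Hw&->). apply tc_unfold in Hw as [Hw|(y&Hy&Hw)].
 + exists (cup (rec0 hist_step w) (sing (opair w (srec w)))). split.
 * apply in_repl;[def|]. exists w. spt. now rewrite ap_lam.
 * rewrite in_cup, in_sing. tauto.
 + exists (cup (rec0 hist_step y) (sing (opair y (srec y)))). split.
 * apply in_repl;[def|]. exists y. spt. now rewrite ap_lam.
 * rewrite in_cup. left. rewrite IH by trivial. apply in_lam2;tauto.
Qed.
End StrongRec.

#[global] Opaque om_rec rec0 srec tc pf.

(** * Cumulative hierarchy, rank and collection *)

Section Hierarchy.
Context {M : structure} {Z : ZFm M}.
Implicit Types a b c d f g k m n p q s u x y z : M.

Definition Vr_step x h := bU (repl x (fun y => pow (ap h y))).
Lemma Vr_step_def : DF2 Vr_step. Proof. unfold Vr_step. def. Qed.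
Definition Vr : M -> M := srec Vr_step.
Lemma DF_Vr : DF1 Vr. Proof. apply DF_srec, Vr_step_def. Qed.
Lemma in_Vr x u : u ∈ Vr x <-> exists y, y ∈ x /\ subset u (Vr y).
Proof.
pose proof DF_Vr as HV. unfold Vr. rewrite srec_eq by apply Vr_step_def. fold Vr.
unfold Vr_step. rewrite in_bU. split.
- intros (w&Hw&Hu). apply in_repl in Hw as (y&Hy&->);[|def].
 rewrite ap_lam in Hu by (trivial;now apply tc_sub). apply in_pow in Hu. now exists y.
- intros (y&Hy&Hu). exists (pow (Vr y)). split;[|now apply in_pow].
 apply in_repl;[def|]. exists y. spt. rewrite ap_lam;trivial. now apply tc_sub.
Qed.
#[local] Opaque Vr.
Lemma Vr_mono x y : subset x y -> subset (Vr x) (Vr y).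
Proof. intros H u. rewrite !in_Vr. intros (w&Hw&Hu). exists w. auto. Qed.
Lemma Vr_trans x : transitive (Vr x).
Proof.
revert x. apply mem_ind;[pose proof DF_Vr;def|]. intros x IH u Hu z Hz.
apply in_Vr in Hu as (y&Hy&Hu). apply in_Vr. exists y. spt.
apply (IH y Hy). now apply Hu.
Qed.
Lemma Vr_sub x u w : u ∈ Vr x -> subset w u -> w ∈ Vr x.
Proof. rewrite !in_Vr. intros (y&Hy&Hu) H. exists y. spt. intros z Hz. auto. Qed.

Definition rk_step x h := bU (repl x (fun y => succ (ap h y))).
Lemma rk_step_def : DF2 rk_step. Proof. unfold rk_step. def. Qed.
Definition rk : M -> M := srec rk_step.
Lemma DF_rk : DF1 rk. Proof. apply DF_srec, rk_step_def. Qed.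
Lemma in_rk x u : u ∈ rk x <-> exists y, y ∈ x /\ u ∈ succ (rk y).
Proof.
pose proof DF_rk as HV. unfold rk. rewrite srec_eq by apply rk_step_def. fold rk.
unfold rk_step. rewrite in_bU. split.
- intros (w&Hw&Hu). apply in_repl in Hw as (y&Hy&->);[|def].
 rewrite ap_lam in Hu by (trivial;now apply tc_sub). now exists y.
- intros (y&Hy&Hu). exists (succ (rk y)). split;[|trivial].
 apply in_repl;[def|]. exists y. spt. rewrite ap_lam;trivial. now apply tc_sub.
Qed.
#[local] Opaque rk.
Lemma rk_ord x : ordinal (rk x).
Proof.
revert x. apply mem_ind;[pose proof DF_rk;def|]. intros x IH. split.
- intros u Hu z Hz. apply in_rk in Hu as (y&Hy&Hu). apply in_rk. exists y. spt.
 apply (ord_trans (ord_succ (IH y Hy)) Hz Hu).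
- intros u Hu. apply in_rk in Hu as (y&Hy&Hu). exact (proj1 (ord_mem (ord_succ (IH y Hy)) Hu)).
Qed.
Lemma rk_mem x y : y ∈ x -> rk y ∈ rk x.
Proof. intro H. apply in_rk. exists y. rewrite in_succ. tauto. Qed.
Lemma sub_Vr_rk x : subset x (Vr (rk x)).
Proof.
revert x. apply mem_ind;[pose proof DF_rk;pose proof DF_Vr;def|]. intros x IH y Hy.
apply in_Vr. exists (rk y). split;[now apply rk_mem|auto].
Qed.
Lemma rk_ordinal x : ordinal x -> rk x = x.
Proof.
revert x. apply (mem_ind (P := fun x => ordinal x -> rk x = x));[pose proof DF_rk;def|]. intros x IH Ox.
apply ext. intro u. rewrite in_rk. split.
- intros (y&Hy&Hu). rewrite IH in Hu;[|trivial|now apply (ord_mem Ox)].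
 apply in_succ in Hu as [Hu| ->];trivial. now apply (ord_trans Ox Hu).
- intro Hu. exists u. rewrite IH;[|trivial|now apply (ord_mem Ox)]. rewrite in_succ. tauto.
Qed.

(** Scott's trick: for each [x] the least rank of a witness is a definable function of [x], and
    replacement applies to the corresponding levels of the hierarchy. *)
Lemma collection (R : M -> M -> Prop) a : Def2 R -> (forall x, x ∈ a -> exists y, R x y) ->
 exists b, forall x, x ∈ a -> exists y, y ∈ b /\ R x y.
Proof.
intros HR H. pose proof DF_Vr as HV.
pose (Q := fun x o => ordinal o /\ (exists y, subset y (Vr o) /\ R x y) /\
 forall o', ordinal o' -> (exists y, subset y (Vr o') /\ R x y) -> o = o' \/ o ∈ o').
assert (HQ : Def2 Q) by (unfold Q;def).
assert (UQ : forall x o o', Q x o -> Q x o' -> o = o').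
{ intros x o o' (O1&E1&L1) (O2&E2&L2). destruct (L1 o' O2 E2) as [|A];trivial.
 destruct (L2 o O1 E1) as [|B];[congruence|]. exfalso. now apply (mem_asym A). }
assert (HF := DF_pf UQ HQ).
exists (bU (repl a (fun x => pow (Vr (pf Q x))))). intros x Hx.
destruct (H x Hx) as [y Hy].
destruct (ord_least (P := fun o => exists y, subset y (Vr o) /\ R x y) (a := rk y)) as (o&Oo&Eo&Lo);
 [def|apply rk_ord|exists y;spt;apply sub_Vr_rk|].
assert (E : pf Q x = o) by (apply pf_eq;[apply UQ|exact (conj Oo (conj Eo Lo))]).
destruct Eo as (y'&Hs&Hr). exists y'. spt. apply in_bU. exists (pow (Vr o)).
split;[|now apply in_pow]. apply in_repl;[def|]. exists x. now rewrite E.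
Qed.
End Hierarchy.

(** * Finite sets *)

Section Finite.
Context {M : structure} {Z : ZFm M}.
Implicit Types a b c d f g k m n p q s u x y z : M.

Lemma is_surj_eq f a b : is_surj f a b <-> is_fun f a b /\ forall y, y ∈ b -> exists x, x ∈ a /\ ap f x = y.
Proof.
unfold is_surj. split;intros [H1 H2];spt;intros y Hy;destruct (H2 y Hy) as [x Hx].
- apply (fun_app x y H1) in Hx as [Hx ->]. now exists x.
- exists x. apply (fun_app x y H1). intuition.
Qed.
Lemma lam_surj a b F : DF1 F -> (forall x, x ∈ a -> F x ∈ b) ->
 (forall y, y ∈ b -> exists x, x ∈ a /\ F x = y) -> is_surj (lam a F) a b.
Proof.
intros HF H1 H2. apply is_surj_eq. split;[now apply lam_fun|].
intros y Hy. destruct (H2 y Hy) as (x&Hx&E). exists x. rewrite ap_lam;auto.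
Qed.
Lemma surj_comp f g a b c : is_surj f a b -> is_surj g b c -> exists h, is_surj h a c.
Proof.
rewrite !is_surj_eq. intros [F1 F2] [G1 G2]. exists (lam a (fun x => ap g (ap f x))).
apply lam_surj;[def| |].
- intros x Hx. apply (fun_ap G1). now apply (fun_ap F1).
- intros z Hz. destruct (G2 z Hz) as (y&Hy&<-). destruct (F2 y Hy) as (x&Hx&<-). now exists x.
Qed.

Lemma finite_emp : finite (emp (M := M)).
Proof.
exists emp, emp. split;[apply natural_eq, om_emp|]. apply is_surj_eq. split.
- apply is_fun_eq. repeat split.
 + intros p Hp. now apply in_emp in Hp. + intros x y z Hp. now apply in_emp in Hp.
 + intros x Hp. now apply in_emp in Hp.
- intros y Hy. now apply in_emp in Hy.
Qed.
Lemma finite_add x y : finite x -> finite (cup x (sing y)).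
Proof.
intros (n&f&Hn&Hf). apply natural_eq in Hn. apply is_surj_eq in Hf as [F1 F2].
exists (succ n), (cup f (sing (opair n y))). split;[now apply natural_eq, om_succ|].
pose proof F1 as F1'. apply is_fun_eq in F1' as (A&B&C).
assert (N : forall z, ~ opair n z ∈ f).
{ intros z Hz. destruct (A _ Hz) as (m&w&Hm&_&E). apply opair_inj in E as [E _]. subst m.
 now apply mem_irrefl in Hm. }
assert (K : is_fun (cup f (sing (opair n y))) (succ n) (cup x (sing y))).
{ apply is_fun_eq. split;[|split].
 - intros p Hp. apply in_cup in Hp as [Hp|Hp].
 + destruct (A p Hp) as (m&w&Hm&Hw&->). exists m, w. rewrite in_succ, in_cup. tauto.
 + apply in_sing in Hp. exists n, y. rewrite in_succ, in_cup, in_sing. tauto.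
 - intros a b c. rewrite !in_cup, !in_sing. intros [H1|H1] [H2|H2].
 + now apply (B a). + apply opair_inj in H2 as [-> _]. now apply N in H1.
 + apply opair_inj in H1 as [-> _]. now apply N in H2.
 + rewrite <- H2 in H1. now apply opair_inj in H1.
 - intros m Hm. apply in_succ in Hm as [Hm| ->].
 + destruct (C m Hm) as [w Hw]. exists w. rewrite in_cup;tauto.
 + exists y. rewrite in_cup, in_sing;tauto. }
spt. intros z Hz. apply in_cup in Hz as [Hz|Hz].
- destruct (F2 z Hz) as (m&Hm&<-). exists m. apply app_eq, in_cup. left. now apply (fun_ap F1).
- apply in_sing in Hz as ->. exists n. apply app_eq, in_cup. right. now apply in_sing.
Qed.
Lemma finite_ind (P : M -> Prop) : Def1 P -> P emp ->
 (forall x y, finite x -> P x -> P (cup x (sing y))) -> forall x, finite x -> P x.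
Proof.
intros HP P0 PS x (n&f&Hn&Hf). apply natural_eq in Hn. revert f x Hf.
revert Hn. revert n.
cut (forall n, n ∈ om -> forall f x, is_surj f n x -> P x /\ finite x).
{ intros H n Hn f x Hf. now apply (H n Hn f). }
apply (om_ind (P := fun n => forall f x, is_surj f n x -> P x /\ finite x));[def| |].
- intros f x Hf. apply is_surj_eq in Hf as [_ F2].
 replace x with (emp (M := M));[split;[trivial|apply finite_emp]|].
 apply ext. intro z. split;intro Hz;[now apply in_emp in Hz|].
 destruct (F2 z Hz) as (w&Hw&_). now apply in_emp in Hw.
- intros n Hn IH f x Hf. apply is_surj_eq in Hf as [F1 F2].
 pose (x' := repl n (fun m => ap f m)).
 assert (Hx' : forall z, z ∈ x' <-> exists m, m ∈ n /\ z = ap f m) by (intro;apply in_repl;def).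
 destruct (IH (lam n (fun m => ap f m)) x') as [Px' Fx'].
 { apply lam_surj;[def| |].
 - intros m Hm. apply Hx'. now exists m.
 - intros z Hz. apply Hx' in Hz as (m&Hm&->). now exists m. }
 replace x with (cup x' (sing (ap f n)));[split;[now apply PS|now apply finite_add]|].
 apply ext. intro z. rewrite in_cup, in_sing, Hx'. split.
 + intros [(m&Hm&->)| ->];apply (fun_ap F1);rewrite in_succ;tauto.
 + intro Hz. destruct (F2 z Hz) as (m&Hm&<-). apply in_succ in Hm as [Hm| ->];[left;now exists m|tauto].
Qed.
Lemma finite_union x y : finite x -> finite y -> finite (cup x y).
Proof.
intros Hx. revert y. apply finite_ind;[def| |].
- replace (cup x emp) with x;trivial. apply ext. intro z. rewrite in_cup. split;[tauto|].
 intros [|H];trivial. now apply in_emp in H.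
- intros y z _ H. replace (cup x (cup y (sing z))) with (cup (cup x y) (sing z));[now apply finite_add|].
 apply ext. intro w. rewrite !in_cup. tauto.
Qed.
Lemma finite_sub x : finite x -> forall y, subset y x -> finite y.
Proof.
revert x. apply (finite_ind (P := fun x => forall y, subset y x -> finite y));[def| |].
- intros y Hy. replace y with (emp (M := M));[apply finite_emp|].
 symmetry. apply is_empty_eq. intros z Hz. apply Hy in Hz. now apply in_emp in Hz.
- intros x a _ IH y Hy. pose (y' := sep y (fun z => z <> a)).
 assert (Hy' : forall z, z ∈ y' <-> z ∈ y /\ z <> a) by (intro z;unfold y';rewrite in_sep by def;reflexivity).
 assert (F : finite y').
 { apply IH. intros z Hz. apply Hy' in Hz as [Hz N]. apply Hy, in_cup in Hz as [|Hz];trivial.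
 apply in_sing in Hz. tauto. }
 destruct (classic (a ∈ y)) as [Ha|Ha].
 + replace y with (cup y' (sing a));[now apply finite_add|]. apply ext. intro z.
 rewrite in_cup, in_sing, Hy'. split;[intros [[]| ->];trivial|]. intro Hz.
 destruct (classic (z = a));tauto.
 + replace y with y';trivial. apply ext. intro z. rewrite Hy'. split;[tauto|].
 intro Hz. spt. intro E. now subst.
Qed.
Lemma finite_repl F x : DF1 F -> finite x -> finite (repl x F).
Proof.
intro HF. revert x. apply finite_ind;[def| |].
- replace (repl emp F) with (emp (M := M));[apply finite_emp|]. symmetry. apply is_empty_eq.
 intros z Hz. apply in_repl in Hz as (w&Hw&_);trivial. now apply in_emp in Hw.
- intros x y _ H. replace (repl (cup x (sing y)) F) with (cup (repl x F) (sing (F y)));[now apply finite_add|].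
 apply ext. intro z. rewrite in_cup, in_sing, !in_repl by trivial. split.
 + intros [(w&Hw&->)| ->];[exists w|exists y];rewrite in_cup, in_sing;tauto.
 + intros (w&Hw&->). apply in_cup in Hw as [Hw|Hw];[left;now exists w|].
 apply in_sing in Hw. subst. tauto.
Qed.
Lemma finite_om n : n ∈ om -> finite n.
Proof.
revert n. apply om_ind;[def|apply finite_emp|]. intros n _ H. now apply finite_add.
Qed.
Lemma finite_pow x : finite x -> finite (pow x).
Proof.
revert x. apply finite_ind;[def| |].
- replace (pow emp) with (cup emp (sing (emp (M := M))));[apply finite_add, finite_emp|].
 apply ext. intro z. rewrite in_pow, in_cup, in_sing. split.
 + intros [H| ->];[now apply in_emp in H|]. now intros w Hw.
 + intro H. right. apply is_empty_eq. intros w Hw. apply H in Hw. now apply in_emp in Hw.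
- intros x y _ H.
 assert (D : DF1 (fun z => cup z (sing y))) by def.
 replace (pow (cup x (sing y))) with (cup (pow x) (repl (pow x) (fun z => cup z (sing y))));
 [apply finite_union;trivial;now apply finite_repl|].
 apply ext. intro z. rewrite in_cup, in_repl, !in_pow by trivial. split.
 + intros [A|(w&A&->)] u Hu;[apply in_cup;auto|]. apply in_pow in A.
 apply in_cup in Hu as [Hu|Hu];apply in_cup;auto.
 + intro A. destruct (classic (y ∈ z)) as [B|B].
 * right. exists (sep z (fun u => u ∈ x)). split.
 -- apply in_pow. intros u Hu. apply in_sep in Hu;[tauto|def].
 -- apply ext. intro u. rewrite in_cup, in_sing, in_sep by def. split;[|intros [[]| ->];trivial].
 intro Hu. destruct (proj1 (in_cup _ _ _) (A u Hu)) as [C|C];[tauto|]. apply in_sing in C. tauto.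
 * left. intros u Hu. destruct (proj1 (in_cup _ _ _) (A u Hu)) as [C|C];trivial.
 apply in_sing in C. exfalso. apply B. now rewrite <- C.
Qed.
End Finite.

(** * Consequences of the axiom of choice *)

Section Choice.
Context {M : structure} {Z : ZFm M}.
Implicit Types a b c d f g k m n p q s u x y z : M.
Hypothesis AC : ax_choice M.

(** [ax_choice] speaks of disjoint families, so each non-empty [x] is replaced by the product of its
    singleton with [x]. *)
Lemma AC_fun a : exists g, forall x, x ∈ a -> x <> emp -> ap g x ∈ x.
Proof.
pose (F := fun x => prod (sing x) x). assert (HF : DF1 F) by (unfold F;def).
pose (a' := sep a (fun x => x <> emp)).
assert (Ha' : forall x, x ∈ a' <-> x ∈ a /\ x <> emp) by (intro x;unfold a';rewrite in_sep by def;reflexivity).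
destruct (AC (a := repl a' F)) as [c Hc].
- intros x Hx. apply in_repl in Hx as (y&Hy&->);trivial. apply Ha' in Hy as [_ Hy].
 apply NNPP. intro C. apply Hy. apply is_empty_eq. intros z Hz. apply C. exists (opair y z).
 apply in_prod2. now rewrite in_sing.
- intros x y z Hx Hy Hzx Hzy. apply in_repl in Hx as (x'&Hx&->);trivial.
 apply in_repl in Hy as (y'&Hy&->);trivial.
 apply in_prod in Hzx as (u&w&Hu&Hw&->). apply in_prod2 in Hzy as [Hu' _].
 apply in_sing in Hu, Hu'. now subst.
- exists (sep c (fun p => exists x y, y ∈ x /\ p = opair x y)). intros x Hx Nx.
 destruct (Hc (F x)) as (z&[Hz Hzc]&U).
 { apply in_repl;trivial. exists x. now rewrite Ha'. }
 apply in_prod in Hz as (u&w&Hu&Hw&->). apply in_sing in Hu. subst u.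
 rewrite (ap_val (y := w));trivial.
 + apply in_sep;[def|]. spt. now exists x, w.
 + intros z Hz. apply in_sep in Hz as (Hz&x'&y'&Hy'&E);[|def].
 apply opair_inj in E as [<- <-]. symmetry. apply (opair_inj (x := x) (x' := x)). apply U.
 spt. apply in_prod2. now rewrite in_sing.
Qed.

Lemma AC_rel (R : M -> M -> Prop) a b : Def2 R -> (forall x, x ∈ a -> exists y, y ∈ b /\ R x y) ->
 exists f, is_fun f a b /\ forall x, x ∈ a -> R x (ap f x).
Proof.
intros HR H. destruct (AC_fun (pow b)) as [g Hg].
assert (K : forall x, x ∈ a -> ap g (sep b (R x)) ∈ b /\ R x (ap g (sep b (R x)))).
{ intros x Hx. assert (D : Def1 (R x)) by (unfold Def1;def).
 refine (proj1 (in_sep _ _ D) _). apply Hg.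
 - apply in_pow. intros u Hu. apply in_sep in Hu;tauto.
 - destruct (H x Hx) as (y&Hy&HRy). intro E.
 apply (in_emp (z := y)). rewrite <- E. now apply in_sep. }
assert (D : DF1 (fun x => ap g (sep b (R x)))) by def.
exists (lam a (fun x => ap g (sep b (R x)))). split.
- apply lam_fun;trivial. intros x Hx. now apply K.
- intros x Hx. rewrite ap_lam by trivial. now apply K.
Qed.

Lemma AC_coll (R : M -> M -> Prop) a : Def2 R -> (forall x, x ∈ a -> exists y, R x y) ->
 exists f b, is_fun f a b /\ forall x, x ∈ a -> R x (ap f x).
Proof.
intros HR H. destruct (collection HR H) as [b Hb]. destruct (AC_rel (R := R) (a := a) (b := b)) as [f Hf];trivial.
now exists f, b.
Qed.

Lemma DC (R : M -> M -> M -> Prop) a x0 : Def3 R -> x0 ∈ a ->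
 (forall n x, n ∈ om -> x ∈ a -> exists y, y ∈ a /\ R n x y) ->
 exists f, is_fun f om a /\ ap f emp = x0 /\ forall n, n ∈ om -> R n (ap f n) (ap f (succ n)).
Proof.
intros HR Hx0 H. destruct (AC_rel (R := fun p y => R (pfst p) (psnd p) y) (a := prod om a) (b := a)) as (g&Hg&Rg).
- def.
- intros p Hp. apply in_prod in Hp as (n&x&Hn&Hx&->). rewrite pfst_eq, psnd_eq. auto.
- pose (G := fun n x => ap g (opair n x)). assert (HG : DF2 G) by (unfold G;def).
 assert (HF := DF_om_rec x0 HG).
 assert (K : forall n, n ∈ om -> om_rec G x0 n ∈ a).
 { apply om_ind;[def|now rewrite om_rec_0|]. intros n Hn IH. rewrite om_rec_S by trivial.
 apply (fun_ap Hg). now apply in_prod2. }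
 exists (lam om (om_rec G x0)). split;[now apply lam_fun|]. split.
 + rewrite ap_lam;trivial;[now apply om_rec_0|apply om_emp].
 + intros n Hn. rewrite !ap_lam by (trivial;now apply om_succ). rewrite om_rec_S by trivial.
 specialize (Rg (opair n (om_rec G x0 n))). rewrite pfst_eq, psnd_eq in Rg. apply Rg.
 apply in_prod2. auto.
Qed.

Lemma no_set_of_ordinals a : exists b, ordinal b /\ ~ b ∈ a.
Proof.
exists (rk a). split;[apply rk_ord|]. intro H. apply rk_mem in H. rewrite (rk_ordinal (rk_ord a)) in H.
now apply mem_irrefl in H.
Qed.

(** Recursion along ordinals picks an element of [a] not picked before. If this never stopped,
    inverting it by replacement would give a set containing all ordinals. *)
Lemma well_order a : exists b f, ordinal b /\ is_surj f b a.
Proof.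
destruct (AC_fun (pow a)) as [g Hg].
pose (rest := fun x h => sep a (fun u => forall y, y ∈ x -> u <> ap h y)).
pose (G := fun x h => ap g (rest x h)). assert (HG : DF2 G) by (unfold G, rest;def).
pose (F := srec G). assert (HF : DF1 F) by (apply DF_srec, HG).
assert (Hr : forall x u, u ∈ rest x (lam (tc x) F) <-> u ∈ a /\ forall y, y ∈ x -> u <> F y).
{ intros x u. unfold rest. rewrite in_sep by def. split;intros [A B];spt;intros y Hy;
 specialize (B y Hy);rewrite ap_lam in *;trivial;now apply tc_sub. }
assert (K : forall x, (exists u, u ∈ a /\ forall y, y ∈ x -> u <> F y) ->
 F x ∈ a /\ forall y, y ∈ x -> F x <> F y).
{ intros x (u&Hu). unfold F at 1 2. rewrite srec_eq by trivial. fold F. apply Hr. unfold G. apply Hg.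
 - apply in_pow. intros w Hw. now apply Hr in Hw.
 - intro E. apply (in_emp (z := u)). rewrite <- E. now apply Hr. }
assert (E : exists x, ordinal x /\ forall u, u ∈ a -> exists y, y ∈ x /\ u = F y).
{ apply NNPP. intro C.
 assert (K' : forall x, ordinal x -> F x ∈ a /\ forall y, y ∈ x -> F x <> F y).
 { intros x Ox. apply K. apply NNPP. intro D. apply C. exists x. spt. intros u Hu.
 apply NNPP. intro B. apply D. exists u. spt. intros y Hy E. apply B. now exists y. }
 pose (R := fun u o => ordinal o /\ u = F o).
 assert (UR : forall u y z, R u y -> R u z -> y = z).
 { intros u y z [Oy ->] [Oz E]. destruct (ord_tri Oy Oz) as [A|[A|A]];trivial.
 - exfalso. now apply (proj2 (K' z Oz) y A). - exfalso. now apply (proj2 (K' y Oy) z A). }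
 assert (HR : DF1 (pf R)) by (apply DF_pf;[apply UR|unfold R;def]).
 destruct (no_set_of_ordinals (repl a (pf R))) as (b&Ob&Nb). apply Nb.
 apply in_repl;trivial. exists (F b). split;[now apply K'|]. symmetry. apply pf_eq;[apply UR|now split]. }
destruct E as (x0&Ox0&Hx0).
destruct (ord_least (P := fun x => forall u, u ∈ a -> exists y, y ∈ x /\ u = F y) (a := x0)) as (x&Ox&Hx&L);
 [def|trivial|trivial|].
exists x, (lam x F). spt. apply lam_surj;trivial.
- intros y Hy. apply K. apply NNPP. intro C. destruct (L y) as [E|E].
 + now apply (ord_mem Ox).
 + intros u Hu. apply NNPP. intro D. apply C. exists u. spt. intros w Hw E. apply D. now exists w.
 + subst y. now apply mem_irrefl in Hy.
 + now apply (mem_asym Hy).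
- intros u Hu. destruct (Hx u Hu) as (y&Hy&->). now exists y.
Qed.
End Choice.

Section More.
Context {M : structure} {Z : ZFm M}.
Lemma mem_ind_tc (P : M -> Prop) : Def1 P -> (forall x, (forall y, y ∈ tc x -> P y) -> P x) -> forall x, P x.
Proof.
intros HP IH. cut (forall x y, y ∈ tc x -> P y);[intros H x0;apply IH, H|].
apply (mem_ind (P := fun x => forall y, y ∈ tc x -> P y));[def|]. intros x Hx y Hy. apply tc_unfold in Hy as [Hy|(z&Hz&Hy)];eauto.
Qed.
Lemma tc_opair (s e t : M) : opair s e ∈ t -> s ∈ tc t /\ e ∈ tc t.
Proof.
intro H. assert (A := tc_sub H).
assert (B : upair s e ∈ tc t) by (apply (tc_trans A);unfold opair;rewrite in_upair;tauto).
split;apply (tc_trans B);rewrite in_upair;tauto.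
Qed.
End More.

(** * Absoluteness between a transitive class and the ambient model *)

Section Inner.
Context {N : structure} {V : N -> Prop} {ZN : ZFm N} {ZV : ZFm (restrict V)}.
Hypothesis TV : transitive_class V.
Notation VS := (restrict V).

Definition inj (x : VS) : N := proj1_sig x.

Lemma inj_mem (x y : VS) : inj x ∈ inj y <-> x ∈ y.
Proof. reflexivity. Qed.
Lemma inj_inj (x y : VS) : inj x = inj y -> x = y.
Proof. intro H. apply ext. intro z. rewrite <- !inj_mem. now rewrite H. Qed.
Lemma inj_V (x : VS) : V (inj x).
Proof. exact (proj2_sig x). Qed.
Lemma inj_lift (z : N) : V z -> exists x, inj x = z.
Proof. intro H. now exists (exist _ z H). Qed.
Lemma in_inj (z : N) (x : VS) : z ∈ inj x <-> exists y, inj y = z /\ y ∈ x.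
Proof.
split.
- intro H. destruct (inj_lift (z := z)) as [y E];[exact (TV (inj_V x) H)|]. exists y. spt.
 change (inj y ∈ inj x). now rewrite E.
- intros (y&<-&H). exact H.
Qed.
Lemma inj_ext (a : N) (x : VS) : (forall z, z ∈ a -> V z) -> (forall y, inj y ∈ a <-> y ∈ x) -> a = inj x.
Proof.
intros HV H. apply ext. intro z. rewrite in_inj. split.
- intro Hz. destruct (inj_lift (HV z Hz)) as [y <-]. exists y. spt. now apply H.
- intros (y&<-&Hy). now apply H.
Qed.
Lemma inj_upair x y : inj (upair x y) = upair (inj x) (inj y).
Proof.
symmetry. apply inj_ext.
- intros z Hz. apply in_upair in Hz as [->| ->];apply inj_V.
- intro z. rewrite !in_upair. split;(intros [H|H];[left|right];[now apply inj_inj || now subst|now apply inj_inj || now subst]).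
Qed.
Lemma inj_opair x y : inj (opair x y) = opair (inj x) (inj y).
Proof. unfold opair, sing. now rewrite !inj_upair. Qed.
Lemma inj_sub x y : subset (inj x) (inj y) <-> subset x y.
Proof.
split.
- intros H z Hz. apply inj_mem. now apply H.
- intros H z Hz. apply in_inj in Hz as (w&<-&Hw). apply inj_mem. auto.
Qed.
Lemma inj_bU x : inj (bU x) = bU (inj x).
Proof.
symmetry. apply inj_ext.
- intros z Hz. apply in_bU in Hz as (y&Hy&Hz). apply in_inj in Hy as (y'&<-&_). apply (TV (inj_V y') Hz).
- intro z. rewrite !in_bU. split.
 + intros (y&Hy&Hz). apply in_inj in Hy as (y'&<-&Hy). now exists y'.
 + intros (y&Hy&Hz). now exists (inj y).
Qed.
Lemma inj_cup x y : inj (cup x y) = cup (inj x) (inj y).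
Proof. unfold cup. now rewrite inj_bU, inj_upair. Qed.
Lemma inj_succ x : inj (succ x) = succ (inj x).
Proof. unfold succ, sing. now rewrite inj_cup, inj_upair. Qed.
Lemma inj_emp : inj emp = emp.
Proof.
apply is_empty_eq. intros z Hz. apply in_inj in Hz as (y&_&Hy). now apply in_emp in Hy.
Qed.
Lemma inj_trans x : transitive (inj x) <-> transitive x.
Proof.
split.
- intros H y Hy. apply inj_sub, H, Hy.
- intros H y Hy. apply in_inj in Hy as (y'&<-&Hy). apply inj_sub. auto.
Qed.
Lemma inj_ord x : ordinal (inj x) <-> ordinal x.
Proof.
split;intros [A B];(split;[now apply inj_trans|]).
- intros y Hy. apply inj_trans, B, Hy.
- intros y Hy. apply in_inj in Hy as (y'&<-&Hy). apply inj_trans. auto.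
Qed.
(** By transitivity the components of a pair in V lie in V, so a relation belonging to V relates
    only elements of V even when read in N. *)
Lemma pinj (p : N) f : p ∈ inj f -> forall x y, p = opair x y -> exists x' y', inj x' = x /\ inj y' = y /\ opair x' y' ∈ f.
Proof.
intros Hp x y ->.
apply in_inj in Hp as (p&E&Hp).
assert (Hu : upair x y ∈ inj p) by (rewrite E;unfold opair;rewrite in_upair;tauto).
apply in_inj in Hu as (u&Eu&Hu).
assert (Hx : x ∈ inj u) by (rewrite Eu, in_upair;tauto).
assert (Hy : y ∈ inj u) by (rewrite Eu, in_upair;tauto).
apply in_inj in Hx as (x'&<-&_), Hy as (y'&<-&_).
exists x', y'. repeat split. rewrite <- inj_opair in E. apply inj_inj in E. now subst.
Qed.
Lemma opinj x y f : opair (inj x) (inj y) ∈ inj f <-> opair x y ∈ f.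
Proof. now rewrite <- inj_opair, inj_mem. Qed.
Lemma inj_functional f : functional (inj f) <-> functional f.
Proof.
split;intros H x y z Hy Hz.
- apply inj_inj. apply (H (inj x));now apply opinj.
- destruct (pinj Hy eq_refl) as (x'&y'&<-&<-&A).
 destruct (pinj Hz eq_refl) as (x2&z'&E&<-&B). apply inj_inj in E. subst x2.
 f_equal. now apply (H x').
Qed.
Lemma inj_ap f x y : functional f -> opair x y ∈ f -> ap (inj f) (inj x) = inj (ap f x).
Proof.
intros F H. rewrite (ap_fun F H). apply ap_fun;[now apply inj_functional|now apply opinj].
Qed.
Lemma inj_om : inj om = om.
Proof.
apply is_omega_eq. split.
- destruct (is_limit_eq (inj om)) as [_ H]. apply H. destruct (proj1 (is_limit_eq _) (om_limit (M := VS))) as (A&B&C).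
 split;[now apply inj_ord|split].
 + intro E. apply B. apply inj_inj. now rewrite E, inj_emp.
 + intros y Hy. apply in_inj in Hy as (y'&<-&Hy). rewrite <- inj_succ. now apply C.
- intros n Hn L. apply in_inj in Hn as (m&<-&Hm).
 apply is_limit_eq in L as (A&B&C). apply (proj2 (proj2 (is_omega_eq (om : VS)) eq_refl) m Hm).
 apply is_limit_eq. split;[now apply inj_ord|split].
 + intro E. apply B. now rewrite E, inj_emp.
 + intros y Hy. change (inj (succ y) ∈ inj m). rewrite inj_succ. now apply C.
Qed.
End Inner.

(** * Sites of conditions and evaluation of names *)

Section Framework.
Context {N : structure} {V : N -> Prop} {ZN : ZFm N} {ZV : ZFm (restrict V)}.
Notation VS := (restrict V).
Notation "'⌊' x '⌋'" := (@inj N V x).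

(* The part of a forcing site that lives in V.  A label [e] stands for a span
 [la e <- lc e -> lb e]: a condition together with two arrows. *)
Record vsite := {
 Cs : VS;Ar : VS;Es : VS;
 idA : VS;comp : VS -> VS -> VS;
 le : VS -> VS -> Prop;ex : VS -> VS -> VS -> Prop;eqA : VS -> VS -> VS -> Prop;
 lc : VS -> VS;la : VS -> VS;lb : VS -> VS;
 def_le : Def2 le;def_ex : Def3 ex;def_eqA : Def3 eqA;def_comp : DF2 comp;
 def_lc : DF1 lc;def_la : DF1 la;def_lb : DF1 lb;
 in_id : idA ∈ Ar;
 in_comp : forall s t, s ∈ Ar -> t ∈ Ar -> comp s t ∈ Ar;
 in_lab : forall e, e ∈ Es -> lc e ∈ Cs /\ la e ∈ Ar /\ lb e ∈ Ar;
 mk_lab : forall c a b, c ∈ Cs -> a ∈ Ar -> b ∈ Ar -> exists e, e ∈ Es /\ lc e = c /\ la e = a /\ lb e = b;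
 le_trans : forall c1 c2 c3, le c1 c2 -> le c2 c3 -> le c1 c3;
 le_ex : forall c c', le c' c -> ex c' idA c;
 ex_le1 : forall c c' c2 r, ex c' r c -> le c2 c' -> ex c2 r c;
 ex_le2 : forall c c' c2 r, ex c' r c -> le c c2 -> ex c' r c2;
 eqA_le : forall c c' s t, eqA c s t -> le c' c -> eqA c' s t
}.

(* The stages, i.e. the generic objects available in N. *)
Record nsite (D : vsite) := {
 Sg : N;
 hold : N -> N -> Prop;act : N -> N -> N -> Prop;
 def_hold : Def2 hold;def_act : Def3 act;
 act_fun : forall s y z z', act s y z -> act s y z' -> z = z';
 act_Sg : forall s y z, s ∈ Ar D -> y ∈ Sg -> act ⌊s⌋ y z -> z ∈ Sg;
 act_id : forall y, y ∈ Sg -> act ⌊idA D⌋ y y;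
 act_comp : forall s t y y1 z, s ∈ Ar D -> t ∈ Ar D -> y ∈ Sg -> act ⌊t⌋ y y1 ->
 (act ⌊comp D s t⌋ y z <-> act ⌊s⌋ y1 z);
 top : forall y, y ∈ Sg -> exists c, c ∈ Cs D /\ hold y ⌊c⌋;
 dir : forall y c1 c2, y ∈ Sg -> c1 ∈ Cs D -> c2 ∈ Cs D -> hold y ⌊c1⌋ -> hold y ⌊c2⌋ ->
 exists c, c ∈ Cs D /\ le D c c1 /\ le D c c2 /\ hold y ⌊c⌋;
 ex_snd : forall y' c' r c, y' ∈ Sg -> c' ∈ Cs D -> r ∈ Ar D -> c ∈ Cs D ->
 hold y' ⌊c'⌋ -> ex D c' r c -> exists y, act ⌊r⌋ y' y /\ hold y ⌊c⌋;
 ex_cpl : forall y' c1 r c y, y' ∈ Sg -> c1 ∈ Cs D -> r ∈ Ar D -> c ∈ Cs D ->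
 hold y' ⌊c1⌋ -> act ⌊r⌋ y' y -> hold y ⌊c⌋ ->
 exists c', c' ∈ Cs D /\ le D c' c1 /\ hold y' ⌊c'⌋ /\ ex D c' r c;
 eqA_snd : forall y c s t, y ∈ Sg -> c ∈ Cs D -> s ∈ Ar D -> t ∈ Ar D ->
 hold y ⌊c⌋ -> eqA D c s t -> exists z, act ⌊s⌋ y z /\ act ⌊t⌋ y z;
 eqA_cpl : forall y c1 s t z, y ∈ Sg -> c1 ∈ Cs D -> s ∈ Ar D -> t ∈ Ar D ->
 hold y ⌊c1⌋ -> act ⌊s⌋ y z -> act ⌊t⌋ y z ->
 exists c', c' ∈ Cs D /\ le D c' c1 /\ hold y ⌊c'⌋ /\ eqA D c' s t;
 amal : forall y1 y2, y1 ∈ Sg -> y2 ∈ Sg -> exists y r1 r2, y ∈ Sg /\ r1 ∈ Ar D /\ r2 ∈ Ar D /\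
 act ⌊r1⌋ y y1 /\ act ⌊r2⌋ y y2;
 generic : forall (X : VS -> VS -> Prop) y, Def2 X -> y ∈ Sg ->
 (exists c r y', c ∈ Cs D /\ r ∈ Ar D /\ X c r /\ y' ∈ Sg /\ hold y' ⌊c⌋ /\ act ⌊r⌋ y' y) \/
 (exists c0, c0 ∈ Cs D /\ hold y ⌊c0⌋ /\
 forall c r, c ∈ Cs D -> r ∈ Ar D -> X c r -> ~ ex D c r c0)
}.

Section Val.
Hypothesis TV : transitive_class V.
Variables (D : vsite) (S : nsite D).

(** The class functions [lc], [la], [lb] are definable over V only; their restrictions to the set
    [Es] are sets of V, through which [RN] becomes definable over N. *)
Definition lcS : VS := lam (Es D) (lc D).
Definition laS : VS := lam (Es D) (la D).
Definition lbS : VS := lam (Es D) (lb D).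
Definition RN (e x z : N) := e ∈ ⌊Es D⌋ /\ exists y, y ∈ Sg S /\
 hold S y (ap ⌊lcS⌋ e) /\ act S (ap ⌊laS⌋ e) y x /\ act S (ap ⌊lbS⌋ e) y z.
Lemma RN_def : Def3 RN.
Proof. unfold RN. pose proof (def_hold S). pose proof (def_act S). def. Qed.
Lemma ap_lab (F : VS -> VS) e : DF1 F -> e ∈ Es D -> ap ⌊lam (Es D) F⌋ ⌊e⌋ = ⌊F e⌋.
Proof.
intros HF He. rewrite (inj_ap TV (y := F e));[now rewrite ap_lam|now apply lam_functional|now apply in_lam2].
Qed.
Lemma RN_eq e x z : e ∈ Es D -> (RN ⌊e⌋ x z <-> exists y, y ∈ Sg S /\
 hold S y ⌊lc D e⌋ /\ act S ⌊la D e⌋ y x /\ act S ⌊lb D e⌋ y z).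
Proof.
intro He. unfold RN, lcS, laS, lbS.
rewrite !ap_lab by (trivial;first [apply def_lc|apply def_la|apply def_lb]).
split;[tauto|]. intro H. spt.
Qed.

Definition cnd t x q := exists s z e, q = opair s z /\ opair s e ∈ t /\ RN e x z.
Definition val_step t h := lam (Sg S) (fun x =>
 repl (sep (prod (tc t) (Sg S)) (cnd t x)) (fun q => ap (ap h (pfst q)) (psnd q))).
Lemma val_step_def : DF2 val_step.
Proof. unfold val_step, cnd. pose proof RN_def. def. Qed.
Definition valf := srec val_step.
Lemma valf_def : DF1 valf. Proof. apply DF_srec, val_step_def. Qed.
(** A member of a name at stage [x] is a subname evaluated at another stage [z], reached through a
    span. The recursion therefore produces for each name a function on the set of all stages at
    once. *)
Lemma val_ex : {val : N -> N -> N | DF2 val /\ forall t x u, x ∈ Sg S ->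
 (u ∈ val t x <-> exists s z e, opair s e ∈ t /\ z ∈ Sg S /\ RN e x z /\ u = val s z)}.
Proof.
exists (fun t x => ap (valf t) x). pose proof RN_def. pose proof valf_def as HV. split;[def|].
intros t x u Hx.
assert (Dc : Def1 (cnd t x)) by (unfold cnd;def).
unfold valf at 1. rewrite srec_eq by apply val_step_def. fold valf.
unfold val_step at 1. rewrite ap_lam by (trivial;unfold cnd;def). rewrite in_repl by def. split.
- intros (q&Hq&->). apply in_sep in Hq as (Hq&s&z&e&->&Hs&Hr);trivial.
 apply in_prod2 in Hq as [Hq Hz]. exists s, z, e. rewrite pfst_eq, psnd_eq, ap_lam by trivial. auto.
- intros (s&z&e&Hs&Hz&Hr&->). exists (opair s z). rewrite pfst_eq, psnd_eq.
 assert (Ts := proj1 (tc_opair Hs)). rewrite ap_lam by trivial. spt.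
 apply in_sep;trivial. rewrite in_prod2. repeat spt. now exists s, z, e.
Qed.
Definition val := proj1_sig val_ex.
Lemma val_def : DF2 val. Proof. exact (proj1 (proj2_sig val_ex)). Qed.
Lemma in_val t x u : x ∈ Sg S ->
 (u ∈ val t x <-> exists s z e, opair s e ∈ t /\ z ∈ Sg S /\ RN e x z /\ u = val s z).
Proof. exact (proj2 (proj2_sig val_ex) t x u). Qed.
Lemma in_valV (t : VS) x u : x ∈ Sg S ->
 (u ∈ val ⌊t⌋ x <-> exists s e y z, opair s e ∈ t /\ e ∈ Es D /\ y ∈ Sg S /\ hold S y ⌊lc D e⌋ /\
 act S ⌊la D e⌋ y x /\ act S ⌊lb D e⌋ y z /\ z ∈ Sg S /\ u = val ⌊s⌋ z).
Proof.
intro Hx. rewrite in_val by trivial. split.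
- intros (s&z&e&Hs&Hz&Hr&->). destruct (pinj TV Hs eq_refl) as (s'&e'&<-&<-&Hs').
 assert (He : e' ∈ Es D) by exact (proj1 Hr). apply RN_eq in Hr as (y&Hy&H1&H2&H3);trivial.
 now exists s', e', y, z.
- intros (s&e&y&z&Hs&He&Hy&H1&H2&H3&Hz&->). exists ⌊s⌋, z, ⌊e⌋.
 repeat spt;[now apply (opinj TV)|]. apply RN_eq;trivial. now exists y.
Qed.

Ltac site := first [assumption | apply in_comp;site | apply in_id | now apply (in_lab (v := D))
 | eapply (proj1 (in_lab _));eassumption | idtac].

Definition tup c s t s' t' : VS := opair c (opair (opair s t) (opair s' t')).

(** Intended meaning: [ex c' r c] says that c' forces the arrow [r] to lead to a stage where [c]
    holds, and [eqA c s t] that c forces [s] and [t] to lead to the same stage; thus [eqA c s s]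
    says that [s] is defined. Here c' lies over the given stage via [r] and over the apex of the
    span [e] via [r'], and both routes meet at the stage where the name is evaluated. *)
Definition sim_pre c s e c' r r' := c' ∈ Cs D /\ r ∈ Ar D /\ r' ∈ Ar D /\ ex D c' r c /\ ex D c' r' (lc D e) /\
 eqA D c' (comp D (la D e) r') (comp D s r) /\ eqA D c' (comp D (lb D e) r') (comp D (lb D e) r').
(** One half of a back-and-forth condition: each member of [s] along [a] is matched, after passing
    to a larger stage, by a member of [t] along [b]. The flag [op] fixes the order in which the
    matched pair is written, so that both halves refer to the same set of tuples. *)
Definition sim (Q : VS -> Prop) (op : bool) c a s b t :=
 forall s' e c' r r', opair s' e ∈ s -> e ∈ Es D -> sim_pre c a e c' r r' ->
 exists t' e2 c2 p p2, opair t' e2 ∈ t /\ e2 ∈ Es D /\ c2 ∈ Cs D /\ p ∈ Ar D /\ p2 ∈ Ar D /\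
 ex D c2 p c' /\ ex D c2 p2 (lc D e2) /\ eqA D c2 (comp D (la D e2) p2) (comp D (comp D b r) p) /\
 eqA D c2 (comp D (lb D e2) p2) (comp D (lb D e2) p2) /\
 Q (if op then tup c2 (comp D (lb D e2) p2) t' (comp D (comp D (lb D e) r') p) s'
 else tup c2 (comp D (comp D (lb D e) r') p) s' (comp D (lb D e2) p2) t').
Definition bis (B : VS) := forall c a s b t, tup c a s b t ∈ B ->
 (c ∈ Cs D /\ a ∈ Ar D /\ b ∈ Ar D) /\
 sim (fun q => q ∈ B) false c a s b t /\ sim (fun q => q ∈ B) true c b t a s.
(** Forced equality of names as the largest bisimulation. This replaces the usual simultaneous
    recursion on two names and is visibly definable over V. *)
Definition FeqQ q := exists B, bis B /\ q ∈ B.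
Definition Feq c a s b t := FeqQ (tup c a s b t).

Lemma tup_inj c a s b t c' a' s' b' t' : tup c a s b t = tup c' a' s' b' t' -> c = c' /\ a = a' /\ s = s' /\ b = b' /\ t = t'.
Proof.
unfold tup. intro H. apply opair_inj in H as [-> H]. apply opair_inj in H as [H1 H2].
apply opair_inj in H1 as [-> ->]. apply opair_inj in H2 as [-> ->]. tauto.
Qed.
End Val.
End Framework.

Ltac site_defs D :=
 pose proof (def_le D);pose proof (def_ex D);pose proof (def_eqA D);pose proof (def_comp D);
 pose proof (def_lc D);pose proof (def_la D);pose proof (def_lb D).
Ltac def_hook3 :=
 lazymatch goal with
 | |- DT (fun v => tup _ _ _ _ _) => unfold tup
 | _ => def_hook2
 end.
Ltac def_hook ::= def_hook3.

(** * The forcing relation and forced equality of names *)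

Section Truth.
Context {N : structure} {V : N -> Prop} {ZN : ZFm N} {ZV : ZFm (restrict V)}.
Notation VS := (restrict V).
Notation "'⌊' x '⌋'" := (@inj N V x).
Hypothesis TV : transitive_class V.
Variables (D : vsite (N := N) (V := V)).

Lemma FeqQ_def : Def1 (FeqQ D).
Proof. unfold FeqQ, bis, sim, sim_pre. site_defs D. def. Qed.

Definition FmemX a s b t c1 := exists t' e c' p p',
 opair t' e ∈ t /\ e ∈ Es D /\ c' ∈ Cs D /\ p ∈ Ar D /\ p' ∈ Ar D /\
 ex D c' p c1 /\ ex D c' p' (lc D e) /\ eqA D c' (comp D (la D e) p') (comp D b p) /\
 eqA D c' (comp D (lb D e) p') (comp D (lb D e) p') /\
 FeqQ D (tup c' (comp D a p) s (comp D (lb D e) p') t').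
Definition Fmem c a s b t := forall c1, c1 ∈ Cs D -> le D c1 c -> FmemX a s b t c1.

(** Variable [i] stands for the name [t i] evaluated along the arrow [a i]; moving along [r]
    composes all these arrows with [r]. In the quantifier clause a new object is a name [u] read
    along an arrow [s], and the double negation says that no c' forces the negation of the
    instance. *)
Fixpoint F (f : formula) (c : VS) (a t : nat -> VS) : Prop :=
 match f with
 | fMem i j => Fmem c (a i) (t i) (a j) (t j)
 | fEq i j => Feq D c (a i) (t i) (a j) (t j)
 | fNot g => forall c', c' ∈ Cs D -> le D c' c -> ~ F g c' a t
 | fAnd g h => F g c a t /\ F h c a t
 | fAll g => forall c' r s u, c' ∈ Cs D -> r ∈ Ar D -> s ∈ Ar D -> ex D c' r c -> eqA D c' s s ->
 ~ (forall c2, c2 ∈ Cs D -> le D c2 c' ->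
 ~ F g c2 (scons s (fun i => comp D (a i) r)) (scons u t))
 end.

Lemma F_def f : forall (c : (nat -> VS) -> VS) (a t : nat -> (nat -> VS) -> VS),
 DT c -> (forall i, DT (a i)) -> (forall i, DT (t i)) ->
 Def (fun v => F f (c v) (fun i => a i v) (fun i => t i v)).
Proof.
pose proof FeqQ_def. site_defs D.
induction f as [i j|i j|g IH|g IHg h IHh|g IH];intros c a t Hc Ha Ht;cbn [F].
- pose proof (Ha i). pose proof (Ha j). pose proof (Ht i). pose proof (Ht j).
 unfold Fmem, FmemX. def.
- pose proof (Ha i). pose proof (Ha j). pose proof (Ht i). pose proof (Ht j). unfold Feq. def.
- assert (K := IH (fun v => v 0) (fun i v => a i (fun j => v (S j))) (fun i v => t i (fun j => v (S j)))
 (DT_var _ 0) (fun i => DT_ren S (Ha i)) (fun i => DT_ren S (Ht i))).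
 refine (@Def_all _ (fun c' v => c' ∈ Cs D -> le D c' (c v) -> ~ F g c' (fun i => a i v) (fun i => t i v)) _).
 cbv beta. def.
- assert (K := IHg c a t Hc Ha Ht). assert (K' := IHh c a t Hc Ha Ht). def.
- pose (q := fun j => S (S (S (S (S j))))).
 assert (K := IH (fun v => v 0)
 (fun i => match i with 0 => fun v => v 2 | S i => fun v => comp D (a i (fun j => v (q j))) (v 3) end)
 (fun i => match i with 0 => fun v => v 1 | S i => fun v => t i (fun j => v (q j)) end)
 (DT_var _ 0)).
 assert (K2 : Def (fun v => F g (v 0) (scons (v 2) (fun i => comp D (a i (fun j => v (q j))) (v 3)))
 (scons (v 1) (fun i => t i (fun j => v (q j)))))).
 { refine (Def_ext _ (K _ _)).
 - intro v.
 replace (fun i => match i with 0 => fun v => v 2 | S i => fun v => comp D (a i (fun j => v (q j))) (v 3) end v)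
 with (scons (v 2) (fun i => comp D (a i (fun j => v (q j))) (v 3)))
 by (apply fext;now intros []).
 replace (fun i => match i with 0 => fun v => v 1 | S i => fun v => t i (fun j => v (q j)) end v)
 with (scons (v 1) (fun i => t i (fun j => v (q j))))
 by (apply fext;now intros []).
 reflexivity.
 - intros [|i];[def|]. assert (K3 := DT_ren q (Ha i)). def.
 - intros [|i];[def|]. exact (DT_ren q (Ht i)). }
 unfold q in K2. clear IH K q.
 repeat (cbv beta;lazymatch goal with
 | |- Def (fun v => F _ _ _ _) => exact K2
 | _ => def_step end).
Qed.
End Truth.

(* A name for the forcing relation that is not captured by local notations [F]. *)
Notation Frc := F.

Section Truth.
Context {N : structure} {V : N -> Prop} {ZN : ZFm N} {ZV : ZFm (restrict V)}.
Notation VS := (restrict V).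
Notation "'⌊' x '⌋'" := (@inj N V x).
Hypothesis TV : transitive_class V.
Variables (D : vsite (N := N) (V := V)) (T : nsite D).
Local Notation Cs := (Cs D).
Local Notation Ar := (Ar D).
Local Notation Es := (Es D).
Local Notation comp := (comp D).
Local Notation le := (le D).
Local Notation ex := (ex D).
Local Notation eqA := (eqA D).
Local Notation lc := (lc D).
Local Notation la := (la D).
Local Notation lb := (lb D).
Local Notation Sg := (Sg T).
Local Notation hold := (hold T).
Local Notation act := (act T).
Local Notation val := (val T).

Ltac arr := repeat (assumption || apply in_comp || apply in_id).

Lemma act_comp2 s t y y1 z : s ∈ Ar -> t ∈ Ar -> y ∈ Sg -> act ⌊t⌋ y y1 -> act ⌊s⌋ y1 z -> act ⌊comp s t⌋ y z.
Proof. intros. now apply (act_comp (n := T) (s := s) (t := t) (y1 := y1)). Qed.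

Lemma lab_in e : e ∈ Es -> lc e ∈ Cs /\ la e ∈ Ar /\ lb e ∈ Ar.
Proof. apply in_lab. Qed.

(* A condition below which the span [e], evaluated along [r'], sits over [a]
 evaluated along [r]. *)
Lemma span_cond a e y y1 y' r r' c c1 x z : a ∈ Ar -> e ∈ Es -> c ∈ Cs -> c1 ∈ Cs -> r ∈ Ar -> r' ∈ Ar -> y' ∈ Sg ->
 y ∈ Sg -> y1 ∈ Sg -> hold y' ⌊c1⌋ ->
 act ⌊r⌋ y' y -> act ⌊r'⌋ y' y1 -> hold y ⌊c⌋ -> hold y1 ⌊lc e⌋ -> act ⌊a⌋ y x -> act ⌊la e⌋ y1 x -> act ⌊lb e⌋ y1 z ->
 exists c', c' ∈ Cs /\ le c' c1 /\ hold y' ⌊c'⌋ /\ ex c' r c /\ ex c' r' (lc e) /\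
 eqA c' (comp (la e) r') (comp a r) /\ eqA c' (comp (lb e) r') (comp (lb e) r').
Proof.
intros Ha He Hc Hc1 Hr Hr' Hy' Hy Hy1 H1 A1 A2 H2 H3 A3 A4 A5. destruct (lab_in He) as (L1&L2&L3).
destruct (ex_cpl (n := T) (y' := y') (c1 := c1) (r := r) (c := c) (y := y)) as (d1&Hd1&l1&h1&e1);trivial.
destruct (ex_cpl (n := T) (y' := y') (c1 := d1) (r := r') (c := lc e) (y := y1)) as (d2&Hd2&l2&h2&e2);trivial.
destruct (eqA_cpl (n := T) (y := y') (c1 := d2) (s := comp (la e) r') (t := comp a r) (z := x)) as (d3&Hd3&l3&h3&e3);arr.
{ now apply (act_comp2 (y1 := y1)). } { now apply (act_comp2 (y1 := y)). }
destruct (eqA_cpl (n := T) (y := y') (c1 := d3) (s := comp (lb e) r') (t := comp (lb e) r') (z := z)) as (d4&Hd4&l4&h4&e4);arr.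
{ now apply (act_comp2 (y1 := y1)). } { now apply (act_comp2 (y1 := y1)). }
assert (m3 := l4). assert (m2 := le_trans m3 l3). assert (m1 := le_trans m2 l2).
exists d4. sp;try assumption.
- exact (le_trans m1 l1). - exact (ex_le1 e1 m1). - exact (ex_le1 e2 m2). - exact (eqA_le e3 m3).
Qed.

Definition form (op : bool) c p s p2 t : VS := if op then tup c p2 t p s else tup c p s p2 t.

(** A member of the left value is given by a span; its apex is amalgamated with [y] to a stage [y'].
    Genericity at [y'] yields either a realised match in [t] or a condition excluding all matches,
    and [sim] refutes the latter. *)
Lemma sim_sub Q op c a s b t y x x' : Def1 Q -> sim D Q op c a s b t -> c ∈ Cs -> a ∈ Ar -> b ∈ Ar ->
 y ∈ Sg -> hold y ⌊c⌋ -> act ⌊a⌋ y x -> act ⌊b⌋ y x' ->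
 (forall s' e t' e2 c2 p p2 y2 z z', opair s' e ∈ s -> opair t' e2 ∈ t -> c2 ∈ Cs -> p ∈ Ar -> p2 ∈ Ar ->
 Q (form op c2 p s' p2 t') -> y2 ∈ Sg -> hold y2 ⌊c2⌋ -> act ⌊p⌋ y2 z -> act ⌊p2⌋ y2 z' ->
 val ⌊s'⌋ z = val ⌊t'⌋ z') -> subset (val ⌊s⌋ x) (val ⌊t⌋ x').
Proof.
intros HQ HS Hc Ha Hb Hy Hh Ax Ax' IH u Hu.
assert (Hx : x ∈ Sg) by exact (act_Sg Ha Hy Ax). assert (Hx' : x' ∈ Sg) by exact (act_Sg Hb Hy Ax').
apply in_valV in Hu as (s'&e&y1&z&Hs'&He&Hy1&H1&A1&A2&Hz&->);trivial.
destruct (lab_in He) as (L1&L2&L3).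
destruct (amal (n := T) Hy Hy1) as (y'&r&r'&Hy'&Hr&Hr'&Ar1&Ar2).
destruct (top (n := T) Hy') as (c1&Hc1&h1).
destruct (span_cond (a := a) (e := e) (y := y) (y1 := y1) (y' := y') (r := r) (r' := r') (c := c) (c1 := c1) (x := x) (z := z))
 as (c'&Hc'&_&h'&E1&E2&E3&E4);trivial.
destruct (generic (n := T) (X := fun c2 p => exists t' e2 p2, opair t' e2 ∈ t /\ e2 ∈ Es /\ p2 ∈ Ar /\
 ex c2 p2 (lc e2) /\ eqA c2 (comp (la e2) p2) (comp (comp b r) p) /\
 eqA c2 (comp (lb e2) p2) (comp (lb e2) p2) /\
 Q (form op c2 (comp (comp (lb e) r') p) s' (comp (lb e2) p2) t')) (y := y'))
 as [(c2&p&y2&Hc2&Hp&(t'&e2&p2&Ht'&He2&Hp2&F1&F2&F3&HQ2)&Hy2&h2&A3)|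
 (c0&Hc0&h0&U)];trivial.
{ site_defs D. destruct op;unfold form;def. }
- destruct (lab_in He2) as (M1&M2&M3).
 destruct (ex_snd (n := T) Hy2 Hc2 Hp2 M1 h2 F1) as (y3&A4&h3).
 assert (Hy3 : y3 ∈ Sg) by exact (act_Sg Hp2 Hy2 A4).
 destruct (eqA_snd (n := T) (y := y2) (c := c2) (s := comp (la e2) p2) (t := comp (comp b r) p)) as (w&B1&B2);arr.
 assert (B3 : act ⌊comp (comp b r) p⌋ y2 x').
 { apply (act_comp2 (y1 := y'));arr. now apply (act_comp2 (y1 := y)). }
 assert (Ew := act_fun B2 B3). subst w. apply (act_comp x' M2 Hp2 Hy2 A4) in B1.
 destruct (eqA_snd (n := T) (y := y2) (c := c2) (s := comp (lb e2) p2) (t := comp (lb e2) p2)) as (z'&B4&_);arr.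
 assert (B5 := B4). apply (act_comp z' M3 Hp2 Hy2 A4) in B5.
 apply in_valV;trivial. exists t', e2, y3, z'. sp;try assumption.
 + exact (act_Sg M3 Hy3 B5).
 + apply (IH s' e t' e2 c2 (comp (comp (lb e) r') p) (comp (lb e2) p2) y2);arr.
 apply (act_comp2 (y1 := y'));arr. now apply (act_comp2 (y1 := y1)).
- destruct (dir (n := T) Hy' Hc0 Hc' h0 h') as (c5&Hc5&l0&l1&h5).
 destruct (HS s' e c5 r r') as (t'&e2&c2&p&p2&Ht'&He2&Hc2&Hp&Hp2&F1&F2&F3&F4&HQ2);trivial.
 { unfold sim_pre;sp;try assumption;[exact (ex_le1 E1 l1)|exact (ex_le1 E2 l1)|exact (eqA_le E3 l1)|exact (eqA_le E4 l1)]. }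
 exfalso. apply (U c2 p);trivial;[|exact (ex_le2 F1 l0)].
 exists t', e2, p2. sp;try assumption.
Qed.

(** Genericity is applied to the counterexamples to [sim]. A realised one would contradict the
    inclusion of values, since the matching member of [t] can be amalgamated and forced; so some
    condition in force at [y] excludes them all. *)
Lemma sim_dich Q op a s b t y x x' : Def1 Q -> a ∈ Ar -> b ∈ Ar -> y ∈ Sg -> act ⌊a⌋ y x -> act ⌊b⌋ y x' ->
 subset (val ⌊s⌋ x) (val ⌊t⌋ x') ->
 (forall s' e t' e2 p p2 y2 z z', opair s' e ∈ s -> opair t' e2 ∈ t -> p ∈ Ar -> p2 ∈ Ar -> y2 ∈ Sg ->
 act ⌊p⌋ y2 z -> act ⌊p2⌋ y2 z' -> val ⌊s'⌋ z = val ⌊t'⌋ z' ->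
 exists c2, c2 ∈ Cs /\ hold y2 ⌊c2⌋ /\ Q (form op c2 p s' p2 t')) ->
 (forall c c' p s' p2 t', c' ∈ Cs -> le c' c -> Q (form op c p s' p2 t') -> Q (form op c' p s' p2 t')) ->
 exists c0, c0 ∈ Cs /\ hold y ⌊c0⌋ /\ forall c1, c1 ∈ Cs -> le c1 c0 -> sim D Q op c1 a s b t.
Proof.
intros HQ Ha Hb Hy Ax Ax' Sub IH QL.
assert (Hx : x ∈ Sg) by exact (act_Sg Ha Hy Ax). assert (Hx' : x' ∈ Sg) by exact (act_Sg Hb Hy Ax').
pose (concl := fun s' e c' r r' => exists t' e2 c2 p p2, opair t' e2 ∈ t /\ e2 ∈ Es /\ c2 ∈ Cs /\ p ∈ Ar /\ p2 ∈ Ar /\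
 ex c2 p c' /\ ex c2 p2 (lc e2) /\ eqA c2 (comp (la e2) p2) (comp (comp b r) p) /\
 eqA c2 (comp (lb e2) p2) (comp (lb e2) p2) /\
 Q (form op c2 (comp (comp (lb e) r') p) s' (comp (lb e2) p2) t')).
destruct (generic (n := T) (X := fun c' r => exists s' e r', opair s' e ∈ s /\ e ∈ Es /\ r' ∈ Ar /\
 ex c' r' (lc e) /\ eqA c' (comp (la e) r') (comp a r) /\ eqA c' (comp (lb e) r') (comp (lb e) r') /\
 ~ concl s' e c' r r') (y := y))
 as [(c'&r&y'&Hc'&Hr&(s'&e&r'&Hs'&He&Hr'&E1&E2&E3&NC)&Hy'&h'&A1)|
 (c0&Hc0&h0&U)];trivial.
{ site_defs D. unfold concl. destruct op;unfold form;def. }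
- exfalso. apply NC. destruct (lab_in He) as (L1&L2&L3).
 destruct (ex_snd (n := T) Hy' Hc' Hr' L1 h' E1) as (y1&A2&h1).
 assert (Hy1 : y1 ∈ Sg) by exact (act_Sg Hr' Hy' A2).
 destruct (eqA_snd (n := T) (y := y') (c := c') (s := comp (la e) r') (t := comp a r)) as (w&B1&B2);arr.
 assert (B3 : act ⌊comp a r⌋ y' x) by (apply (act_comp2 (y1 := y));arr).
 assert (Ew := act_fun B2 B3). subst w. apply (act_comp x L2 Hr' Hy' A2) in B1.
 destruct (eqA_snd (n := T) (y := y') (c := c') (s := comp (lb e) r') (t := comp (lb e) r')) as (z&B4&_);arr.
 assert (B5 := B4). apply (act_comp z L3 Hr' Hy' A2) in B5. assert (Hz : z ∈ Sg) by exact (act_Sg L3 Hy1 B5).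
 assert (Hu : val ⌊s'⌋ z ∈ val ⌊t⌋ x').
 { apply Sub. apply in_valV;trivial. exists s', e, y1, z. sp;try assumption;reflexivity. }
 apply in_valV in Hu as (t'&e2&y2&z'&Ht'&He2&Hy2&h2&C1&C2&Hz'&Ev);trivial.
 destruct (lab_in He2) as (M1&M2&M3).
 destruct (amal (n := T) Hy' Hy2) as (y3&p&p2&Hy3&Hp&Hp2&G1&G2).
 destruct (IH s' e t' e2 (comp (comp (lb e) r') p) (comp (lb e2) p2) y3 z z') as (c2&Hc2&h3&HQ2);arr.
 { apply (act_comp2 (y1 := y'));arr. } { apply (act_comp2 (y1 := y2));arr. }
 destruct (span_cond (a := comp b r) (e := e2) (y := y') (y1 := y2) (y' := y3) (r := p) (r' := p2) (c := c') (c1 := c2) (x := x') (z := z'))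
 as (c3&Hc3&l3&h4&F1&F2&F3&F4);arr.
 { apply (act_comp2 (y1 := y));arr. }
 exists t', e2, c3, p, p2. sp;try assumption. now apply (QL c2).
- exists c0. sp;try assumption. intros c1 Hc1 l1 s' e c' r r' Hs' He (P1&P2&P3&P4&P5&P6&P7).
 apply NNPP. intro C. apply (U c' r);trivial;[|exact (ex_le2 P4 l1)].
 exists s', e, r'. sp;try assumption.
Qed.

Lemma Feq_in c a s b t : Feq D c a s b t -> c ∈ Cs /\ a ∈ Ar /\ b ∈ Ar.
Proof. intros (B&HB&H). now apply (HB _ _ _ _ _ H). Qed.

Lemma sim_mono (Q Q' : VS -> Prop) op c c' a s b t : sim D Q op c a s b t -> le c' c ->
 (forall s' e t' e2 c2 p p2, opair s' e ∈ s -> opair t' e2 ∈ t -> c2 ∈ Cs -> p ∈ Ar -> p2 ∈ Ar ->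
 Q (form op c2 p s' p2 t') -> Q' (form op c2 p s' p2 t')) -> sim D Q' op c' a s b t.
Proof.
intros HS l HQ s' e d r r' Hs' He (P1&P2&P3&P4&P5&P6&P7).
destruct (HS s' e d r r') as (t'&e2&c2&p&p2&H1&H2&H3&H4&H5&H6&H7&H8&H9&H10);trivial.
{ unfold sim_pre;sp;try assumption. exact (ex_le2 P4 l). }
destruct (lab_in He) as (L1&L2&L3). destruct (lab_in H2) as (M1&M2&M3).
exists t', e2, c2, p, p2. sp;try assumption.
apply (HQ s' e t' e2 c2 (comp (comp (lb e) r') p) (comp (lb e2) p2));arr.
Qed.

(** All forced equalities between names in the transitive closures of [s] and [t], together with the
    new tuple, again form a bisimulation. Bounding the names is what makes this collection a set. *)
Lemma Feq_step c a s b t : c ∈ Cs -> a ∈ Ar -> b ∈ Ar -> sim D (FeqQ D) false c a s b t ->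
 sim D (FeqQ D) true c b t a s -> Feq D c a s b t.
Proof.
intros Hc Ha Hb S1 S2. pose proof (FeqQ_def D) as HF.
pose (d0 := cup (tc s) (tc t)).
pose (U0 := prod Cs (prod (prod Ar d0) (prod Ar d0))).
exists (cup (sep U0 (FeqQ D)) (sing (tup c a s b t))). split;[|rewrite in_cup, in_sing;tauto].
set (B := cup _ _).
assert (T0 : transitive d0).
{ intros u Hu w Hw. apply in_cup in Hu as [Hu|Hu];apply in_cup;[left|right];now apply (tc_trans Hu). }
assert (Td : forall u w e, u ∈ d0 -> opair w e ∈ u -> w ∈ d0).
{ intros u w e Hu Hw. assert (A : upair w e ∈ d0).
 { apply (T0 (opair w e));[now apply (T0 u)|]. unfold opair. rewrite in_upair. tauto. }
 apply (T0 _ A). rewrite in_upair. tauto. }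
assert (InB : forall c2 p s' p2 t', c2 ∈ Cs -> p ∈ Ar -> p2 ∈ Ar -> s' ∈ d0 -> t' ∈ d0 ->
 FeqQ D (tup c2 p s' p2 t') -> tup c2 p s' p2 t' ∈ B).
{ intros. apply in_cup. left. apply in_sep;trivial. spt. unfold U0, tup. rewrite !in_prod2. tauto. }
assert (InB' : forall op c2 p s' p2 t', c2 ∈ Cs -> p ∈ Ar -> p2 ∈ Ar -> s' ∈ d0 -> t' ∈ d0 ->
 FeqQ D (form op c2 p s' p2 t') -> form op c2 p s' p2 t' ∈ B) by (intros [|];unfold form;auto).
assert (le_refl : forall Q op c a s b t, sim D Q op c a s b t ->
 (forall s' e t' e2 c2 p p2, opair s' e ∈ s -> opair t' e2 ∈ t -> c2 ∈ Cs -> p ∈ Ar -> p2 ∈ Ar ->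
 Q (form op c2 p s' p2 t') -> form op c2 p s' p2 t' ∈ B) -> sim D (fun q => q ∈ B) op c a s b t).
{ intros Q op c' a' s' b' t' HS HQ u e d r r' Hs' He P. pose proof P as (P1&P2&P3&P4&P5&P6&P7).
 destruct (HS u e d r r') as (t2&e2&c2&p&p2&H1&H2&H3&H4&H5&H6&H7&H8&H9&H10);trivial.
 destruct (lab_in He) as (L1&L2&L3). destruct (lab_in H2) as (M1&M2&M3).
 exists t2, e2, c2, p, p2. sp;try assumption.
 apply (HQ u e t2 e2 c2 (comp (comp (lb e) r') p) (comp (lb e2) p2));arr. }
intros c' a' s' b' t' H. apply in_cup in H as [H|H].
- apply in_sep in H as [H (B1&HB1&H1)];trivial.
 unfold U0, tup in H. rewrite !in_prod2 in H. destruct H as (K1&(K2&K3)&K4&K5).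
 destruct (HB1 _ _ _ _ _ H1) as (K&S3&S4). split;[trivial|]. split.
 + apply (le_refl _ _ _ _ _ _ _ S3). intros. apply InB';trivial;[now apply (Td s' _ e)|now apply (Td t' _ e2)|].
 now exists B1.
 + apply (le_refl _ _ _ _ _ _ _ S4). intros. apply InB';trivial;[now apply (Td t' _ e)|now apply (Td s' _ e2)|].
 now exists B1.
- apply in_sing, tup_inj in H as (->&->&->&->&->). split;[tauto|]. split.
 + apply (le_refl _ _ _ _ _ _ _ S1). intros. apply InB';trivial;apply in_cup;[left|right];eapply (fun H => proj1 (tc_opair H));eassumption.
 + apply (le_refl _ _ _ _ _ _ _ S2). intros. apply InB';trivial;apply in_cup;[right|left];eapply (fun H => proj1 (tc_opair H));eassumption.
Qed.

Lemma Feq_le c c' a s b t : c' ∈ Cs -> le c' c -> Feq D c a s b t -> Feq D c' a s b t.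
Proof.
intros Hc' l H. destruct (Feq_in H) as (A&Ha&Hb). destruct H as (B&HB&H).
destruct (HB _ _ _ _ _ H) as (_&S1&S2). apply Feq_step;trivial.
- apply (sim_mono S1 l). intros. now exists B.
- apply (sim_mono S2 l). intros. now exists B.
Qed.

Lemma inj_opair_inv (q : VS) x y : ⌊q⌋ = opair x y -> exists x' y', ⌊x'⌋ = x /\ ⌊y'⌋ = y /\ q = opair x' y'.
Proof.
intro E. destruct (@pinj N V ZN ZV TV ⌊q⌋ (sing q)) with (x := x) (y := y) as (x'&y'&E1&E2&H);trivial.
{ apply inj_mem. now apply in_sing. }
exists x', y'. sp;try assumption. symmetry. now apply in_sing.
Qed.
Definition tupN (c a s b t : N) := opair c (opair (opair a s) (opair b t)).
Lemma inj_tup c a s b t : ⌊tup c a s b t⌋ = tupN ⌊c⌋ ⌊a⌋ ⌊s⌋ ⌊b⌋ ⌊t⌋.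
Proof. unfold tup, tupN. now rewrite !(inj_opair TV). Qed.
Lemma tupN_lift c a s b t B : tupN c a s b t ∈ ⌊B⌋ -> exists c' a' s' b' t', c = ⌊c'⌋ /\ a = ⌊a'⌋ /\ s = ⌊s'⌋ /\
 b = ⌊b'⌋ /\ t = ⌊t'⌋ /\ tup c' a' s' b' t' ∈ B.
Proof.
intro H. destruct (pinj TV H eq_refl) as (c'&q&<-&Eq&Hq).
apply inj_opair_inv in Eq as (q1&q2&E1&E2&->).
apply inj_opair_inv in E1 as (a'&s'&<-&<-&->). apply inj_opair_inv in E2 as (b'&t'&<-&<-&->).
now exists c', a', s', b', t'.
Qed.

(** Induction in N on the left name. The statement is phrased for arbitrary elements of N with the
    set [B] as parameter, since the induction predicate has to be definable there. *)
Lemma Feq_snd c a s b t y x x' : Feq D c a s b t -> y ∈ Sg -> hold y ⌊c⌋ -> act ⌊a⌋ y x -> act ⌊b⌋ y x' ->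
 val ⌊s⌋ x = val ⌊t⌋ x'.
Proof.
intros (B&HB&H).
assert (K : forall s, forall c a b t y x x' : N, tupN c a s b t ∈ ⌊B⌋ -> y ∈ Sg -> hold y c -> act a y x -> act b y x' ->
 val s x = val t x').
{ apply (mem_ind_tc (P := fun s => forall c a b t y x x', tupN c a s b t ∈ ⌊B⌋ -> y ∈ Sg -> hold y c -> act a y x -> act b y x' ->
 val s x = val t x')).
 { pose proof (def_hold T). pose proof (def_act T). pose proof (val_def T). unfold tupN. def. }
 clear s t c a b y x x' H. intros s0 IH c0 a0 b0 t0 y x x' H Hy h A1 A2.
 apply tupN_lift in H as (c&a&s&b&t&->&->&->&->&->&H).
 destruct (HB _ _ _ _ _ H) as ((Hc&Ha&Hb)&S1&S2).
 assert (IH' : forall s' e t' c2 p p2 y2 z z', opair s' e ∈ s -> tup c2 p s' p2 t' ∈ B -> y2 ∈ Sg -> hold y2 ⌊c2⌋ ->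
 act ⌊p⌋ y2 z -> act ⌊p2⌋ y2 z' -> val ⌊s'⌋ z = val ⌊t'⌋ z').
 { intros s' e t' c2 p p2 y2 z z' Hs' Hq Hy2 h2 B1 B2. apply (IH ⌊s'⌋) with (c := ⌊c2⌋) (a := ⌊p⌋) (b := ⌊p2⌋) (y := y2);trivial.
 - apply (tc_opair (e := ⌊e⌋)). now apply (opinj TV).
 - now rewrite <- inj_tup. }
 assert (DB : Def1 (fun q => q ∈ B)) by def.
 apply ext. intro u. split.
 - apply (sim_sub DB S1 Hc Ha Hb Hy h A1 A2). intros s' e t' e2 c2 p p2 y2 z z' K1 K2 K3 K4 K5 K6 K7 K8 K9 K10.
 now apply (IH' s' e t' c2 p p2 y2).
 - apply (sim_sub DB S2 Hc Hb Ha Hy h A2 A1). intros t' e s' e2 c2 p p2 y2 z z' K1 K2 K3 K4 K5 K6 K7 K8 K9 K10.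
 symmetry. now apply (IH' s' e2 t' c2 p2 p y2). }
intros Hy h A1 A2. apply (K ⌊s⌋ ⌊c⌋ ⌊a⌋ ⌊b⌋ ⌊t⌋ y x x');trivial. now rewrite <- inj_tup.
Qed.

(** Again induction in N. The class of forced equalities is first cut down to the set [Bm] of those
    between names in [d0], which N can use as a parameter. *)
Lemma Feq_cpl a s b t y x x' : a ∈ Ar -> b ∈ Ar -> y ∈ Sg -> act ⌊a⌋ y x -> act ⌊b⌋ y x' -> val ⌊s⌋ x = val ⌊t⌋ x' ->
 exists c, c ∈ Cs /\ hold y ⌊c⌋ /\ Feq D c a s b t.
Proof.
pose proof (FeqQ_def D) as HF.
pose (d0 := tc (upair s t)).
pose (Bm := sep (prod Cs (prod (prod Ar d0) (prod Ar d0))) (FeqQ D)).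
assert (HBm : forall c a s b t, tup c a s b t ∈ Bm <-> c ∈ Cs /\ a ∈ Ar /\ s ∈ d0 /\ b ∈ Ar /\ t ∈ d0 /\ Feq D c a s b t).
{ intros. unfold Bm. rewrite in_sep by trivial. unfold tup at 1. rewrite !in_prod2. unfold Feq. tauto. }
assert (K : forall s, s ∈ ⌊d0⌋ -> forall t a b y x x', t ∈ ⌊d0⌋ -> a ∈ ⌊Ar⌋ -> b ∈ ⌊Ar⌋ -> y ∈ Sg -> act a y x -> act b y x' ->
 val s x = val t x' -> exists c, c ∈ ⌊Cs⌋ /\ hold y c /\ tupN c a s b t ∈ ⌊Bm⌋).
{ apply (mem_ind_tc (P := fun s => s ∈ ⌊d0⌋ -> forall t a b y x x', t ∈ ⌊d0⌋ -> a ∈ ⌊Ar⌋ -> b ∈ ⌊Ar⌋ -> y ∈ Sg -> act a y x -> act b y x' ->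
 val s x = val t x' -> exists c, c ∈ ⌊Cs⌋ /\ hold y c /\ tupN c a s b t ∈ ⌊Bm⌋)).
 { pose proof (def_hold T). pose proof (def_act T). pose proof (val_def T). unfold tupN. def. }
 intros s0 IH Hs0 t0 a0 b0 y0 x0 x0' Ht0 Ha0 Hb0 Hy A1 A2 Ev.
 apply (in_inj TV) in Hs0 as (s1&<-&Hs1), Ht0 as (t1&<-&Ht1), Ha0 as (a1&<-&Ha1), Hb0 as (b1&<-&Hb1).
 assert (Td : forall u w e, u ∈ d0 -> opair w e ∈ u -> w ∈ d0).
 { intros u w e Hu Hw. assert (B : upair w e ∈ d0).
 { apply (@tc_trans _ _ _ (opair w e));[now apply (@tc_trans _ _ _ u)|]. unfold opair. rewrite in_upair. tauto. }
 apply (tc_trans B). rewrite in_upair. tauto. }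
 assert (IH' : forall s' e t' e2 p p2 y2 z z', opair s' e ∈ s1 -> opair t' e2 ∈ t1 -> p ∈ Ar -> p2 ∈ Ar -> y2 ∈ Sg ->
 act ⌊p⌋ y2 z -> act ⌊p2⌋ y2 z' -> val ⌊s'⌋ z = val ⌊t'⌋ z' ->
 exists c2, c2 ∈ Cs /\ hold y2 ⌊c2⌋ /\ FeqQ D (tup c2 p s' p2 t')).
 { intros s' e t' e2 p p2 y2 z z' K1 K2 K3 K4 K5 K6 K7 K8.
 destruct (IH ⌊s'⌋) with (t := ⌊t'⌋) (a := ⌊p⌋) (b := ⌊p2⌋) (y := y2) (x := z) (x' := z') as (c&Hc&h&Hq);trivial.
 - apply (tc_opair (e := ⌊e⌋)). now apply (opinj TV).
 - apply inj_mem. now apply (Td s1 _ e). - apply inj_mem. now apply (Td t1 _ e2).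
 - apply (in_inj TV) in Hc as (c'&<-&Hc). exists c'. rewrite <- inj_tup, inj_mem, HBm in Hq. unfold Feq in Hq. tauto. }
 assert (FL : forall op c c' p s' p2 t', c' ∈ Cs -> le c' c -> FeqQ D (form op c p s' p2 t') -> FeqQ D (form op c' p s' p2 t')).
 { intros [|] c c' p s' p2 t' Hc' l Hq;unfold form in *;now apply (Feq_le Hc' l). }
 destruct (@sim_dich (FeqQ D) false a1 s1 b1 t1 y0 x0 x0') as (c0&Hc0&h0&S0);trivial.
 { rewrite Ev. now intro. } { now apply FL. }
 destruct (@sim_dich (FeqQ D) true b1 t1 a1 s1 y0 x0' x0) as (c1&Hc1&h1&S1);trivial.
 { rewrite Ev. now intro. }
 { intros t' e s' e2 p p2 y2 z z' K1 K2 K3 K4 K5 K6 K7 K8. unfold form.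
 exact (IH' s' e2 t' e p2 p y2 z' z K2 K1 K4 K3 K5 K7 K6 (eq_sym K8)). } { now apply FL. }
 destruct (dir (n := T) Hy Hc0 Hc1 h0 h1) as (c&Hc&l0&l1&h).
 exists ⌊c⌋. sp;try assumption. rewrite <- inj_tup, inj_mem, HBm. sp;try assumption.
 apply Feq_step;auto. }
intros Ha Hb Hy A1 A2 Ev. destruct (K ⌊s⌋) with (t := ⌊t⌋) (a := ⌊a⌋) (b := ⌊b⌋) (y := y) (x := x) (x' := x') as (c&Hc&h&Hq);trivial.
- apply inj_mem, tc_sub. rewrite in_upair;tauto.
- apply inj_mem, tc_sub. rewrite in_upair;tauto.
- apply (in_inj TV) in Hc as (c'&<-&Hc). exists c'. rewrite <- inj_tup, inj_mem, HBm in Hq. tauto.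
Qed.
End Truth.

Section FreeVar.
(** Only finitely many elements of [W] can be brought to a common stage, so an assignment has to be
    cut down to the variables that a formula really reads. *)
Fixpoint fvb (f : formula) : nat :=
 match f with
 | fMem i j | fEq i j => S (max i j)
 | fNot g => fvb g
 | fAnd g h => max (fvb g) (fvb h)
 | fAll g => pred (fvb g)
 end.
Lemma sat_fvb (M : structure) f : forall v w : nat -> M, (forall i, i < fvb f -> v i = w i) -> (sat v f <-> sat w f).
Proof.
induction f as [i j|i j|g IH|g IHg h IHh|g IH];intros v w E;cbn [sat fvb] in *.
- rewrite (E i), (E j) by lia. tauto.
- rewrite (E i), (E j) by lia. tauto.
- now rewrite (IH v w).
- rewrite (IHg v w), (IHh v w);[tauto|intros;apply E;lia..].
- assert (K : forall x, sat (scons x v) g <-> sat (scons x w) g).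
 { intro x. apply IH. intros [|i] Hi;simpl;trivial. apply E. lia. }
 split;intros H x;apply K, H.
Qed.
End FreeVar.

(** * The truth lemma, and ZF in the model of all values *)

Section Truth.
Context {N : structure} {V : N -> Prop} {ZN : ZFm N} {ZV : ZFm (restrict V)}.
Notation VS := (restrict V).
Notation "'⌊' x '⌋'" := (@inj N V x).
Hypothesis TV : transitive_class V.
Variables (D : vsite (N := N) (V := V)) (T : nsite D).
Local Notation Cs := (Cs D).
Local Notation Ar := (Ar D).
Local Notation Es := (Es D).
Local Notation comp := (comp D).
Local Notation le := (le D).
Local Notation ex := (ex D).
Local Notation eqA := (eqA D).
Local Notation lc := (lc D).
Local Notation la := (la D).
Local Notation lb := (lb D).
Local Notation Sg := (Sg T).
Local Notation hold := (hold T).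
Local Notation act := (act T).
Local Notation val := (val T).
Local Notation F := (F D).
Ltac arr := repeat (assumption || apply in_comp || apply in_id).

Lemma generic1 (X : VS -> Prop) y : Def1 X -> y ∈ Sg ->
 (exists c, c ∈ Cs /\ X c /\ hold y ⌊c⌋) \/
 (exists c0, c0 ∈ Cs /\ hold y ⌊c0⌋ /\ forall c, c ∈ Cs -> le c c0 -> ~ X c).
Proof.
intros HX Hy.
destruct (generic (n := T) (X := fun c r => r = idA D /\ X c) (y := y)) as
 [(c&r&y'&Hc&Hr&(->&HXc)&Hy'&h&A)|(c0&Hc0&h0&U)];[def|trivial| |].
- left. exists c. sp;try assumption. now rewrite (act_fun A (act_id Hy')).
- right. exists c0. sp;try assumption. intros c Hc l HXc. apply (U c (idA D));[trivial|apply in_id|now split|].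
 now apply le_ex.
Qed.

Lemma Fmem_snd c a s b t y x x' : a ∈ Ar -> b ∈ Ar -> c ∈ Cs -> Fmem D c a s b t -> y ∈ Sg -> hold y ⌊c⌋ ->
 act ⌊a⌋ y x -> act ⌊b⌋ y x' -> val ⌊s⌋ x ∈ val ⌊t⌋ x'.
Proof.
intros Ha Hb Hc HF Hy h A1 A2. pose proof (FeqQ_def D) as HQ.
assert (Hx' : x' ∈ Sg) by exact (act_Sg Hb Hy A2).
destruct (generic (n := T) (X := fun c' p => exists t' e p', opair t' e ∈ t /\ e ∈ Es /\ p' ∈ Ar /\
 ex c' p' (lc e) /\ eqA c' (comp (la e) p') (comp b p) /\ eqA c' (comp (lb e) p') (comp (lb e) p') /\
 FeqQ D (tup c' (comp a p) s (comp (lb e) p') t')) (y := y)) as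
 [(c'&p&y'&Hc'&Hp&(t'&e&p'&Ht'&He&Hp'&E1&E2&E3&E4)&Hy'&h'&A3)|(c0&Hc0&h0&U)];trivial.
{ site_defs D. def. }
- destruct (lab_in He) as (L1&L2&L3).
 destruct (ex_snd (n := T) Hy' Hc' Hp' L1 h' E1) as (y1&A4&h1).
 assert (Hy1 : y1 ∈ Sg) by exact (act_Sg Hp' Hy' A4).
 destruct (eqA_snd (n := T) (y := y') (c := c') (s := comp (la e) p') (t := comp b p)) as (w&B1&B2);arr.
 assert (B3 : act ⌊comp b p⌋ y' x') by (apply (act_comp2 (y1 := y));arr).
 assert (Ew := act_fun B2 B3). subst w. apply (act_comp x' L2 Hp' Hy' A4) in B1.
 destruct (eqA_snd (n := T) (y := y') (c := c') (s := comp (lb e) p') (t := comp (lb e) p')) as (z&B4&_);arr.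
 assert (B5 := B4). apply (act_comp z L3 Hp' Hy' A4) in B5.
 apply (in_valV TV);trivial. exists t', e, y1, z. sp;try assumption;[exact (act_Sg L3 Hy1 B5)|].
 apply (Feq_snd TV E4 Hy' h');trivial. apply (act_comp2 (y1 := y));arr.
- destruct (dir (n := T) Hy Hc Hc0 h h0) as (c1&Hc1&l1&l0&h1).
 destruct (HF c1 Hc1 l1) as (t'&e&c'&p&p'&H1&H2&H3&H4&H5&H6&H7&H8&H9&H10).
 exfalso. apply (U c' p);trivial;[|exact (ex_le2 H6 l0)]. exists t', e, p'. sp;try assumption.
Qed.

Lemma Fmem_cpl a s b t y x x' : a ∈ Ar -> b ∈ Ar -> y ∈ Sg -> act ⌊a⌋ y x -> act ⌊b⌋ y x' -> val ⌊s⌋ x ∈ val ⌊t⌋ x' ->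
 exists c, c ∈ Cs /\ hold y ⌊c⌋ /\ Fmem D c a s b t.
Proof.
intros Ha Hb Hy A1 A2 Hv. pose proof (FeqQ_def D) as HQ.
destruct (@generic1 (fun c => ~ FmemX D a s b t c) y) as [(c1&Hc1&NX&h1)|(c0&Hc0&h0&U)];trivial.
{ unfold FmemX. site_defs D. def. }
- exfalso. apply NX. assert (Hx' : x' ∈ Sg) by exact (act_Sg Hb Hy A2).
 apply (in_valV TV) in Hv as (t'&e&y1&z&Ht'&He&Hy1&h&B1&B2&Hz&Ev);trivial.
 destruct (lab_in He) as (L1&L2&L3).
 destruct (amal (n := T) Hy Hy1) as (y'&p&p'&Hy'&Hp&Hp'&G1&G2).
 destruct (Feq_cpl TV (T := T) (a := comp a p) (s := s) (b := comp (lb e) p') (t := t') (y := y') (x := x) (x' := z))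
 as (c2&Hc2&h2&E2);arr;[apply (act_comp2 (y1 := y));arr|apply (act_comp2 (y1 := y1));arr|].
 destruct (span_cond (T := T) (a := b) (e := e) (y := y) (y1 := y1) (y' := y') (r := p) (r' := p') (c := c1) (c1 := c2) (x := x') (z := z))
 as (c3&Hc3&l3&h4&F1&F2&F3&F4);arr.
 exists t', e, c3, p, p'. sp;try assumption. now apply (Feq_le Hc3 l3).
- exists c0. sp;try assumption. intros c1 Hc1 l1. apply NNPP. now apply U.
Qed.

Lemma F_le f : forall c c' a t, c' ∈ Cs -> le c' c -> F f c a t -> F f c' a t.
Proof.
induction f as [i j|i j|g IH|g IHg h IHh|g IH];intros c c' a t Hc' l H;cbn [Frc] in *.
- intros c1 Hc1 l1. apply H;trivial. now apply (le_trans l1).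
- now apply (Feq_le Hc' l).
- intros c1 Hc1 l1. apply H;trivial. now apply (le_trans l1).
- destruct H. split;eauto.
- intros c1 r s u H1 H2 H3 H4 H5. apply (H c1 r s u);trivial. now apply (ex_le2 H4).
Qed.

Definition W (u : N) := exists (t : VS) x, x ∈ Sg /\ u = val ⌊t⌋ x.
Notation WS := (restrict W).

Definition mkW (u : N) (H : W u) : WS := exist W u H.

Lemma F_def2 f (a t : nat -> VS) : Def1 (fun c => F f c a t).
Proof.
exact (@F_def N V ZV D f (fun v => v 0) (fun i _ => a i) (fun i _ => t i) (DT_var _ 0)
 (fun i => DT_const (a i)) (fun i => DT_const (t i))).
Qed.

Definition interp (y : N) (a t : nat -> VS) (u : nat -> WS) :=
 forall i, a i ∈ Ar /\ exists x, act ⌊a i⌋ y x /\ proj1_sig (u i) = val ⌊t i⌋ x.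

Lemma interp_scons y y' r s n (a t : nat -> VS) (u : nat -> WS) (w : WS) z : y' ∈ Sg -> r ∈ Ar -> s ∈ Ar ->
 act ⌊r⌋ y' y -> act ⌊s⌋ y' z -> proj1_sig w = val ⌊n⌋ z -> interp y a t u ->
 interp y' (scons s (fun i => comp (a i) r)) (scons n t) (scons w u).
Proof.
intros Hy' Hr Hs A1 A2 E H [|i];simpl.
- spt. now exists z.
- destruct (H i) as (Ha&x&A&Ex). split;arr. exists x. spt. now apply (act_comp2 (y1 := y)).
Qed.

Lemma truth f : forall y a t (u : nat -> WS), y ∈ Sg -> interp y a t u ->
 (forall c, c ∈ Cs -> hold y ⌊c⌋ -> F f c a t -> sat u f) /\
 (sat u f -> exists c, c ∈ Cs /\ hold y ⌊c⌋ /\ F f c a t).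
Proof.
(* Negation is isolated because the quantifier clause also needs a condition forcing the negation of
   an instance. *)
assert (Neg : forall f y a t (u : nat -> WS), y ∈ Sg ->
 ((forall c, c ∈ Cs -> hold y ⌊c⌋ -> F f c a t -> sat u f) /\
 (sat u f -> exists c, c ∈ Cs /\ hold y ⌊c⌋ /\ F f c a t)) ->
 (forall c, c ∈ Cs -> hold y ⌊c⌋ -> (forall c', c' ∈ Cs -> le c' c -> ~ F f c' a t) -> ~ sat u f) /\
 (~ sat u f -> exists c, c ∈ Cs /\ hold y ⌊c⌋ /\ forall c', c' ∈ Cs -> le c' c -> ~ F f c' a t)).
{ clear f. intros f y a t u Hy [S1 C1]. split.
 - intros c Hc h H Hs. destruct (C1 Hs) as (c1&Hc1&h1&HF).
 destruct (dir (n := T) Hy Hc Hc1 h h1) as (c2&Hc2&l&l1&h2).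
 apply (H c2 Hc2 l). now apply (F_le Hc2 l1).
 - intro NS. destruct (@generic1 (fun c => F f c a t) y) as [(c&Hc&HF&h)|K];trivial;[apply F_def2|].
 exfalso. now apply NS, (S1 c). }
induction f as [i j|i j|g IH|g IHg h IHh|g IH];intros y a t u Hy Hi;cbn [Frc sat].
- destruct (Hi i) as (Ha&x&A&E), (Hi j) as (Ha'&x'&A'&E').
 change (u i ∈ u j) with (proj1_sig (u i) ∈ proj1_sig (u j)). rewrite E, E'. split.
 + intros c Hc h HF. now apply (Fmem_snd Ha Ha' Hc HF Hy h).
 + now apply Fmem_cpl.
- destruct (Hi i) as (Ha&x&A&E), (Hi j) as (Ha'&x'&A'&E').
 assert (Q : u i = u j <-> val ⌊t i⌋ x = val ⌊t j⌋ x').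
 { rewrite <- E, <- E'. split;[now intros ->|]. intro Q. destruct (u i) as [p Hp], (u j) as [q Hq]. simpl in Q.
 subst q. f_equal. apply proof_irrelevance. }
 split.
 + intros c Hc h HF. apply Q. now apply (Feq_snd TV HF Hy h).
 + intro H. apply Q in H. now apply (Feq_cpl TV (x := x) (x' := x')).
- apply Neg;auto.
- destruct (IHg y a t u Hy Hi) as [S1 C1], (IHh y a t u Hy Hi) as [S2 C2]. split.
 + intros c Hc k [H1 H2]. split;eauto.
 + intros [H1 H2]. destruct (C1 H1) as (c1&Hc1&h1&F1), (C2 H2) as (c2&Hc2&h2&F2).
 destruct (dir (n := T) Hy Hc1 Hc2 h1 h2) as (c&Hc&l1&l2&h0).
 exists c. sp;try assumption;[now apply (F_le Hc l1)|now apply (F_le Hc l2)].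
- split.
 + intros c Hc h H w. apply NNPP. intro NS. destruct (proj2_sig w) as (n&z&Hz&Ew).
 destruct (amal (n := T) Hy Hz) as (y'&r&s&Hy'&Hr&Hs&A1&A2).
 assert (I' : interp y' (scons s (fun i => comp (a i) r)) (scons n t) (scons w u))
 by (apply (@interp_scons y y' r s n a t u _ z);trivial).
 destruct (Neg g y' _ _ _ Hy' (IH y' _ _ _ Hy' I')) as [_ C]. destruct (C NS) as (c1&Hc1&h1&U1).
 destruct (ex_cpl (n := T) (y' := y') (c1 := c1) (r := r) (c := c) (y := y)) as (c2&Hc2&l2&h2&E2);trivial.
 destruct (eqA_cpl (n := T) (y := y') (c1 := c2) (s := s) (t := s) (z := z)) as (c3&Hc3&l3&h3&E3);trivial.
 apply (H c3 r s n);trivial;[exact (ex_le1 E2 l3)|]. intros c4 Hc4 l4. apply U1;trivial.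
 apply (le_trans l4). now apply (le_trans l3).
 + intro HS.
 destruct (generic (n := T) (X := fun c' r => exists s n, s ∈ Ar /\ eqA c' s s /\
 forall c2, c2 ∈ Cs -> le c2 c' -> ~ F g c2 (scons s (fun i => comp (a i) r)) (scons n t)) (y := y))
 as [(c'&r&y'&Hc'&Hr&(s&n&Hs&E1&U)&Hy'&h'&A1)|(c0&Hc0&h0&U)];trivial.
 { site_defs D.
 assert (K := @F_def N V ZV D g (fun v => v 0)
 (fun i => match i with 0 => fun v => v 2 | S i => fun v => comp (a i) (v 4) end)
 (fun i => match i with 0 => fun v => v 1 | S i => fun v => t i end) (DT_var _ 0)).
 assert (K2 : Def (fun v => F g (v 0) (scons (v 2) (fun i => comp (a i) (v 4))) (scons (v 1) t))).
 { refine (Def_ext _ (K _ _)).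
 - intro v. match goal with |- Frc _ _ _ ?p ?q <-> Frc _ _ _ ?p' ?q' => replace p with p';[replace q with q';[reflexivity|]|] end;
 apply fext;now intros [].
 - intros [|i];def. - intros [|i];def. }
 clear K. repeat (unfold Def2;cbv beta;lazymatch goal with
 | |- Def (fun v => Frc _ _ _ _ _) => exact K2
 | _ => def_step end). }
 * destruct (eqA_snd (n := T) Hy' Hc' Hs Hs h' E1) as (z&A2&_).
 assert (Hz : z ∈ Sg) by exact (act_Sg Hs Hy' A2).
 pose (w := exist W (val ⌊n⌋ z) (ex_intro _ n (ex_intro _ z (conj Hz eq_refl))) : WS).
 assert (I' : interp y' (scons s (fun i => comp (a i) r)) (scons n t) (scons w u))
 by (apply (@interp_scons y y' r s n a t u _ z);trivial).
 destruct (IH y' _ _ _ Hy' I') as [_ C]. destruct (C (HS w)) as (c1&Hc1&h1&F1).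
 destruct (dir (n := T) Hy' Hc' Hc1 h' h1) as (c2&Hc2&l&l1&h2).
 exfalso. apply (U c2 Hc2 l). now apply (F_le Hc2 l1).
 * exists c0. sp;try assumption. intros c' r s n Hc' Hr Hs E1 E2 K. apply (U c' r);trivial.
 exists s, n. sp;try assumption.
Qed.

Lemma W_val (t : VS) x : x ∈ Sg -> W (val ⌊t⌋ x).
Proof. intro H. now exists t, x. Qed.
Lemma W_trans : transitive_class W.
Proof.
intros x y (t&z&Hz&->) Hx. apply (in_valV TV) in Hx as (s&e&y1&z1&H);trivial.
destruct H as (_&_&_&_&_&_&Hz1&->). now apply W_val.
Qed.

Lemma common_stage (u : nat -> WS) : forall n, exists y, y ∈ Sg /\ forall i, i < n -> exists a t x, a ∈ Ar /\ act ⌊a⌋ y x /\ proj1_sig (u i) = val ⌊t⌋ x.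
Proof.
induction n as [|n (y&Hy&H)].
- destruct (proj2_sig (u 0)) as (t&x&Hx&_). exists x. spt. intros i Hi. lia.
- destruct (proj2_sig (u n)) as (t&x&Hx&E).
 destruct (amal (n := T) Hy Hx) as (y'&r&s&Hy'&Hr&Hs&A1&A2).
 exists y'. spt. intros i Hi. destruct (Nat.eq_dec i n) as [->|Ne].
 + now exists s, t, x.
 + destruct (H i) as (a&t'&x'&Ha&A&E');[lia|]. exists (comp a r), t', x'. sp;arr.
 now apply (act_comp2 (y1 := y)).
Qed.

Lemma interp_ex (u : nat -> WS) n : exists y a t u', y ∈ Sg /\ interp y a t u' /\ forall i, i < n -> u' i = u i.
Proof.
destruct (common_stage u (S n)) as (y&Hy&H).
assert (E : forall i, exists p : VS * VS, fst p ∈ Ar /\ exists x, act ⌊fst p⌋ y x /\ proj1_sig (u (if Nat.ltb i n then i else 0)) = val ⌊snd p⌋ x).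
{ intro i. destruct (H (if Nat.ltb i n then i else 0)) as (a&t&x&Ha&A&E).
 - destruct (Nat.ltb_spec i n);lia.
 - exists (a, t). spt. now exists x. }
pose (g := fun i => proj1_sig (cid _ (E i))).
assert (Hg := fun i => proj2_sig (cid _ (E i)) : fst (g i) ∈ Ar /\ exists x, act ⌊fst (g i)⌋ y x /\ proj1_sig (u (if Nat.ltb i n then i else 0)) = val ⌊snd (g i)⌋ x).
exists y, (fun i => fst (g i)), (fun i => snd (g i)), (fun i => u (if Nat.ltb i n then i else 0)).
spt. split;[exact Hg|]. intros i Hi. destruct (Nat.ltb_spec i n);[trivial|lia].
Qed.

(** The name consists of the pairs (s,e) whose label [e] itself forces the formula, with [s] read
    along [lb e] and the parameters along [la e]. That it is a subset of a fixed product is the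
    bound needed for power sets. *)
Lemma W_core (d : VS) f y (a t : nat -> VS) (u : nat -> WS) : y ∈ Sg -> interp y a t u ->
 exists t', t' ∈ pow (prod d Es) /\
 forall w : WS, proj1_sig w ∈ val ⌊t'⌋ y <-> (exists s z, s ∈ d /\ z ∈ Sg /\ proj1_sig w = val ⌊s⌋ z) /\ sat (scons w u) f.
Proof.
intros Hy Hi.
pose (X := fun p => exists s e, p = opair s e /\ eqA (lc e) (lb e) (lb e) /\
 F f (lc e) (scons (lb e) (fun i => comp (a i) (la e))) (scons s t)).
assert (HX : Def1 X).
{ unfold X. site_defs D.
 assert (K := @F_def N V ZV D f (fun v => lc (v 0))
 (fun i => match i with 0 => fun v => lb (v 0) | S i => fun v => comp (a i) (la (v 0)) end)
 (fun i => match i with 0 => fun v => v 1 | S i => fun v => t i end)).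
 assert (K2 : Def (fun v => F f (lc (v 0)) (scons (lb (v 0)) (fun i => comp (a i) (la (v 0)))) (scons (v 1) t))).
 { refine (Def_ext _ (K _ _ _)).
 - intro v. match goal with |- Frc _ _ _ ?p ?q <-> Frc _ _ _ ?p' ?q' => replace p with p';[replace q with q';[reflexivity|]|] end;
 apply fext;now intros [].
 - def. - intros [|i];def. - intros [|i];def. }
 clear K. repeat (unfold Def1;cbv beta;lazymatch goal with
 | |- Def (fun v => Frc _ _ _ _ _) => exact K2
 | _ => def_step end). }
exists (sep (prod d Es) X). split.
{ apply in_pow. intros p Hp. now apply in_sep in Hp. }
intro w. rewrite (in_valV TV) by trivial. split.
- intros (s&e&y1&z&Hs&He&Hy1&h&A1&A2&Hz&E).
 apply in_sep in Hs as [Hs (s'&e'&Ep&Eq&HF)];trivial. apply opair_inj in Ep as [<- <-].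
 apply in_prod2 in Hs as [Hs _]. destruct (lab_in He) as (L1&L2&L3). split;[now exists s, z|].
 exact (proj1 (truth f Hy1 (@interp_scons y y1 (la e) (lb e) s a t u w z Hy1 L2 L3 A1 A2 E Hi)) (lc e) L1 h HF).
- intros ((s&z&Hs&Hz&E)&HS).
 destruct (amal (n := T) Hy Hz) as (y'&r&b&Hy'&Hr&Hb&A1&A2).
 assert (I' := @interp_scons y y' r b s a t u w z Hy' Hr Hb A1 A2 E Hi).
 destruct (proj2 (truth f Hy' I') HS) as (c&Hc&h&HF).
 destruct (eqA_cpl (n := T) (y := y') (c1 := c) (s := b) (t := b) (z := z)) as (c3&Hc3&l3&h3&E3);trivial.
 destruct (mk_lab Hc3 Hr Hb) as (e&He&<-&<-&<-).
 exists s, e, y', z. sp;try assumption. apply in_sep;trivial. split;[now apply in_prod2|].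
 exists s, e. split;[reflexivity|]. split;[assumption|]. exact (F_le Hc3 l3 HF).
Qed.

Lemma W_comp (d : VS) f (u : nat -> WS) :
 exists b : WS, forall w : WS, w ∈ b <-> (exists s z, s ∈ d /\ z ∈ Sg /\ proj1_sig w = val ⌊s⌋ z) /\ sat (scons w u) f.
Proof.
destruct (interp_ex u (fvb f)) as (y&a&t&u'&Hy&Hi&E).
destruct (@W_core d f y a t u' Hy Hi) as (t'&_&H).
exists (mkW (W_val t' Hy)). intro w. rewrite <- (sat_fvb (v := scons w u')).
- apply H.
- intros [|i] Hi';simpl;trivial. apply E. lia.
Qed.

(** A subset of a value may need parameters from another stage, so a name for it is evaluated at an
    amalgamated stage; the name still comes from one fixed set of V, over which the power set axiom
    can collect. *)
Lemma W_sub_name (t : VS) x (b : WS) : x ∈ Sg -> (forall z, z ∈ proj1_sig b -> z ∈ val ⌊t⌋ x) ->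
 exists t' y r, t' ∈ pow (prod (tc t) Es) /\ y ∈ Sg /\ r ∈ Ar /\ act ⌊r⌋ y x /\ proj1_sig b = val ⌊t'⌋ y.
Proof.
intros Hx Hb. destruct (proj2_sig b) as (s&z&Hz&E).
destruct (amal (n := T) Hx Hz) as (y&r&a&Hy&Hr&Ha&A1&A2).
destruct (@W_core (tc t) (fMem 0 1) y (fun _ => a) (fun _ => s) (fun _ => b) Hy) as (t'&Ht'&H).
{ intro i. spt. now exists z. }
exists t', y, r. sp;try assumption. apply ext. intro w. split.
- intro Hw. pose (w' := mkW (W_trans (proj2_sig b) Hw)). apply (H w'). split;[|exact Hw].
 assert (Hw2 := Hb w Hw). apply (in_valV TV) in Hw2 as (s'&e&y1&z1&Hs'&_&_&_&_&_&Hz1&Ew);trivial.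
 exists s', z1. split;[apply (tc_opair Hs')|]. spt.
- intro Hw. pose (w' := mkW (W_trans (W_val t' Hy) Hw)). exact (proj2 (proj1 (H w') Hw)).
Qed.

Lemma W_eq (p q : WS) : proj1_sig p = proj1_sig q -> p = q.
Proof. destruct p as [p Hp], q as [q Hq]. simpl. intros <-. f_equal. apply proof_irrelevance. Qed.

Lemma W_in (x : WS) (t : VS) z (w : N) : z ∈ Sg -> proj1_sig x = val ⌊t⌋ z -> w ∈ proj1_sig x ->
 exists s z', s ∈ tc t /\ z' ∈ Sg /\ w = val ⌊s⌋ z'.
Proof.
intros Hz E Hw. rewrite E in Hw.
apply (in_valV TV) in Hw as (s'&e&y1&z1&Hs'&_&_&_&_&_&Hz1&Ew);trivial.
exists s', z1. split;[apply (tc_opair Hs')|now split].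
Qed.

Definition chk_step x h : VS := prod (repl x (fun y => ap h y)) Es.
Lemma chk_step_def : DF2 chk_step. Proof. unfold chk_step. def. Qed.
Definition chk : VS -> VS := srec chk_step.
Lemma chk_def : DF1 chk. Proof. apply DF_srec, chk_step_def. Qed.
Lemma in_chk x s e : opair s e ∈ chk x <-> (exists y, y ∈ x /\ s = chk y) /\ e ∈ Es.
Proof.
pose proof chk_def. unfold chk at 1. rewrite srec_eq by apply chk_step_def. fold chk.
unfold chk_step. rewrite in_prod2, in_repl by def. split.
- intros [(y&Hy&->) He]. spt. exists y. spt. now rewrite ap_lam by (trivial;now apply tc_sub).
- intros [(y&Hy&->) He]. spt. exists y. spt. now rewrite ap_lam by (trivial;now apply tc_sub).
Qed.
Lemma val_chk (x : VS) z : z ∈ Sg -> val ⌊chk x⌋ z = ⌊x⌋.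
Proof.
intro Hz0.
 pose proof chk_def as HC.
 (* the graph of [chk] makes the induction hypothesis definable in N *)
 pose (g := lam (tc (sing x)) chk : VS).
 assert (Fg : functional g) by now apply lam_functional.
 assert (Ag : forall y, y ∈ tc (sing x) -> ap ⌊g⌋ ⌊y⌋ = ⌊chk y⌋).
 { intros y Hy. rewrite (inj_ap TV (y := chk y));trivial;[|now apply in_lam2]. unfold g. now rewrite (ap_lam HC Hy). }
 assert (K : forall y : N, y ∈ ⌊tc (sing x)⌋ -> forall z, z ∈ Sg -> val (ap ⌊g⌋ y) z = y).
 { apply (mem_ind (P := fun y => y ∈ ⌊tc (sing x)⌋ -> forall z, z ∈ Sg -> val (ap ⌊g⌋ y) z = y)).
 { pose proof (val_def T). def. }
 intros y IH Hy. apply (in_inj TV) in Hy as (y'&<-&Hy). rewrite Ag by trivial. intros w Hw.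
 apply ext. intro u. rewrite (in_valV TV) by trivial. split.
 - intros (s&e&y1&z1&Hs&He&Hy1&h&A1&A2&Hz1&->).
 apply in_chk in Hs as [(v&Hv&->) _]. assert (Hv' : v ∈ tc (sing x)) by exact (tc_trans Hy Hv).
 rewrite <- (Ag v Hv'), IH;trivial.
 - intro Hu. apply (in_inj TV) in Hu as (v&<-&Hv). assert (Hv' : v ∈ tc (sing x)) by exact (tc_trans Hy Hv).
 destruct (top (n := T) Hw) as (c&Hc&h). destruct (mk_lab Hc (in_id D) (in_id D)) as (e&He&E1&E2&E3).
 exists (chk v), e, w, w. rewrite E1, E2, E3. sp;try assumption;try (apply act_id;assumption).
 + apply in_chk. spt. now exists v.
 + rewrite <- (Ag v Hv'). symmetry. apply IH;trivial. }
assert (Hx : x ∈ tc (sing x)) by (apply tc_sub;now apply in_sing).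
rewrite <- (Ag x Hx). apply K;trivial.
Qed.

Hypothesis Sg_ne : exists z, z ∈ Sg.
Lemma W_V (x : VS) : W ⌊x⌋.
Proof. destruct Sg_ne as [z Hz]. rewrite <- (val_chk x Hz). now apply W_val. Qed.

Lemma W_def (d : VS) (P : WS -> Prop) : Def1 P ->
 exists b : WS, forall w : WS, w ∈ b <-> (exists s z, s ∈ d /\ z ∈ Sg /\ proj1_sig w = val ⌊s⌋ z) /\ P w.
Proof.
intro HP. destruct (Def1_sat (mkW (W_V d)) HP) as (f&e&H).
destruct (W_comp d f e) as [b Hb]. exists b. intro w. now rewrite Hb, H.
Qed.

Lemma W_sep (P : WS -> Prop) (a : WS) : Def1 P -> exists b : WS, forall w : WS, w ∈ b <-> w ∈ a /\ P w.
Proof.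
intro HP. destruct (proj2_sig a) as (t&x&Hx&E).
destruct (@W_def (tc t) (fun w => w ∈ a /\ P w)) as [b Hb];[def|].
exists b. intro w. rewrite Hb. split;[tauto|]. intro H. spt.
apply (W_in Hx E). exact (proj1 H).
Qed.

(** Collection is done in V: for every code of a condition, two arrows and a name of the argument,
    some name of a forced value is bounded by [d]. The name found this way may differ from the given
    one, and uniqueness of the value identifies the two. *)
Lemma W_repl (phi : formula) (e : nat -> WS) (a : WS) :
 (forall x, x ∈ a -> exists! y, sat (scons y (scons x e)) phi) ->
 exists b : WS, forall y, y ∈ b <-> exists x, x ∈ a /\ sat (scons y (scons x e)) phi.
Proof.
intro Hu. destruct (proj2_sig a) as (t&x0&Hx0&Ea).
destruct (interp_ex e (fvb phi)) as (y0&a0&t0&e'&Hy0&Hi&Ee).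
assert (Es : forall x y, sat (scons y (scons x e)) phi <-> sat (scons y (scons x e')) phi).
{ intros x y. apply sat_fvb. intros [|[|i]] Hi';simpl;trivial. symmetry. apply Ee. lia. }
pose (R := fun q s' => exists c r b s g, q = opair c (opair r (opair b s)) /\ g ∈ Ar /\ eqA c g g /\
 F phi c (scons g (scons b (fun i => comp (a0 i) r))) (scons s' (scons s t0))).
assert (HR : Def2 R).
{ unfold R. site_defs D.
 assert (K := @F_def N V ZV D phi (fun v => v 4)
 (fun i => match i with 0 => fun v => v 0 | 1 => fun v => v 2 | S (S i) => fun v => comp (a0 i) (v 3) end)
 (fun i => match i with 0 => fun v => v 6 | 1 => fun v => v 1 | S (S i) => fun v => t0 i end) (DT_var _ 4)).
 assert (K2 : Def (fun v => F phi (v 4) (scons (v 0) (scons (v 2) (fun i => comp (a0 i) (v 3)))) (scons (v 6) (scons (v 1) t0)))).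
 { refine (Def_ext _ (K _ _)).
 - intro v. match goal with |- Frc _ _ _ ?p ?q <-> Frc _ _ _ ?p' ?q' => replace p with p';[replace q with q';[reflexivity|]|] end;
 apply fext;now intros [|[]].
 - intros [|[|i]];def. - intros [|[|i]];def. }
 clear K. repeat (unfold Def2;cbv beta;lazymatch goal with
 | |- Def (fun v => Frc _ _ _ _ _) => exact K2
 | _ => def_step end). }
pose (Q0 := sep (prod Cs (prod Ar (prod Ar (tc t)))) (fun q => exists s', R q s')).
destruct (collection HR (a := Q0)) as [d Hd].
{ intros q Hq. apply in_sep in Hq;[tauto|def]. }
destruct (@W_def d (fun y => exists x, x ∈ a /\ sat (scons y (scons x e)) phi)) as [b Hb].
{ apply Def_ext with (P := fun v => exists x, x ∈ a /\ sat (fun i => match i with 0 => v 0 | 1 => x | S (S i) => e i end) phi).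
 - intro v. split;intros (x&Hx&H);exists x;spt;
 match goal with H : sat ?p _ |- sat ?q _ => replace q with p;[exact H|] end;apply fext;now intros [|[]].
 - assert (K : Def (fun v : nat -> WS => sat (fun i => match i with 0 => v 1 | 1 => v 0 | S (S i) => e i end) phi)).
 { refine (Def_ext _ (@Def_sat WS phi (fun i => match i with 0 => fun v => v 1 | 1 => fun v => v 0 | S (S i) => fun v => e i end) _)).
 - intro v. match goal with |- sat ?p _ <-> sat ?q _ => replace q with p;[reflexivity|] end;apply fext;now intros [|[]].
 - intros [|[|i]];def. }
 repeat (cbv beta;lazymatch goal with |- Def (fun v => sat _ _) => exact K | _ => def_step end). }
exists b. intro y. rewrite Hb. split;[tauto|]. intros (x&Hx&Hs). split;[|now exists x].
destruct (W_in Hx0 Ea Hx) as (s&z&Hs'&Hz&Ex). destruct (proj2_sig y) as (s1&z1&Hz1&Ey).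
destruct (amal (n := T) Hy0 Hz) as (y1&r1&b1&Hy1&Hr1&Hb1&A1&A2).
destruct (amal (n := T) Hy1 Hz1) as (y2&r2&g&Hy2&Hr2&Hg&A3&A4).
assert (I2 : forall g' s2 z2 (w : WS), g' ∈ Ar -> act ⌊g'⌋ y2 z2 -> proj1_sig w = val ⌊s2⌋ z2 ->
 interp y2 (scons g' (scons (comp b1 r2) (fun i => comp (a0 i) (comp r1 r2)))) (scons s2 (scons s t0)) (scons w (scons x e'))).
{ intros g' s2 z2 w Hg' A5 E5 [|[|i]];simpl.
 - spt. now exists z2.
 - split;arr. exists z. split;[apply (act_comp2 (y1 := y1));arr|trivial].
 - destruct (Hi i) as (Ha&x'&A&E'). split;arr. exists x'. spt.
 apply (act_comp2 (y1 := y0));arr. apply (act_comp2 (y1 := y1));arr. }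
apply Es in Hs. destruct (proj2 (truth phi Hy2 (I2 g s1 z1 y Hg A4 Ey)) Hs) as (c&Hc&h&HF).
destruct (eqA_cpl (n := T) (y := y2) (c1 := c) (s := g) (t := g) (z := z1)) as (c3&Hc3&l3&h3&E3);trivial.
destruct (Hd (opair c3 (opair (comp r1 r2) (opair (comp b1 r2) s)))) as (s2&Hs2&HR2).
{ apply in_sep;[def|]. rewrite !in_prod2. split;[sp;arr|]. exists s1, c3, (comp r1 r2), (comp b1 r2), s, g.
 split;[reflexivity|]. split;[trivial|]. split;[trivial|]. exact (F_le Hc3 l3 HF). }
destruct HR2 as (c'&r'&b'&s'&g'&Eq&Hg'&E4&HF2).
apply opair_inj in Eq as [<- Eq]. apply opair_inj in Eq as [<- Eq]. apply opair_inj in Eq as [<- <-].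
destruct (eqA_snd (n := T) Hy2 Hc3 Hg' Hg' h3 E4) as (z2&A5&_).
assert (Hz2 : z2 ∈ Sg) by exact (act_Sg Hg' Hy2 A5).
pose (w := mkW (W_val s2 Hz2)).
assert (Hw := proj1 (truth phi Hy2 (I2 g' s2 z2 w Hg' A5 eq_refl)) c3 Hc3 h3 HF2).
apply Es in Hw, Hs. destruct (Hu x Hx) as (y'&_&U).
exists s2, z2. spt. spt. rewrite <- (U y Hs), (U w Hw). reflexivity.
Qed.

Lemma W_lift (w : N) (b : WS) : w ∈ proj1_sig b -> exists w' : WS, proj1_sig w' = w.
Proof. intro H. now exists (mkW (W_trans (proj2_sig b) H)). Qed.

Theorem ZF_W : ZF WS.
Proof.
assert (Ext : ax_extensionality WS).
{ intros x y H. apply W_eq, ext. intro z. split;intro Hz.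
 - destruct (W_lift Hz) as [z' <-]. now apply H. - destruct (W_lift Hz) as [z' <-]. now apply H. }
split;[trivial|split;[|split;[|split;[|split;[|split;[|split]]]]]].
- intros a [x Hx]. destruct (proj1 (proj2 (zfm (M := N))) (proj1_sig a)) as (y&Hy&U);[now exists (proj1_sig x)|].
 destruct (W_lift Hy) as [y' <-]. exists y'. spt. intros w Hw. apply (U (proj1_sig w) Hw).
- intros x y. destruct (proj2_sig x) as (s&z&Hz&Ex), (proj2_sig y) as (s'&z'&Hz'&Ey).
 destruct (@W_def (upair s s') (fun w => w = x \/ w = y)) as [b Hb];[def|]. exists b. intro w. rewrite Hb.
 split;[tauto|]. intro H. spt. destruct H as [->| ->];[exists s, z|exists s', z'];rewrite in_upair;tauto.
- intro a. destruct (proj2_sig a) as (t&x&Hx&E).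
 destruct (@W_def (tc t) (fun w => exists y, y ∈ a /\ w ∈ y)) as [b Hb];[def|]. exists b. intro w. rewrite Hb.
 split;[tauto|]. intros (y&Hy&Hw). split;[|now exists y].
 destruct (W_in Hx E Hy) as (s&z&Hs&Hz&Ey). destruct (W_in Hz Ey Hw) as (s'&z'&Hs'&Hz'&Ew).
 exists s', z'. split;[|now split]. apply (@tc_min _ _ s (tc t));trivial;[apply tc_trans|].
 intros p Hp. exact (tc_trans Hs Hp).
- intro a. destruct (proj2_sig a) as (t&x&Hx&E).
 destruct (@W_def (pow (prod (tc t) Es)) (fun w => subset w a)) as [b Hb];[def|]. exists b. intro w. rewrite Hb.
 split;[tauto|]. intro H. spt.
 destruct (@W_sub_name t x w Hx) as (t'&y&r&Ht'&Hy&_&_&Ew).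
 { intros u Hu. destruct (W_lift Hu) as [u' <-]. rewrite <- E. exact (H u' Hu). }
 exists t', y. now split.
- exists (mkW (W_V om)). split.
 + exists (mkW (W_V emp)). split.
 * intros z Hz. change (proj1_sig z ∈ ⌊emp⌋) in Hz. rewrite (inj_emp TV) in Hz. now apply in_emp in Hz.
 * change (⌊emp⌋ ∈ ⌊om⌋). apply inj_mem, om_emp.
 + intros x Hx. change (proj1_sig x ∈ ⌊om⌋) in Hx. apply (in_inj TV) in Hx as (n&En&Hn).
 exists (mkW (W_V (succ n))). split.
 * intro z. change (proj1_sig z ∈ ⌊succ n⌋ <-> proj1_sig z ∈ proj1_sig x \/ z = x).
 rewrite (inj_succ TV), in_succ, En. split;(intros [H|H];[now left|right]);[now apply W_eq|now rewrite H].
 * change (⌊succ n⌋ ∈ ⌊om⌋). apply inj_mem, om_succ, Hn.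
- intros phi e a. apply W_sep.
 refine (Def_ext _ (@Def_sat WS phi (fun i => match i with 0 => fun v => v 0 | S i => fun v => e i end) _)).
 + intro v. match goal with |- sat ?p _ <-> sat ?q _ => replace q with p;[reflexivity|] end;apply fext;now intros [].
 + intros [|i];def.
- intros phi e a. apply W_repl.
Qed.
End Truth.

Section Img.
Context {M : structure} {Z : ZFm M}.
(** The value of the nice name [r] under the filter [y]: the pair (u,q) puts [u] into the value when
    [q] is in the filter. *)
Definition img (r y : M) : M := sep (bU (bU r)) (fun u => exists q, q ∈ y /\ opair u q ∈ r).
Lemma in_img r y u : u ∈ img r y <-> exists q, q ∈ y /\ opair u q ∈ r.
Proof.
unfold img. rewrite in_sep by def. split;[tauto|]. intros (q&Hq&H). split;[now apply in_UU in H|now exists q].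
Qed.
Lemma DT_img (t u : (nat -> M) -> M) : DT t -> DT u -> DT (fun v => img (t v) (u v)).
Proof. intros. unfold img. def. Qed.
End Img.
Ltac def_hook4 :=
 lazymatch goal with
 | |- DT (fun v => img (@?t v) (@?u v)) => refine (@DT_img _ _ t u _ _)
 | _ => def_hook3
 end.
Ltac def_hook ::= def_hook4.

(** * Forcing with a single poset *)
Section Posets.
Context {N : structure} {V : N -> Prop} {ZN : ZFm N} {ZV : ZFm (restrict V)}.
Notation VS := (restrict V).
Notation "'⌊' x '⌋'" := (@inj N V x).
Hypothesis TV : transitive_class V.

Lemma inj_img (r y : VS) : ⌊img r y⌋ = img ⌊r⌋ ⌊y⌋.
Proof.
symmetry. apply (inj_ext TV).
- intros z Hz. apply in_img in Hz as (q&Hq&H). destruct (pinj TV H eq_refl) as (a&b&<-&_). apply inj_V.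
- intro z. rewrite !in_img. split.
 + intros (q&Hq&H). apply (in_inj TV) in Hq as (q'&<-&Hq). exists q'. spt. now apply (opinj TV).
 + intros (q&Hq&H). exists ⌊q⌋. spt. now apply (opinj TV).
Qed.

(* A poset is a family of sets; stronger conditions are larger sets. *)
Definition dense (Q D : VS) := subset D Q /\ forall p, p ∈ Q -> exists q, q ∈ D /\ subset p q.
Definition gen (Q : VS) (y : N) := subset y ⌊Q⌋ /\ (exists p, p ∈ y) /\
 (forall p q, q ∈ ⌊Q⌋ -> p ∈ y -> subset q p -> q ∈ y) /\
 (forall p q, p ∈ y -> q ∈ y -> exists r, r ∈ y /\ subset p r /\ subset q r) /\
 (forall D, dense Q D -> exists p, p ∈ D /\ ⌊p⌋ ∈ y).

Lemma gen_lift Q y p : gen Q y -> p ∈ y -> exists p', ⌊p'⌋ = p /\ p' ∈ Q.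
Proof. intros (H&_) Hp. apply H in Hp. now apply (in_inj TV). Qed.

Lemma gen_dich (X : VS -> Prop) Q y : Def1 X -> gen Q y ->
 (exists p, p ∈ Q /\ ⌊p⌋ ∈ y /\ X p) \/
 (exists p, p ∈ Q /\ ⌊p⌋ ∈ y /\ forall q, q ∈ Q -> subset p q -> ~ X q).
Proof.
intros HX HG. destruct HG as (G1&G2&G3&G4&G5).
pose (P := fun p => X p \/ forall q, q ∈ Q -> subset p q -> ~ X q).
assert (HP : Def1 P) by (unfold P;def).
destruct (G5 (sep Q P)) as (p&Hp&Hy).
- split.
 + intros p Hp. now apply in_sep in Hp.
 + intros p Hp. destruct (classic (exists q, q ∈ Q /\ subset p q /\ X q)) as [(q&Hq&Hs&Hx)|C].
 * exists q. spt. apply in_sep;trivial. spt. now left.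
 * exists p. split;[|now intros ? ?]. apply in_sep;trivial. spt. right. intros q Hq Hs Hx. apply C. now exists q.
- apply in_sep in Hp as [Hp [Hx|Hx]];trivial;[left|right];now exists p.
Qed.

(** A single poset as a degenerate site: one arrow, one stage, and labels that are just
    conditions. *)
Definition pv (Q : VS) : vsite (N := N) (V := V).
Proof.
refine {| Cs := Q;Ar := sing emp;Es := Q;idA := emp;comp := fun _ _ => emp;
 le := fun c' c => subset c c';ex := fun c' _ c => subset c c';eqA := fun _ _ _ => True;
 lc := fun e => e;la := fun _ => emp;lb := fun _ => emp |};try def.
- now apply in_sing.
- intros. now apply in_sing.
- intros. rewrite in_sing. tauto.
- intros c a b Hc Ha Hb. apply in_sing in Ha, Hb. exists c. now repeat split.
- intros c1 c2 c3 A B x Hx. auto.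
- trivial.
- intros c c' c2 _ A B x Hx. auto.
- intros c c' c2 _ A B x Hx. auto.
- trivial.
Defined.

Definition pn (Q : VS) (y : N) (HG : gen Q y) : nsite (pv Q).
Proof.
refine {| Sg := sing emp;hold := fun _ c => c ∈ y;act := fun _ y z => z = y |};try def.
- intros;congruence.
- intros s u z _ Hu ->. trivial.
- trivial.
- intros s t u u1 z _ _ _ ->. tauto.
- intros u _. pose proof HG as (G1&(p&Hp)&_). destruct (gen_lift HG Hp) as (p'&<-&Hp'). now exists p'.
- intros u c1 c2 _ H1 H2 h1 h2. destruct (proj1 (proj2 (proj2 (proj2 HG))) _ _ h1 h2) as (r&Hr&A&B).
 destruct (gen_lift HG Hr) as (r'&<-&Hr'). exists r'. repeat spt;now apply (inj_sub TV).
- intros u c' r c Hu Hc' Hr Hc h E. exists u. spt.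
 apply (proj1 (proj2 (proj2 HG)) ⌊c'⌋);trivial. now apply (inj_sub TV).
- intros u c1 r c z Hu Hc1 Hr Hc h -> h'.
 destruct (proj1 (proj2 (proj2 (proj2 HG))) _ _ h h') as (q&Hq&A&B).
 destruct (gen_lift HG Hq) as (q'&<-&Hq'). exists q'. repeat spt;now apply (inj_sub TV).
- intros u c s t Hu Hc _ _ h _. now exists u.
- intros u c1 s t z Hu Hc1 _ _ h _ _. exists c1. split;[exact Hc1|split;[now intros ? ?|split;[exact h|exact I]]].
- intros y1 y2 H1 H2. apply in_sing in H1, H2. subst. exists emp, emp, emp. repeat spt;now apply in_sing.
- intros X u HX Hu. apply in_sing in Hu. subst u.
 destruct (@gen_dich (fun c => X c emp) Q y) as [(p&Hp&Hy&Hx)|(p&Hp&Hy&U)];trivial;[def| |].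
 + left. exists p, emp, emp. repeat spt;now apply in_sing.
 + right. exists p. repeat spt. intros c r Hc Hr Hx Hs. apply in_sing in Hr. subst r. now apply (U c).
Defined.

Section One.
Variables (Q : VS) (y : N).
Hypothesis HG : gen Q y.
Local Notation T := (pn HG).
Definition pval t := val T t emp.
Lemma pval_def : DF1 pval. Proof. unfold pval. pose proof (val_def T). def. Qed.
Lemma emp_Sg : emp ∈ Sg T. Proof. now apply in_sing. Qed.
Lemma in_pval t u : u ∈ pval t <-> exists s e, opair s e ∈ t /\ e ∈ y /\ u = pval s.
Proof.
unfold pval. rewrite in_val by apply emp_Sg. split.
- intros (s&z&e&Hs&Hz&Hr&->). apply in_sing in Hz. subst z. exists s, e. spt. spt.
 destruct (in_inj TV e (Es (pv Q))) as [K _]. destruct (K (proj1 Hr)) as (e'&<-&He).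
 apply (RN_eq TV) in Hr as (u&_&h&_);trivial.
- intros (s&e&Hs&He&->). exists s, emp, e. spt. split;[apply emp_Sg|]. spt.
 destruct (gen_lift HG He) as (e'&<-&He'). apply (RN_eq TV);trivial. exists emp. repeat spt. apply emp_Sg.
Qed.
Lemma in_pvalV (t : VS) u : u ∈ pval ⌊t⌋ <-> exists s e, opair s e ∈ t /\ ⌊e⌋ ∈ y /\ u = pval ⌊s⌋.
Proof.
rewrite in_pval. split.
- intros (s&e&Hs&He&->). destruct (pinj TV Hs eq_refl) as (s'&e'&<-&<-&Hs'). now exists s', e'.
- intros (s&e&Hs&He&->). exists ⌊s⌋, ⌊e⌋. split;[now apply (opinj TV)|]. now split.
Qed.
Definition PW := W T.
Lemma PW_eq u : PW u <-> exists t : VS, u = pval ⌊t⌋.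
Proof.
split.
- intros (t&x&Hx&->). apply in_sing in Hx. subst x. now exists t.
- intros (t&->). exists t, emp. split;[apply emp_Sg|trivial].
Qed.
Lemma PW_trans : transitive_class PW. Proof. apply (W_trans TV). Qed.
Lemma PW_ZF : ZF (restrict PW).
Proof. apply (ZF_W TV). exists emp. apply emp_Sg. Qed.
Lemma PW_V (x : VS) : PW ⌊x⌋.
Proof. apply (W_V TV). exists emp. apply emp_Sg. Qed.
Lemma pval_chk (x : VS) : pval ⌊chk (pv Q) x⌋ = ⌊x⌋.
Proof. apply (val_chk TV). apply emp_Sg. Qed.

Definition fo f c (t : nat -> VS) := F (pv Q) f c (fun _ => emp) t.
Lemma ptruth f (t : nat -> VS) (u : nat -> restrict PW) : (forall i, proj1_sig (u i) = pval ⌊t i⌋) ->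
 (sat u f <-> exists c, c ∈ Q /\ ⌊c⌋ ∈ y /\ fo f c t).
Proof.
intro H. destruct (truth TV f (T := T) (y := emp) (a := fun _ => emp) (t := t) (u := u)) as [A B].
- apply emp_Sg. - intro i. split;[now apply in_sing|]. now exists emp.
- split;[exact B|]. intros (c&Hc&h&HF). now apply (A c).
Qed.
Lemma fo_le f c c' t : c' ∈ Q -> subset c c' -> fo f c t -> fo f c' t.
Proof. intros. now apply (F_le (D := pv Q) (c := c)). Qed.

Lemma nice_name (a : VS) x : PW x -> subset x ⌊a⌋ -> exists r : VS, subset r (prod a Q) /\ x = img ⌊r⌋ y /\
 forall u p p', opair u p ∈ r -> p' ∈ Q -> subset p p' -> opair u p' ∈ r.
Proof.
intros Hx Hs. apply PW_eq in Hx as (t&->).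
pose (X := fun q => Fmem (pv Q) (psnd q) emp (chk (pv Q) (pfst q)) emp t).
assert (HX : Def1 X).
{ unfold X, Fmem, FmemX. pose proof (FeqQ_def (pv Q)). site_defs (pv Q). pose proof (chk_def (pv Q)). def. }
assert (Hr : forall u p, opair u p ∈ sep (prod a Q) X <-> u ∈ a /\ p ∈ Q /\ Fmem (pv Q) p emp (chk (pv Q) u) emp t).
{ intros u p. rewrite in_sep by trivial. unfold X. rewrite in_prod2, pfst_eq, psnd_eq. tauto. }
exists (sep (prod a Q) X). split;[|split].
- intros q Hq. now apply in_sep in Hq.
- apply ext. intro u. rewrite in_img. split.
 + intro Hu. assert (Hu' := Hs u Hu). apply (in_inj TV) in Hu' as (u'&<-&Hu').
 assert (K : val T ⌊chk (pv Q) u'⌋ emp ∈ val T ⌊t⌋ emp) by (fold (pval ⌊chk (pv Q) u'⌋);rewrite pval_chk;exact Hu).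
 assert (E0 : (emp : VS) ∈ Ar (pv Q)) by now apply in_sing.
 destruct (Fmem_cpl TV (T := T) (y := emp) (x := emp) (x' := emp) E0 E0 emp_Sg eq_refl eq_refl K) as (c&Hc&h&HF).
 exists ⌊c⌋. spt. apply (opinj TV), Hr. repeat spt.
 + intros (q&Hq&H). destruct (pinj TV H eq_refl) as (u'&c&<-&<-&H').
 apply Hr in H' as (Hu&Hc&HF). rewrite <- pval_chk.
 assert (E0 : (emp : VS) ∈ Ar (pv Q)) by now apply in_sing.
 exact (Fmem_snd TV (T := T) E0 E0 Hc HF emp_Sg Hq eq_refl eq_refl).
- intros u p p' H Hp' Hs'. apply Hr in H as (Hu&Hp&HF). apply Hr. repeat spt.
 exact (F_le (D := pv Q) (f := fMem 0 1) (a := fun _ => emp) (t := fun i => match i with 0 => chk (pv Q) u | _ => t end) Hp' Hs' HF).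
Qed.

Definition nm (r : VS) : VS := repl r (fun q => opair (chk (pv Q) (pfst q)) (psnd q)).
Lemma pval_nm (a r : VS) : subset r (prod a Q) -> pval ⌊nm r⌋ = img ⌊r⌋ y.
Proof.
intro Hr. pose proof (chk_def (pv Q)). apply ext. intro u. rewrite in_pvalV, in_img. split.
- intros (s&e&Hs&He&->). apply in_repl in Hs as (q&Hq&E);[|def].
 assert (Hq' := Hr q Hq). apply in_prod in Hq' as (w&p&Hw&Hp&->). rewrite pfst_eq, psnd_eq in E.
 apply opair_inj in E as [-> ->]. rewrite pval_chk. exists ⌊p⌋. spt. now apply (opinj TV).
- intros (q&Hq&H'). destruct (pinj TV H' eq_refl) as (w&p&<-&<-&Hwp).
 exists (chk (pv Q) w), p. rewrite pval_chk. repeat spt. apply in_repl;[def|]. exists (opair w p).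
 rewrite pfst_eq, psnd_eq. now split.
Qed.
Lemma PW_y : PW y.
Proof.
assert (E : y = img ⌊lam Q (fun p => p)⌋ y).
{ apply ext. intro p. rewrite in_img. split.
 - intro Hp. destruct (gen_lift HG Hp) as (p'&<-&Hp'). exists ⌊p'⌋. spt.
 apply (opinj TV), in_lam2;[def|]. now split.
 - intros (q&Hq&H). destruct (pinj TV H eq_refl) as (a&b&<-&<-&H').
 apply in_lam2 in H' as [_ ->];[|def]. trivial. }
rewrite E, <- (@pval_nm Q). { apply PW_eq. now eexists. }
intros p Hp. apply in_lam in Hp as (q&Hq&->);[|def]. now apply in_prod2.
Qed.
End One.
End Posets.

(** * Regular and Mahlo cardinals *)

Section Regular.
Context {M : structure} {Z : ZFm M}.
Implicit Types a b c d f g k m n p q s u x y z : M.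

Lemma ap_undef f x : (forall y, ~ opair x y ∈ f) -> ap f x = emp.
Proof.
intro H. unfold ap. apply is_empty_eq. intros z Hz. apply in_bU in Hz as (w&Hw&_).
apply in_sep in Hw as [_ Hw];[|def]. now apply (H w).
Qed.
Lemma ord_max k a b : ordinal k -> a ∈ k -> b ∈ k -> exists c, c ∈ k /\ subset a c /\ subset b c.
Proof.
intros Ok Ha Hb. destruct (ord_tri (ord_mem Ok Ha) (ord_mem Ok Hb)) as [H|[->|H]].
- exists b. split;[trivial|]. split;[exact (proj1 (ord_mem Ok Hb) a H)|now intros ? ?].
- exists b. split;[trivial|]. split;now intros ? ?.
- exists a. split;[trivial|]. split;[now intros ? ?|exact (proj1 (ord_mem Ok Ha) b H)].
Qed.
Lemma least_fun (R : M -> M -> Prop) : Def2 R -> exists F, DF1 F /\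
 forall x o, ordinal o -> R x o -> ordinal (F x) /\ R x (F x) /\ forall o', ordinal o' -> R x o' -> F x = o' \/ F x ∈ o'.
Proof.
intro HR. pose (Q := fun x o => ordinal o /\ R x o /\ forall o', ordinal o' -> R x o' -> o = o' \/ o ∈ o').
assert (HQ : Def2 Q) by (unfold Q;def).
assert (UQ : forall x o o', Q x o -> Q x o' -> o = o').
{ intros x o o' (O1&E1&L1) (O2&E2&L2). destruct (L1 o' O2 E2) as [|A];trivial.
 destruct (L2 o O1 E1) as [|B];[congruence|]. exfalso. now apply (mem_asym A). }
exists (pf Q). split;[now apply DF_pf|]. intros x o Oo Ro.
destruct (ord_least (P := R x) (a := o)) as (b&Ob&Rb&L);[unfold Def1;def|trivial|trivial|].
rewrite (pf_eq (u := x) (y := b));[exact (conj Ob (conj Rb L))|intros ? ?;apply UQ|]. exact (conj Ob (conj Rb L)).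
Qed.

Section Reg.
Variable k : M.
Hypothesis Rk : regular k.
Hypothesis Wk : om ∈ k.

Lemma reg_ord : ordinal k. Proof. apply Rk. Qed.
Lemma reg_succ a : a ∈ k -> succ a ∈ k.
Proof. destruct Rk as (_&L&_). apply is_limit_eq in L. apply L. Qed.
Lemma reg_emp : emp ∈ k.
Proof. apply (ord_trans reg_ord om_emp Wk). Qed.
Lemma reg_bd a F : a ∈ k -> DF1 F -> (forall x, x ∈ a -> F x ∈ k) -> exists b, b ∈ k /\ forall x, x ∈ a -> F x ∈ b.
Proof.
intros Ha HF H. destruct Rk as (_&_&B). destruct (B a (lam a F) Ha) as (b&Hb&U);[now apply lam_fun|].
exists b. spt. intros x Hx. apply (U x). apply app_eq, in_lam2;trivial. now split.
Qed.
Lemma ord_bU a : (forall x, x ∈ a -> ordinal x) -> ordinal (bU a).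
Proof.
intro H. split.
- intros y Hy z Hz. apply in_bU in Hy as (x&Hx&Hy). apply in_bU. exists x. spt.
 apply (ord_trans (H x Hx) Hz Hy).
- intros y Hy. apply in_bU in Hy as (x&Hx&Hy). exact (proj1 (ord_mem (H x Hx) Hy)).
Qed.

(** [S d] is the least ordinal above [d] that bounds [F] on [d], below [k] by regularity. The
    supremum of ω iterates of [S] starting from [succ g0] is closed under [F], and it stays below
    [k] since ω does. *)
Lemma closure_point F g0 : DF1 F -> (forall g, g ∈ k -> F g ∈ k) -> g0 ∈ k ->
 exists b, b ∈ k /\ limit_ordinal b /\ g0 ∈ b /\ forall g, g ∈ b -> F g ∈ b.
Proof.
intros HF HFk Hg0. pose proof reg_ord as Ok.
destruct (@least_fun (fun d b => d ∈ b /\ b ∈ k /\ forall g, g ∈ d -> F g ∈ b)) as (S&HS&US);[def|].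
assert (Sk : forall d, d ∈ k -> S d ∈ k /\ d ∈ S d /\ forall g, g ∈ d -> F g ∈ S d).
{ intros d Hd. destruct (@reg_bd d F) as (b&Hb&Ub);trivial.
 { intros x Hx. apply HFk. apply (ord_trans Ok Hx Hd). }
 destruct (ord_max Ok Hb (reg_succ Hd)) as (c&Hc&Sb&Sd).
 destruct (US d c) as (_&(A&B&C)&_);[now apply (ord_mem Ok)| |tauto].
 split;[apply Sd, in_succ;tauto|]. split;[trivial|auto]. }
pose (G := fun _ x : M => S x). assert (HG : DF2 G) by (unfold G;def).
pose (q := om_rec G (succ g0)). assert (Hq : DF1 q) by (apply DF_om_rec, HG).
assert (q0 : q emp = succ g0) by now apply om_rec_0.
assert (qS : forall n, n ∈ om -> q (succ n) = S (q n)) by (intros;now apply (om_rec_S (G := G))).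
assert (qk : forall n, n ∈ om -> q n ∈ k).
{ apply om_ind;[def|rewrite q0;now apply reg_succ|]. intros n Hn IH. rewrite qS by trivial. now apply Sk. }
pose (b := bU (repl om q)).
assert (Hb : forall x, x ∈ b <-> exists n, n ∈ om /\ x ∈ q n).
{ intro x. unfold b. rewrite in_bU. split.
 - intros (y&Hy&Hx). apply in_repl in Hy as (n&Hn&->);trivial. now exists n.
 - intros (n&Hn&Hx). exists (q n). spt. apply in_repl;trivial. now exists n. }
assert (Ob : ordinal b).
{ apply ord_bU. intros x Hx. apply in_repl in Hx as (n&Hn&->);trivial. apply (ord_mem Ok). auto. }
assert (Hstep : forall x n, n ∈ om -> x ∈ q n -> q n ∈ b).
{ intros x n Hn Hx. apply Hb. exists (succ n). split;[now apply om_succ|]. rewrite qS by trivial. apply Sk. auto. }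
exists b. split;[|split;[|split]].
- destruct (@reg_bd om q) as (c&Hc&Uc);trivial. apply (ord_le_lt Ok Ob (y := c));trivial;[|now apply (ord_mem Ok)].
 intros x Hx. apply Hb in Hx as (n&Hn&Hx). apply (ord_trans (ord_mem Ok Hc) Hx). auto.
- apply is_limit_eq. spt. split.
 + intro E. apply (in_emp (z := g0)). rewrite <- E. apply Hb. exists emp. rewrite q0, in_succ. split;[apply om_emp|tauto].
 + intros x Hx. apply Hb in Hx as (n&Hn&Hx).
 assert (On := ord_mem Ok (qk n Hn)). destruct (ord_succ_le On Hx) as [A|A].
 * apply Hb. now exists n. * rewrite A. now apply (Hstep x).
- apply Hb. exists emp. rewrite q0, in_succ. split;[apply om_emp|tauto].
- intros g Hg. apply Hb in Hg as (n&Hn&Hg). apply Hb. exists (succ n). split;[now apply om_succ|].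
 rewrite qS by trivial. apply Sk;auto.
Qed.
End Reg.

(** The limit ordinals above [g0] closed under the least-witness function [F] form a club in [k],
    and Mahloness provides a regular member. *)
Lemma Mahlo_closure k (Rl : M -> M -> Prop) g0 : Mahlo k -> Def2 Rl -> (forall g, g ∈ k -> exists d, d ∈ k /\ Rl g d) -> g0 ∈ k ->
 exists a, a ∈ k /\ regular a /\ g0 ∈ a /\ forall g, g ∈ a -> exists d, d ∈ a /\ Rl g d.
Proof.
intros [(Rk&_&(w&Hw&Hwk)) HM] HR HRk Hg0. apply is_omega_eq in Hw. subst w. pose proof (reg_ord Rk) as Ok.
destruct (@least_fun (fun g d => d ∈ k /\ Rl g d)) as (F&HF&UF);[def|].
assert (Fk : forall g, g ∈ k -> F g ∈ k /\ Rl g (F g)).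
{ intros g Hg. destruct (HRk g Hg) as (d&Hd&Hr). destruct (UF g d) as (_&A&_);trivial;[now apply (ord_mem Ok)|now split]. }
pose (P := fun b => limit_ordinal b /\ g0 ∈ b /\ forall g, g ∈ b -> F g ∈ b).
assert (HP : Def1 P) by (unfold P;def).
destruct (HM (sep k P)) as (a&Ha&Ra).
- split;[|split].
 + intros x Hx. now apply in_sep in Hx.
 + intros a Ha. destruct (ord_max Ok Ha Hg0) as (c&Hc&S1&S2).
 destruct (@closure_point k Rk Hwk F (succ c)) as (b&Hb&Lb&Cb&U);trivial;[intros g Hg;now apply Fk|now apply reg_succ|].
 assert (Ob := ord_mem Ok Hb).
 assert (K : forall x, subset x c -> ordinal x -> x ∈ b).
 { intros x Hx Ox. destruct (ord_sub Ox (ord_mem Ok Hc) Hx) as [A|A].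
 - apply (ord_trans Ob A). apply (ord_trans Ob (y := succ c));trivial. apply in_succ. tauto.
 - subst x. apply (ord_trans Ob (y := succ c));trivial. apply in_succ. tauto. }
 exists b. split;[|apply K;trivial;now apply (ord_mem Ok)].
 apply in_sep;trivial. spt. split;[trivial|split;[|trivial]]. apply K;trivial. now apply (ord_mem Ok).
 + intros a Ha La U. apply in_sep;trivial. spt. spt. split.
 * apply is_limit_eq in La. destruct La as (Oa&Na&_).
 assert (E : exists x, x ∈ a) by (apply NNPP;intro C;apply Na, is_empty_eq;intros z Hz;apply C;now exists z).
 destruct E as [x Hx]. destruct (U x Hx) as (y&Hy&Hya&_). apply in_sep in Hy as (_&_&Hy&_);trivial.
 apply (ord_trans Oa Hy Hya).
 * intros g Hg. destruct (U g Hg) as (y&Hy&Hya&Hgy). apply in_sep in Hy as (_&_&_&Hy);trivial.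
 apply is_limit_eq in La. destruct La as (Oa&_). apply (ord_trans Oa (Hy g Hgy) Hya).
- apply in_sep in Ha as (Ha&_&Hg&U);trivial. exists a. split;[trivial|]. split;[trivial|]. split;[trivial|].
 intros g Hga. exists (F g). split;[auto|]. apply Fk. apply (ord_trans Ok Hga Ha).
Qed.
End Regular.

(** * Inaccessible cardinals and the conditions of the collapse *)

Section Card.
Context {M : structure} {Z : ZFm M}.
Implicit Types a b c d f g m n p q s u x y z : M.
Hypothesis AC : ax_choice M.
Variable k : M.
Hypothesis Hk : inaccessible k.

Lemma inacc_reg : regular k. Proof. apply Hk. Qed.
Lemma inacc_om : om ∈ k.
Proof. destruct Hk as (_&_&w&Hw&H). apply is_omega_eq in Hw. now subst. Qed.
Lemma inacc_ord : ordinal k. Proof. apply inacc_reg. Qed.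
Notation K := (Vr k).

Lemma K_sub x y : x ∈ K -> subset y x -> y ∈ K. Proof. intros H. now apply Vr_sub. Qed.
Lemma K_pow x : x ∈ K -> pow x ∈ K.
Proof.
rewrite !in_Vr. intros (b&Hb&Hx). exists (succ b). split;[now apply reg_succ, Hb;apply inacc_reg|].
intros z Hz. apply in_pow in Hz. apply in_Vr. exists b. rewrite in_succ. split;[tauto|]. intros w Hw. auto.
Qed.
Lemma K_cup x y : x ∈ K -> y ∈ K -> cup x y ∈ K.
Proof.
rewrite !in_Vr. intros (b&Hb&Hx) (c&Hc&Hy). destruct (ord_max inacc_ord Hb Hc) as (d&Hd&S1&S2).
exists d. spt. intros z Hz. apply in_cup in Hz as [Hz|Hz];[apply (Vr_mono S1)|apply (Vr_mono S2)];auto.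
Qed.
Lemma prod_sub x y : subset (prod x y) (pow (pow (cup x y))).
Proof.
intros z Hz. apply in_prod in Hz as (u&w&Hu&Hw&->). apply in_pow. intros q Hq. apply in_pow.
unfold opair, sing in Hq. apply in_upair in Hq as [->| ->];intros v Hv;apply in_upair in Hv as [->| ->];rewrite in_cup;tauto.
Qed.
Lemma K_prod x y : x ∈ K -> y ∈ K -> prod x y ∈ K.
Proof. intros. apply (K_sub (x := pow (pow (cup x y))));[auto using K_pow, K_cup|apply prod_sub]. Qed.
Lemma K_ord a : a ∈ k -> a ∈ K.
Proof.
intro Ha. apply in_Vr. exists a. spt. assert (Oa := ord_mem inacc_ord Ha).
rewrite <- (rk_ordinal Oa) at 2. apply sub_Vr_rk.
Qed.

Definition Card x := exists b f, b ∈ k /\ is_surj f b x.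
Lemma Card_ord a : a ∈ k -> Card a.
Proof.
intro Ha. exists a, (lam a (fun x => x)). spt. apply lam_surj;[def|trivial|]. intros y Hy. now exists y.
Qed.
Lemma Card_surj x y F : DF1 F -> Card x -> (forall u, u ∈ x -> F u ∈ y) -> (forall w, w ∈ y -> exists u, u ∈ x /\ F u = w) -> Card y.
Proof.
intros HF (b&f&Hb&Hf) H1 H2. destruct (surj_comp Hf (lam_surj HF H1 H2)) as [h Hh]. now exists b, h.
Qed.
Lemma Card_sub x y : Card x -> subset y x -> Card y.
Proof.
intros Hx Hs. destruct (classic (exists y0, y0 ∈ y)) as [[y0 Hy0]|C].
- pose (R := fun u w => (u ∈ y /\ w = u) \/ (~ u ∈ y /\ w = y0)).
 assert (UR : forall u w w', R u w -> R u w' -> w = w') by (unfold R;intros;intuition congruence).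
 assert (HR : DF1 (pf R)) by (apply DF_pf;[apply UR|unfold R;def]).
 assert (E : forall u w, R u w -> pf R u = w) by (intros u w H;apply pf_eq;[apply UR|trivial]).
 apply (Card_surj HR Hx).
 + intros u _. destruct (classic (u ∈ y)) as [Hu|Hu].
 * rewrite (E u u);trivial. now left. * rewrite (E u y0);trivial. now right.
 + intros w Hw. exists w. split;[auto|]. apply E. now left.
- exists emp, emp. split;[apply (reg_emp inacc_reg inacc_om)|]. apply is_surj_eq. split.
 + apply is_fun_eq. repeat split;[intros p Hp|intros a b c Hp|intros a Hp];now apply in_emp in Hp.
 + intros w Hw. exfalso. apply C. now exists w.
Qed.
Lemma Card_pow x : Card x -> Card (pow x).
Proof.
intros (b&f&Hb&Hf). destruct Hk as (_&SL&_). destruct (SL b Hb) as (q&c&g&Hq&Hc&Hg).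
apply is_power_eq in Hq. subst q. apply is_surj_eq in Hf as [F1 F2].
assert (HF : DF1 (fun z => repl z (fun u => ap f u))) by def.
apply (Card_surj (x := pow b) HF);[now exists c, g| |].
- intros z Hz. apply in_pow. intros w Hw. apply in_repl in Hw as (u&Hu&->);[|def]. apply in_pow in Hz. apply (fun_ap F1). auto.
- intros w Hw. apply in_pow in Hw. exists (sep b (fun u => ap f u ∈ w)). split.
 + apply in_pow. intros u Hu. apply in_sep in Hu;[tauto|def].
 + apply ext. intro v. rewrite in_repl by def. split.
 * intros (u&Hu&->). apply in_sep in Hu;[tauto|def].
 * intro Hv. destruct (F2 v (Hw v Hv)) as (u&Hu&<-). exists u. spt. apply in_sep;[def|]. now split.
Qed.
Lemma Card_prod x y : Card x -> Card y -> Card (prod x y).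
Proof.
intros (a&f&Ha&Hf) (b&g&Hb&Hg). apply is_surj_eq in Hf as [F1 F2], Hg as [G1 G2].
destruct (ord_max inacc_ord Ha Hb) as (m&Hm&S1&S2).
assert (Cp : Card (prod a b)).
{ apply (Card_sub (x := pow (pow m)));[now apply Card_pow, Card_pow, Card_ord|].
 intros z Hz. apply prod_sub in Hz. apply in_pow in Hz. apply in_pow. intros q Hq. specialize (Hz q Hq).
 apply in_pow in Hz. apply in_pow. intros w Hw. specialize (Hz w Hw). apply in_cup in Hz as [Hz|Hz];auto. }
assert (HF : DF1 (fun q => opair (ap f (pfst q)) (ap g (psnd q)))) by def.
apply (Card_surj HF Cp).
- intros u Hu. apply in_prod in Hu as (p&q&Hp&Hq&->). rewrite pfst_eq, psnd_eq, in_prod2.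
 split;[now apply (fun_ap F1)|now apply (fun_ap G1)].
- intros w Hw. apply in_prod in Hw as (p&q&Hp&Hq&->). destruct (F2 p Hp) as (i&Hi&<-), (G2 q Hq) as (j&Hj&<-).
 exists (opair i j). now rewrite pfst_eq, psnd_eq, in_prod2.
Qed.
Lemma Card_bd x F : Card x -> DF1 F -> (forall u, u ∈ x -> F u ∈ k) -> exists b, b ∈ k /\ forall u, u ∈ x -> F u ∈ b.
Proof.
intros (a&f&Ha&Hf) HF H. apply is_surj_eq in Hf as [F1 F2].
destruct (@reg_bd _ _ k inacc_reg a (fun i => F (ap f i))) as (b&Hb&U);trivial;[def| |].
- intros i Hi. apply H. now apply (fun_ap F1).
- exists b. spt. intros u Hu. destruct (F2 u Hu) as (i&Hi&<-). auto.
Qed.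
Lemma Card_bd_rel x (R : M -> M -> Prop) : Card x -> Def2 R -> (forall u, u ∈ x -> exists d, d ∈ k /\ R u d) ->
 (forall u d d', R u d -> subset d d' -> R u d') -> exists b, b ∈ k /\ forall u, u ∈ x -> R u b.
Proof.
intros Cx HR H Mo. destruct (@least_fun _ _ (fun u d => d ∈ k /\ R u d)) as (F&HF&UF);[def|].
assert (A : forall u, u ∈ x -> F u ∈ k /\ R u (F u)).
{ intros u Hu. destruct (H u Hu) as (d&Hd&Rd). destruct (UF u d) as (_&B&_);trivial;[apply (ord_mem inacc_ord Hd)|now split]. }
destruct (@Card_bd x F Cx HF) as (b&Hb&U);[intros;now apply A|]. exists b. spt.
intros u Hu. apply (Mo u (F u));[now apply A|]. exact (proj1 (ord_mem inacc_ord Hb) _ (U u Hu)).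
Qed.
(** Induction on [b]: chosen enumerations of the power sets of [Vr g] for g < b are glued into one
    map on [b] times [B], where [B] bounds all their lengths by regularity. *)
Lemma Card_Vr b : b ∈ k -> Card (Vr b).
Proof.
pose proof DF_Vr. revert b.
apply (mem_ind (P := fun b => b ∈ k -> Card (Vr b)));[unfold Card;def|]. intros b IH Hb.
destruct (AC_coll AC (R := fun g q => exists c f, q = opair c f /\ c ∈ k /\ is_surj f c (pow (Vr g))) (a := b)) as (h&X&Hh&Rh);[def| |].
{ intros g Hg. assert (Hg' : g ∈ k) by exact (ord_trans inacc_ord Hg Hb). destruct (Card_pow (IH g Hg Hg')) as (c&f&Hc&Hf).
 now exists (opair c f), c, f. }
destruct (@reg_bd _ _ k inacc_reg b (fun g => pfst (ap h g))) as (B&HB&UB);trivial;[def| |].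
{ intros g Hg. destruct (Rh g Hg) as (c&f&->&Hc&_). now rewrite pfst_eq. }
assert (HF : DF1 (fun q => ap (psnd (ap h (pfst q))) (psnd q))) by def.
apply (Card_surj HF (Card_prod (Card_ord Hb) (Card_ord HB))).
- intros q Hq. apply in_prod in Hq as (g&i&Hg&Hi&->). rewrite pfst_eq, psnd_eq.
 destruct (Rh g Hg) as (c&f&->&Hc&Hf). rewrite psnd_eq. apply is_surj_eq in Hf as [F1 _]. apply in_Vr. exists g. spt.
 destruct (classic (i ∈ c)) as [Hic|Hic].
 + apply in_pow. now apply (fun_ap F1).
 (* An index beyond the length of the g-th enumeration yields the default value [emp], which belongs
    to [Vr b] because g < b. *)
 + rewrite ap_undef;[intros z Hz;now apply in_emp in Hz|]. intros w Hw. apply is_fun_eq in F1 as (F1&_).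
 destruct (F1 _ Hw) as (i'&w'&Hi'&_&E). apply opair_inj in E as [E _]. now subst.
- intros w Hw. apply in_Vr in Hw as (g&Hg&Hw). destruct (Rh g Hg) as (c&f&E&Hc&Hf).
 apply is_surj_eq in Hf as [F1 F2]. destruct (F2 w) as (i&Hi&<-);[now apply in_pow|].
 exists (opair g i). rewrite pfst_eq, psnd_eq, in_prod2, E, psnd_eq. repeat spt.
 specialize (UB g Hg). rewrite E, pfst_eq in UB. apply (ord_trans (ord_mem inacc_ord HB) Hi UB).
Qed.
Lemma Card_K x : x ∈ K -> Card x.
Proof. intro H. apply in_Vr in H as (b&Hb&Hx). now apply (Card_sub (Card_Vr Hb)). Qed.

Lemma collapse_eq b p : collapse b p <-> finite p /\
 (forall z, z ∈ p -> exists al n be, al ∈ b /\ n ∈ om /\ be ∈ al /\ z = opair (opair al n) be) /\ functional p.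
Proof.
unfold collapse. split;intros (A&B&C);spt;split.
- intros z Hz. destruct (B z Hz) as (al&n&be&q&H1&H2&H3&H4&H5). apply natural_eq in H2.
 apply is_opair_eq in H4, H5. subst. now exists al, n, be.
- intros x y z Hy Hz. apply (C x);now apply app_eq.
- intros z Hz. destruct (B z Hz) as (al&n&be&H1&H2&H3&->). exists al, n, be, (opair al n).
 rewrite natural_eq, !is_opair_eq. now repeat split.
- intros x y z Hy Hz. apply app_eq in Hy, Hz. now apply (C x).
Qed.
Definition coll b := sep (pow (prod (prod b om) b)) (collapse b).
Lemma in_coll b p : ordinal b -> (p ∈ coll b <-> collapse b p).
Proof.
intro Ob. unfold coll. rewrite in_sep by def. split;[tauto|]. intro H. spt. apply in_pow. intros z Hz.
apply collapse_eq in H as (_&H&_). destruct (H z Hz) as (al&n&be&H1&H2&H3&->).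
rewrite !in_prod2. repeat spt. apply (ord_trans Ob H3 H1).
Qed.
Lemma coll_mono b c p : subset b c -> collapse b p -> collapse c p.
Proof.
rewrite !collapse_eq. intros S (A&B&C). repeat spt. intros z Hz.
destruct (B z Hz) as (al&n&be&H1&H2&H3&->). exists al, n, be. auto.
Qed.
Lemma coll_sub b p q : collapse b p -> subset q p -> collapse b q.
Proof.
rewrite !collapse_eq. intros (A&B&C) S. repeat split;[now apply (finite_sub A)|auto|]. intros x y z Hy Hz. apply (C x);auto.
Qed.
Lemma coll_emp b : collapse b emp.
Proof. apply collapse_eq. repeat split;[apply finite_emp|intros z Hz|intros x y z Hz];now apply in_emp in Hz. Qed.
Lemma coll_bound a p : limit_ordinal a -> collapse a p -> exists b, b ∈ a /\ collapse b p.
Proof.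
rewrite is_limit_eq, collapse_eq. intros (Ok&Na&Sa) (A&B&C).
assert (H : exists b, b ∈ a /\ forall z, z ∈ p -> exists al n be, al ∈ b /\ n ∈ om /\ be ∈ al /\ z = opair (opair al n) be).
{ clear C. revert B. revert p A.
 apply (finite_ind (P := fun p => (forall z, z ∈ p -> exists al n be, al ∈ a /\ n ∈ om /\ be ∈ al /\ z = opair (opair al n) be) ->
 exists b, b ∈ a /\ forall z, z ∈ p -> exists al n be, al ∈ b /\ n ∈ om /\ be ∈ al /\ z = opair (opair al n) be));[def| |].
 - intros _. apply NNPP. intro D. apply Na, is_empty_eq. intros b Hb. apply D. exists b. spt.
 intros z Hz. now apply in_emp in Hz.
 - intros p y _ IH B. destruct IH as (b&Hb&U);[intros z Hz;apply B, in_cup;tauto|].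
 destruct (B y) as (al&n&be&H1&H2&H3&->);[rewrite in_cup, in_sing;tauto|].
 destruct (ord_max Ok Hb (Sa _ H1)) as (c&Hc&S1&S2). exists c. spt.
 intros z Hz. apply in_cup in Hz as [Hz|Hz].
 + destruct (U z Hz) as (al'&n'&be'&K1&K2&K3&->). exists al', n', be'. auto.
 + apply in_sing in Hz. exists al, n, be. repeat spt. apply S2, in_succ. tauto. }
destruct H as (b&Hb&U). exists b. spt. apply collapse_eq. now repeat split.
Qed.
Lemma coll_add b p al n be : collapse b p -> al ∈ b -> n ∈ om -> be ∈ al -> (forall w, ~ opair (opair al n) w ∈ p) ->
 collapse b (cup p (sing (opair (opair al n) be))).
Proof.
rewrite !collapse_eq. intros (A&B&C) Ha Hn Hb U. repeat split.
- now apply finite_add.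
- intros z Hz. apply in_cup in Hz as [Hz|Hz];[auto|]. apply in_sing in Hz. now exists al, n, be.
- intros x y z Hy Hz. rewrite in_cup, in_sing in Hy, Hz. destruct Hy as [Hy|Hy], Hz as [Hz|Hz].
 + now apply (C x). + apply opair_inj in Hz as [-> _]. now apply U in Hy.
 + apply opair_inj in Hy as [-> _]. now apply U in Hz.
 + rewrite <- Hz in Hy. now apply opair_inj in Hy.
Qed.
(** An entry of a condition has the form ((alpha,n),beta), so [pfst (pfst z)] is alpha and this is
    the projection to Coll(ω,<b). *)
Definition rsb p b := sep p (fun z => pfst (pfst z) ∈ b).
Lemma in_rsb p b z : z ∈ rsb p b <-> z ∈ p /\ pfst (pfst z) ∈ b.
Proof. unfold rsb. rewrite in_sep by def. reflexivity. Qed.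
Lemma rsb_sub p b : subset (rsb p b) p. Proof. intros z Hz. now apply in_rsb in Hz. Qed.
Lemma rsb_coll c p b : collapse c p -> collapse b (rsb p b).
Proof.
rewrite !collapse_eq. intros (A&B&C). repeat split.
- apply (finite_sub A). apply rsb_sub.
- intros z Hz. apply in_rsb in Hz as [Hz Hb]. destruct (B z Hz) as (al&n&be&H1&H2&H3&->).
 rewrite !pfst_eq in Hb. now exists al, n, be.
- intros x y z Hy Hz. apply in_rsb in Hy, Hz. now apply (C x).
Qed.
Lemma rsb_in b p q : collapse b p -> subset p q -> subset p (rsb q b).
Proof.
rewrite collapse_eq. intros (_&B&_) S z Hz. apply in_rsb. split;[auto|].
destruct (B z Hz) as (al&n&be&H1&H2&H3&->). now rewrite !pfst_eq.
Qed.
(** Entries of [d] have their coordinate in [b], and those of [p] with such a coordinate already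
    belong to [d]; hence the two conditions agree on common arguments. *)
Lemma coll_cup b c p d : collapse c p -> collapse b d -> subset b c -> subset (rsb p b) d -> collapse c (cup p d).
Proof.
intros Hp Hd Hs S. assert (Hd' := coll_mono Hs Hd). rewrite collapse_eq in *.
destruct Hp as (A&B&C), Hd as (_&Bd&_), Hd' as (A'&B'&C').
assert (X : forall x y z, opair x y ∈ p -> opair x z ∈ d -> y = z).
{ intros x y z Hy Hz. apply (C' x);trivial. apply S, in_rsb. spt. rewrite pfst_eq.
 destruct (Bd _ Hz) as (al&n&be&H1&H2&H3&E). apply opair_inj in E as [-> _]. now rewrite pfst_eq. }
repeat split.
- now apply finite_union.
- intros z Hz. apply in_cup in Hz as [Hz|Hz];auto.
- intros x y z Hy Hz. apply in_cup in Hy as [Hy|Hy], Hz as [Hz|Hz].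
 + now apply (C x). + now apply (X x). + symmetry. now apply (X x). + now apply (C' x).
Qed.
Lemma coll_K b : b ∈ k -> coll b ∈ K.
Proof.
intro Hb. apply (K_sub (x := pow (prod (prod b om) b)));[|intros p Hp;apply in_sep in Hp;[tauto|def]].
apply K_pow, K_prod;[apply K_prod|];apply K_ord;trivial. apply inacc_om.
Qed.
End Card.

Ltac def_hook5 :=
 lazymatch goal with
 | |- DT (fun v => coll _) => unfold coll
 | |- DT (fun v => Vr (@?t v)) => refine (@DT_app1 _ Vr t DF_Vr _)
 | |- DT (fun v => rsb _ _) => unfold rsb
 | _ => def_hook4
 end.
Ltac def_hook ::= def_hook5.

(** * The collapse extension and its initial parts *)

Section Ext.
Context {N : structure} {V : N -> Prop} {ZN : ZFm N} {ZV : ZFm (restrict V)}.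
Notation VS := (restrict V).
Notation "'⌊' x '⌋'" := (@inj N V x).
Hypothesis TV : transitive_class V.

Lemma inj_fun (f a b : VS) : is_fun f a b -> is_fun ⌊f⌋ ⌊a⌋ ⌊b⌋.
Proof.
intro H. pose proof H as H0. apply is_fun_eq in H as (A&B&C). apply is_fun_eq. split;[|split].
- intros p Hp. apply (in_inj TV) in Hp as (p'&<-&Hp). destruct (A p' Hp) as (x&y&Hx&Hy&->).
 exists ⌊x⌋, ⌊y⌋. repeat spt. apply (inj_opair TV).
- now apply (inj_functional TV).
- intros x Hx. apply (in_inj TV) in Hx as (x'&<-&Hx). destruct (C x' Hx) as [y Hy]. exists ⌊y⌋. now apply (opinj TV).
Qed.
Lemma inj_fun_ap (f a b x : VS) : is_fun f a b -> x ∈ a -> ap ⌊f⌋ ⌊x⌋ = ⌊ap f x⌋.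
Proof.
intros H Hx. apply (inj_ap TV (y := ap f x));[now apply is_fun_eq in H|now apply (fun_ap H)].
Qed.
Lemma inj_surj (f a b : VS) : is_surj f a b -> is_surj ⌊f⌋ ⌊a⌋ ⌊b⌋.
Proof.
intro H. apply is_surj_eq in H as [A B]. apply is_surj_eq. split;[now apply inj_fun|].
intros y Hy. apply (in_inj TV) in Hy as (y'&<-&Hy). destruct (B y' Hy) as (x&Hx&<-). exists ⌊x⌋.
spt. now apply (inj_fun_ap A).
Qed.

Hypothesis ACN : ax_choice N.
Hypothesis ACV : ax_choice VS.

(* Rasiowa-Sikorski inside N, keeping all chosen conditions in [Inv]. *)
Lemma generic_ex (Q : VS) (Inv : N -> Prop) (q0 : N) e : Def1 Inv -> is_surj e om ⌊pow Q⌋ ->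
 (forall D q, dense Q D -> q ∈ ⌊Q⌋ -> Inv q -> exists q', q' ∈ ⌊D⌋ /\ Inv q' /\ subset q q') ->
 q0 ∈ ⌊Q⌋ -> Inv q0 -> exists y, gen Q y /\ q0 ∈ y /\ forall r, r ∈ y -> exists q, q ∈ y /\ Inv q /\ subset r q.
Proof.
intros HI He H Hq0 Iq0. apply is_surj_eq in He as [E1 E2].
pose (dN := fun D => forall p, p ∈ ⌊Q⌋ -> exists q, q ∈ D /\ subset p q).
pose (a := sep ⌊Q⌋ Inv). assert (Ha : forall x, x ∈ a <-> x ∈ ⌊Q⌋ /\ Inv x) by (intro x;unfold a;now rewrite in_sep).
destruct (@DC _ _ ACN (fun n x x' => subset x x' /\ (dN (ap e n) -> x' ∈ ap e n)) a q0) as (f&Hf&f0&fS).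
- unfold dN. def.
- now apply Ha.
- intros n x Hn Hx. apply Ha in Hx as [Hx Ix].
 destruct (classic (dN (ap e n))) as [Dn|Dn].
 + assert (Hen := proj1 (fun_ap E1 Hn)). apply (in_inj TV) in Hen as (D&ED&HD). apply in_pow in HD. rewrite <- ED in *.
 destruct (H D x) as (q'&Hq'&Iq'&S);trivial.
 { spt. intros p Hp. destruct (Dn ⌊p⌋) as (q&Hq&S);[trivial|].
 apply (in_inj TV) in Hq as (q'&<-&Hq'). exists q'. spt. now apply (inj_sub TV). }
 exists q'. split;[|now split]. apply Ha. spt. apply (inj_sub TV) in HD. auto.
 + exists x. split;[now apply Ha|]. split;[now intros ? ?|tauto].
- assert (fa : forall n, n ∈ om -> ap f n ∈ ⌊Q⌋ /\ Inv (ap f n)) by (intros n Hn;apply Ha;now apply (fun_ap Hf)).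
 assert (mono : forall m, m ∈ om -> forall n, n ∈ om -> n ∈ m \/ n = m -> subset (ap f n) (ap f m)).
 { apply (om_ind (P := fun m => forall n, n ∈ om -> n ∈ m \/ n = m -> subset (ap f n) (ap f m)));[def| |].
 - intros n Hn [A| ->];[now apply in_emp in A|now intros ? ?].
 - intros m Hm IH n Hn [A| ->];[|now intros ? ?]. apply in_succ in A.
 intros z Hz. apply (fS m Hm). revert z Hz. now apply IH. }
 assert (dirf : forall n m, n ∈ om -> m ∈ om -> exists l, l ∈ om /\ subset (ap f n) (ap f l) /\ subset (ap f m) (ap f l)).
 { intros n m Hn Hm. destruct (ord_tri (om_ord Hn) (om_ord Hm)) as [A|A].
 - exists m. spt. split;[now apply mono;auto|now intros ? ?].
 - exists n. spt. split;[now intros ? ?|]. apply mono;trivial. destruct A;auto. }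
 pose (y := sep ⌊Q⌋ (fun r => exists n, n ∈ om /\ subset r (ap f n))).
 assert (Hy : forall r, r ∈ y <-> r ∈ ⌊Q⌋ /\ exists n, n ∈ om /\ subset r (ap f n)) by (intro r;unfold y;rewrite in_sep by def;reflexivity).
 assert (fy : forall n, n ∈ om -> ap f n ∈ y).
 { intros n Hn. apply Hy. split;[now apply fa|]. exists n. spt. now intros ? ?. }
 exists y. split;[|split].
 + split;[|split;[|split;[|split]]].
 * intros r Hr. now apply Hy in Hr.
 * exists (ap f emp). apply fy, om_emp.
 * intros p q Hq Hp S. apply Hy in Hp as [_ (n&Hn&Sn)]. apply Hy. spt. exists n. spt. intros z Hz. auto.
 * intros p q Hp Hq. apply Hy in Hp as [_ (n&Hn&Sn)], Hq as [_ (m&Hm&Sm)].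
 destruct (dirf n m Hn Hm) as (l&Hl&A&B). exists (ap f l). split;[now apply fy|]. split;intros z Hz;auto.
 * intros D HD. destruct (E2 ⌊D⌋) as (n&Hn&En);[apply inj_mem, in_pow, HD|].
 destruct (fS n Hn) as [_ K]. rewrite En in K. destruct HD as [DQ HD].
 assert (Dn : dN ⌊D⌋).
 { intros p Hp. apply (in_inj TV) in Hp as (p'&<-&Hp). destruct (HD p' Hp) as (q&Hq&S). exists ⌊q⌋.
 spt. now apply (inj_sub TV). }
 specialize (K Dn). apply (in_inj TV) in K as (p&Ep&Hp). exists p. spt. rewrite Ep. apply fy. now apply om_succ.
 + rewrite <- f0. apply fy, om_emp.
 + intros r Hr. apply Hy in Hr as [_ (n&Hn&Sn)]. exists (ap f n). split;[now apply fy|]. split;[now apply fa|trivial].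
Qed.

Variables (k : VS) (G : N).
Hypothesis Hk : Mahlo k.
Hypothesis hG : collapse_generic k G.
Hypothesis hN : forall x : N, exists t : N, V t /\ is_val G t x.

Lemma k_inacc : inaccessible k. Proof. apply Hk. Qed.
Lemma k_ord : ordinal k. Proof. exact (inacc_ord k_inacc). Qed.
Notation P := (coll k).
Lemma gen_G : gen P G.
Proof.
destruct hG as (H1&H2&H3&H4&H5). pose proof k_ord as Ok. split;[|split;[|split;[|split]]].
- intros p Hp. destruct (H1 p Hp) as (c&<-&Hc). apply inj_mem. now apply in_coll.
- trivial.
- intros p q Hq Hp S. apply (in_inj TV) in Hq as (q'&<-&Hq). destruct (H1 p Hp) as (c&<-&Hc).
 apply (H3 c q');trivial;[now apply in_coll in Hq|]. apply (inj_sub TV). exact S.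
- trivial.
- intros D [D1 D2]. destruct (H5 D) as (p&Hp&HpG).
 + split;[intros p Hp;apply in_coll;auto|]. intros p Hp. apply D2. now apply in_coll.
 + now exists p.
Qed.

(** [is_val] certifies a value by a function on a transitive set of names; induction on names
    identifies that function with evaluation by recursion. Hence every element of N is some
    [pval]. *)
Lemma val_pval t x : is_val G t x -> x = pval TV gen_G t.
Proof.
intros (d&b&f&Td&Ht&Hf&Hv&Hx). pose proof Hf as Hf'. apply is_fun_eq in Hf' as (F1&F2&F3).
assert (K : forall s, s ∈ d -> forall y, opair s y ∈ f -> y = pval TV gen_G s).
{ apply (mem_ind_tc (P := fun s => s ∈ d -> forall y, opair s y ∈ f -> y = pval TV gen_G s)).
 { pose proof (pval_def TV gen_G). def. }
 intros s IH Hs y Hy. apply ext. intro z. rewrite in_pval.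
 assert (Hsy : app f s y) by now apply app_eq. rewrite (Hv s y Hsy z).
 assert (Hr : forall r p, opair r p ∈ s -> r ∈ d).
 { intros r p Hrp. apply (Td (upair r p));[|rewrite in_upair;tauto].
 apply (Td (opair r p));[now apply (Td s)|]. unfold opair. rewrite in_upair. tauto. }
 split.
 - intros (r&p&q&Hp&Eq&Hq&Hz). apply is_opair_eq in Eq. subst q. apply app_eq in Hz.
 exists r, p. repeat spt. apply IH;trivial;[apply (tc_opair Hq)|now apply (Hr r p)].
 - intros (r&p&Hq&Hp&->). destruct (F3 r (Hr r p Hq)) as [w Hw]. exists r, p, (opair r p).
 repeat spt;[now apply is_opair_eq|]. apply app_eq.
 rewrite <- (IH r) with (y := w);trivial;[apply (tc_opair Hq)|now apply (Hr r p)]. }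
apply app_eq in Hx. now apply K.
Qed.
Lemma all_PW x : PW TV gen_G x.
Proof.
destruct (hN x) as (t&Ht&Hx). apply (PW_eq TV). destruct (inj_lift Ht) as [t' <-]. exists t'. now apply val_pval.
Qed.

Definition Gb (a : VS) : N := sep G (fun p => p ∈ ⌊coll a⌋).
Lemma in_Gb a p : p ∈ Gb a <-> p ∈ G /\ p ∈ ⌊coll a⌋.
Proof. unfold Gb. rewrite in_sep by def. reflexivity. Qed.
Definition small_ord (a : VS) := ordinal a /\ subset a k.
Lemma small_k : small_ord k. Proof. split;[apply k_ord|now intros ? ?]. Qed.
Lemma small_in a : a ∈ k -> small_ord a.
Proof. intro H. split;[exact (ord_mem k_ord H)|exact (proj1 k_ord a H)]. Qed.

(** A dense set of [coll a] is lifted to the conditions of [coll k] extending one of its members,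
    dense by [coll_cup]. Directedness comes from projecting a common extension with [rsb]. *)
Lemma gen_Gb a : small_ord a -> gen (coll a) (Gb a).
Proof.
intros [Oa Sa]. pose proof k_ord as Ok. pose proof gen_G as (G1&G2&G3&G4&G5).
assert (In : forall p, p ∈ G -> exists p', ⌊p'⌋ = p /\ collapse k p').
{ intros p Hp. destruct (gen_lift TV gen_G Hp) as (p'&E&Hp'). exists p'. spt. now apply in_coll. }
split;[|split;[|split;[|split]]].
- intros p Hp. now apply in_Gb in Hp.
- destruct G2 as [p Hp]. exists ⌊emp⌋. apply in_Gb. split.
 + apply (G3 p);trivial;[apply inj_mem, in_coll;trivial;apply coll_emp|]. rewrite (inj_emp TV). intros z Hz. now apply in_emp in Hz.
 + apply inj_mem, in_coll;trivial. apply coll_emp.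
- intros p q Hq Hp S. apply in_Gb in Hp as [Hp _]. apply in_Gb. spt. apply (G3 p);trivial.
 apply (in_inj TV) in Hq as (q'&<-&Hq). apply inj_mem, in_coll;trivial. apply in_coll in Hq;trivial. now apply (coll_mono Sa).
- intros p q Hp Hq. apply in_Gb in Hp as [Hp Hp'], Hq as [Hq Hq']. destruct (G4 p q Hp Hq) as (r&Hr&S1&S2).
 destruct (In r Hr) as (r'&<-&Hr'). apply (in_inj TV) in Hp' as (p'&<-&Hp'), Hq' as (q'&<-&Hq').
 apply in_coll in Hp', Hq';trivial. rewrite (inj_sub TV) in S1, S2.
 exists ⌊rsb r' a⌋. split;[|split;apply (inj_sub TV);now apply rsb_in].
 apply in_Gb. split;[|apply inj_mem, in_coll;trivial;exact (rsb_coll a Hr')].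
 apply (G3 ⌊r'⌋);trivial;[|apply (inj_sub TV), rsb_sub]. apply inj_mem, in_coll;trivial. apply (coll_sub Hr'), rsb_sub.
- intros D [D1 D2].
 pose (X := fun p => exists d, d ∈ D /\ subset d p).
 assert (HX : Def1 X) by (unfold X;def).
 destruct (G5 (sep P X)) as (p&Hp&HpG).
 + split;[intros p Hp;now apply in_sep in Hp|]. intros p Hp. apply in_coll in Hp;trivial.
 destruct (D2 (rsb p a)) as (d&Hd&Sd);[apply in_coll;trivial;exact (rsb_coll a Hp)|].
 assert (Hd' : collapse a d) by (apply in_coll;auto).
 exists (cup p d). split;[|intros z Hz;apply in_cup;tauto]. apply in_sep;trivial. split.
 * apply in_coll;trivial. exact (coll_cup Hp Hd' Sa Sd).
 * exists d. spt. intros z Hz. apply in_cup;tauto.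
 + apply in_sep in Hp as (Hp&d&Hd&Sd);trivial. exists d. spt. apply in_Gb. split;[|apply inj_mem;auto].
 apply (G3 ⌊p⌋);trivial;[|now apply (inj_sub TV)]. apply inj_mem, in_coll;trivial.
 apply (coll_mono Sa). apply in_coll;auto.
Qed.

Lemma fin_dom (b p : VS) : finite p -> exists m, m ∈ om /\ forall n w, n ∈ om -> opair (opair b n) w ∈ p -> n ∈ m.
Proof.
revert p. apply (finite_ind (P := fun p => exists m, m ∈ om /\ forall n w, n ∈ om -> opair (opair b n) w ∈ p -> n ∈ m));[def| |].
- exists emp. split;[apply om_emp|]. intros n w _ H. now apply in_emp in H.
- intros p z _ (m&Hm&U). destruct (classic (exists n w, n ∈ om /\ z = opair (opair b n) w)) as [(n&w&Hn&->)|C].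
 + destruct (ord_max ord_om Hm (om_succ Hn)) as (c&Hc&S1&S2). exists c. spt. intros n' w' Hn' H.
 apply in_cup in H as [H|H];[apply S1;now apply (U n' w')|]. apply in_sing, opair_inj in H as [H _].
 apply opair_inj in H as [_ ->]. apply S2, in_succ. tauto.
 + exists m. spt. intros n' w' Hn' H. apply in_cup in H as [H|H];[now apply (U n' w')|].
 apply in_sing in H. exfalso. apply C. now exists n', w'.
Qed.

(** The coordinate [b] of the generic is the map sending n to the g with ((b,n),g) in some condition
    of [G]; density makes it total and onto. *)
Lemma countable_ord (b : VS) : b ∈ k -> b <> emp -> exists f, is_surj f om ⌊b⌋.
Proof.
intros Hb Nb. pose proof k_ord as Ok. pose proof gen_G as (G1&G2&G3&G4&G5).
assert (E0 : exists g0, g0 ∈ b) by (apply NNPP;intro C;apply Nb, is_empty_eq;intros z Hz;apply C;now exists z).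
destruct E0 as [g0 Hg0].
pose (f := sep (prod om ⌊b⌋) (fun q => exists p, p ∈ G /\ opair (opair ⌊b⌋ (pfst q)) (psnd q) ∈ p)).
assert (Hf : forall n g, opair n g ∈ f <-> n ∈ om /\ g ∈ ⌊b⌋ /\ exists p, p ∈ G /\ opair (opair ⌊b⌋ n) g ∈ p).
{ intros n g. unfold f. rewrite in_sep by def. rewrite in_prod2, pfst_eq, psnd_eq. tauto. }
assert (Pf : forall p, p ∈ G -> exists p', ⌊p'⌋ = p /\ collapse k p').
{ intros p Hp. destruct (gen_lift TV gen_G Hp) as (p'&E&Hp'). exists p'. spt. now apply in_coll. }
assert (Ff : functional f).
{ intros n g g' H H'. apply Hf in H as (_&_&p&Hp&H), H' as (_&_&p'&Hp'&H').
 destruct (G4 p p' Hp Hp') as (r&Hr&S1&S2). destruct (Pf r Hr) as (r'&<-&Hr').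
 apply collapse_eq in Hr' as (_&_&Fr). apply (inj_functional TV) in Fr. apply (Fr (opair ⌊b⌋ n));auto. }
assert (tot : forall n, n ∈ om -> exists g, opair n g ∈ f).
{ intros n Hn. rewrite <- (inj_om TV) in Hn. apply (in_inj TV) in Hn as (n'&<-&Hn).
 assert (HX : Def1 (fun p => exists g, opair (opair b n') g ∈ p)) by def.
 destruct (G5 (sep P (fun p => exists g, opair (opair b n') g ∈ p))) as (p&Hp&HpG).
 - split;[intros p Hp;now apply in_sep in Hp|]. intros p Hp. pose proof Hp as Hc. apply in_coll in Hc;trivial.
 destruct (classic (exists g, opair (opair b n') g ∈ p)) as [C|C].
 + exists p. split;[apply in_sep;trivial;now split|now intros ? ?].
 + exists (cup p (sing (opair (opair b n') g0))). split;[|intros z Hz;apply in_cup;tauto].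
 apply in_sep;trivial. split;[|exists g0;rewrite in_cup, in_sing;tauto].
 apply in_coll;trivial. apply coll_add;trivial. intros w Hw. apply C. now exists w.
 - apply in_sep in Hp as (Hp&g&Hg);trivial. exists ⌊g⌋. apply Hf. split;[rewrite <- (inj_om TV);trivial|].
 split;[|exists ⌊p⌋;spt;rewrite <- !(inj_opair TV);exact Hg].
 apply in_coll, collapse_eq in Hp as (_&B&_);trivial. destruct (B _ Hg) as (al&m&be&H1&H2&H3&E).
 apply opair_inj in E as [E ->]. apply opair_inj in E as [-> _]. exact H3. }
exists f. apply is_surj_eq.
assert (Fun : is_fun f om ⌊b⌋).
{ apply is_fun_eq. split;[|split];trivial. intros p Hp. unfold f in Hp. apply in_sep in Hp as [Hp _];[|def].
 apply in_prod in Hp as (x&y&H). now exists x, y. }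
spt. intros g Hg. apply (in_inj TV) in Hg as (g'&<-&Hg).
assert (HX : Def1 (fun p => exists n, n ∈ om /\ opair (opair b n) g' ∈ p)) by def.
destruct (G5 (sep P (fun p => exists n, n ∈ om /\ opair (opair b n) g' ∈ p))) as (p&Hp&HpG).
- split;[intros p Hp;now apply in_sep in Hp|]. intros p Hp. pose proof Hp as Hc. apply in_coll in Hc;trivial.
 pose proof Hc as Hc'. apply collapse_eq in Hc' as (Fp&_). destruct (fin_dom b Fp) as (m&Hm&U).
 exists (cup p (sing (opair (opair b m) g'))). split;[|intros z Hz;apply in_cup;tauto].
 apply in_sep;trivial. split;[|exists m;rewrite in_cup, in_sing;tauto].
 apply in_coll;trivial. apply coll_add;trivial. intros w Hw. apply (mem_irrefl (x := m)). now apply (U m w).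
- apply in_sep in Hp as (Hp&n&Hn&Hnp);trivial. exists ⌊n⌋.
 assert (Hn' : ⌊n⌋ ∈ om) by (rewrite <- (inj_om TV);exact Hn).
 spt. apply ap_fun;trivial. apply Hf. spt. spt.
 exists ⌊p⌋. spt. rewrite <- !(inj_opair TV). exact Hnp.
Qed.

Lemma countable_K (x : VS) : x ∈ Vr k -> x <> emp -> exists f, is_surj f om ⌊x⌋.
Proof.
intros Hx Nx. destruct (Card_K ACV k_inacc Hx) as (b&f&Hb&Hf).
destruct (@countable_ord b Hb) as [g Hg].
- intros ->. apply Nx, is_empty_eq. intros z Hz. apply is_surj_eq in Hf as [_ F2]. destruct (F2 z Hz) as (w&Hw&_). now apply in_emp in Hw.
- exact (surj_comp Hg (inj_surj Hf)).
Qed.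

Lemma generic_K (Q : VS) (Inv : N -> Prop) (q0 : N) : Q ∈ Vr k -> Def1 Inv ->
 (forall D q, dense Q D -> q ∈ ⌊Q⌋ -> Inv q -> exists q', q' ∈ ⌊D⌋ /\ Inv q' /\ subset q q') ->
 q0 ∈ ⌊Q⌋ -> Inv q0 -> exists y, gen Q y /\ q0 ∈ y /\ forall r, r ∈ y -> exists q, q ∈ y /\ Inv q /\ subset r q.
Proof.
intros HQ HI H Hq0 Iq0. destruct (@countable_K (pow Q)) as [e He].
- now apply K_pow;[apply k_inacc|].
- intro E. apply (in_emp (z := Q)). rewrite <- E. apply in_pow. now intros ? ?.
- now apply (@generic_ex Q Inv q0 e).
Qed.

Lemma small_name (a A : VS) (Sa : small_ord a) : regular a -> om ∈ a ->
 (forall g, g ∈ a -> exists b f, b ∈ a /\ is_surj f b (prod A (coll g))) ->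
 forall x, PW TV (gen_Gb Sa) x -> subset x ⌊A⌋ ->
 exists b r, b ∈ a /\ subset r (prod A (coll b)) /\ x = img ⌊r⌋ G.
Proof.
intros Ra Wa HA x Hx Hs. destruct (nice_name Hx Hs) as (r&Hr&Ex&Mo). pose proof Sa as [Oa Sak].
assert (La : limit_ordinal a) by apply Ra.
pose (ok := fun u q => opair u q ∈ r \/ forall q', q' ∈ coll a -> subset q q' -> ~ opair u q' ∈ r).
destruct (@least_fun _ _ (fun g d => d ∈ a /\ forall u p, u ∈ A -> p ∈ coll g -> exists q, q ∈ coll d /\ subset p q /\ ok u q)) as (F&HF&UF).
{ unfold ok. def. }
assert (Fa : forall g, g ∈ a -> F g ∈ a /\ forall u p, u ∈ A -> p ∈ coll g -> exists q, q ∈ coll (F g) /\ subset p q /\ ok u q).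
{ intros g Hg. assert (Og := ord_mem Oa Hg).
 destruct (@least_fun _ _ (fun z d => d ∈ a /\ exists q, q ∈ coll d /\ subset (psnd z) q /\ ok (pfst z) q)) as (E&HE&UE).
 { unfold ok. def. }
 assert (Ez : forall u p, u ∈ A -> p ∈ coll g -> E (opair u p) ∈ a /\ exists q, q ∈ coll (E (opair u p)) /\ subset p q /\ ok u q).
 { intros u p Hu Hp. assert (Hpa : p ∈ coll a).
 { apply in_coll in Hp;trivial. apply in_coll;trivial. apply (coll_mono (b := g));trivial. exact (proj1 Oa g Hg). }
 assert (Q : exists q, q ∈ coll a /\ subset p q /\ ok u q).
 { destruct (classic (exists q, q ∈ coll a /\ subset p q /\ opair u q ∈ r)) as [(q&Hq&S&H)|C].
 - exists q. repeat spt. now left.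
 - exists p. spt. split;[now intros ? ?|]. right. intros q Hq S H. apply C. now exists q. }
 destruct Q as (q&Hq&S&O). apply in_coll in Hq;trivial. destruct (coll_bound La Hq) as (d&Hd&Hqd).
 destruct (UE (opair u p) d) as (_&K&_).
 - exact (ord_mem Oa Hd).
 - spt. exists q. rewrite pfst_eq, psnd_eq. split;[apply in_coll;trivial;exact (ord_mem Oa Hd)|now split].
 - rewrite pfst_eq, psnd_eq in K. exact K. }
 destruct (HA g Hg) as (b&f&Hb&Hf). apply is_surj_eq in Hf as [F1 F2].
 destruct (@reg_bd _ _ a Ra b (fun i => E (ap f i))) as (c&Hc&Uc);trivial;[def| |].
 { intros i Hi. assert (K := proj1 (fun_ap F1 Hi)). apply in_prod in K as (u&p&Hu&Hp&->). now apply Ez. }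
 destruct (UF g c) as (_&K&_);trivial;[exact (ord_mem Oa Hc)|]. spt. intros u p Hu Hp.
 destruct (Ez u p Hu Hp) as (He&q&Hq&S&O). exists q. split;[|now split].
 assert (Oe := ord_mem Oa He). assert (Oc := ord_mem Oa Hc). apply in_coll in Hq;trivial. apply in_coll;trivial.
 apply (coll_mono (b := E (opair u p)));trivial.
 destruct (F2 (opair u p)) as (i&Hi&Ei);[now apply in_prod2|]. specialize (Uc i Hi). rewrite Ei in Uc. exact (proj1 Oc _ Uc). }
destruct (closure_point (k := a) Ra Wa (F := F) (g0 := om)) as (b&Hb&Lb&_&Cb);trivial;[intros;now apply Fa|].
assert (Ob := ord_mem Oa Hb). assert (Sb : small_ord b) by (spt;intros z Hz;apply Sak;exact (ord_trans Oa Hz Hb)).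
exists b, (sep r (fun q => psnd q ∈ coll b)). spt.
assert (Hr' : forall u p, opair u p ∈ sep r (fun q => psnd q ∈ coll b) <-> opair u p ∈ r /\ p ∈ coll b).
{ intros u p. rewrite in_sep by def. rewrite psnd_eq. tauto. }
split.
- intros q Hq. apply in_sep in Hq as [Hq Hq2];[|def]. specialize (Hr q Hq). apply in_prod in Hr as (u&p&Hu&Hp&->).
 rewrite psnd_eq in Hq2. now apply in_prod2.
- rewrite Ex. apply ext. intro u. rewrite !in_img. split.
 + intros (p&Hp&H). destruct (pinj TV H eq_refl) as (u'&p'&<-&<-&H').
 assert (Hu' : u' ∈ A) by (specialize (Hr _ H');now apply in_prod2 in Hr).
 destruct (proj2 (proj2 (proj2 (proj2 (gen_Gb Sb)))) (sep (coll b) (ok u'))) as (q&Hq&HqG).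
 { assert (Dok : Def1 (ok u')) by (unfold ok;def). split;[intros z Hz;now apply in_sep in Hz|].
 intros z Hz. pose proof Hz as Hz'. apply in_coll in Hz';trivial. destruct (coll_bound Lb Hz') as (g&Hg&Hzg).
 assert (Hga : g ∈ a) by exact (ord_trans Oa Hg Hb).
 destruct (proj2 (Fa g Hga) u' z Hu') as (q&Hq&S&O);[apply in_coll;trivial;exact (ord_mem Oa Hga)|].
 exists q. spt. apply in_sep;trivial. spt.
 assert (HFb := Cb g Hg). apply in_coll in Hq;[|exact (ord_mem Ob HFb)]. apply in_coll;trivial.
 apply (coll_mono (b := F g));trivial. exact (proj1 Ob _ HFb). }
 apply in_sep in Hq as [Hq [O|O]];[| |unfold ok;def].
 * exists ⌊q⌋. apply in_Gb in HqG as [HqG _]. spt. apply (opinj TV), Hr'. now split.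
 * exfalso. apply in_Gb in HqG as [HqG _].
 assert (HqG' : ⌊q⌋ ∈ Gb a).
 { apply in_Gb. spt. apply inj_mem, in_coll;trivial. apply in_coll in Hq;trivial.
 apply (coll_mono (b := b));trivial. exact (proj1 Oa b Hb). }
 destruct (proj1 (proj2 (proj2 (proj2 (gen_Gb Sa)))) _ _ Hp HqG') as (s&Hs'&S1&S2).
 destruct (gen_lift TV (gen_Gb Sa) Hs') as (s'&<-&Hs2). rewrite (inj_sub TV) in S1, S2.
 apply (O s');trivial. now apply (Mo u' p').
 + intros (p&Hp&H). destruct (pinj TV H eq_refl) as (u'&p'&<-&<-&H'). apply Hr' in H' as [H' Hb'].
 exists ⌊p'⌋. split;[|now apply (opinj TV)]. apply in_Gb. spt. apply inj_mem.
 specialize (Hr _ H'). now apply in_prod2 in Hr.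
Qed.
End Ext.

(** * Arrows between posets and forced genericity *)

Section Arrows.
Context {M : structure} {Z : ZFm M}.
Implicit Types r s t u x y q Q : M.

Definition rcomp r t := sep (prod (bU (bU r)) (bU (bU t))) (fun p => exists w, opair (pfst p) w ∈ r /\ opair w (psnd p) ∈ t).
Lemma in_rcomp r t u p : opair u p ∈ rcomp r t <-> exists w, opair u w ∈ r /\ opair w p ∈ t.
Proof.
unfold rcomp. rewrite in_sep by def. rewrite in_prod2, pfst_eq, psnd_eq. split;[tauto|].
intros (w&A&B). split;[|now exists w]. apply in_UU in A, B. tauto.
Qed.
Lemma img_rcomp r t y : img (rcomp r t) y = img r (img t y).
Proof.
apply ext. intro u. rewrite !in_img. split.
- intros (p&Hp&H). apply in_rcomp in H as (w&A&B). exists w. spt. apply in_img. now exists p.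
- intros (w&Hw&H). apply in_img in Hw as (p&Hp&Hw). exists p. spt. apply in_rcomp. now exists w.
Qed.
Definition idr Q := lam Q (fun x => x).
Lemma in_idr Q u w : opair u w ∈ idr Q <-> u ∈ Q /\ w = u.
Proof. unfold idr. rewrite in_lam2 by def. reflexivity. Qed.
Lemma img_idr Q y : subset y Q -> img (idr Q) y = y.
Proof.
intro S. apply ext. intro u. rewrite in_img. split.
- intros (w&Hw&H). apply in_idr in H as [_ ->]. trivial.
- intro Hu. exists u. rewrite in_idr. auto.
Qed.
Lemma opair_emp x y : opair x y <> emp.
Proof. intro E. apply (in_emp (z := sing x)). rewrite <- E. unfold opair. rewrite in_upair. tauto. Qed.

(* The empty set serves as the identity arrow. *)
Definition tq_rel q r := (pfst q = emp /\ r = psnd q) \/ (pfst q <> emp /\ r = pfst (pfst q)).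
Definition tr_rel q r := (pfst q = emp /\ r = idr (psnd q)) \/ (pfst q <> emp /\ r = psnd (pfst q)).
Definition tq s Q := pf tq_rel (opair s Q).
Definition tr s Q := pf tr_rel (opair s Q).
Lemma tq_rel_fun q r r' : tq_rel q r -> tq_rel q r' -> r = r'.
Proof. unfold tq_rel. intuition congruence. Qed.
Lemma tr_rel_fun q r r' : tr_rel q r -> tr_rel q r' -> r = r'.
Proof. unfold tr_rel. intuition congruence. Qed.
Lemma tq_def : DF2 tq.
Proof. unfold tq. assert (H : DF1 (pf tq_rel)) by (apply DF_pf;[apply tq_rel_fun|unfold tq_rel;def]). def. Qed.
Lemma tr_def : DF2 tr.
Proof. unfold tr. assert (H : DF1 (pf tr_rel)) by (apply DF_pf;[apply tr_rel_fun|unfold tr_rel, idr;def]). def. Qed.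
Lemma tq_emp Q : tq emp Q = Q.
Proof. apply pf_eq;[intros ? ?;apply tq_rel_fun|]. left. now rewrite pfst_eq, psnd_eq. Qed.
Lemma tr_emp Q : tr emp Q = idr Q.
Proof. apply pf_eq;[intros ? ?;apply tr_rel_fun|]. left. now rewrite pfst_eq, psnd_eq. Qed.
Lemma tq_pair a r Q : tq (opair a r) Q = a.
Proof. apply pf_eq;[intros ? ?;apply tq_rel_fun|]. right. rewrite !pfst_eq. spt. apply opair_emp. Qed.
Lemma tr_pair a r Q : tr (opair a r) Q = r.
Proof. apply pf_eq;[intros ? ?;apply tr_rel_fun|]. right. rewrite !pfst_eq, psnd_eq. spt. apply opair_emp. Qed.
(** The composite keeps the target of the outer arrow and composes the relations; the other two
    cases absorb the identity [emp]. *)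
Definition cmp_rel q r := (pfst q = emp /\ r = psnd q) \/ (pfst q <> emp /\ psnd q = emp /\ r = pfst q) \/
 (pfst q <> emp /\ psnd q <> emp /\ r = opair (pfst (pfst q)) (rcomp (psnd (pfst q)) (psnd (psnd q)))).
Lemma cmp_rel_fun q r r' : cmp_rel q r -> cmp_rel q r' -> r = r'.
Proof. unfold cmp_rel. intuition congruence. Qed.
Definition cmp s t := pf cmp_rel (opair s t).
Lemma cmp_def : DF2 cmp.
Proof. unfold cmp. assert (H : DF1 (pf cmp_rel)) by (apply DF_pf;[apply cmp_rel_fun|unfold cmp_rel, rcomp;def]). def. Qed.
Lemma cmp_emp1 t : cmp emp t = t.
Proof. apply pf_eq;[intros ? ?;apply cmp_rel_fun|]. left. now rewrite pfst_eq, psnd_eq. Qed.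
Lemma cmp_emp2 a r : cmp (opair a r) emp = opair a r.
Proof. apply pf_eq;[intros ? ?;apply cmp_rel_fun|]. right;left. rewrite !pfst_eq, !psnd_eq. repeat spt. apply opair_emp. Qed.
Lemma cmp_pair a r b t : cmp (opair a r) (opair b t) = opair a (rcomp r t).
Proof. apply pf_eq;[intros ? ?;apply cmp_rel_fun|]. right;right. rewrite !pfst_eq, !psnd_eq. repeat spt;apply opair_emp. Qed.

(* [inn Q q r u]: the condition q of Q forces u to belong to the image of the
 generic filter under r. *)
Definition inn Q q r u := forall q1, q1 ∈ Q -> subset q q1 ->
 exists q2, q2 ∈ Q /\ subset q1 q2 /\ exists w, w ∈ Q /\ opair u w ∈ r /\ subset w q2.
Definition dns Q D := subset D Q /\ forall p, p ∈ Q -> exists q, q ∈ D /\ subset p q.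
(** The clauses of being [Q0]-generic, forced by [q] for the image of the generic under [r] and
    spelled out through [inn]; non-emptiness follows from the last clause applied to [Q0] itself. *)
Definition fgen Q q r Q0 := forall q1, q1 ∈ Q -> subset q q1 ->
 (forall u, inn Q q1 r u -> u ∈ Q0) /\
 (forall u v, inn Q q1 r u -> v ∈ Q0 -> subset v u -> inn Q q1 r v) /\
 (forall u v, inn Q q1 r u -> inn Q q1 r v ->
 exists q2, q2 ∈ Q /\ subset q1 q2 /\ exists w, inn Q q2 r w /\ subset u w /\ subset v w) /\
 (forall D, dns Q0 D -> exists q2, q2 ∈ Q /\ subset q1 q2 /\ exists u, u ∈ D /\ inn Q q2 r u).
Lemma subT x y q : subset x y -> subset y q -> subset x q.
Proof. intros A B z Hz. auto. Qed.
Lemma sub_refl x : subset x x. Proof. now intros ? ?. Qed.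
#[local] Arguments sub_refl x : clear implicits.
Lemma inn_mono Q q q' r u : inn Q q r u -> subset q q' -> inn Q q' r u.
Proof. intros H S q1 Hq1 S1. apply H;trivial. exact (subT S S1). Qed.
Lemma inn_dense Q q r u : (forall q1, q1 ∈ Q -> subset q q1 -> exists q2, q2 ∈ Q /\ subset q1 q2 /\ inn Q q2 r u) -> inn Q q r u.
Proof.
intros H q1 Hq1 S. destruct (H q1 Hq1 S) as (q2&Hq2&S2&I). destruct (I q2 Hq2 (sub_refl q2)) as (q3&Hq3&S3&W).
exists q3. spt. split;[exact (subT S2 S3)|trivial].
Qed.
Lemma fgen_mono Q q q' r Q0 : fgen Q q r Q0 -> subset q q' -> fgen Q q' r Q0.
Proof. intros H S q1 Hq1 S1. apply H;trivial. exact (subT S S1). Qed.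
Lemma inn_id Q q u : u ∈ Q -> subset u q -> inn Q q (idr Q) u.
Proof.
intros Hu S q1 Hq1 S1. exists q1. spt. split;[apply sub_refl|]. exists u. rewrite in_idr.
repeat spt. exact (subT S S1).
Qed.
Lemma fgen_id Q q : fgen Q q (idr Q) Q.
Proof.
intros q1 Hq1 S1. split;[|split;[|split]].
- intros u I. destruct (I q1 Hq1 (sub_refl q1)) as (q2&Hq2&S2&w&Hw&Ho&Sw). now apply in_idr in Ho.
- intros u v I Hv Sv q2 Hq2 S2. destruct (I q2 Hq2 S2) as (q3&Hq3&S3&w&Hw&Ho&Sw). apply in_idr in Ho as [_ ->].
 exists q3. spt. spt. exists v. rewrite in_idr. repeat spt. exact (subT Sv Sw).
- intros u v I J. destruct (I q1 Hq1 (sub_refl q1)) as (q2&Hq2&S2&w&Hw&Ho&Sw). apply in_idr in Ho as [_ ->].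
 destruct (J q2 Hq2 S2) as (q3&Hq3&S3&w&Hw'&Ho&Sw'). apply in_idr in Ho as [_ ->].
 exists q3. spt. split;[exact (subT S2 S3)|]. exists q3. split;[apply inn_id;[trivial|apply sub_refl]|].
 split;[exact (subT Sw S3)|trivial].
- intros D [DQ HD]. destruct (HD q1 Hq1) as (q2&Hq2&S2). exists q2. split;[auto|]. spt.
 exists q2. spt. apply inn_id;[auto|apply sub_refl].
Qed.
End Arrows.
Arguments sub_refl {M} x.

Ltac def_hook6 :=
 lazymatch goal with
 | |- DT (fun v => tq (@?t v) (@?u v)) => refine (@DT_app2 _ tq t u tq_def _ _)
 | |- DT (fun v => tr (@?t v) (@?u v)) => refine (@DT_app2 _ tr t u tr_def _ _)
 | |- DT (fun v => cmp (@?t v) (@?u v)) => refine (@DT_app2 _ cmp t u cmp_def _ _)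
 | |- DT (fun v => idr _) => unfold idr
 | |- DT (fun v => rcomp _ _) => unfold rcomp
 | |- Def (fun v => inn _ _ _ _) => unfold inn
 | |- Def (fun v => dns _ _) => unfold dns
 | |- Def (fun v => fgen _ _ _ _) => unfold fgen, inn, dns
 | _ => def_hook5
 end.
Ltac def_hook ::= def_hook6.

Section Forced.
Context {N : structure} {V : N -> Prop} {ZN : ZFm N} {ZV : ZFm (restrict V)}.
Notation VS := (restrict V).
Notation "'⌊' x '⌋'" := (@inj N V x).
Hypothesis TV : transitive_class V.

Lemma gen_up Q y p q : gen Q y -> q ∈ Q -> ⌊p⌋ ∈ y -> subset q p -> ⌊q⌋ ∈ y.
Proof. intros (_&_&H&_) Hq Hp S. apply (H ⌊p⌋);trivial. now apply (inj_sub TV). Qed.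
Lemma gen_in Q y p : gen Q y -> ⌊p⌋ ∈ y -> p ∈ Q.
Proof. intros (H&_) Hp. now apply inj_mem, H. Qed.
Lemma gen_dir Q y p q : gen Q y -> ⌊p⌋ ∈ y -> ⌊q⌋ ∈ y -> exists r, r ∈ Q /\ ⌊r⌋ ∈ y /\ subset p r /\ subset q r.
Proof.
intros HG Hp Hq. destruct (proj1 (proj2 (proj2 (proj2 HG))) _ _ Hp Hq) as (r&Hr&A&B).
destruct (gen_lift TV HG Hr) as (r'&<-&Hr'). exists r'. rewrite (inj_sub TV) in A, B. now repeat split.
Qed.

Lemma inn_snd Q y q r u : gen Q y -> ⌊q⌋ ∈ y -> inn Q q r u -> ⌊u⌋ ∈ img ⌊r⌋ y.
Proof.
intros HG Hq I. apply in_img.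
destruct (@gen_dich _ _ _ (fun q2 => exists w, w ∈ Q /\ opair u w ∈ r /\ subset w q2) Q y) as [(p&Hp&Hy&w&Hw&Ho&Sw)|(p&Hp&Hy&U)];trivial;[def| |].
- exists ⌊w⌋. split;[exact (gen_up HG Hw Hy Sw)|now apply (opinj TV)].
- destruct (gen_dir HG Hy Hq) as (p3&Hp3&Hy3&S1&S2). destruct (I p3 Hp3 S2) as (q2&Hq2&S3&W).
 exfalso. apply (U q2);trivial. exact (subT S1 S3).
Qed.
Lemma inn_cpl Q y r u : gen Q y -> u ∈ img ⌊r⌋ y -> exists u' q, ⌊u'⌋ = u /\ ⌊q⌋ ∈ y /\ inn Q q r u'.
Proof.
intros HG H. apply in_img in H as (w&Hw&H). destruct (pinj TV H eq_refl) as (u'&w'&<-&<-&Ho).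
exists u', w'. spt. spt. intros q1 Hq1 S. exists q1. spt. split;[apply sub_refl|].
exists w'. repeat spt. exact (gen_in HG Hw).
Qed.
Lemma inn_cplV Q y r u q0 : gen Q y -> ⌊u⌋ ∈ img ⌊r⌋ y -> ⌊q0⌋ ∈ y -> exists q, ⌊q⌋ ∈ y /\ q ∈ Q /\ subset q0 q /\ inn Q q r u.
Proof.
intros HG H Hq0. destruct (inn_cpl HG H) as (u'&q&E&Hq&I). apply inj_inj in E. subst u'.
destruct (gen_dir HG Hq Hq0) as (q1&Hq1&Hy1&S1&S2). exists q1. repeat spt. exact (inn_mono I S1).
Qed.

Lemma fgen_snd Q y q r Q0 : gen Q y -> ⌊q⌋ ∈ y -> fgen Q q r Q0 -> gen Q0 (img ⌊r⌋ y).
Proof.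
intros HG Hq Fg.
assert (Ext : forall u, u ∈ img ⌊r⌋ y -> exists u' q1, ⌊u'⌋ = u /\ q1 ∈ Q /\ ⌊q1⌋ ∈ y /\ subset q q1 /\ inn Q q1 r u').
{ intros u Hu. destruct (inn_cpl HG Hu) as (u'&q'&<-&Hq'&I).
 destruct (gen_dir HG Hq' Hq) as (q1&Hq1&Hy1&S1&S2). exists u', q1. repeat spt. exact (inn_mono I S1). }
assert (Dn : forall (X : VS -> Prop) q1, Def1 X -> ⌊q1⌋ ∈ y -> (forall q2, q2 ∈ Q -> subset q1 q2 -> exists q3, q3 ∈ Q /\ subset q2 q3 /\ X q3) ->
 exists q3, ⌊q3⌋ ∈ y /\ X q3).
{ intros X q1 HX Hq1 H. destruct (gen_dich HX HG) as [(p&Hp&Hy&Xp)|(p&Hp&Hy&U)];[now exists p|].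
 destruct (gen_dir HG Hy Hq1) as (p3&Hp3&Hy3&S1&S2). destruct (H p3 Hp3 S2) as (q3&Hq3&S3&X3).
 exfalso. apply (U q3);trivial. exact (subT S1 S3). }
split;[|split;[|split;[|split]]].
- intros u Hu. destruct (Ext u Hu) as (u'&q1&<-&Hq1&Hy1&S1&I). apply inj_mem. now apply (Fg q1 Hq1 S1).
- destruct (Dn (fun q3 => exists u, inn Q q3 r u) q) as (q3&Hy3&u&I);trivial;[def| |].
 + intros q2 Hq2 S2. destruct (Fg q2 Hq2 S2) as (_&_&_&H). destruct (H Q0) as (q3&Hq3&S3&u&Hu&I).
 * split;[apply sub_refl|]. intros p Hp. exists p. spt. apply sub_refl.
 * exists q3. repeat spt. now exists u.
 + exists ⌊u⌋. exact (inn_snd HG Hy3 I).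
- intros p v Hv Hp S. destruct (Ext p Hp) as (p'&q1&<-&Hq1&Hy1&S1&I).
 apply (in_inj TV) in Hv as (v'&<-&Hv). apply (inn_snd HG Hy1). apply (Fg q1 Hq1 S1) with (u := p');trivial. now apply (inj_sub TV).
- intros u v Hu Hv. destruct (Ext u Hu) as (u'&q1&<-&Hq1&Hy1&S1&I1), (Ext v Hv) as (v'&q2&<-&Hq2&Hy2&S2&I2).
 destruct (gen_dir HG Hy1 Hy2) as (q4&Hq4&Hy4&S3&S4).
 destruct (Dn (fun q3 => exists w, inn Q q3 r w /\ subset u' w /\ subset v' w) q4) as (q3&Hy3&w&I&A&B);trivial;[def| |].
 + intros q5 Hq5 S5. destruct (Fg q5 Hq5) as (_&_&H&_);[exact (subT S1 (subT S3 S5))|].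
 destruct (H u' v') as (q6&Hq6&S6&W);[exact (inn_mono I1 (subT S3 S5))|exact (inn_mono I2 (subT S4 S5))|].
 exists q6. now repeat split.
 + exists ⌊w⌋. split;[exact (inn_snd HG Hy3 I)|]. now rewrite !(inj_sub TV).
- intros D HD. destruct (Dn (fun q3 => exists u, u ∈ D /\ inn Q q3 r u) q) as (q3&Hy3&u&Hu&I);trivial;[def| |].
 + intros q2 Hq2 S2. destruct (Fg q2 Hq2 S2) as (_&_&_&H). destruct (H D) as (q3&Hq3&S3&W);trivial. exists q3. now repeat split.
 + exists u. spt. exact (inn_snd HG Hy3 I).
Qed.

(** Each way in which a clause of [fgen] may fail is recorded by a disjunct of [X]. The filter
    cannot contain a condition in [X], since the image really is generic, so it contains one with no
    extension in [X], and above that all clauses hold. *)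
Lemma fgen_cpl Q y r Q0 q0 : gen Q y -> gen Q0 (img ⌊r⌋ y) -> ⌊q0⌋ ∈ y ->
 exists q, q ∈ Q /\ ⌊q⌋ ∈ y /\ subset q0 q /\ fgen Q q r Q0.
Proof.
intros HG HG0 Hq0.
pose (X := fun p => (exists u, inn Q p r u /\ ~ u ∈ Q0) \/
 (exists u v, inn Q p r u /\ v ∈ Q0 /\ subset v u /\ forall q2, q2 ∈ Q -> subset p q2 -> ~ inn Q q2 r v) \/
 (exists u v, inn Q p r u /\ inn Q p r v /\ forall q2, q2 ∈ Q -> subset p q2 -> forall w, inn Q q2 r w -> subset u w -> ~ subset v w) \/
 (exists D, dns Q0 D /\ forall q2, q2 ∈ Q -> subset p q2 -> forall u, u ∈ D -> ~ inn Q q2 r u)).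
destruct (@gen_dich _ _ _ X Q y) as [(p&Hp&Hy&Xp)|(p&Hp&Hy&U)];trivial;[unfold X;def| |].
- exfalso. destruct Xp as [(u&I&Nu)|[(u&v&I&Hv&S&C)|[(u&v&I&J&C)|(D&HD&C)]]].
 + apply Nu. exact (gen_in HG0 (inn_snd HG Hy I)).
 + assert (K := gen_up HG0 Hv (inn_snd HG Hy I) S). destruct (inn_cplV HG K Hy) as (q&Hqy&Hq&Sq&Iq). exact (C q Hq Sq Iq).
 + destruct (gen_dir HG0 (inn_snd HG Hy I) (inn_snd HG Hy J)) as (w&Hw&Hwy&A&B).
 destruct (inn_cplV HG Hwy Hy) as (q&Hqy&Hq&Sq&Iq). exact (C q Hq Sq w Iq A B).
 + destruct (proj2 (proj2 (proj2 (proj2 HG0))) D HD) as (u&Hu&Huy).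
 destruct (inn_cplV HG Huy Hy) as (q&Hqy&Hq&Sq&Iq). exact (C q Hq Sq u Hu Iq).
- destruct (gen_dir HG Hy Hq0) as (q&Hq&Hqy&S1&S2). exists q. repeat spt;
 rename q1 into p1;assert (S3 : subset p p1) by exact (subT S1 H0).
 + intros u I. apply NNPP. intro C. apply (U p1);trivial. left. now exists u.
 + intros u v I Hv S. apply inn_dense. intros q2 Hq2 S4. apply NNPP. intro C. apply (U q2);trivial;[exact (subT S3 S4)|].
 right;left. exists u, v. split;[exact (inn_mono I S4)|]. spt. spt. intros q3 Hq3 S5 I3. apply C. now exists q3.
 + intros u v I J. apply NNPP. intro C. apply (U p1);trivial. right;right;left. exists u, v. spt. spt.
 intros q2 Hq2 S4 w Iw A B. apply C. exists q2. spt. spt. now exists w.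
 + intros D HD. apply NNPP. intro C. apply (U p1);trivial. right;right;right. exists D. spt.
 intros q2 Hq2 S4 u Hu I. apply C. exists q2. spt. spt. now exists u.
Qed.

Lemma same_cpl Q y r t q0 : gen Q y -> img ⌊r⌋ y = img ⌊t⌋ y -> ⌊q0⌋ ∈ y ->
 exists q, q ∈ Q /\ ⌊q⌋ ∈ y /\ subset q0 q /\ forall q1 u, q1 ∈ Q -> subset q q1 -> (inn Q q1 r u <-> inn Q q1 t u).
Proof.
intros HG E Hq0.
assert (K : forall r t, img ⌊r⌋ y = img ⌊t⌋ y -> exists q, q ∈ Q /\ ⌊q⌋ ∈ y /\ forall q1 u, q1 ∈ Q -> subset q q1 -> inn Q q1 r u -> inn Q q1 t u).
{ clear r t E. intros r t E.
 destruct (@gen_dich _ _ _ (fun p => exists u, inn Q p r u /\ forall q2, q2 ∈ Q -> subset p q2 -> ~ inn Q q2 t u) Q y)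
 as [(p&Hp&Hy&u&I&C)|(p&Hp&Hy&U)];trivial;[def| |].
 - assert (K := inn_snd HG Hy I). rewrite E in K. destruct (inn_cplV HG K Hy) as (q&Hqy&Hq&Sq&Iq). exfalso. exact (C q Hq Sq Iq).
 - exists p. spt. spt. intros q1 u Hq1 S I. apply inn_dense. intros q2 Hq2 S2. apply NNPP. intro C.
 apply (U q2);trivial;[exact (subT S S2)|]. exists u. split;[exact (inn_mono I S2)|]. intros q3 Hq3 S3 I3. apply C. now exists q3. }
destruct (K r t E) as (a&Ha&Hay&A). destruct (K t r (eq_sym E)) as (b&Hb&Hby&B).
destruct (gen_dir HG Hay Hby) as (c&Hc&Hcy&S1&S2). destruct (gen_dir HG Hcy Hq0) as (d&Hd&Hdy&S3&S4).
exists d. repeat spt;intros I;[apply A|apply B];trivial;(eapply subT;[eassumption|];eapply subT;eassumption).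
Qed.
Lemma same_snd Q y q r t : gen Q y -> ⌊q⌋ ∈ y -> (forall q1 u, q1 ∈ Q -> subset q q1 -> (inn Q q1 r u <-> inn Q q1 t u)) -> img ⌊r⌋ y = img ⌊t⌋ y.
Proof.
intros HG Hq H.
assert (K : forall r t, (forall q1 u, q1 ∈ Q -> subset q q1 -> inn Q q1 r u -> inn Q q1 t u) -> forall u, u ∈ img ⌊r⌋ y -> u ∈ img ⌊t⌋ y).
{ clear r t H. intros r t H u Hu. destruct (inn_cpl HG Hu) as (u'&q'&<-&Hq'&I).
 destruct (gen_dir HG Hq' Hq) as (q1&Hq1&Hy1&S1&S2). apply (inn_snd HG Hy1). apply H;trivial. exact (inn_mono I S1). }
apply ext. intro u. split;apply K;intros q1 v Hq1 S;now apply H.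
Qed.
End Forced.

(** * The site of small generic extensions *)
Section Quotient.
Context {M : structure} {Z : ZFm M}.
Implicit Types r s t u x y q Q : M.
(* Forced genericity bounds the image of q' from below: some r1 above p is
 compatible, in the strong sense, with everything q' may still decide. *)
Lemma proj_ex Q' q' r Q p : q' ∈ Q' -> fgen Q' q' r Q -> inn Q' q' r p -> p ∈ Q ->
 exists r1, r1 ∈ Q /\ subset p r1 /\ forall r2, r2 ∈ Q -> subset r1 r2 -> exists q2, q2 ∈ Q' /\ subset q' q2 /\ inn Q' q2 r r2.
Proof.
intros Hq' Fg Ip Hp. apply NNPP. intro C.
pose (out := fun v => forall q2, q2 ∈ Q' -> subset q' q2 -> ~ inn Q' q2 r v).
assert (D1 : forall r1, r1 ∈ Q -> subset p r1 -> exists r2, r2 ∈ Q /\ subset r1 r2 /\ out r2).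
{ intros r1 Hr1 S. apply NNPP. intro D. apply C. exists r1. spt. spt. intros r2 Hr2 S2.
 apply NNPP. intro E. apply D. exists r2. spt. spt. intros q2 Hq2 Sq I. apply E. now exists q2. }
pose (X := fun v => out v \/ forall w, w ∈ Q -> subset v w -> ~ subset p w).
assert (HX : Def1 X) by (unfold X, out;def).
destruct (Fg q' Hq' (sub_refl q')) as (_&_&_&G4).
destruct (G4 (sep Q X)) as (q2&Hq2&S2&u&Hu&I).
{ split;[intros v Hv;now apply in_sep in Hv|]. intros v Hv.
 destruct (classic (exists w, w ∈ Q /\ subset v w /\ subset p w)) as [(w&Hw&A&B)|E].
 - destruct (D1 w Hw B) as (r2&Hr2&S&O). exists r2. split;[|exact (subT A S)]. apply in_sep;trivial. spt. now left.
 - exists v. split;[|apply sub_refl]. apply in_sep;trivial. spt. right. intros w Hw A B. apply E. now exists w. }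
apply in_sep in Hu as [Hu [O|O]];trivial;[exact (O q2 Hq2 S2 I)|].
destruct (Fg q2 Hq2 S2) as (_&_&G3&_). destruct (G3 u p I (inn_mono Ip S2)) as (q3&Hq3&S3&w&Iw&A&B).
apply (O w);trivial. exact (proj1 (Fg q3 Hq3 (subT S2 S3)) w Iw).
Qed.
End Quotient.

Section Site.
Context {N : structure} {V : N -> Prop} {ZN : ZFm N} {ZV : ZFm (restrict V)}.
Notation VS := (restrict V).
Notation "'⌊' x '⌋'" := (@inj N V x).
Hypothesis TV : transitive_class V.
Hypothesis ACN : ax_choice N.
Hypothesis ACV : ax_choice VS.
Variables (k : VS) (G : N).
Hypothesis Hk : Mahlo k.
Hypothesis hG : collapse_generic k G.
Hypothesis hN : forall x : N, exists t : N, V t /\ is_val G t x.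
Notation K := (Vr k).
Let Hi : inaccessible k := k_inacc Hk.

Lemma K_bU x : x ∈ K -> bU x ∈ K.
Proof.
rewrite !in_Vr. intros (b&Hb&Hx). exists b. spt. intros z Hz. apply in_bU in Hz as (y&Hy&Hz).
exact (Vr_trans (Hx y Hy) Hz).
Qed.

(** A generic for Q' with prescribed image [y] is built in N by meeting the countably many dense
    sets while keeping every element of [y] possible in the image. The generic [y], applied to the
    dense set at hand, selects an extension that keeps this promise; [proj_ex] supplies the
    density. *)
Lemma lift_generic Q' q' r Q p y : Q' ∈ K -> q' ∈ Q' -> fgen Q' q' r Q -> gen Q y -> ⌊p⌋ ∈ y ->
 (forall r2, r2 ∈ Q -> subset p r2 -> exists q2, q2 ∈ Q' /\ subset q' q2 /\ inn Q' q2 r r2) ->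
 exists y', gen Q' y' /\ ⌊q'⌋ ∈ y' /\ img ⌊r⌋ y' = y.
Proof.
intros HQ' Hq' Fg HG Hp Ep.
pose (IS := sep (prod Q' Q) (fun z => inn Q' (pfst z) r (psnd z))).
assert (HIS : forall q2 v, opair q2 v ∈ IS <-> q2 ∈ Q' /\ v ∈ Q /\ inn Q' q2 r v).
{ intros q2 v. unfold IS. rewrite in_sep by def. rewrite in_prod2, pfst_eq, psnd_eq. tauto. }
(* The promise: above [x] no element of [y] has been ruled out of the image. The set [IS] codes
   [inn], a notion of V, so that the invariant is definable in N. *)
pose (Inv := fun x => subset ⌊q'⌋ x /\ forall v, v ∈ y -> exists q2, q2 ∈ ⌊Q'⌋ /\ subset x q2 /\ opair q2 v ∈ ⌊IS⌋).
assert (InvE : forall x, x ∈ Q' -> (Inv ⌊x⌋ <-> subset q' x /\ forall v, ⌊v⌋ ∈ y -> exists q2, q2 ∈ Q' /\ subset x q2 /\ inn Q' q2 r v)).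
{ intros x Hx. unfold Inv. rewrite (inj_sub TV). split;intros [A B];spt;intros v Hv.
 - destruct (B ⌊v⌋ Hv) as (q2&Hq2&S&H). apply (in_inj TV) in Hq2 as (q3&<-&Hq3). exists q3. spt.
 rewrite (inj_sub TV) in S. spt. apply (opinj TV), HIS in H. tauto.
 - destruct (gen_lift TV HG Hv) as (v'&<-&Hv'). destruct (B v' Hv) as (q2&Hq2&S&I). exists ⌊q2⌋. spt.
 split;[now apply (inj_sub TV)|]. apply (opinj TV), HIS. tauto. }
assert (G2 : forall q2 u v, q2 ∈ Q' -> subset q' q2 -> inn Q' q2 r u -> v ∈ Q -> subset v u -> inn Q' q2 r v).
{ intros q2 u v Hq2 S I Hv Sv. now apply (Fg q2 Hq2 S) with (u := u). }
destruct (@generic_K N V ZN ZV TV ACN ACV k G Hk hG Q' Inv ⌊q'⌋) as (y'&HG'&Hq'y&Hy');trivial.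
{ unfold Inv. def. }
{ intros D x HD Hx Ix. apply (in_inj TV) in Hx as (x'&<-&Hx). apply InvE in Ix as [Sx Ix];trivial.
 destruct (@gen_dich _ _ _ (fun v => exists q2, q2 ∈ D /\ subset x' q2 /\ forall r2, r2 ∈ Q -> subset v r2 ->
 exists q3, q3 ∈ Q' /\ subset q2 q3 /\ inn Q' q3 r r2) Q y) as [(p1&Hp1&Hy1&q2&Hq2&S2&E)|(p1&Hp1&Hy1&U)];trivial;[def| |].
 - exists ⌊q2⌋. spt. split;[|now apply (inj_sub TV)]. apply InvE;[now apply HD|]. split;[exact (subT Sx S2)|].
 intros v Hv. destruct (gen_dir TV HG Hy1 Hv) as (r1&Hr1&_&A&B). destruct (E r1 Hr1 A) as (q3&Hq3&S3&I).
 exists q3. spt. spt. apply (G2 q3 r1);trivial;[exact (subT Sx (subT S2 S3))|exact (gen_in HG Hv)].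
 - exfalso. destruct (Ix p1 Hy1) as (q2&Hq2&S2&I). destruct (proj2 HD q2 Hq2) as (q3&Hq3&S3).
 assert (Hq3' : q3 ∈ Q') by now apply HD.
 destruct (proj_ex Hq3' (fgen_mono Fg (subT Sx (subT S2 S3))) (inn_mono I S3) Hp1) as (r1&Hr1&Sr&E).
 apply (U r1);trivial. exists q3. spt. split;[exact (subT S2 S3)|trivial]. }
{ apply InvE;trivial. split;[apply sub_refl|]. intros v Hv. destruct (gen_dir TV HG Hp Hv) as (r1&Hr1&_&A&B).
 destruct (Ep r1 Hr1 A) as (q2&Hq2&S&I). exists q2. spt. spt. apply (G2 q2 r1);trivial. exact (gen_in HG Hv). }
exists y'. spt. spt. assert (HGi := fgen_snd TV HG' Hq'y Fg).
(* An image element u outside [y] would be excluded by some p2 in [y]; the invariant keeps p2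
   possible together with u, a contradiction. The reverse inclusion then holds because a generic
   filter has no proper generic extension. *)
assert (Sub : forall u, ⌊u⌋ ∈ img ⌊r⌋ y' -> ⌊u⌋ ∈ y).
{ intros u Hu. assert (HuQ := gen_in HGi Hu). destruct (inn_cplV TV HG' Hu Hq'y) as (q1&Hq1y&Hq1&S1&I1).
 destruct (Hy' ⌊q1⌋ Hq1y) as (x&Hxy&Ix&Sx). destruct (gen_lift TV HG' Hxy) as (x'&<-&Hx). rewrite (inj_sub TV) in Sx.
 apply InvE in Ix as [Sq Ix];trivial.
 destruct (@gen_dich _ _ _ (fun v => subset u v) Q y) as [(p2&Hp2&Hy2&S)|(p2&Hp2&Hy2&U)];trivial;[def|exact (gen_up TV HG HuQ Hy2 S)|].
 exfalso. destruct (Ix p2 Hy2) as (q2&Hq2&S2&I2).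
 destruct (Fg q2 Hq2 (subT Sq S2)) as (_&_&G3&_).
 destruct (G3 u p2 (inn_mono I1 (subT Sx S2)) I2) as (q3&Hq3&S3&w&Iw&A&B).
 apply (U w);trivial. exact (proj1 (Fg q3 Hq3 (subT Sq (subT S2 S3))) w Iw). }
apply ext. intro u. split;intro Hu.
- destruct (gen_lift TV HGi Hu) as (u'&<-&_). auto.
- destruct (gen_lift TV HG Hu) as (u'&<-&HuQ).
 destruct (@gen_dich _ _ _ (fun v => subset u' v) Q (img ⌊r⌋ y')) as [(p2&Hp2&Hy2&S)|(p2&Hp2&Hy2&U)];trivial;[def|exact (gen_up TV HGi HuQ Hy2 S)|].
 exfalso. destruct (gen_dir TV HG (Sub p2 Hy2) Hu) as (w&Hw&_&A&B). exact (U w Hw A B).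
Qed.

Definition sCs : VS := sep (prod K K) (fun c => psnd c ∈ pfst c).
Definition sAr : VS := cup (prod K K) (sing emp).
Lemma in_Cs c : c ∈ sCs <-> exists Q q, c = opair Q q /\ Q ∈ K /\ q ∈ Q.
Proof.
unfold sCs. rewrite in_sep by def. rewrite in_prod. split.
- intros [(Q&q&HQ&Hq&->) H]. rewrite pfst_eq, psnd_eq in H. now exists Q, q.
- intros (Q&q&->&HQ&Hq). rewrite pfst_eq, psnd_eq. spt. exists Q, q. spa. exact (Vr_trans HQ Hq).
Qed.
Lemma in_Ar s : s ∈ sAr <-> s = emp \/ exists Q r, s = opair Q r /\ Q ∈ K /\ r ∈ K.
Proof.
unfold sAr. rewrite in_cup, in_sing, in_prod. split.
- intros [(Q&r&HQ&Hr&->)|H];[right;now exists Q, r|now left].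
- intros [H|(Q&r&->&HQ&Hr)];[now right|left;now exists Q, r].
Qed.
Lemma K_rcomp r t : r ∈ K -> t ∈ K -> rcomp r t ∈ K.
Proof.
intros Hr Ht. apply (K_sub (x := prod (bU (bU r)) (bU (bU t)))).
- apply (K_prod Hi);now apply K_bU, K_bU.
- intros p Hp. unfold rcomp in Hp. apply in_sep in Hp;[tauto|def].
Qed.

(** With c' = (Q',q') and c = (Q,q), [ex c' r c] says that q' forces the image under [r] to be
    [Q]-generic and to contain q. [eqA] says that the targets agree, that the first image is forced
    to be generic and that the two images are forced to coincide. *)
Definition sv : vsite (N := N) (V := V).
Proof.
refine {| Cs := sCs;Ar := sAr;Es := prod sCs (prod sAr sAr);idA := emp;comp := cmp;
 le := fun c' c => pfst c' = pfst c /\ subset (psnd c) (psnd c') /\ psnd c ∈ pfst c /\ psnd c' ∈ pfst c';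
 ex := fun c' r c => tq r (pfst c') = pfst c /\ fgen (pfst c') (psnd c') (tr r (pfst c')) (pfst c) /\
 inn (pfst c') (psnd c') (tr r (pfst c')) (psnd c) /\ psnd c ∈ pfst c;
 eqA := fun c s t => tq s (pfst c) = tq t (pfst c) /\ fgen (pfst c) (psnd c) (tr s (pfst c)) (tq s (pfst c)) /\
 forall q1 u, q1 ∈ pfst c -> subset (psnd c) q1 -> (inn (pfst c) q1 (tr s (pfst c)) u <-> inn (pfst c) q1 (tr t (pfst c)) u);
 lc := pfst;la := fun e => pfst (psnd e);lb := fun e => psnd (psnd e) |};try def.
- apply in_Ar. now left.
- intros s t Hs Ht. apply in_Ar in Hs as [->|(Q&r&->&HQ&Hr)];[now rewrite cmp_emp1|].
 apply in_Ar in Ht as [->|(Q'&r'&->&HQ'&Hr')];apply in_Ar;right.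
 + rewrite cmp_emp2. now exists Q, r.
 + rewrite cmp_pair. exists Q, (rcomp r r'). spa. now apply K_rcomp.
- intros e He. apply in_prod in He as (c&z&Hc&Hz&->). apply in_prod in Hz as (a&b&Ha&Hb&->).
 now rewrite !pfst_eq, !psnd_eq, !pfst_eq.
- intros c a b Hc Ha Hb. exists (opair c (opair a b)). rewrite ?in_prod2, ?psnd_eq, ?pfst_eq. spa.
- intros c1 c2 c3 (A1&A2&A3&A4) (B1&B2&B3&B4). split;[congruence|]. split;[exact (subT B2 A2)|now split].
- intros c c' (A1&A2&A3&A4). rewrite tq_emp, tr_emp, A1. spt. split;[apply fgen_id|]. spt. now apply inn_id.
- intros c c' c2 r (A1&A2&A3&A4) (B1&B2&B3&B4). rewrite B1. spt. split;[exact (fgen_mono A2 B2)|]. spt. exact (inn_mono A3 B2).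
- intros c c' c2 r (A1&A2&A3&A4) (B1&B2&B3&B4). rewrite <- B1. spt. spt. rewrite B1. spt.
 intros q1 Hq1 S1. assert (K2 := A2 q1 Hq1 S1). destruct K2 as (_&K2&_).
 apply (K2 (psnd c) (psnd c2) (inn_mono A3 S1));trivial;[now rewrite B1|apply sub_refl].
- intros c c' s t (A1&A2&A3) (B1&B2&B3&B4). rewrite B1. spt. split;[exact (fgen_mono A2 B2)|].
 intros q1 u Hq1 S. apply A3;trivial. exact (subT B2 S).
Defined.

(** Genericity refers to the dense sets lying in V, which N need not be able to define. The table of
    power sets computed in V, a set parameter, makes it expressible in N for all posets of [K] at
    once. *)
Definition genN (Q y : N) := subset y Q /\ (exists p, p ∈ y) /\
 (forall p q, q ∈ Q -> p ∈ y -> subset q p -> q ∈ y) /\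
 (forall p q, p ∈ y -> q ∈ y -> exists r, r ∈ y /\ subset p r /\ subset q r) /\
 (forall D, D ∈ ap ⌊lam K (fun x => pow x)⌋ Q -> (forall p, p ∈ Q -> exists q, q ∈ D /\ subset p q) -> exists p, p ∈ D /\ p ∈ y).
Lemma genN_eq Q y : Q ∈ K -> (genN ⌊Q⌋ y <-> gen Q y).
Proof.
intro HQ. assert (Hp : DF1 (fun x : VS => pow x)) by def.
assert (E : ap ⌊lam K (fun x => pow x)⌋ ⌊Q⌋ = ⌊pow Q⌋).
{ rewrite (inj_ap TV (y := pow Q));[now rewrite ap_lam|now apply lam_functional|now apply in_lam2]. }
unfold genN, gen. rewrite E. split;intros (A&B&C&D&F);(split;[trivial|split;[trivial|split;[trivial|split;[trivial|]]]]).
- intros X [XQ HX]. destruct (F ⌊X⌋) as (p&Hp'&Hy).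
 + now apply inj_mem, in_pow.
 + intros p Hp'. apply (in_inj TV) in Hp' as (p'&<-&Hp'). destruct (HX p' Hp') as (q&Hq&S). exists ⌊q⌋. spt. now apply (inj_sub TV).
 + apply (in_inj TV) in Hp' as (p'&<-&Hp'). now exists p'.
- intros X HX HD. apply (in_inj TV) in HX as (X'&<-&HX). apply in_pow in HX. destruct (F X') as (p&Hp'&Hy);[|now exists ⌊p⌋].
 spt. intros p Hp'. destruct (HD ⌊p⌋ Hp') as (q&Hq&S). apply (in_inj TV) in Hq as (q'&<-&Hq). exists q'. spt. now apply (inj_sub TV).
Qed.
Definition sSg : N := sep (prod ⌊K⌋ (pow ⌊K⌋)) (fun z => genN (pfst z) (psnd z)).
Lemma in_Sg z : z ∈ sSg <-> exists Q y, Q ∈ K /\ z = opair ⌊Q⌋ y /\ gen Q y.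
Proof.
unfold sSg. rewrite in_sep by (unfold genN;def). rewrite in_prod. split.
- intros [(Q&y&HQ&Hy&->) H]. rewrite pfst_eq, psnd_eq in H. apply (in_inj TV) in HQ as (Q'&<-&HQ).
 exists Q', y. spa;now apply genN_eq.
- intros (Q&y&HQ&->&H). rewrite pfst_eq, psnd_eq. split;[|now apply genN_eq]. exists ⌊Q⌋, y. spa.
 apply in_pow. intros p Hp. destruct (gen_lift TV H Hp) as (p'&<-&Hp'). exact (Vr_trans HQ Hp').
Qed.
Lemma Sg_pair Q y : opair ⌊Q⌋ y ∈ sSg <-> Q ∈ K /\ gen Q y.
Proof.
rewrite in_Sg. split.
- intros (Q'&y'&HQ&E&H). apply opair_inj in E as [E ->]. apply inj_inj in E. now subst.
- intros []. now exists Q, y.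
Qed.
Definition shold (z c : N) := exists Q y q, z = opair Q y /\ c = opair Q q /\ q ∈ y.
Definition sact (s y z : N) := z ∈ sSg /\ z = opair (tq s (pfst y)) (img (tr s (pfst y)) (psnd y)).
Lemma shold_eq Q y Q' q : shold (opair ⌊Q⌋ y) ⌊opair Q' q⌋ <-> Q' = Q /\ ⌊q⌋ ∈ y.
Proof.
unfold shold. rewrite (inj_opair TV). split.
- intros (a&b&c&E1&E2&H). apply opair_inj in E1 as [<- <-], E2 as [E2 <-]. spt. now apply inj_inj.
- intros [-> H]. now exists ⌊Q⌋, y, ⌊q⌋.
Qed.
Lemma inj_tq s Q : s ∈ sAr -> tq ⌊s⌋ ⌊Q⌋ = ⌊tq s Q⌋.
Proof.
intro Hs. apply in_Ar in Hs as [->|(Q'&r&->&_)];[now rewrite (inj_emp TV), !tq_emp|now rewrite (inj_opair TV), !tq_pair].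
Qed.
Lemma inj_idr Q : ⌊idr Q⌋ = idr ⌊Q⌋.
Proof.
symmetry. apply (inj_ext TV).
- intros z Hz. unfold idr in Hz. apply in_lam in Hz as (x&Hx&->);[|def]. apply (in_inj TV) in Hx as (x'&<-&_).
 rewrite <- (inj_opair TV). apply inj_V.
- intro z. unfold idr. rewrite !in_lam by def. split.
 + intros (x&Hx&E). apply (in_inj TV) in Hx as (x'&<-&Hx). exists x'. spt. apply inj_inj. now rewrite (inj_opair TV).
 + intros (x&Hx&->). exists ⌊x⌋. spt. apply (inj_opair TV).
Qed.
Lemma inj_tr s Q : s ∈ sAr -> tr ⌊s⌋ ⌊Q⌋ = ⌊tr s Q⌋.
Proof.
intro Hs. apply in_Ar in Hs as [->|(Q'&r&->&_)];[now rewrite (inj_emp TV), !tr_emp, inj_idr|now rewrite (inj_opair TV), !tr_pair].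
Qed.
Lemma tq_K s Q : s ∈ sAr -> Q ∈ K -> tq s Q ∈ K.
Proof. intros Hs HQ. apply in_Ar in Hs as [->|(Q'&r&->&H&_)];[now rewrite tq_emp|now rewrite tq_pair]. Qed.
Lemma sact_eq s Q y z : s ∈ sAr -> Q ∈ K ->
 (sact ⌊s⌋ (opair ⌊Q⌋ y) z <-> z = opair ⌊tq s Q⌋ (img ⌊tr s Q⌋ y) /\ gen (tq s Q) (img ⌊tr s Q⌋ y)).
Proof.
intros Hs HQ. unfold sact. rewrite pfst_eq, psnd_eq, inj_tq, inj_tr by trivial. split.
- intros [A ->]. now apply Sg_pair in A.
- intros [-> A]. spt. apply Sg_pair. spt. now apply tq_K.
Qed.

Lemma small_image (A : VS) x : A ∈ K -> subset x ⌊A⌋ -> exists b r, b ∈ k /\ subset r (prod A (coll b)) /\ x = img ⌊r⌋ G.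
Proof.
intros HA Hs.
assert (EG : Gb G k = G).
{ apply ext. intro p. rewrite in_Gb. split;[tauto|]. intro Hp. spt. now apply (gen_G TV Hk hG). }
apply (@small_name N V ZN ZV TV k G Hk hG k A (small_k Hk)).
- apply Hi.
- exact (inacc_om Hi).
- intros g Hg. destruct (Card_K ACV Hi (x := prod A (coll g))) as (b&f&Hb&Hf);[apply (K_prod Hi);trivial;now apply coll_K|].
 now exists b, f.
- generalize (gen_Gb TV Hk hG (small_k Hk)). rewrite EG. intro H. rewrite (proof_irrelevance _ H (gen_G TV Hk hG)). now apply all_PW.
- trivial.
Qed.

Lemma img_Gb b A r : subset r (prod A (coll b)) -> img ⌊r⌋ G = img ⌊r⌋ (Gb G b).
Proof.
intro Hr. apply ext. intro u. rewrite !in_img. split;intros (p&Hp&H).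
- exists p. spt. destruct (pinj TV H eq_refl) as (u'&p'&<-&<-&H'). apply in_Gb. spt.
 specialize (Hr _ H'). apply in_prod2 in Hr as [_ Hr]. exact Hr.
- exists p. apply in_Gb in Hp as [Hp _]. now split.
Qed.
Lemma coll_mono_set b c : b ∈ k -> c ∈ k -> subset b c -> subset (coll b) (coll c).
Proof.
intros Hb Hc S p Hp. apply in_coll in Hp;[|exact (ord_mem (k_ord Hk) Hb)]. apply in_coll;[exact (ord_mem (k_ord Hk) Hc)|]. exact (coll_mono S Hp).
Qed.
Lemma Gb_stage b : b ∈ k -> opair ⌊coll b⌋ (Gb G b) ∈ sSg.
Proof. intro Hb. apply Sg_pair. split;[now apply coll_K|]. apply (gen_Gb TV Hk hG). now apply small_in. Qed.

(** The filter of a stage is a small subset of V, hence has a name bounded below [k]; that name is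
    an arrow from every sufficiently large collapse stage. Being images of a common collapse stage
    is how any two stages amalgamate. *)
Lemma stage_image z : z ∈ sSg -> exists b s, b ∈ k /\ s ∈ sAr /\
 forall c, c ∈ k -> subset b c -> sact ⌊s⌋ (opair ⌊coll c⌋ (Gb G c)) z.
Proof.
intro Hz. apply in_Sg in Hz as (Q&y&HQ&->&HG). destruct (@small_image Q y HQ) as (b&r&Hb&Hr&E);[apply HG|].
assert (Hs : opair Q r ∈ sAr).
{ apply in_Ar. right. exists Q, r. spa. apply (K_sub (x := prod Q (coll b)));trivial. apply (K_prod Hi);trivial. now apply coll_K. }
exists b, (opair Q r). spt. spt. intros c Hc S.
assert (Hr' : subset r (prod Q (coll c))).
{ intros p Hp. specialize (Hr p Hp). apply in_prod in Hr as (u&w&Hu&Hw&->). apply in_prod2. spt. now apply (coll_mono_set Hb Hc S). }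
apply sact_eq;trivial;[now apply coll_K|]. rewrite tq_pair, tr_pair, <- (img_Gb Hr'), <- E. now split.
Qed.

Definition sn : nsite sv.
Proof.
refine {| Sg := sSg;hold := shold : N -> N -> Prop;act := sact |}.
- unfold shold. def.
- unfold sact. def.
- intros s y z z' [_ ->] [_ ->]. trivial.
- intros s y z Hs Hy [H _]. exact H.
- intros z Hz. apply in_Sg in Hz as (Q&y&HQ&->&HG). change (idA sv) with (emp : VS). apply sact_eq;trivial;[apply in_Ar;now left|].
 rewrite tq_emp, tr_emp, inj_idr, img_idr by apply HG. now split.
- intros s t z z1 w Hs Ht Hz A. apply in_Sg in Hz as (Q&y&HQ&->&HG). change (comp sv s t) with (cmp s t).
 apply sact_eq in A as [-> A];trivial. rewrite (@sact_eq s (tq t Q) (img ⌊tr t Q⌋ y) w) by (trivial;now apply tq_K).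
 assert (Hc : cmp s t ∈ sAr) by exact (in_comp (v := sv) Hs Ht). rewrite sact_eq by trivial.
 pose proof Hs as Hs'. apply in_Ar in Hs' as [->|(Q1&r1&->&HQ1&Hr1)].
 + rewrite cmp_emp1, tq_emp, tr_emp, inj_idr, img_idr by apply A. reflexivity.
 + pose proof Ht as Ht'. apply in_Ar in Ht' as [->|(Q2&r2&->&HQ2&Hr2)].
 * rewrite cmp_emp2, !tq_emp, !tr_emp, !tq_pair, !tr_pair, inj_idr, img_idr by apply HG. reflexivity.
 * rewrite cmp_pair, !tq_pair, !tr_pair.
 assert (E : img ⌊rcomp r1 r2⌋ y = img ⌊r1⌋ (img ⌊r2⌋ y)).
 { rewrite <- img_rcomp. apply ext. intro u. rewrite !in_img. split;intros (p&Hp&H);exists p;spt.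
 - destruct (pinj TV H eq_refl) as (u'&p'&<-&<-&H'). apply in_rcomp in H' as (v&H1&H2).
 apply in_rcomp. exists ⌊v⌋. split;now apply (opinj TV).
 - apply in_rcomp in H as (v&H1&H2). destruct (pinj TV H1 eq_refl) as (u'&v'&<-&<-&H1').
 destruct (pinj TV H2 eq_refl) as (v2&p'&Ev&<-&H2'). apply inj_inj in Ev. subst v2.
 apply (opinj TV), in_rcomp. now exists v'. }
 rewrite E. reflexivity.
- intros z Hz. apply in_Sg in Hz as (Q&y&HQ&->&HG). pose proof HG as (_&(p&Hp)&_).
 destruct (gen_lift TV HG Hp) as (p'&<-&Hp'). exists (opair Q p'). split;[apply in_Cs;now exists Q, p'|]. now apply shold_eq.
- intros z c1 c2 Hz Hc1 Hc2 h1 h2. apply in_Sg in Hz as (Q&y&HQ&->&HG).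
 apply in_Cs in Hc1 as (Q1&q1&->&HQ1&Hq1), Hc2 as (Q2&q2&->&HQ2&Hq2).
 apply shold_eq in h1 as [-> h1], h2 as [-> h2]. destruct (gen_dir TV HG h1 h2) as (r&Hr&Hry&S1&S2).
 exists (opair Q r). split;[apply in_Cs;now exists Q, r|]. cbn [le sv]. rewrite !pfst_eq, !psnd_eq. spa. now apply shold_eq.
- intros z c' r c Hz Hc' Hr Hc h (E1&E2&E3&E4). apply in_Sg in Hz as (Q&y&HQ&->&HG).
 apply in_Cs in Hc' as (Q1&q1&->&HQ1&Hq1), Hc as (Q2&q2&->&HQ2&Hq2). apply shold_eq in h as [-> h].
 rewrite ?pfst_eq, ?psnd_eq in *. exists (opair ⌊tq r Q⌋ (img ⌊tr r Q⌋ y)). split.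
 + apply sact_eq;trivial. spt. rewrite E1. exact (fgen_snd TV HG h E2).
 + apply shold_eq. split;[congruence|]. exact (inn_snd TV HG h E3).
- intros z c1 r c w Hz Hc1 Hr Hc h A h'. apply in_Sg in Hz as (Q&y&HQ&->&HG).
 apply in_Cs in Hc1 as (Q1&q1&->&HQ1&Hq1), Hc as (Q2&q2&->&HQ2&Hq2). apply shold_eq in h as [-> h].
 apply sact_eq in A as [-> A];trivial. apply shold_eq in h' as [-> h'].
 destruct (fgen_cpl TV HG A h) as (a&Ha&Hay&S1&Fg). destruct (inn_cplV TV HG h' Hay) as (b&Hby&Hb&S2&Ib).
 exists (opair Q b). split;[apply in_Cs;now exists Q, b|]. cbn [le ex sv]. rewrite !pfst_eq, !psnd_eq. split.
 + spa. exact (subT S1 S2).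
 + split;[now apply shold_eq|]. spa;try (exact (fgen_mono Fg S2 q1 H H0));now apply (fgen_mono Fg S2).
- intros z c s t Hz Hc Hs Ht h (E1&E2&E3). apply in_Sg in Hz as (Q&y&HQ&->&HG).
 apply in_Cs in Hc as (Q1&q1&->&HQ1&Hq1). apply shold_eq in h as [-> h]. rewrite ?pfst_eq, ?psnd_eq in *.
 exists (opair ⌊tq s Q⌋ (img ⌊tr s Q⌋ y)). assert (Gs := fgen_snd TV HG h E2). assert (Es := same_snd TV HG h E3).
 split;apply sact_eq;trivial;[now split|]. rewrite <- Es, <- E1. now split.
- intros z c1 s t w Hz Hc1 Hs Ht h A B. apply in_Sg in Hz as (Q&y&HQ&->&HG).
 apply in_Cs in Hc1 as (Q1&q1&->&HQ1&Hq1). apply shold_eq in h as [-> h].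
 apply sact_eq in A as [-> A];trivial. apply sact_eq in B as [E B];trivial. apply opair_inj in E as [E1 E2]. apply inj_inj in E1.
 destruct (fgen_cpl TV HG A h) as (a&Ha&Hay&S1&Fg). destruct (same_cpl TV HG E2 Hay) as (b&Hb&Hby&S2&Sm).
 exists (opair Q b). split;[apply in_Cs;now exists Q, b|]. cbn [le eqA sv]. rewrite !pfst_eq, !psnd_eq. split.
 + spa. exact (subT S1 S2).
 + split;[now apply shold_eq|]. spt. split;[exact (fgen_mono Fg S2)|trivial].
- intros z1 z2 H1 H2. destruct (stage_image H1) as (b1&s1&Hb1&Hs1&K1), (stage_image H2) as (b2&s2&Hb2&Hs2&K2).
 destruct (ord_max (k_ord Hk) Hb1 Hb2) as (b&Hb&S1&S2). assert (A1 := K1 b Hb S1). assert (A2 := K2 b Hb S2).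
 exists (opair ⌊coll b⌋ (Gb G b)), s1, s2. spa;[now apply Gb_stage|..];first [apply A1|apply A2].
- intros X z HX Hz. apply in_Sg in Hz as (Q&y&HQ&->&HG).
 (* The dichotomy for [y] concerns those p above which nothing is ruled out by some c and r in [X].
    If [y] contains such a p, [lift_generic] produces the required stage over [y]; otherwise a p in
    [y] with no such extension serves, as [proj_ex] shows. *)
 destruct (@gen_dich _ _ _ (fun p => exists c r, c ∈ sCs /\ r ∈ sAr /\ X c r /\ tq r (pfst c) = Q /\ fgen (pfst c) (psnd c) (tr r (pfst c)) Q /\
 forall r2, r2 ∈ Q -> subset p r2 -> exists q2, q2 ∈ pfst c /\ subset (psnd c) q2 /\ inn (pfst c) q2 (tr r (pfst c)) r2) Q y)
 as [(p&Hp&Hy&c&r&Hc&Hr&HXc&E1&Fg&Ep)|(p&Hp&Hy&U)];trivial;[def| |].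
 + left. pose proof Hc as Hc'. apply in_Cs in Hc' as (Q'&q'&->&HQ'&Hq'). rewrite ?pfst_eq, ?psnd_eq in *.
 destruct (lift_generic HQ' Hq' Fg HG Hy Ep) as (y'&HG'&Hq'y&Ei).
 exists (opair Q' q'), r, (opair ⌊Q'⌋ y'). spt. spt. spt. split;[now apply Sg_pair|].
 split;[now apply shold_eq|]. apply sact_eq;trivial. rewrite E1, Ei. now split.
 + right. exists (opair Q p). split;[apply in_Cs;now exists Q, p|]. split;[now apply shold_eq|].
 intros c r Hc Hr HXc (E1&E2&E3&E4). pose proof Hc as Hc'. apply in_Cs in Hc' as (Q'&q'&->&HQ'&Hq'). rewrite ?pfst_eq, ?psnd_eq in *.
 destruct (proj_ex Hq' E2 E3 Hp) as (r1&Hr1&S1&Er). apply (U r1);trivial.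
 exists (opair Q' q'), r. rewrite !pfst_eq, !psnd_eq. spa;now apply E2.
Defined.
End Site.

Lemma sat_total (S : structure) (C : S -> Prop) : (forall x, C x) -> forall f (u : nat -> restrict C),
 sat u f <-> sat (fun i => proj1_sig (u i)) f.
Proof.
intros HC f. induction f as [i j|i j|g IH|g IHg h IHh|g IH];intro u;simpl.
- reflexivity.
- split;[now intros ->|]. intro E. destruct (u i) as [x Hx], (u j) as [y Hy]. simpl in E. subst. f_equal. apply proof_irrelevance.
- now rewrite IH.
- now rewrite IHg, IHh.
- assert (E : forall x : restrict C, (fun i => proj1_sig (scons x u i)) = scons (proj1_sig x) (fun i => proj1_sig (u i)))
 by (intro x;apply fext;now intros []).
 split;intros H x.
 + assert (K := proj1 (IH _) (H (exist _ x (HC x)))). now rewrite E in K.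
 + apply IH. rewrite E. apply H.
Qed.

(** * Reflection below a Mahlo cardinal *)
Section Reflection.
Context {N : structure} {V : N -> Prop} {ZN : ZFm N} {ZV : ZFm (restrict V)}.
Notation VS := (restrict V).
Notation "'⌊' x '⌋'" := (@inj N V x).
Hypothesis TV : transitive_class V.
Hypothesis ACV : ax_choice VS.
Variables (k : VS) (G : N).
Hypothesis Hk : Mahlo k.
Hypothesis hG : collapse_generic k G.
Hypothesis hN : forall x : N, exists t : N, V t /\ is_val G t x.
Notation K := (Vr k).
Let Hi : inaccessible k := k_inacc Hk.

(** As N = V[G], the parameters of a formula defining [R] have names, and the truth lemma of the
    collapse turns [R] into a forcing relation definable over V. *)
Lemma forcing_rel (R : N -> Prop) : Def1 R -> exists Fo : VS -> VS -> Prop, Def2 Fo /\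
 (forall u q, ⌊q⌋ ∈ G -> Fo u q -> R ⌊u⌋) /\
 (forall u, R ⌊u⌋ -> exists q, q ∈ coll k /\ ⌊q⌋ ∈ G /\ Fo u q) /\
 (forall u q q', q' ∈ coll k -> subset q q' -> Fo u q -> Fo u q').
Proof.
intro HR. destruct (Def1_sat emp HR) as (f&e&He).
assert (HG := gen_G TV Hk hG).
assert (nms : forall x : N, exists t : VS, x = pval TV HG ⌊t⌋).
{ intro x. apply PW_eq. rewrite (proof_irrelevance _ HG (gen_G TV Hk hG)). now apply all_PW. }
pose (te := fun i => proj1_sig (cid _ (nms (e i)))).
assert (Ete : forall i, e i = pval TV HG ⌊te i⌋) by (intro i;apply (proj2_sig (cid _ (nms (e i))))).
pose (tt := fun u i => match i with 0 => chk (pv (coll k)) u | S j => te j end).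
assert (Al : forall x, PW TV HG x) by (intro x;apply PW_eq, nms).
assert (TT : forall u, R ⌊u⌋ <-> exists c, c ∈ coll k /\ ⌊c⌋ ∈ G /\ fo (coll k) f c (tt u)).
{ intro u. rewrite He. pose (w := fun i => exist (PW TV HG) (scons ⌊u⌋ e i) (Al _)).
 rewrite <- (ptruth (HG := HG) f (t := tt u) (u := w)).
 - rewrite (sat_total Al). reflexivity.
 - intros [|i];simpl;[now rewrite pval_chk|apply Ete]. }
exists (fun u q => fo (coll k) f q (tt u)). split;[|split;[|split]].
- pose proof (chk_def (pv (coll k))).
 refine (@F_def N V ZV (pv (coll k)) f (fun v => v 1) (fun _ _ => emp) (fun i v => tt (v 0) i) _ _ _);[def|intro;def|].
 intros [|i];simpl;def.
- intros u q Hq HF. apply TT. exists q. split;[|now split]. exact (gen_in HG Hq).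
- intros u Hu. now apply TT.
- intros u q q' Hq' S HF. exact (fo_le Hq' S HF).
Qed.

Lemma k_lim : limit_ordinal k. Proof. apply Hi. Qed.
Lemma k_succ b : b ∈ k -> succ b ∈ k.
Proof. intro Hb. destruct k_lim as (_&_&H). destruct (H b Hb) as (z&Hz&Hzk). apply is_succ_eq in Hz. now subst. Qed.
Lemma ord_in_k b : b ∈ k -> ordinal b. Proof. apply ord_mem, (k_ord Hk). Qed.

(** Read [X d u q] as: q forces a witness of rank d for u. Closing under bounds for all u in [A g]
    and all p in [coll g] gives a regular [a] at which the decisive conditions are dense in
    [coll a], so the initial part of [G] contains one. *)
Lemma reflect_rel (Z0 g0 : VS) (A : VS -> VS) (X : VS -> VS -> VS -> Prop) :
 Z0 ∈ K -> g0 ∈ k -> DF1 A -> Def3 X -> (forall g, g ∈ k -> A g ∈ K) ->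
 (forall g g', subset g g' -> subset (A g) (A g')) -> (forall d d' u q, X d u q -> subset d d' -> X d' u q) ->
 exists a, a ∈ k /\ regular a /\ g0 ∈ a /\ om ∈ a /\
 (forall g, g ∈ a -> exists b f, b ∈ a /\ is_surj f b (prod Z0 (coll g))) /\
 forall g u, g ∈ a -> u ∈ A g -> exists q, q ∈ coll a /\ ⌊q⌋ ∈ G /\
 ((exists d, d ∈ a /\ X d u q) \/ (forall q', q' ∈ coll k -> subset q q' -> forall d, d ∈ k -> ~ X d u q')).
Proof.
intros HZ Hg0 HA HX KA MA MX.
(* Decisive outcomes: either a witness below d is forced, or no extension ever forces a witness
   below [k]. *)
pose (X' := fun d u q => X d u q \/ (forall q', q' ∈ coll k -> subset q q' -> forall d', d' ∈ k -> ~ X d' u q')).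
assert (MX' : forall d d' u q, X' d u q -> subset d d' -> X' d' u q) by (intros d d' u q [H|H] S;[left;eauto|now right]).
assert (HX' : Def3 X') by (unfold X';def).
pose (R1 := fun z d => exists q, collapse d q /\ q ∈ coll k /\ subset (psnd z) q /\ X' d (pfst z) q).
assert (HR1 : Def2 R1) by (unfold R1;def).
assert (MR1 : forall z d d', R1 z d -> subset d d' -> R1 z d').
{ intros z d d' (q&Hq&Hqk&S&H) Sd. exists q. split;[exact (coll_mono Sd Hq)|]. spt. spt. exact (MX' _ _ _ _ H Sd). }
pose (R2 := fun g d => exists b f, b ∈ d /\ is_surj f b (prod Z0 (coll g))).
assert (HR2 : Def2 R2) by (unfold R2;def).
assert (T1 : forall g, g ∈ k -> exists d, d ∈ k /\ forall z, z ∈ prod (A g) (coll g) -> R1 z d).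
{ intros g Hg. apply (@Card_bd_rel VS ZV k Hi (prod (A g) (coll g)) R1);trivial.
 - apply (Card_K ACV Hi), (K_prod Hi);[now apply KA|now apply (coll_K Hi)].
 - intros z Hz. apply in_prod in Hz as (u&p&Hu&Hp&->). unfold R1. rewrite pfst_eq, psnd_eq.
 assert (Hpk : p ∈ coll k).
 { apply in_coll;[exact (k_ord Hk)|]. apply in_coll in Hp;[|now apply ord_in_k]. apply (coll_mono (b := g));trivial. exact (proj1 (k_ord Hk) g Hg). }
 destruct (classic (exists q d, q ∈ coll k /\ subset p q /\ d ∈ k /\ X d u q)) as [(q&d&Hq&S&Hd&H)|C].
 + pose proof Hq as Hq'. apply in_coll in Hq';[|exact (k_ord Hk)]. destruct (coll_bound k_lim Hq') as (b&Hb&Hqb).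
 destruct (ord_max (k_ord Hk) Hd Hb) as (c&Hc&S1&S2). exists c. spt. exists q. split;[exact (coll_mono S2 Hqb)|].
 spt. spt. left. exact (MX _ _ _ _ H S1).
 + exists g. spt. exists p. split;[apply in_coll;trivial;now apply ord_in_k|]. spt. split;[apply sub_refl|].
 right. intros q' Hq' S d Hd H. apply C. now exists q', d. }
assert (T2 : forall g, g ∈ k -> exists d, d ∈ k /\ R2 g d).
{ intros g Hg. destruct (Card_K ACV Hi (x := prod Z0 (coll g))) as (b&f&Hb&Hf);[apply (K_prod Hi);trivial;now apply (coll_K Hi)|].
 exists (succ b). split;[now apply k_succ|]. exists b, f. spt. apply in_succ. now right. }
destruct (ord_max (k_ord Hk) Hg0 (inacc_om Hi)) as (g1&Hg1&S0&S1).
destruct (@Mahlo_closure VS ZV k (fun g d => (forall z, z ∈ prod (A g) (coll g) -> R1 z d) /\ R2 g d) g1 Hk) as (a&Ha&Ra&Hga&Cl);trivial.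
{ def. }
{ intros g Hg. destruct (T1 g Hg) as (d1&Hd1&H1), (T2 g Hg) as (d2&Hd2&(b&f&Hb&Hf)).
 destruct (ord_max (k_ord Hk) Hd1 Hd2) as (c&Hc&Sa&Sb). exists c. spt. split;[intros z Hz;exact (MR1 _ _ _ (H1 z Hz) Sa)|].
 exists b, f. spt. now apply Sb. }
assert (Oa : ordinal a) by now apply ord_in_k.
assert (La : limit_ordinal a) by apply Ra.
assert (le_in : forall g, g ∈ k -> subset g g1 -> g ∈ a).
{ intros g Hg S. destruct (ord_sub (ord_in_k Hg) (ord_in_k Hg1) S) as [E|E];[exact (proj1 Oa g1 Hga g E)|now subst]. }
exists a. spt. spt. split;[now apply le_in|]. split;[apply le_in;trivial;exact (inacc_om Hi)|]. split.
{ intros g Hg. destruct (Cl g Hg) as (d&Hd&_&b&f&Hb&Hf). exists b, f. spt. exact (proj1 Oa d Hd b Hb). }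
intros g u Hg Hu. assert (HGa := gen_Gb TV Hk hG (small_in Hk Ha)).
pose (D := fun q => exists d, d ∈ a /\ X' d u q).
assert (HD : Def1 D) by (unfold D;def).
destruct (gen_dich HD HGa) as [(q&Hq&Hy&d&Hd&H)|(p&Hp&Hy&U)].
- exists q. spt. split;[now apply in_Gb in Hy|]. destruct H as [H|H];[left;now exists d|now right].
- exfalso. apply in_coll in Hp;trivial. destruct (coll_bound La Hp) as (b&Hb&Hpb).
 destruct (ord_max Oa Hg Hb) as (c&Hc&Sg'&Sb).
 destruct (Cl c Hc) as (d&Hd&H&_). destruct (H (opair u p)) as (q&Hq&Hqk&S&HXq).
 { apply in_prod2. split;[now apply (MA g c)|]. apply in_coll;[exact (ord_mem Oa Hc)|]. exact (coll_mono Sb Hpb). }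
 rewrite pfst_eq, psnd_eq in *. apply (U q);trivial;[|now exists d].
 apply in_coll;trivial. apply (coll_mono (b := d));trivial. exact (proj1 Oa d Hd).
Qed.

(** [A g] holds the names of arguments and [B d] those of possible witnesses. A true instance rules
    out the negative outcome of [reflect_rel], so a witness named below [a] is forced by a condition
    in the initial part of [G]; this is the form in which Mahloness is used. *)
Lemma reflect (Z0 g0 : VS) (A B : VS -> VS) (R : N -> Prop) :
 Z0 ∈ K -> g0 ∈ k -> DF1 A -> DF1 B -> Def1 R -> (forall g, g ∈ k -> A g ∈ K) ->
 (forall g g', subset g g' -> subset (A g) (A g')) -> (forall g g', subset g g' -> subset (B g) (B g')) ->
 exists a (Fo : VS -> VS -> Prop), a ∈ k /\ regular a /\ g0 ∈ a /\ om ∈ a /\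
 (forall g, g ∈ a -> exists b f, b ∈ a /\ is_surj f b (prod Z0 (coll g))) /\
 Def2 Fo /\ (forall u q, ⌊q⌋ ∈ G -> Fo u q -> R ⌊u⌋) /\
 (forall u q q', q' ∈ coll k -> subset q q' -> Fo u q -> Fo u q') /\
 forall g u d w, g ∈ a -> u ∈ A g -> d ∈ k -> w ∈ B d -> R ⌊opair u w⌋ ->
 exists d w q, d ∈ a /\ w ∈ B d /\ q ∈ coll a /\ ⌊q⌋ ∈ G /\ Fo (opair u w) q.
Proof.
intros HZ Hg0 HA HB HR KA MA MB. destruct (forcing_rel HR) as (Fo&HF&F1&F2&F3).
destruct (@reflect_rel Z0 g0 A (fun d u q => exists w, w ∈ B d /\ Fo (opair u w) q)) as (a&Ha&Ra&Hga&Hom&Hs&H);trivial.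
{ def. }
{ intros d d' u q (w&Hw&Hq) S. exists w. spt. now apply (MB d d'). }
exists a, Fo. do 8 (spt). intros g u d w Hg Hu Hd Hw Rw.
destruct (H g u Hg Hu) as (q&Hq&Hy&[(d'&Hd'&w'&Hw'&Hf)|U]);[now exists d', w', q|].
exfalso. destruct (F2 _ Rw) as (q1&Hq1&Hy1&Hf). destruct (gen_dir TV (gen_G TV Hk hG) Hy Hy1) as (r&Hr&Hry&S1&S2).
apply (U r Hr S1 d Hd). exists w. spt. exact (F3 _ _ _ Hr S2 Hf).
Qed.
End Reflection.

(** * The model of all values at small stages *)

Section Solovay.
Context {N : structure} {V : N -> Prop} {ZN : ZFm N} {ZV : ZFm (restrict V)}.
Notation VS := (restrict V).
Notation "'⌊' x '⌋'" := (@inj N V x).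
Hypothesis TV : transitive_class V.
Hypothesis ACN : ax_choice N.
Hypothesis ACV : ax_choice VS.
Variables (k : VS) (G : N).
Hypothesis Hk : Mahlo k.
Hypothesis hG : collapse_generic k G.
Hypothesis hN : forall x : N, exists t : N, V t /\ is_val G t x.
Notation K := (Vr k).
Let Hi : inaccessible k := k_inacc Hk.

Lemma rk_pval Q y (HG : gen Q y) t : subset (rk (pval TV HG t)) (rk t).
Proof.
pose proof (pval_def TV HG) as Hp. pose proof (@DF_rk N ZN). revert t.
apply (mem_ind_tc (P := fun t => subset (rk (pval TV HG t)) (rk t)));[def|].
intros t IH u Hu. apply in_rk in Hu as (x&Hx&Hu). apply in_pval in Hx as (s&e&Hs&He&->).
assert (H1 : rk s ∈ rk t).
{ apply (proj1 (rk_ord t) (rk (opair s e)));[now apply rk_mem|].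
 assert (E : sing s ∈ opair s e) by (unfold opair;apply in_upair;now left).
 apply (proj1 (rk_ord (opair s e)) (rk (sing s)));[now apply rk_mem|]. apply rk_mem. now apply in_sing. }
assert (S : subset (rk (pval TV HG s)) (rk s)) by (apply IH;now apply (tc_opair Hs)).
apply in_succ in Hu as [Hu| ->];[exact (proj1 (rk_ord t) _ H1 u (S u Hu))|].
destruct (ord_sub (rk_ord _) (rk_ord _) S) as [E|E];[exact (proj1 (rk_ord t) _ H1 _ E)|now rewrite E].
Qed.

Lemma inj_rk (x : VS) : rk ⌊x⌋ = ⌊rk x⌋.
Proof.
pose proof (@DF_rk N ZN) as HN. pose proof (@DF_rk VS ZV) as HV.
pose (g := lam (tc (sing x)) rk : VS).
assert (Ag : forall y, y ∈ tc (sing x) -> ap ⌊g⌋ ⌊y⌋ = ⌊rk y⌋).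
{ intros y Hy. rewrite (inj_ap TV (y := rk y));[unfold g;now rewrite (ap_lam HV Hy)|now apply lam_functional|now apply in_lam2]. }
assert (KK : forall y : N, y ∈ ⌊tc (sing x)⌋ -> rk y = ap ⌊g⌋ y).
{ apply (mem_ind (P := fun y => y ∈ ⌊tc (sing x)⌋ -> rk y = ap ⌊g⌋ y));[def|].
 intros y IH Hy. apply (in_inj TV) in Hy as (y'&<-&Hy). rewrite Ag by trivial.
 assert (IH' : forall v, v ∈ y' -> rk ⌊v⌋ = ⌊rk v⌋).
 { intros v Hv. assert (Hv' : v ∈ tc (sing x)) by exact (tc_trans Hy Hv). rewrite <- Ag by trivial. now apply IH. }
 apply (inj_ext TV).
 - intros z Hz. apply in_rk in Hz as (w&Hw&Hz). apply (in_inj TV) in Hw as (v&<-&Hv). rewrite IH' in Hz by trivial.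
 rewrite <- (inj_succ TV) in Hz. apply (in_inj TV) in Hz as (z'&<-&_). apply inj_V.
 - intro z. rewrite !in_rk. split.
 + intros (w&Hw&Hz). apply (in_inj TV) in Hw as (v&<-&Hv). rewrite IH' in Hz by trivial. exists v. spt.
 rewrite <- (inj_succ TV) in Hz. exact Hz.
 + intros (v&Hv&Hz). exists ⌊v⌋. spt. rewrite IH' by trivial. rewrite <- (inj_succ TV). exact Hz. }
assert (Hx : x ∈ tc (sing x)) by (apply tc_sub;now apply in_sing).
rewrite <- Ag by trivial. now apply KK.
Qed.

(** The rank of a value is at most that of its name and rank is absolute for V, so an ordinal of N
    is bounded by one of V. *)
Lemma ord_in_V a : ordinal a -> V a.
Proof.
intro Oa. destruct (proj1 (PW_eq _ _ _) (all_PW TV Hk hG hN a)) as (t&E).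
assert (S : subset a ⌊rk t⌋).
{ rewrite <- inj_rk. rewrite <- (rk_ordinal Oa), E. apply rk_pval. }
assert (Ob : ordinal ⌊rk t⌋) by (apply (inj_ord TV), rk_ord).
destruct (ord_sub Oa Ob S) as [H| ->];[|apply inj_V]. apply (in_inj TV) in H as (b&<-&_). apply inj_V.
Qed.

Definition SN : nsite (sv Hk) := sn TV ACN ACV Hk hG hN.
Definition SW : N -> Prop := W SN.
Lemma SN_stage b : b ∈ k -> opair ⌊coll b⌋ (Gb G b) ∈ Sg SN.
Proof. apply (Gb_stage TV Hk hG). Qed.
Lemma SN_ne : exists z, z ∈ Sg SN.
Proof. eexists. apply SN_stage. exact (inacc_om Hi). Qed.
Lemma SW_ZF : ZF (restrict SW). Proof. exact (ZF_W TV SN_ne). Qed.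
Lemma SW_trans : transitive_class SW. Proof. exact (W_trans TV (T := SN)). Qed.
Lemma SW_V (x : VS) : SW ⌊x⌋. Proof. exact (W_V TV SN_ne x). Qed.

(** Choose for each n a code of e(n): a name, an arrow and a bound beyond which the collapse stages
    lead along that arrow to the right stage. Reflecting the sequence of codes gives a single [a] at
    which all of it is forced, and a name over the stage of [a] collects the values. *)
Lemma SW_countable P x e : SW P -> subset x P -> (forall u, u ∈ x -> exists n, n ∈ om /\ ap e n = u) -> SW x.
Proof.
intros HP Sx He. pose proof HP as (t1&z1&Hz1&EP).
set (St := fun c : N => opair c (sep G (fun p => p ∈ c))).
assert (HSt : DF1 St) by (unfold St;def).
pose (cf := ⌊lam k coll⌋).
assert (Hcf : forall c, c ∈ k -> ap cf ⌊c⌋ = ⌊coll c⌋).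
{ intros c Hc. assert (Hd : DF1 (fun c : VS => coll c)) by def. unfold cf.
 rewrite (inj_ap TV (y := coll c));[now rewrite (ap_lam Hd Hc)|now apply lam_functional|now apply in_lam2]. }
assert (HStE : forall c, c ∈ k -> St (ap cf ⌊c⌋) = opair ⌊coll c⌋ (Gb G c)) by (intros c Hc;rewrite Hcf;trivial).
pose (D := prod (tc t1) (prod (sAr k) k)).
pose (Rl := fun n w => exists z, z ∈ Sg SN /\ ap e n = val SN (pfst w) z /\
 forall c, c ∈ ⌊k⌋ -> subset (psnd (psnd w)) c -> act SN (pfst (psnd w)) (St (ap cf c)) z).
assert (HRl : Def2 Rl).
{ unfold Rl. pose proof (val_def SN). pose proof (def_act SN). def. }
pose (I0 := sep om (fun n => ap e n ∈ x)).
assert (HI0 : forall n, n ∈ I0 <-> n ∈ om /\ ap e n ∈ x) by (intro n;unfold I0;rewrite in_sep by def;reflexivity).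
destruct (@AC_rel N ZN ACN Rl I0 ⌊D⌋ HRl) as (f&Hf&Hfr).
{ intros n Hn. apply HI0 in Hn as [Hn Hx].
 destruct (@W_in N V ZN ZV TV _ SN (exist _ P HP) t1 z1 (ap e n) Hz1 EP (Sx _ Hx)) as (s&z&Hs&Hz&E).
 destruct (stage_image TV ACV Hk hG hN Hz) as (b&r&Hb&Hr&A). exists ⌊opair s (opair r b)⌋. split.
 - apply inj_mem. unfold D. now rewrite !in_prod2.
 - unfold Rl. exists z. spt. rewrite !(inj_opair TV), !psnd_eq, !pfst_eq. spt.
 intros c Hc Sc. apply (in_inj TV) in Hc as (c'&<-&Hc). rewrite HStE by trivial. apply A;trivial. now apply (inj_sub TV). }
destruct (@reflect N V ZN ZV TV ACV k G Hk hG hN emp emp (fun _ => om) (fun d => sep D (fun w => psnd (psnd w) ∈ d)) (fun p => p ∈ f))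
 as (a&Fo&Ha&_&_&Hom&_&HFo&F1&_&F2).
{ apply in_Vr. exists emp. split;[|intros w Hw;now apply in_emp in Hw].
 exact (proj1 (k_ord Hk) om (inacc_om Hi) emp om_emp). }
{ exact (proj1 (k_ord Hk) om (inacc_om Hi) emp om_emp). }
{ def. } { def. } { def. }
{ intros g Hg. exact (K_ord Hi (inacc_om Hi)). }
{ intros g g' _. apply sub_refl. }
{ intros g g' S w Hw. apply in_sep in Hw as [Hw Hd];[|def]. apply in_sep;[def|]. split;auto. }
pose (X := sep (prod (prod om D) (coll a)) (fun z => Fo (pfst z) (psnd z) /\ psnd (psnd (psnd (pfst z))) ∈ a)).
assert (HX : forall n w q, opair (opair n w) q ∈ X <-> n ∈ om /\ w ∈ D /\ q ∈ coll a /\ Fo (opair n w) q /\ psnd (psnd w) ∈ a).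
{ intros n w q. unfold X. rewrite in_sep by def. rewrite !in_prod2, !pfst_eq, !psnd_eq. tauto. }
(* The label is a span with apex condition (coll a, q): the identity leads back to the stage of [a],
   and the arrow [r] leads to the stage where the name [t] is evaluated. *)
pose (nf := fun z : VS => opair (pfst (psnd (pfst z))) (opair (opair (coll a) (psnd z)) (opair emp (pfst (psnd (psnd (pfst z))))))).
assert (Hnf : DF1 nf) by (unfold nf;def).
pose (S0 := opair ⌊coll a⌋ (Gb G a)). assert (HS0 : S0 ∈ Sg SN) by now apply SN_stage.
exists (repl X nf), S0. spt.
assert (valid : forall n t r b q, opair (opair n (opair t (opair r b))) q ∈ X -> ⌊q⌋ ∈ G ->
 exists z, ⌊n⌋ ∈ I0 /\ z ∈ Sg SN /\ act SN ⌊r⌋ S0 z /\ ap e ⌊n⌋ = val SN ⌊t⌋ z).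
{ intros n t r b q Hq Gq. apply HX in Hq as (Hn&HD&Hqa&HF&Hb). rewrite !psnd_eq in Hb.
 assert (Hff := F1 _ _ Gq HF). rewrite (inj_opair TV) in Hff. pose proof Hf as Hf'. apply is_fun_eq in Hf' as (P1&P2&_).
 destruct (P1 _ Hff) as (n'&w'&Hn'&Hw'&E). apply opair_inj in E as [<- <-].
 assert (Ev : ap f ⌊n⌋ = ⌊opair t (opair r b)⌋) by exact (P2 _ _ _ (proj2 (fun_ap Hf Hn')) Hff).
 destruct (Hfr _ Hn') as (z&Hz&E1&E2). rewrite Ev, !(inj_opair TV) in E1, E2. rewrite !pfst_eq in E1. rewrite !psnd_eq, !pfst_eq in E2.
 exists z. spt. spt. spt. unfold S0. rewrite <- HStE by trivial. apply E2;[exact Ha|].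
 apply (inj_sub TV). exact (proj1 (ord_mem (k_ord Hk) Ha) b Hb). }
apply ext. intro u. rewrite (in_valV TV) by trivial. split.
- intro Hu. destruct (He u Hu) as (n&Hn&E). assert (Hn0 : n ∈ I0) by (apply HI0;now rewrite E).
 destruct (fun_ap Hf Hn0) as [HD Hpair]. apply (in_inj TV) in HD as (w&Ew&HD). rewrite <- Ew in Hpair.
 rewrite <- (inj_om TV) in Hn. apply (in_inj TV) in Hn as (n'&<-&Hn).
 pose proof HD as HD'. apply in_prod in HD' as (t&rb&Ht&Hrb&->). apply in_prod in Hrb as (r&b&Hr&Hb&->).
 destruct (F2 emp n' (succ b) (opair t (opair r b))) as (d&w&q&Hd&Hw&Hq&Gq&HF).
 + exact (proj1 (ord_mem (k_ord Hk) Ha) om Hom emp om_emp).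
 + trivial.
 + now apply k_succ.
 + apply in_sep;[def|]. spt. rewrite !psnd_eq. apply in_succ. now right.
 + now rewrite (inj_opair TV).
 + apply in_sep in Hw as [HwD Hwd];[|def].
 assert (Hff := F1 _ _ Gq HF). rewrite (inj_opair TV) in Hff. pose proof Hf as Hf'. apply is_fun_eq in Hf' as (_&P2&_).
 assert (Ev := P2 _ _ _ Hpair Hff). apply inj_inj in Ev. subst w. rewrite !psnd_eq in Hwd.
 assert (HXq : opair (opair n' (opair t (opair r b))) q ∈ X).
 { apply HX. rewrite !psnd_eq. spa. exact (proj1 (ord_mem (k_ord Hk) Ha) d Hd b Hwd). }
 destruct (valid _ _ _ _ _ HXq Gq) as (z&_&Hz&A&Ez).
 exists t, (opair (opair (coll a) q) (opair emp r)), S0, z. cbn [lc la lb sv].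
 rewrite ?pfst_eq, ?psnd_eq, ?pfst_eq, ?psnd_eq. spa.
 * apply in_repl;trivial. eexists. split;[exact HXq|]. unfold nf. now rewrite ?pfst_eq, ?psnd_eq, ?pfst_eq, ?psnd_eq.
 * cbn [Es sv]. rewrite !in_prod2. spa;[|apply in_Ar;now left]. apply in_Cs. exists (coll a), q. spa. now apply (coll_K Hi).
 * apply (shold_eq TV). spt. apply in_Gb. now split.
 * apply (act_id (n := SN) HS0).
 * now rewrite <- E.
- intros (s&e0&y&z&Hs&He0&Hy&h&A1&A2&Hz&->). apply in_repl in Hs as (p&Hp&E);trivial.
 pose proof Hp as Hp'. unfold X in Hp'. apply in_sep in Hp' as [Hp' _];[|def].
 apply in_prod in Hp' as (nw&q&Hnw&Hq&->). apply in_prod in Hnw as (n&w&Hn&HD&->).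
 pose proof HD as HD'. apply in_prod in HD' as (t&rb&Ht&Hrb&->). apply in_prod in Hrb as (r&b&Hr&Hb&->).
 unfold nf in E. rewrite ?pfst_eq, ?psnd_eq, ?pfst_eq, ?psnd_eq in E. apply opair_inj in E as [-> ->].
 cbn [lc la lb sv] in h, A1, A2. rewrite !pfst_eq in h. rewrite !psnd_eq, !pfst_eq in A1. rewrite !psnd_eq in A2.
 assert (EyS : y = S0).
 { exact (act_fun (act_id (n := SN) Hy) A1). }
 subst y. apply (shold_eq TV) in h as [_ h]. apply in_Gb in h as [Gq _].
 destruct (valid _ _ _ _ _ Hp Gq) as (z'&Hn0&Hz'&A&Ez).
 rewrite (act_fun A2 A), <- Ez. now apply HI0.
Qed.

Lemma SW_real w r : is_omega w -> subset r w -> SW r.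
Proof.
intros Hw Hr. apply is_omega_eq in Hw. subst w. apply (@SW_countable om r (lam om (fun n => n)));trivial.
- rewrite <- (inj_om TV). apply SW_V.
- intros u Hu. exists u. split;[auto|]. apply ap_lam;[def|auto].
Qed.

Lemma in_LR_SW x : in_LR x -> SW x.
Proof.
intro H. apply H;[exact SW_trans|exact SW_ZF| |exact SW_real].
intros a Oa. destruct (inj_lift (ord_in_V Oa)) as (b&<-). apply SW_V.
Qed.

(** The nice name [r] recast as a name of the site: the condition q becomes the span with apex (Q,q)
    and two identity arrows. *)
Definition img_name (Q r : VS) : VS :=
 repl r (fun z => opair (chk (sv Hk) (pfst z)) (opair (opair Q (psnd z)) (opair emp emp))).
Lemma val_img_name Q y A r : Q ∈ K -> gen Q y -> subset r (prod A Q) -> val SN ⌊img_name Q r⌋ (opair ⌊Q⌋ y) = img ⌊r⌋ y.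
Proof.
intros HQ HG Hr. pose proof (chk_def (sv Hk)) as HC. assert (HS : opair ⌊Q⌋ y ∈ Sg SN) by (apply (Sg_pair TV);now split).
assert (E0 : (emp : VS) ∈ sAr k) by (apply in_Ar;now left).
apply ext. intro u. rewrite (in_valV TV) by trivial. rewrite in_img. split.
- intros (s&e0&y1&z&Hs&He0&Hy&h&A1&A2&Hz&->). apply in_repl in Hs as (p&Hp&E);[|def].
 assert (Hp' := Hr p Hp). apply in_prod in Hp' as (w&q&Hw&Hq&->). rewrite !pfst_eq, !psnd_eq in E. apply opair_inj in E as [-> ->].
 cbn [lc la lb sv] in h, A1, A2. rewrite !pfst_eq in h. rewrite !psnd_eq, !pfst_eq in A1. rewrite !psnd_eq in A2.
 assert (Ey := act_fun (act_id (n := SN) Hy) A1). subst y1. apply (shold_eq TV) in h as [_ h].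
 rewrite (val_chk TV) by trivial. exists ⌊q⌋. spt. now apply (opinj TV).
- intros (q&Hq&H). destruct (pinj TV H eq_refl) as (w&p&<-&<-&Hwp).
 assert (Hp' := Hr _ Hwp). apply in_prod2 in Hp' as [Hw Hp].
 exists (chk (sv Hk) w), (opair (opair Q p) (opair emp emp)), (opair ⌊Q⌋ y), (opair ⌊Q⌋ y). cbn [lc la lb Es sv].
 rewrite !psnd_eq, !pfst_eq. spa.
 + apply in_repl;[def|]. exists (opair w p). spt. now rewrite !pfst_eq, !psnd_eq.
 + rewrite !in_prod2. spa. apply in_Cs. now exists Q, p.
 + apply (shold_eq TV). now split.
 + exact (act_id (n := SN) HS).
 + exact (act_id (n := SN) HS).
 + symmetry. now apply (val_chk TV).
Qed.
End Solovay.

(** * Blocks of natural numbers *)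
Section Blocks.
Context {M : structure} {Z : ZFm M}.
Implicit Types s t b C S F D U A B m n x y : M.

Definition FIN : M := sep (pow om) (fun s => (exists m, m ∈ s) /\ exists n, n ∈ om /\ subset s n).
Lemma in_FIN s : s ∈ FIN <-> (exists m, m ∈ s) /\ exists n, n ∈ om /\ subset s n.
Proof.
unfold FIN. rewrite in_sep by def. rewrite in_pow. split;[tauto|]. intros [A (n&Hn&S)]. split;[|spt;now exists n].
intros m Hm. exact (om_mem Hn (S m Hm)).
Qed.
Definition lt s t := forall m n, m ∈ s -> n ∈ t -> m ∈ n.
Definition bey b s := forall t, t ∈ b -> lt t s.
Definition block C := forall s t, s ∈ C -> t ∈ C -> s = t \/ lt s t \/ lt t s.
(** A set of pairwise comparable blocks has only one increasing enumeration, so finite and infinite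
    block sequences are treated as sets. The common bound n is what makes these sets finite. *)
Definition FB : M := sep (pow FIN) (fun b => block b /\ exists n, n ∈ om /\ forall s, s ∈ b -> subset s n).
Lemma in_FB b : b ∈ FB <-> subset b FIN /\ block b /\ exists n, n ∈ om /\ forall s, s ∈ b -> subset s n.
Proof. unfold FB. rewrite in_sep by (unfold block, lt;def). rewrite in_pow. tauto. Qed.
Definition init b C := subset b C /\ forall s, s ∈ C -> s ∈ b \/ bey b s.
Definition infb C := subset C FIN /\ block C /\ forall n, n ∈ om -> exists s, s ∈ C /\ forall m, m ∈ s -> n ∈ m.
(** The counterpart of [a,A] for block sets. In the applications [S] contains the supports of all
    non-zero vectors of a span, so that membership in [S] takes the place of being below A. *)
Definition Box b S C := infb C /\ init b C /\ forall s, s ∈ C -> s ∈ b \/ s ∈ S.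
Definition tl S b := sep S (bey b).
Lemma in_tl S b s : s ∈ tl S b <-> s ∈ S /\ bey b s.
Proof. unfold tl. rewrite in_sep by (unfold bey, lt;def). reflexivity. Qed.
Lemma DT_tl (t u : (nat -> M) -> M) : DT t -> DT u -> DT (fun v => tl (t v) (u v)).
Proof. intros. unfold tl, bey, lt. def. Qed.
End Blocks.
Ltac def_hook7 :=
 lazymatch goal with
 | |- DT (fun v => tl (@?t v) (@?u v)) => refine (@DT_tl _ _ t u _ _)
 | |- Def (fun v => lt _ _) => unfold lt
 | |- Def (fun v => bey _ _) => unfold bey
 | |- Def (fun v => block _) => unfold block
 | |- Def (fun v => init _ _) => unfold init
 | |- Def (fun v => infb _) => unfold infb
 | |- Def (fun v => Box _ _ _) => unfold Box
 | _ => def_hook6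
 end.
Ltac def_hook ::= def_hook7.

(** * Fusion and the open Ramsey theorem *)

Section Ramsey.
Context {M : structure} {Z : ZFm M}.
Implicit Types s t b C S F D U A B m n x y : M.

Lemma max_ex x n : n ∈ om -> subset x n -> (exists m, m ∈ x) -> exists m, m ∈ x /\ forall j, j ∈ x -> j ∈ m \/ j = m.
Proof.
intro Hn. revert x. revert n Hn. apply (om_ind (P := fun n => forall x, subset x n -> (exists m, m ∈ x) -> exists m, m ∈ x /\ forall j, j ∈ x -> j ∈ m \/ j = m)).
- def.
- intros x S [m Hm]. apply S in Hm. now apply in_emp in Hm.
- intros n Hn IH x S [m Hm]. destruct (classic (n ∈ x)) as [H|H].
 + exists n. spt. intros j Hj. apply S, in_succ in Hj. tauto.
 + apply IH;[|now exists m]. intros j Hj. specialize (S j Hj). apply in_succ in S as [S| ->];tauto.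
Qed.
Lemma FIN_max s : s ∈ FIN -> exists m, m ∈ s /\ m ∈ om /\ forall j, j ∈ s -> j ∈ m \/ j = m.
Proof.
intro H. apply in_FIN in H as [E (n&Hn&S)]. destruct (max_ex Hn S E) as (m&Hm&H). exists m. spt. spt. exact (om_mem Hn (S m Hm)).
Qed.
Lemma FIN_ne s : s ∈ FIN -> exists m, m ∈ s /\ m ∈ om.
Proof. intro H. destruct (FIN_max H) as (m&A&B&_). now exists m. Qed.
Lemma lt_irr s : s ∈ FIN -> ~ lt s s.
Proof. intros H L. destruct (FIN_ne H) as (m&Hm&_). exact (mem_irrefl (L m m Hm Hm)). Qed.
Lemma lt_trans s t u : t ∈ FIN -> u ∈ FIN -> lt s t -> lt t u -> lt s u.
Proof.
intros H Hu A B m n Hm Hn. destruct (FIN_ne H) as (j&Hj&Hjo). apply in_FIN in Hu as [_ (l&Hl&Su)].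
assert (On : ordinal n) by exact (om_ord (om_mem Hl (Su n Hn))). exact (proj1 On j (B j n Hj Hn) m (A m j Hm Hj)).
Qed.
Lemma lt_asym s t : s ∈ FIN -> t ∈ FIN -> lt s t -> ~ lt t s.
Proof. intros Hs Ht A B. exact (lt_irr Hs (lt_trans Ht Hs A B)). Qed.

Lemma last_ex a b : b ∈ FB -> init a b -> b <> a -> exists s, s ∈ b /\ ~ s ∈ a /\ forall t, t ∈ b -> t = s \/ lt t s.
Proof.
intros Hb [Ia Ib] Ne. apply in_FB in Hb as (Hf&Hbl&n&Hn&Hs).
assert (E : exists t, t ∈ b /\ ~ t ∈ a).
{ apply NNPP. intro C. apply Ne. apply ext. intro t. split;[|apply Ia]. intro Ht. apply NNPP. intro D. apply C. now exists t. }
destruct E as (t0&Ht0&Nt0).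
destruct (@max_ex (bU b) n Hn) as (m&Hm&Mx).
{ intros j Hj. apply in_bU in Hj as (t&Ht&Hj). exact (Hs t Ht j Hj). }
{ destruct (FIN_ne (Hf t0 Ht0)) as (j&Hj&_). exists j. apply in_bU. now exists t0. }
apply in_bU in Hm as (s&Hsb&Hm).
assert (L : forall t, t ∈ b -> t = s \/ lt t s).
{ intros t Ht. destruct (Hbl t s Ht Hsb) as [->|[H|H]];[now left|now right|]. exfalso.
 destruct (FIN_ne (Hf t Ht)) as (j&Hj&_). assert (Hmj := H m j Hm Hj).
 destruct (Mx j) as [A| ->];[apply in_bU;now exists t|exact (mem_asym A Hmj)|exact (mem_irrefl Hmj)]. }
exists s. spt. spt. intro Hsa. destruct (Ib t0 Ht0) as [A|A];[tauto|].
destruct (L t0 Ht0) as [->|B];[tauto|]. exact (lt_asym (Hf _ Ht0) (Hf _ Hsb) B (A s Hsa)).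
Qed.

Section Step.
Variable Fm : M.
Definition dec D b S := forall A, A ∈ Fm -> subset A S -> opair b A ∈ D -> opair b S ∈ D.
(** The bound is n+2 because [S] serves as term n+1 of a fusion sequence: it has to settle every b
    whose blocks have maximum at most n+1. *)
Definition decn D n S := forall b, b ∈ FB -> (forall s, s ∈ b -> subset s (succ (succ n))) -> dec D b S.
Definition mono D := forall b S S', opair b S ∈ D -> S' ∈ Fm -> subset (tl S' b) S -> opair b S' ∈ D.
Definition diag F S := forall s t n, s ∈ S -> t ∈ S -> lt s t -> n ∈ s -> t ∈ ap F n.
(** The fusion principle as a property of the family [Fm]. It is verified twice, for the coideal in
    N and for its trace on V[G_alpha], and [step1] is used with both. *)
Definition chains D := forall S0, S0 ∈ Fm -> (forall n S, n ∈ om -> S ∈ Fm -> exists S', S' ∈ Fm /\ subset S' S /\ decn D n S') ->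
 exists F S, is_fun F om Fm /\ ap F emp = S0 /\ (forall n, n ∈ om -> decn D n (ap F (succ n))) /\
 S ∈ Fm /\ subset S S0 /\ diag F S.
Hypothesis FF : forall S, S ∈ Fm -> subset S FIN.
Hypothesis FT : forall S b, S ∈ Fm -> b ∈ FB -> tl S b ∈ Fm.
Definition ok a B b := b = a \/ exists s, s ∈ b /\ s ∈ B /\ forall t, t ∈ b -> t = s \/ lt t s.

Lemma dec_sub D b S S' : mono D -> dec D b S -> S' ∈ Fm -> subset S' S -> dec D b S'.
Proof.
intros HD H HS' Sb A HA SA Hb. apply (HD b S);trivial.
- apply (H A);trivial. exact (subT SA Sb).
- intros s Hs. apply in_tl in Hs as [Hs _]. auto.
Qed.
Lemma dec_finite D x S : mono D -> finite x -> S ∈ Fm -> exists S', S' ∈ Fm /\ subset S' S /\ forall b, b ∈ x -> dec D b S'.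
Proof.
intros HD Hx HS. revert x Hx. apply (finite_ind (P := fun x => exists S', S' ∈ Fm /\ subset S' S /\ forall b, b ∈ x -> dec D b S')).
- unfold dec. def.
- exists S. spt. split;[apply sub_refl|]. intros b Hb. now apply in_emp in Hb.
- intros x b _ (S1&HS1&Sb&H1).
 assert (E : exists S2, S2 ∈ Fm /\ subset S2 S1 /\ dec D b S2).
 { destruct (classic (exists A, A ∈ Fm /\ subset A S1 /\ opair b A ∈ D)) as [(A&HA&SA&H)|C].
 - exists A. spt. spt. now intros ? _ _ _.
 - exists S1. spt. split;[apply sub_refl|]. intros A HA SA H. exfalso. apply C. now exists A. }
 destruct E as (S2&HS2&S12&H2). exists S2. spt. split;[exact (subT S12 Sb)|].
 intros b' Hb'. apply in_cup in Hb' as [Hb'|Hb'];[exact (dec_sub HD (H1 b' Hb') HS2 S12)|]. apply in_sing in Hb'. now subst.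
Qed.

(** A fusion: if the last block of b lies in [B] and has maximum n, diagonality puts all of [B]
    beyond b into F(n), and F(n) has already decided b. *)
Lemma step1 D a S0 : mono D -> chains D -> a ∈ FB -> S0 ∈ Fm -> exists B, B ∈ Fm /\ subset B S0 /\
 forall b A, b ∈ FB -> ok a B b -> A ∈ Fm -> subset (tl A b) B -> opair b A ∈ D -> opair b B ∈ D.
Proof.
intros HD HC Ha HS0.
assert (fin : forall n, n ∈ om -> finite (pow (pow (succ (succ n))))) by (intros n Hn;apply finite_pow, finite_pow, finite_om;now do 2 apply om_succ).
destruct (@dec_finite D (cup (pow (pow (succ (succ emp)))) (sing a)) S0 HD) as (S1&HS1&S10&H1);trivial.
{ apply finite_add, fin, om_emp. }
destruct (HC S1 HS1) as (F&B&HF&F0&Fd&HB&SB&Dg).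
{ intros n S Hn HS. destruct (dec_finite HD (fin n Hn) HS) as (S'&HS'&Sb&H). exists S'. spt. spt.
 intros b Hb Hbn. apply H. apply in_pow. intros s Hs. apply in_pow. now apply Hbn. }
exists B. spt. split;[exact (subT SB S10)|].
intros b A Hb Hok HA HAB HbA.
assert (HbA' : opair b (tl A b) ∈ D).
{ apply (HD b A);trivial;[now apply FT|]. intros s Hs. apply in_tl in Hs as [Hs _]. now apply in_tl in Hs. }
destruct Hok as [->|(s&Hsb&HsB&Ls)].
- apply (dec_sub HD (H1 a (proj2 (in_cup _ _ _) (or_intror (proj2 (in_sing _ _) eq_refl)))) HB SB) with (A := tl A a);trivial. now apply FT.
- destruct (FIN_max (FF HB HsB)) as (n&Hn&Hno&Mx).
 assert (bnd : forall t, t ∈ b -> subset t (succ n)).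
 { intros t Ht j Hj. apply in_succ. destruct (Ls t Ht) as [->|L];[now apply Mx|left;now apply (L j n)]. }
 assert (tlF : forall A', subset A' B -> subset (tl A' b) (ap F n)).
 { intros A' SA' t Ht. apply in_tl in Ht as [Ht Hbt]. apply (Dg s t n);trivial;[now apply SA'|now apply Hbt]. }
 assert (HFn : ap F n ∈ Fm) by (now apply (fun_ap HF)).
 assert (Dn : dec D b (ap F n)).
 (* F(m+1) decides the blocks of maximum at most m+1, so n = 0 is left over; it was settled in
    advance in S1 = F(0), along with [a], whose blocks may lie outside [B]. *)
 { destruct (classic (n = emp)) as [->|Nn].
 - rewrite F0. apply H1. apply in_cup. left. apply in_pow. intros t Ht. apply in_pow. intros j Hj. apply in_succ. left. exact (bnd t Ht j Hj).
 - assert (Ex : exists m, m ∈ om /\ n = succ m).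
 { clear - Hno Nn Z. revert Nn. revert n Hno. apply (om_ind (P := fun n => n <> emp -> exists m, m ∈ om /\ n = succ m));[def|tauto|].
 intros n Hn _ _. now exists n. }
 destruct Ex as (m&Hm&->). apply Fd;trivial. }
 apply (HD b (ap F n));trivial;[|apply tlF, sub_refl].
 apply (Dn (tl A b));trivial;[now apply FT|]. intros t Ht. apply tlF with (A' := tl A b);trivial.
 apply in_tl. spt. now apply in_tl in Ht.
Qed.
End Step.

Section Open.
Variable Hh : M.
Hypothesis AC : ax_choice M.
Hypothesis HF : forall S, S ∈ Hh -> subset S FIN.
Hypothesis HT : forall S b, S ∈ Hh -> b ∈ FB -> tl S b ∈ Hh.
Hypothesis HC : forall Y S, S ∈ Hh -> exists S', S' ∈ Hh /\ subset S' S /\ ((forall s, s ∈ S' -> s ∈ Y) \/ (forall s, s ∈ S' -> ~ s ∈ Y)).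
Hypothesis HS : forall F, is_fun F om Hh -> (forall n, n ∈ om -> subset (ap F (succ n)) (ap F n)) ->
 exists S, S ∈ Hh /\ subset S (ap F emp) /\ diag F S.

Lemma chains_all D : chains Hh D.
Proof.
intros S0 HS0 H. destruct (@DC M Z AC (fun n S S' => subset S' S /\ decn Hh D n S') Hh S0) as (F&HFu&F0&Fs);trivial.
{ unfold decn, dec. def. }
destruct (HS HFu) as (S&HSh&Sb&Dg);[intros n Hn;now apply Fs|].
exists F, S. spa;[|now rewrite <- F0]. intros n Hn. now apply Fs.
Qed.

Definition hit U b C := exists b', b' ∈ U /\ init b b' /\ init b' C.
Lemma init_trans a b C : init a b -> init b C -> init a C.
Proof.
intros [A1 A2] [B1 B2]. split;[exact (subT A1 B1)|]. intros s Hs. destruct (B2 s Hs) as [H|H];[auto|]. right. intros t Ht. apply H. auto.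
Qed.
Lemma Box_tl b S S' C : Box b S' C -> subset (tl S' b) S -> Box b S C.
Proof.
intros (A&B&D) H. spt. spt. intros s Hs. destruct (D s Hs) as [E|E];[now left|].
destruct B as [_ B]. destruct (B s Hs) as [F|F];[now left|]. right. apply H. apply in_tl. now split.
Qed.
Lemma next_ex b S C : b ∈ FB -> Box b S C -> exists s, s ∈ C /\ s ∈ S /\ bey b s /\ cup b (sing s) ∈ FB /\ init (cup b (sing s)) C.
Proof.
intros Hb ((CF&Cb&Ci)&[I1 I2]&Bx). apply in_FB in Hb as (Hbf&Hbb&n&Hn&Hbn).
destruct (Ci n Hn) as (s0&Hs0&Hs0n).
assert (Bs0 : bey b s0). { intros t Ht m j Hm Hj. assert (Hmn := Hbn t Ht m Hm). assert (Hnj := Hs0n j Hj).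
 assert (Oj : ordinal j). { assert (K := CF s0 Hs0). apply in_FIN in K as [_ (l&Hl&Sl)]. exact (om_ord (om_mem Hl (Sl j Hj))). }
 exact (proj1 Oj n Hnj m Hmn). }
destruct (FIN_ne (CF s0 Hs0)) as (m0&Hm0&Hm0o).
destruct (ord_least (P := fun m => exists s, s ∈ C /\ bey b s /\ m ∈ s) (a := m0)) as (m&Om&(s&HsC&Hbs&Hms)&Lm);[def|exact (om_ord Hm0o)|now exists s0|].
assert (LL : forall t, t ∈ C -> bey b t -> t = s \/ lt s t).
{ intros t Ht Hbt. destruct (Cb s t HsC Ht) as [->|[L|L]];[now left|now right|]. exfalso. destruct (FIN_ne (CF t Ht)) as (j&Hj&Hjo).
 assert (Hjm := L j m Hj Hms). destruct (Lm j (om_ord Hjo)) as [->|Q];[now exists t|exact (mem_irrefl Hjm)|exact (mem_asym Q Hjm)]. }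
assert (Nb : forall t, t ∈ b -> ~ bey b t) by (intros t Ht H;exact (lt_irr (Hbf t Ht) (H t Ht))).
exists s. spt. split;[|spt;split].
- destruct (Bx s HsC) as [H|H];trivial. now apply Nb in H.
- apply in_FB. split;[|split].
 + intros t Ht. apply in_cup in Ht as [Ht|Ht];[auto|]. apply in_sing in Ht. subst. auto.
 + intros t u Ht Hu. apply in_cup in Ht, Hu. rewrite in_sing in Ht, Hu. destruct Ht as [Ht| ->], Hu as [Hu| ->];auto.
 + assert (K := CF s HsC). apply in_FIN in K as [_ (l&Hl&Sl)]. destruct (ord_max ord_om Hn Hl) as (c&Hc&S1&S2). exists c. spt.
 intros t Ht. apply in_cup in Ht as [Ht|Ht];[exact (subT (Hbn t Ht) S1)|]. apply in_sing in Ht. subst. exact (subT Sl S2).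
- split.
 + intros t Ht. apply in_cup in Ht as [Ht|Ht];[auto|]. apply in_sing in Ht. now subst.
 + intros t Ht. destruct (I2 t Ht) as [H|H];[left;apply in_cup;now left|].
 destruct (LL t Ht H) as [->|L];[left;apply in_cup;right;now apply in_sing|]. right.
 intros u Hu. apply in_cup in Hu as [Hu|Hu];[auto|]. apply in_sing in Hu. now subst.
Qed.

(** Accepting and rejecting: [acc] holds of (b,S) when every C in the box hits [U]. [B0] decides
    acceptance of each b; if it rejects [a], a second fusion gives [B1] along which rejection passes
    from b to all one-block extensions, so no initial piece of a C can lie in [U]. *)
Lemma open_ramsey U a A : a ∈ FB -> subset U FB -> A ∈ Hh -> exists B, B ∈ Hh /\ subset B A /\
 ((forall C, Box a B C -> hit U a C) \/ (forall C, Box a B C -> ~ hit U a C)).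
Proof.
intros Ha HU HA.
pose (acc := sep (prod FB Hh) (fun p => forall C, Box (pfst p) (psnd p) C -> hit U (pfst p) C)).
assert (Hacc : forall b S, opair b S ∈ acc <-> b ∈ FB /\ S ∈ Hh /\ forall C, Box b S C -> hit U b C).
{ intros b S. unfold acc. rewrite in_sep by (unfold hit;def). rewrite in_prod2, pfst_eq, psnd_eq. tauto. }
assert (Macc : mono Hh acc).
{ intros b S S' H HS' St. apply Hacc in H as (Hb&_&H). apply Hacc. spa. intros C HB. apply H. exact (Box_tl HB St). }
destruct (step1 HF HT Macc (chains_all (D := acc)) Ha HA) as (B0&HB0&SB0&P0).
destruct (classic (opair a B0 ∈ acc)) as [E|Rj].
{ exists B0. spt. spt. left. now apply Hacc in E. }
pose (rej := fun b => ~ opair b B0 ∈ acc).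
pose (D2 := sep (prod FB Hh) (fun p => rej (pfst p) -> forall s, s ∈ psnd p -> bey (pfst p) s -> rej (cup (pfst p) (sing s)))).
assert (HD2 : forall b S, opair b S ∈ D2 <-> b ∈ FB /\ S ∈ Hh /\ (rej b -> forall s, s ∈ S -> bey b s -> rej (cup b (sing s)))).
{ intros b S. unfold D2. rewrite in_sep by (unfold rej;def). rewrite in_prod2, pfst_eq, psnd_eq. tauto. }
assert (MD2 : mono Hh D2).
{ intros b S S' H HS' St. apply HD2 in H as (Hb&_&H). apply HD2. spa. intros Hr s Hs Hbs. apply H;trivial. apply St, in_tl. now split. }
destruct (step1 HF HT MD2 (chains_all (D := D2)) Ha HB0) as (B1&HB1&SB1&P1).
exists B1. spt. split;[exact (subT SB1 SB0)|]. right.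
assert (step : forall b, b ∈ FB -> ok a B1 b -> rej b -> forall s, s ∈ B1 -> bey b s -> rej (cup b (sing s))).
{ intros b Hb Hok Hr. apply (HD2 b B1);trivial.
 (* The coideal property makes the one-block extensions uniformly rejected or uniformly accepted; in
    the latter case b itself would be accepted by S', hence by [B0], contrary to its rejection. *)
 destruct (HC (sep FIN (fun s => rej (cup b (sing s)))) (HT HB1 Hb)) as (S'&HS'&Sb&Hom).
 assert (DY : Def1 (fun s => rej (cup b (sing s)))) by (unfold rej;def).
 assert (St : subset (tl S' b) B1) by (intros s Hs;apply in_tl in Hs as [Hs _];apply Sb, in_tl in Hs;tauto).
 apply (P1 b S');trivial. apply HD2. spa. intros _ s Hs Hbs.
 destruct Hom as [Hom|Hom];[apply Hom, in_sep in Hs;tauto|]. exfalso. apply Hr.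
 apply (P0 b S');trivial.
 { destruct Hok as [->|(s1&X1&X2&X3)];[now left|]. right. exists s1. spa. now apply SB1. }
 { exact (subT St SB1). }
 apply Hacc. spa. intros C HB. destruct (next_ex Hb HB) as (s1&Hs1C&Hs1&Hbs1&Hcf&Hci).
 assert (Ac : opair (cup b (sing s1)) B0 ∈ acc).
 { apply NNPP. intro Q. apply (Hom s1 Hs1). apply in_sep;trivial. spt. exact (HF HS' Hs1). }
 apply Hacc in Ac as (_&_&Ac). destruct (Ac C) as (b'&Hb'&J1&J2).
 { destruct HB as (X1&X2&X3). spt. spt. intros t Ht. destruct (X3 t Ht) as [X|X];[left;apply in_cup;now left|].
 destruct (proj2 X2 t Ht) as [Y|Y];[left;apply in_cup;now left|]. right. apply SB1, St, in_tl. now split. }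
 exists b'. spt. spt. refine (init_trans _ J1). split;[intros t Ht;apply in_cup;now left|].
 intros t Ht. apply in_cup in Ht as [Ht|Ht];[now left|]. apply in_sing in Ht. subst. now right. }
intros C HB (b&HbU&I1&I2).
assert (key : forall n, n ∈ om -> forall b, b ∈ FB -> init a b -> init b C -> (forall s, s ∈ b -> subset s n) -> rej b).
{ apply (om_ind (P := fun n => forall b, b ∈ FB -> init a b -> init b C -> (forall s, s ∈ b -> subset s n) -> rej b)).
 - unfold rej. def.
 - intros b1 Hb1 J1 J2 Bn. assert (E : b1 = a);[|now subst]. apply ext. intro t. split;[|apply J1]. intro Ht. exfalso.
 apply in_FB in Hb1 as (Fb&_). destruct (FIN_ne (Fb t Ht)) as (j&Hj&_). apply (Bn t Ht) in Hj. now apply in_emp in Hj.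
 - intros n Hn IH b1 Hb1 J1 J2 Bn. destruct (classic (b1 = a)) as [->|Ne];trivial.
 destruct (last_ex Hb1 J1 Ne) as (s&Hs&Nsa&Ls). pose proof Hb1 as Hb1'. apply in_FB in Hb1' as (Fb&Bb&nb&Hnb&Hbb).
 pose (b0 := sep b1 (fun t => t <> s)).
 assert (Hb0 : forall t, t ∈ b0 <-> t ∈ b1 /\ t <> s) by (intro t;unfold b0;rewrite in_sep by def;reflexivity).
 assert (Eb : b1 = cup b0 (sing s)).
 { apply ext. intro t. rewrite in_cup, Hb0, in_sing. split;[intro Ht;destruct (classic (t = s));auto|]. intros [[]| ->];trivial. }
 assert (Lb0 : bey b0 s) by (intros t Ht;apply Hb0 in Ht as [Ht Nt];destruct (Ls t Ht);tauto).
 assert (Fb0 : b0 ∈ FB).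
 { apply in_FB. split;[|split].
 - intros t Ht. apply Hb0 in Ht as [Ht _]. auto. - intros t u Ht Hu. apply Hb0 in Ht as [Ht _], Hu as [Hu _]. auto.
 - exists nb. spt. intros t Ht. apply Hb0 in Ht as [Ht _]. auto. }
 assert (J3 : init a b0).
 { split;[intros t Ht;apply Hb0;split;[now apply J1|intros ->;tauto]|]. intros t Ht. apply Hb0 in Ht as [Ht _]. now apply J1. }
 assert (J4 : init b0 C).
 { split;[intros t Ht;apply Hb0 in Ht as [Ht _];now apply J2|]. intros t Ht. destruct (proj2 J2 t Ht) as [X|X].
 - destruct (classic (t = s)) as [->|Nt];[now right|]. left. now apply Hb0.
 - right. intros u Hu. apply Hb0 in Hu as [Hu _]. auto. }
 assert (R0 : rej b0).
 { apply IH;trivial. intros t Ht j Hj. destruct (FIN_ne (Fb s Hs)) as (m&Hm&_). assert (Hjm := Lb0 t Ht j m Hj Hm).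
 assert (Hmn := Bn s Hs m Hm). apply in_succ in Hmn as [Hmn| ->];trivial. exact (proj1 (om_ord Hn) m Hmn j Hjm). }
 assert (inB1 : forall t, t ∈ b1 -> ~ t ∈ a -> t ∈ B1).
 { intros t Ht Nt. destruct HB as (_&_&X). destruct (X t);[now apply J2|tauto|trivial]. }
 rewrite Eb. apply step;trivial;[|now apply inB1].
 destruct (classic (b0 = a)) as [->|Ne0];[now left|]. destruct (last_ex Fb0 J3 Ne0) as (s'&Hs'&Ns'&Ls').
 right. exists s'. spa. apply Hb0 in Hs' as [Hs' _]. now apply inB1. }
(* A member of [U] hits itself and is thus accepted, while [key] rejects every initial piece of C
   beyond [a]. *)
pose proof (HU b HbU) as Hb. pose proof Hb as Hb'. apply in_FB in Hb' as (_&_&n&Hn&Bn).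
apply (key n Hn b Hb I1 I2 Bn). apply Hacc. spa. intros C' (X1&X2&X3). exists b. spt. spt.
split;[apply sub_refl|now left].
Qed.
End Open.
End Ramsey.

Section DCwo.
Context {M : structure} {Z : ZFm M}.
(** Successors are chosen by least index in an enumeration along an ordinal. Applied in V[G_alpha],
    which is at hand as a model of ZF and where the relevant sets inherit an enumeration from a
    well-order of names in V. *)
Lemma DC_wo (b a x0 : M) (E : M -> M) (R : M -> M -> M -> Prop) : ordinal b -> DF1 E -> Def3 R ->
 (forall x, x ∈ a -> exists o, o ∈ b /\ E o = x) -> x0 ∈ a ->
 (forall n x, n ∈ om -> x ∈ a -> exists y, y ∈ a /\ R n x y) ->
 exists f, is_fun f om a /\ ap f emp = x0 /\ forall n, n ∈ om -> R n (ap f n) (ap f (succ n)).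
Proof.
intros Ob HE HR Sj H0 Tot.
pose (Q := fun n x o => E o ∈ a /\ R n x (E o)).
pose (P := fun p o => ordinal o /\ Q (pfst p) (psnd p) o /\ forall c, ordinal c -> Q (pfst p) (psnd p) c -> o = c \/ o ∈ c).
assert (HQ : Def3 Q) by (unfold Q;def).
assert (HP : Def2 P) by (unfold P;def).
assert (UP : forall p u w, P p u -> P p w -> u = w).
{ intros p u w (A1&A2&A3) (B1&B2&B3). destruct (A3 w B1 B2) as [|C];trivial. destruct (B3 u A1 A2) as [|D];[auto|]. destruct (mem_asym C D). }
pose (st := fun n x => E (pf P (opair n x))).
assert (Hst : DF2 st) by (unfold st;pose proof (DF_pf UP HP);def).
assert (stE : forall n x, n ∈ om -> x ∈ a -> st n x ∈ a /\ R n x (st n x)).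
{ intros n x Hn Hx. destruct (Tot n x Hn Hx) as (y&Hy&Ry). destruct (Sj y Hy) as (o&Ho&<-).
 destruct (ord_least (P := Q n x) (a := o)) as (o'&Oo&Qo&Lo);[def|exact (ord_mem Ob Ho)|now split|].
 assert (E1 : pf P (opair n x) = o').
 { apply pf_eq;[apply UP|]. unfold P. rewrite pfst_eq, psnd_eq. spa. }
 unfold st. rewrite E1. exact Qo. }
pose proof (DF_om_rec x0 Hst) as Hrec.
assert (Rin : forall n, n ∈ om -> om_rec st x0 n ∈ a).
{ apply (om_ind (P := fun n => om_rec st x0 n ∈ a));[def|now rewrite om_rec_0|]. intros n Hn IH. rewrite om_rec_S by trivial. now apply stE. }
exists (lam om (om_rec st x0)). split;[now apply lam_fun|]. split.
- rewrite ap_lam by (trivial;apply om_emp). now apply om_rec_0.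
- intros n Hn. rewrite !ap_lam by (trivial;now apply om_succ). rewrite om_rec_S by trivial. apply stE;auto.
Qed.

Lemma fin_handle (Fm X : M) (Hd : M -> M -> Prop) (x S : M) : Def2 Hd ->
 (forall i S S', Hd i S -> S' ∈ Fm -> subset S' S -> Hd i S') ->
 (forall i S, i ∈ X -> S ∈ Fm -> exists S', S' ∈ Fm /\ subset S' S /\ Hd i S') ->
 finite x -> subset x X -> S ∈ Fm -> exists S', S' ∈ Fm /\ subset S' S /\ forall i, i ∈ x -> Hd i S'.
Proof.
intros HD Mo Ex Hx Sx HS. revert Sx. revert x Hx. 
apply (finite_ind (P := fun x => subset x X -> exists S', S' ∈ Fm /\ subset S' S /\ forall i, i ∈ x -> Hd i S')).
- def.
- intros _. exists S. spt. split;[apply sub_refl|]. intros b Hb. now apply in_emp in Hb.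
- intros x i _ IH Sx. destruct IH as (S1&HS1&Sb&H1);[intros j Hj;apply Sx, in_cup;now left|].
 destruct (Ex i S1) as (S2&HS2&S12&H2);trivial;[apply Sx, in_cup;right;now apply in_sing|].
 exists S2. spt. split;[exact (subT S12 Sb)|].
 intros b' Hb'. apply in_cup in Hb' as [Hb'|Hb'];[exact (Mo _ _ _ (H1 b' Hb') HS2 S12)|]. apply in_sing in Hb'. now subst.
Qed.
End DCwo.

(** * Absoluteness of finite blocks *)

Section Absolute.
Context {N : structure} {V : N -> Prop} {ZN : ZFm N} {ZV : ZFm (restrict V)}.
Notation VS := (restrict V).
Notation "'⌊' x '⌋'" := (@inj N V x).
Hypothesis TV : transitive_class V.
Implicit Types s t b C : VS.

Lemma inj_lt s t : lt ⌊s⌋ ⌊t⌋ <-> lt s t.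
Proof.
split;intros H m n Hm Hn.
- exact (H ⌊m⌋ ⌊n⌋ Hm Hn).
- apply (in_inj TV) in Hm as (m'&<-&Hm), Hn as (n'&<-&Hn). exact (H m' n' Hm Hn).
Qed.
Lemma inj_bey b s : bey ⌊b⌋ ⌊s⌋ <-> bey b s.
Proof.
split;intros H t Ht.
- apply inj_lt. exact (H ⌊t⌋ Ht).
- apply (in_inj TV) in Ht as (t'&<-&Ht). apply inj_lt. now apply H.
Qed.
Lemma inj_init b C : init ⌊b⌋ ⌊C⌋ <-> init b C.
Proof.
unfold init. rewrite (inj_sub TV). split;intros [A H];spt;intros s Hs.
- destruct (H ⌊s⌋ Hs) as [B|B];[now left|right;now apply inj_bey].
- apply (in_inj TV) in Hs as (s'&<-&Hs). destruct (H s' Hs) as [B|B];[now left|right;now apply inj_bey].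
Qed.
Lemma inj_block b : block ⌊b⌋ <-> block b.
Proof.
split;intros H s t Hs Ht.
- destruct (H ⌊s⌋ ⌊t⌋ Hs Ht) as [E|[E|E]];[left;now apply inj_inj|right;left;now apply inj_lt|right;right;now apply inj_lt].
- apply (in_inj TV) in Hs as (s'&<-&Hs), Ht as (t'&<-&Ht).
 destruct (H s' t' Hs Ht) as [E|[E|E]];[left;now subst|right;left;now apply inj_lt|right;right;now apply inj_lt].
Qed.

(** Induction on n in N; the power sets computed in V are put into one table so that the inductive
    statement is definable in N. *)
Lemma sub_nat_V n (x : N) : n ∈ om -> subset x ⌊n⌋ -> V x.
Proof.
intros Hn Hx. pose (pf := ⌊lam om (fun n : VS => pow n)⌋). assert (Hd : DF1 (fun n : VS => pow n)) by def.
assert (Hpf : forall n, n ∈ om -> ap pf ⌊n⌋ = ⌊pow n⌋).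
{ intros m Hm. unfold pf. rewrite (inj_ap TV (y := pow m));[now rewrite (ap_lam Hd Hm)|now apply lam_functional|now apply in_lam2]. }
assert (KK : forall m, m ∈ om -> forall x, subset x m -> x ∈ ap pf m).
{ apply (om_ind (P := fun m => forall x, subset x m -> x ∈ ap pf m));[def| |].
 - intros y Hy. assert (E : y = ⌊emp⌋). { rewrite (inj_emp TV). apply ext. intro z. split;[apply Hy|]. intro H. now apply in_emp in H. }
 rewrite <- (inj_emp TV), Hpf by apply om_emp. rewrite E. apply inj_mem, in_pow, sub_refl.
 - intros m Hm IH y Hy. rewrite <- (inj_om TV) in Hm. apply (in_inj TV) in Hm as (m'&<-&Hm).
 assert (K1 : sep y (fun z => z ∈ ⌊m'⌋) ∈ ap pf ⌊m'⌋) by (apply IH;intros z Hz;now apply in_sep in Hz as [_ Hz];[|def]).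
 rewrite Hpf in K1 by trivial. apply (in_inj TV) in K1 as (y'&Ey&Hy'). apply in_pow in Hy'.
 rewrite <- (inj_succ TV), Hpf by now apply om_succ.
 assert (My : forall z, z ∈ ⌊y'⌋ <-> z ∈ y /\ z ∈ ⌊m'⌋) by (intro z;rewrite Ey, in_sep by def;reflexivity).
 destruct (classic (⌊m'⌋ ∈ y)) as [C|C].
 + assert (E : y = ⌊cup y' (sing m')⌋).
 { rewrite (inj_cup TV). apply ext. intro z. rewrite in_cup, My. split.
 - intro Hz. specialize (Hy z Hz). apply in_succ in Hy as [Hy| ->];[auto|]. right. apply inj_mem. now apply in_sing.
 - intros [[Hz _]|Hz];trivial. apply (in_inj TV) in Hz as (z'&<-&Hz). apply in_sing in Hz. now subst. }
 rewrite E. apply inj_mem, in_pow. intros z Hz. apply in_cup in Hz as [Hz|Hz];apply in_succ;[left;auto|right;now apply in_sing in Hz].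
 + assert (E : y = ⌊y'⌋). { apply ext. intro z. rewrite My. split;[|tauto]. intro Hz. spt.
 specialize (Hy z Hz). apply in_succ in Hy as [Hy| ->];tauto. }
 rewrite E. apply inj_mem, in_pow. intros z Hz. apply in_succ. left. auto. }
assert (Hx' : x ∈ ap pf ⌊n⌋) by (apply KK;trivial;rewrite <- (inj_om TV);exact Hn).
rewrite Hpf in Hx' by trivial. apply (in_inj TV) in Hx' as (x'&<-&_). apply inj_V.
Qed.
Lemma finite_V a (x : N) : finite a -> subset x ⌊a⌋ -> V x.
Proof.
intros (m&f&Hm&Hf) Hx. apply natural_eq in Hm. apply is_surj_eq in Hf as [Hf Sf].
assert (HV : V (sep ⌊m⌋ (fun i => ap ⌊f⌋ i ∈ x))).
{ apply (sub_nat_V Hm). intros i Hi. now apply in_sep in Hi as [Hi _];[|def]. }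
destruct (inj_lift HV) as (p&Ep).
assert (Hp : forall i, i ∈ p <-> i ∈ m /\ ⌊ap f i⌋ ∈ x).
{ intro i. change (i ∈ p) with (⌊i⌋ ∈ ⌊p⌋). rewrite Ep, in_sep by def. split;intros [A B];(split;[exact A|]).
 - now rewrite (inj_fun_ap TV Hf A) in B. - now rewrite (inj_fun_ap TV Hf A). }
assert (E : x = ⌊repl p (fun i => ap f i)⌋);[|rewrite E;apply inj_V].
symmetry. symmetry. apply (inj_ext TV).
- intros z Hz. destruct (proj1 (in_inj TV z a) (Hx z Hz)) as (z'&<-&_). apply inj_V.
- intro z. rewrite in_repl by def. split.
 + intro Hz. destruct (Sf z (Hx _ Hz)) as (i&Hi&<-). exists i. spt. apply Hp. now split.
 + intros (i&Hi&->). now apply Hp.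
Qed.
Lemma inj_FIN : ⌊FIN⌋ = FIN.
Proof.
symmetry. apply (inj_ext TV).
- intros s Hs. apply in_FIN in Hs as [_ (n&Hn&S)]. rewrite <- (inj_om TV) in Hn. apply (in_inj TV) in Hn as (n'&<-&Hn). exact (sub_nat_V Hn S).
- intro s. rewrite !in_FIN. split;intros [(m&Hm) (n&Hn&S)];split.
 + apply (in_inj TV) in Hm as (m'&<-&Hm). now exists m'.
 + rewrite <- (inj_om TV) in Hn. apply (in_inj TV) in Hn as (n'&<-&Hn). exists n'. spt. now apply (inj_sub TV).
 + now exists ⌊m⌋.
 + exists ⌊n⌋. split;[rewrite <- (inj_om TV);exact Hn|]. now apply (inj_sub TV).
Qed.
Lemma FB_V (b : N) : b ∈ FB -> V b.
Proof.
intro Hb. apply in_FB in Hb as (Hf&_&n&Hn&Hs). rewrite <- (inj_om TV) in Hn. apply (in_inj TV) in Hn as (n'&<-&Hn).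
apply (@finite_V (pow n') b);[now apply finite_pow, finite_om|]. intros s Hsb. assert (S := Hs s Hsb).
destruct (inj_lift (sub_nat_V Hn S)) as (s'&<-). apply inj_mem, in_pow. now apply (inj_sub TV).
Qed.
Lemma inj_FB : ⌊FB⌋ = FB.
Proof.
symmetry. apply (inj_ext TV).
- exact FB_V.
- intro b. rewrite !in_FB, <- inj_FIN, (inj_sub TV), inj_block. split;intros (A&B&n&Hn&S);(split;[trivial|split;[trivial|]]).
 + rewrite <- (inj_om TV) in Hn. apply (in_inj TV) in Hn as (n'&<-&Hn). exists n'. spt. intros s Hs. apply (inj_sub TV). now apply S.
 + exists ⌊n⌋. split;[rewrite <- (inj_om TV);exact Hn|]. intros s Hs. apply (in_inj TV) in Hs as (s'&<-&Hs). apply (inj_sub TV). now apply S.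
Qed.
End Absolute.

(** * Choice of alpha and the trace of the coideal *)

Section Setup.
Context {N : structure} {V : N -> Prop} {ZN : ZFm N} {ZV : ZFm (restrict V)}.
Notation VS := (restrict V).
Notation "'⌊' x '⌋'" := (@inj N V x).
Hypothesis TV : transitive_class V.
Hypothesis ACN : ax_choice N.
Hypothesis ACV : ax_choice VS.
Variables (k : VS) (G : N).
Hypothesis Hk : Mahlo k.
Hypothesis hG : collapse_generic k G.
Hypothesis hN : forall x : N, exists t : N, V t /\ is_val G t x.
Notation K := (Vr k).
Let Hi : inaccessible k := k_inacc Hk.
Variable Hh : N.

(** One ambient set for everything that gets reflected: sets of blocks, sequences of such sets coded
    as relations between numbers and blocks, and sets of finite block sets. *)
Definition Z1 : VS := cup FIN (cup (prod om FIN) FB).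
Lemma om_K : (om : VS) ∈ K. Proof. exact (K_ord Hi (inacc_om Hi)). Qed.
Lemma FIN_K : (FIN : VS) ∈ K.
Proof. apply (K_sub (x := pow om));[apply (K_pow Hi), om_K|]. intros s Hs. unfold FIN in Hs. now apply in_sep in Hs as [Hs _];[|def]. Qed.
Lemma FB_K : (FB : VS) ∈ K.
Proof. apply (K_sub (x := pow FIN));[apply (K_pow Hi), FIN_K|]. intros s Hs. apply in_pow. now apply in_FB in Hs. Qed.
Lemma Z1_K : Z1 ∈ K.
Proof. unfold Z1. apply (K_cup Hi);[apply FIN_K|]. apply (K_cup Hi);[|apply FB_K]. apply (K_prod Hi);[apply om_K|apply FIN_K]. Qed.

Definition cl d := sep (coll k) (fun p => collapse d p).
Lemma cl_coll d : d ∈ k -> cl d = coll d.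
Proof.
intro Hd. apply ext. intro p. unfold cl. rewrite in_sep by def. rewrite !in_coll by first [exact (k_ord Hk)|now apply (ord_mem (k_ord Hk))].
split;[tauto|]. intro H. spt. apply (coll_mono (b := d));trivial. exact (proj1 (k_ord Hk) d Hd).
Qed.
Definition Nm d := pow (prod Z1 (cl d)).
Lemma Nm_def : DF1 Nm. Proof. unfold Nm, cl. def. Qed.
Lemma Nm_mono d d' : subset d d' -> subset (Nm d) (Nm d').
Proof.
intros S x Hx. unfold Nm in *. apply in_pow in Hx. apply in_pow. intros z Hz. specialize (Hx z Hz). apply in_prod in Hx as (u&p&Hu&Hp&->).
apply in_prod2. spt. unfold cl in *. apply in_sep in Hp as [A B];[|def]. apply in_sep;[def|]. spt. exact (coll_mono S B).
Qed.
Lemma in_Nm d x : d ∈ k -> (x ∈ Nm d <-> subset x (prod Z1 (coll d))).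
Proof. intro Hd. unfold Nm. rewrite in_pow, cl_coll by trivial. reflexivity. Qed.
Lemma Nm_K d : d ∈ k -> Nm d ∈ K.
Proof. intro Hd. unfold Nm. rewrite cl_coll by trivial. apply (K_pow Hi), (K_prod Hi);[apply Z1_K|now apply (coll_K Hi)]. Qed.

(* The statements about H that are reflected below alpha; pfst i selects one of them. *)
Definition Rf (i F A B : N) :=
 (pfst i = emp -> A ∈ Hh) /\
 (pfst i = succ emp -> B ∈ Hh /\ subset B A /\ forall s t n, s ∈ B -> t ∈ B -> lt s t -> n ∈ s -> opair n t ∈ F) /\
 (pfst i = succ (succ emp) -> B ∈ Hh /\ subset B A /\
 ((forall C, Box (psnd i) B C -> hit F (psnd i) C) \/ (forall C, Box (psnd i) B C -> ~ hit F (psnd i) C))).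
Lemma e01 : (emp : N) <> succ emp. Proof. intro E. assert (H : (emp : N) ∈ succ emp) by (apply in_succ;now right). rewrite <- E in H. now apply in_emp in H. Qed.
Lemma e02 : (emp : N) <> succ (succ emp). Proof. intro E. assert (H : (succ emp : N) ∈ succ (succ emp)) by (apply in_succ;now right). rewrite <- E in H. now apply in_emp in H. Qed.
Lemma e12 : (succ emp : N) <> succ (succ emp).
Proof. intro E. assert (H : (succ emp : N) ∈ succ (succ emp)) by (apply in_succ;now right). rewrite <- E in H. now apply mem_irrefl in H. Qed.

(** The three statements collected in [Rf] are reflected together, with bounded names for F and A as
    arguments and a name for B as witness. [NS] consists of the names bounded below alpha, and
    [hh t p] is the forcing of membership of [t] in the coideal, with conditions of [coll al]
    only. *)
Lemma setup g0 : g0 ∈ k -> exists al (Hal : al ∈ k) NS (hh : VS -> VS -> Prop),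
 let g := Gb G al in let Wa := PW TV (gen_Gb TV Hk hG (small_in Hk Hal)) in
 g0 ∈ al /\ NS ∈ K /\ (forall t, t ∈ NS -> subset t (prod Z1 (coll al))) /\ Def2 hh /\
 (forall d t, d ∈ al -> subset t (prod Z1 (coll d)) -> t ∈ NS) /\
 (forall x, Wa x -> subset x ⌊Z1⌋ -> exists t, t ∈ NS /\ x = img ⌊t⌋ g) /\
 (forall t p p', p' ∈ coll al -> subset p p' -> hh t p -> hh t p') /\
 (forall t p, t ∈ NS -> ⌊p⌋ ∈ g -> hh t p -> img ⌊t⌋ g ∈ Hh) /\
 (forall t, t ∈ NS -> img ⌊t⌋ g ∈ Hh -> exists p, p ∈ coll al /\ ⌊p⌋ ∈ g /\ hh t p) /\
 (forall i F A B, i ∈ prod om FB -> Wa F -> Wa A -> subset F ⌊Z1⌋ -> subset A ⌊Z1⌋ -> subset B ⌊Z1⌋ -> Rf ⌊i⌋ F A B ->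
 exists t, t ∈ NS /\ Rf ⌊i⌋ F A (img ⌊t⌋ g)).
Proof.
intro Hg0. pose proof Nm_def as HNm.
pose (R := fun x : N => Rf (pfst (pfst x)) (img (pfst (psnd (pfst x))) G) (img (psnd (psnd (pfst x))) G) (img (psnd x) G)).
assert (RE : forall i r t s : VS, R ⌊opair (opair i (opair r t)) s⌋ <-> Rf ⌊i⌋ (img ⌊r⌋ G) (img ⌊t⌋ G) (img ⌊s⌋ G)).
{ intros i r t s. unfold R. rewrite !(inj_opair TV). rewrite ?pfst_eq, ?psnd_eq. rewrite ?pfst_eq, ?psnd_eq. reflexivity. }
destruct (@reflect N V ZN ZV TV ACV k G Hk hG hN Z1 g0 (fun g => prod (prod om FB) (prod (Nm g) (Nm g))) Nm R)
 as (al&Fo&Hal&Ra&Hga&Hom&Hsj&HFo&F1&Fm&F2);trivial.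
{ exact Z1_K. }
{ def. }
{ unfold R, Rf, hit. def. }
{ intros g Hg. apply (K_prod Hi);apply (K_prod Hi);first [apply om_K|apply FB_K|now apply Nm_K]. }
{ intros g g' S x Hx. apply in_prod in Hx as (i&rt&Hi'&Hrt&->). apply in_prod in Hrt as (r&t&Hr&Ht&->).
 rewrite !in_prod2. spt. split;now apply (Nm_mono S). }
{ exact Nm_mono. }
assert (Oal : ordinal al) by exact (ord_mem (k_ord Hk) Hal).
assert (dk : forall d, d ∈ al -> d ∈ k) by (intros d Hd;exact (proj1 (k_ord Hk) al Hal d Hd)).
pose (NS := sep (pow (prod Z1 (coll al))) (fun t => exists d, d ∈ al /\ t ∈ Nm d)).
assert (HNS : forall t, t ∈ NS <-> exists d, d ∈ al /\ t ∈ Nm d).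
{ intro t. unfold NS. rewrite in_sep by def. rewrite in_pow. split;[tauto|]. intros (d&Hd&Ht). split;[|now exists d].
 apply in_Nm;trivial. apply (Nm_mono (proj1 Oal d Hd));trivial. }
assert (NSs : forall t, t ∈ NS -> subset t (prod Z1 (coll al))).
{ intros t Ht. apply HNS in Ht as (d&Hd&Ht). apply in_Nm;trivial. apply (Nm_mono (proj1 Oal d Hd));trivial. }
assert (imE : forall t, t ∈ NS -> img ⌊t⌋ G = img ⌊t⌋ (Gb G al)) by (intros t Ht;exact (img_Gb TV G (NSs t Ht))).
assert (Gg : forall p : VS, ⌊p⌋ ∈ Gb G al -> ⌊p⌋ ∈ G) by (intros p Hp;now apply in_Gb in Hp).
assert (nmE : forall x, PW TV (gen_Gb TV Hk hG (small_in Hk Hal)) x -> subset x ⌊Z1⌋ -> exists d t, d ∈ al /\ t ∈ Nm d /\ x = img ⌊t⌋ (Gb G al)).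
{ intros x Hx Sx. destruct (@small_name N V ZN ZV TV k G Hk hG al Z1 (small_in Hk Hal) Ra Hom Hsj x Hx Sx) as (b&r&Hb&Hr&E).
 assert (Hr' : r ∈ Nm b) by (apply in_Nm;auto). exists b, r. spt. spt. rewrite <- imE;trivial. apply HNS. now exists b. }
assert (E0 : (opair emp emp : VS) ∈ prod om FB).
{ apply in_prod2. split;[apply om_emp|]. apply in_FB. split;[intros s Hs;now apply in_emp in Hs|].
 split;[intros s t Hs;now apply in_emp in Hs|]. exists emp. split;[apply om_emp|]. intros s Hs. now apply in_emp in Hs. }
assert (eNm : forall d, emp ∈ Nm d) by (intro d;apply in_pow;intros z Hz;now apply in_emp in Hz).
(* The index with first component 0 selects the plain membership statement, in which F and B do not
   occur; [emp] and [s] fill their places. *)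
pose (hh := fun t p => exists d s, d ∈ al /\ s ∈ Nm d /\ Fo (opair (opair (opair emp emp) (opair emp t)) s) p).
exists al, Hal, NS, hh. cbv zeta. spa.
- apply (K_sub (x := pow (prod Z1 (coll al))));[|intros t Ht;apply in_pow;auto].
 apply (K_pow Hi), (K_prod Hi);[apply Z1_K|now apply (coll_K Hi)].
- unfold hh. def.
- intros d t Hd Ht. apply HNS. exists d. spt. apply in_Nm;auto.
- intros x Hx Sx. destruct (nmE x Hx Sx) as (d&t&Hd&Ht&E). exists t. spt. apply HNS. now exists d.
- intros t p p' Hp' S (d&s&Hd&Hs&HF). exists d, s. spa. apply (Fm _ p);trivial.
 apply in_coll;[exact (k_ord Hk)|]. apply in_coll in Hp';trivial. apply (coll_mono (b := al));[exact (proj1 (k_ord Hk) al Hal)|trivial].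
- intros t p Ht Hp (d&s&Hd&Hs&HF). assert (HR := F1 _ _ (Gg _ Hp) HF). apply RE in HR as [HR _].
 rewrite <- imE by trivial. apply HR. rewrite (inj_opair TV), pfst_eq. apply (inj_emp TV).
- intros t Ht Hin. pose proof Ht as Ht'. apply HNS in Ht' as (d&Hd&Htd).
 destruct (F2 d (opair (opair emp emp) (opair emp t)) d emp) as (d'&s&q&Hd'&Hs&Hq&Gq&HF);trivial.
 + now rewrite !in_prod2 in *.
 + auto.
 + apply RE. rewrite (imE t Ht). unfold Rf. rewrite (inj_opair TV), pfst_eq, (inj_emp TV). split;[auto|].
 split;intro E;[destruct (e01 E)|destruct (e02 E)].
 + exists q. spt. split;[apply in_Gb;now split|]. now exists d', s.
- intros i F A B Hi' HF HA SF SA SB HR. destruct (nmE F HF SF) as (d1&r&Hd1&Hr&->), (nmE A HA SA) as (d2&t&Hd2&Ht&->).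
 destruct (ord_max Oal Hd1 Hd2) as (d&Hd&S1&S2).
 destruct (@small_image N V ZN ZV TV ACV k G Hk hG hN Z1 B Z1_K SB) as (b&s&Hb&Hs&->).
 assert (Hr' : r ∈ NS) by (apply HNS;now exists d1). assert (Ht' : t ∈ NS) by (apply HNS;now exists d2).
 destruct (F2 d (opair i (opair r t)) b s) as (d'&s'&q&Hd'&Hs'&Hq&Gq&HFo');trivial.
 + rewrite !in_prod2. spt. split;[now apply (Nm_mono S1)|now apply (Nm_mono S2)].
 + apply in_Nm;trivial.
 + apply RE. now rewrite !imE by trivial.
 + assert (Hs'' : s' ∈ NS) by (apply HNS;now exists d').
 exists s'. spt. assert (HR' := F1 _ _ Gq HFo'). apply RE in HR'. now rewrite !imE in HR' by trivial.
Qed.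
End Setup.

(** * Mathias forcing over an intermediate model *)
Section Mathias.
Context {N : structure} {V : N -> Prop} {ZN : ZFm N} {ZV : ZFm (restrict V)}.
Notation VS := (restrict V).
Notation "'⌊' x '⌋'" := (@inj N V x).
Hypothesis TV : transitive_class V.
Hypothesis ACN : ax_choice N.
Hypothesis ACV : ax_choice VS.
Variables (k : VS) (G : N).
Hypothesis Hk : Mahlo k.
Hypothesis hG : collapse_generic k G.
Notation K := (Vr k).
Let Hi : inaccessible k := k_inacc Hk.
Variable Hh : N.
Hypothesis HF : forall S, S ∈ Hh -> subset S FIN.
Hypothesis HT : forall S b, S ∈ Hh -> b ∈ FB -> tl S b ∈ Hh.
Hypothesis HC : forall Y S, S ∈ Hh -> exists S', S' ∈ Hh /\ subset S' S /\ ((forall s, s ∈ S' -> s ∈ Y) \/ (forall s, s ∈ S' -> ~ s ∈ Y)).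
Hypothesis HS : forall F, is_fun F om Hh -> (forall n, n ∈ om -> subset (ap F (succ n)) (ap F n)) ->
 exists S, S ∈ Hh /\ subset S (ap F emp) /\ diag F S.
Hypothesis HI : forall S b, S ∈ Hh -> b ∈ FB -> exists C, Box b S C.

Variables (al : VS) (Hal : al ∈ k) (NS : VS) (hh : VS -> VS -> Prop).
Notation g := (Gb G al).
Notation HGa := (gen_Gb TV Hk hG (small_in Hk Hal)).
Notation Wa := (PW TV HGa).
Notation MS := (restrict Wa).
Notation "'⌈' x '⌉'" := (@inj N Wa x).
Hypothesis NS_K : NS ∈ K.
Hypothesis NS_sub : forall t, t ∈ NS -> subset t (prod Z1 (coll al)).
Hypothesis hh_def : Def2 hh.
Hypothesis nmE : forall x, Wa x -> subset x ⌊Z1⌋ -> exists t, t ∈ NS /\ x = img ⌊t⌋ g.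
Hypothesis hh_mono : forall t p p', p' ∈ coll al -> subset p p' -> hh t p -> hh t p'.
Hypothesis hh_snd : forall t p, t ∈ NS -> ⌊p⌋ ∈ g -> hh t p -> img ⌊t⌋ g ∈ Hh.
Hypothesis hh_cpl : forall t, t ∈ NS -> img ⌊t⌋ g ∈ Hh -> exists p, p ∈ coll al /\ ⌊p⌋ ∈ g /\ hh t p.
Hypothesis refl : forall i F A B, i ∈ prod om FB -> Wa F -> Wa A -> subset F ⌊Z1⌋ -> subset A ⌊Z1⌋ -> subset B ⌊Z1⌋ -> Rf Hh ⌊i⌋ F A B ->
 exists t, t ∈ NS /\ Rf Hh ⌊i⌋ F A (img ⌊t⌋ g).

Local Instance ZM : ZFm MS := PW_ZF TV HGa.
Let TM : transitive_class Wa := @PW_trans N V ZN ZV TV _ _ HGa.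

Lemma img_W t : t ∈ NS -> Wa (img ⌊t⌋ g).
Proof. intro Ht. rewrite <- (pval_nm TV HGa (NS_sub Ht)). apply PW_eq. now eexists. Qed.
Lemma FIN_Z1 x : subset x FIN -> subset x ⌊Z1⌋.
Proof. intros S s Hs. apply S in Hs. rewrite <- (inj_FIN TV) in Hs. apply (in_inj TV) in Hs as (s'&<-&Hs). apply inj_mem, in_cup. now left. Qed.
Lemma FB_Z1 x : subset x FB -> subset x ⌊Z1⌋.
Proof. intros S s Hs. apply S in Hs. rewrite <- (inj_FB TV) in Hs. apply (in_inj TV) in Hs as (s'&<-&Hs). apply inj_mem, in_cup. right. apply in_cup. now right. Qed.
Lemma lift_V (x : VS) : exists x' : MS, ⌈x'⌉ = ⌊x⌋.
Proof. apply inj_lift, PW_V. Qed.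

Definition Ha : N := sep Hh (fun S => exists t, t ∈ ⌊NS⌋ /\ S = img t g).
Lemma in_Ha0 S : S ∈ Ha <-> S ∈ Hh /\ exists t, t ∈ NS /\ S = img ⌊t⌋ g.
Proof.
unfold Ha. rewrite in_sep by def. split;intros [A (t&Ht&E)];spt.
- apply (in_inj TV) in Ht as (t'&<-&Ht). now exists t'.
- now exists ⌊t⌋.
Qed.
Lemma in_Ha S : S ∈ Ha <-> S ∈ Hh /\ Wa S.
Proof.
rewrite in_Ha0. split;intros [A B];spt.
- destruct B as (t&Ht&->). now apply img_W.
- apply nmE;trivial. now apply FIN_Z1, HF.
Qed.
(** The relation [hh] restricted to [NS] and [coll al] is a set of V, so the trace is computed in
    V[G_alpha] from it and the generic alone. *)
Lemma Ha_W : Wa Ha.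
Proof.
pose (hs := sep (prod NS (coll al)) (fun z => hh (pfst z) (psnd z))).
assert (Hhs : forall t p, opair t p ∈ hs <-> t ∈ NS /\ p ∈ coll al /\ hh t p).
{ intros t p. unfold hs. rewrite in_sep by def. rewrite in_prod2, pfst_eq, psnd_eq. tauto. }
destruct (lift_V FIN) as (FM&EF), (lift_V NS) as (NM&EN), (lift_V hs) as (hM&Eh), (inj_lift (PW_y TV HGa)) as (gM&Eg).
pose (X := fun S : MS => exists t p, t ∈ NM /\ p ∈ gM /\ opair t p ∈ hM /\ S = img t gM).
assert (HX : Def1 X) by (unfold X;def).
assert (E : ⌈sep (pow FM) X⌉ = Ha);[|rewrite <- E;apply inj_V].
symmetry. apply (inj_ext TM).
- intros S H. now apply in_Ha in H.
- intro S. rewrite in_sep by trivial. rewrite in_pow, in_Ha0. split.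
 + intros [H (t&Ht&E)]. split.
 { intros s Hs. change (⌈s⌉ ∈ ⌈FM⌉). rewrite EF, (inj_FIN TV). exact (HF H Hs). }
 rewrite E in H. destruct (hh_cpl Ht H) as (p&Hp&Hg&Hhp).
 destruct (lift_V t) as (tM&Et), (lift_V p) as (pM&Ep). exists tM, pM. sp.
 * change (⌈tM⌉ ∈ ⌈NM⌉). now rewrite Et, EN.
 * change (⌈pM⌉ ∈ ⌈gM⌉). now rewrite Ep, Eg.
 * apply (opinj TM). rewrite Et, Ep, Eh. apply (opinj TV), Hhs. spa.
 * apply inj_inj. rewrite E, (inj_img TM). now rewrite Et, Eg.
 + intros [_ (t&p&Ht&Hp&H&->)].
 change (⌈t⌉ ∈ ⌈NM⌉) in Ht. change (⌈p⌉ ∈ ⌈gM⌉) in Hp. apply (opinj TM) in H. rewrite EN in Ht. rewrite Eg in Hp. rewrite Eh in H.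
 destruct (pinj TV H eq_refl) as (t'&p'&Et&Ep&H'). rewrite <- Et in Ht. rewrite <- Ep in Hp. apply Hhs in H' as (Ht'&Hp'&Hhp).
 rewrite (inj_img TM), <- Et, Eg. split;[exact (hh_snd Ht' Hp Hhp)|now exists t'].
Qed.

Lemma succ_inj_emp : ⌊succ emp⌋ = succ emp. Proof. now rewrite (inj_succ TV), (inj_emp TV). Qed.

(** The sequence is built inside V[G_alpha]. Selectivity in N gives a diagonalisation that may lie
    outside; coding the sequence as a relation [rM] and reflecting replaces it by one in
    V[G_alpha]. *)
Lemma chains_alpha D : Wa D -> chains Ha D.
Proof.
intros HD S0 HS0 Tot.
destruct (well_order ACV NS) as (b&e&Ob&He). apply is_surj_eq in He as [He Se].
destruct (inj_lift Ha_W) as (HM&EH), (inj_lift HD) as (DM&ED), (lift_V FB) as (BM&EB), (inj_lift (PW_y TV HGa)) as (gM&Eg),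
 (lift_V b) as (bM&Eb), (lift_V e) as (eM&Ee), (lift_V FIN) as (FM&EF).
rewrite (inj_FB TV) in EB. rewrite (inj_FIN TV) in EF.
destruct (inj_lift (proj2 (proj1 (in_Ha S0) HS0))) as (S0M&ES0).
pose (R := fun n S S' : MS => subset S' S /\ forall b, b ∈ BM -> (forall s, s ∈ b -> subset s (succ (succ n))) ->
 forall A, A ∈ HM -> subset A S' -> opair b A ∈ DM -> opair b S' ∈ DM).
assert (RE : forall n S S', R n S S' <-> subset ⌈S'⌉ ⌈S⌉ /\ decn Ha D ⌈n⌉ ⌈S'⌉).
{ intros n S S'. unfold R, decn, dec. rewrite (inj_sub TM). split;intros [A B];spt.
 - intros c Hc Hcn A' HA' SA' Hin. rewrite <- EB in Hc. apply (in_inj TM) in Hc as (c'&<-&Hc). rewrite <- EH in HA'. apply (in_inj TM) in HA' as (A1&<-&HA').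
 rewrite <- ED in Hin |- *. apply (opinj TM) in Hin. apply (opinj TM). apply (B c' Hc) with (A := A1);trivial.
 + intros s Hs. apply (inj_sub TM). rewrite !(inj_succ TM). now apply Hcn.
 + now apply (inj_sub TM).
 - intros c Hc Hcn A' HA' SA' Hin. apply (opinj TM). rewrite ED. apply (B ⌈c⌉) with (A := ⌈A'⌉).
 + rewrite <- EB. exact Hc.
 + intros s Hs. apply (in_inj TM) in Hs as (s'&<-&Hs). rewrite <- !(inj_succ TM). apply (inj_sub TM). now apply Hcn.
 + rewrite <- EH. exact HA'.
 + now apply (inj_sub TM).
 + rewrite <- ED. now apply (opinj TM). }
destruct (@DC_wo MS ZM bM HM S0M (fun o => img (ap eM o) gM) R) as (f&Hf&f0&fS).
{ apply (inj_ord TM). rewrite Eb. now apply (inj_ord TV). }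
{ def. }
{ unfold R. def. }
{ intros x Hx. change (⌈x⌉ ∈ ⌈HM⌉) in Hx. rewrite EH in Hx. apply in_Ha0 in Hx as [_ (t&Ht&E)]. destruct (Se t Ht) as (o&Ho&Eo).
 destruct (lift_V o) as (oM&EoM), (lift_V t) as (tM&Et). exists oM. split;[change (⌈oM⌉ ∈ ⌈bM⌉);now rewrite EoM, Eb|].
 assert (Hin : opair oM tM ∈ eM).
 { apply (opinj TM). rewrite EoM, Et, Ee. apply (opinj TV). rewrite <- Eo. now apply (fun_ap He). }
 assert (Fe : functional eM).
 { apply (inj_functional TM). rewrite Ee. apply (inj_functional TV). now apply is_fun_eq in He. }
 rewrite (ap_fun Fe Hin). apply inj_inj. now rewrite (inj_img TM), Et, Eg. }
{ change (⌈S0M⌉ ∈ ⌈HM⌉). now rewrite ES0, EH. }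
{ intros n x Hn Hx. change (⌈x⌉ ∈ ⌈HM⌉) in Hx. rewrite EH in Hx.
 destruct (Tot ⌈n⌉ ⌈x⌉) as (S'&HS'&Sb&Dn);trivial. { rewrite <- (inj_om TM). exact Hn. }
 destruct (inj_lift (proj2 (proj1 (in_Ha S') HS'))) as (y&<-). exists y. split;[change (⌈y⌉ ∈ ⌈HM⌉);now rewrite EH|]. now apply RE. }
assert (HFu : is_fun ⌈f⌉ om Ha) by (rewrite <- (inj_om TM), <- EH;now apply (inj_fun TM)).
assert (apF : forall n, n ∈ om -> ap ⌈f⌉ ⌈n⌉ = ⌈ap f n⌉) by (intros n Hn;exact (inj_fun_ap TM Hf Hn)).
assert (F0 : ap ⌈f⌉ emp = S0) by (rewrite <- (inj_emp TM), apF, f0 by apply om_emp;exact ES0).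
assert (Fs : forall n, n ∈ om -> subset (ap ⌈f⌉ (succ n)) (ap ⌈f⌉ n) /\ decn Ha D n (ap ⌈f⌉ (succ n))).
{ intros n Hn. rewrite <- (inj_om TM) in Hn. apply (in_inj TM) in Hn as (n'&<-&Hn). rewrite <- (inj_succ TM), !apF by (trivial;now apply om_succ).
 apply RE. now apply fS. }
pose (rM := sep (prod om FM) (fun z => psnd z ∈ ap f (pfst z))).
assert (Hr : forall n t, opair n t ∈ ⌈rM⌉ <-> n ∈ om /\ t ∈ FIN /\ t ∈ ap ⌈f⌉ n).
{ intros n t. split.
 - intro H. destruct (pinj TM H eq_refl) as (n'&t'&<-&<-&H'). unfold rM in H'. apply in_sep in H' as [A B];[|def].
 apply in_prod2 in A as [A1 A2]. rewrite pfst_eq, psnd_eq in B. rewrite apF by trivial. sp;[rewrite <- (inj_om TM);exact A1|rewrite <- EF;exact A2|exact B].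
 - intros (Hn&Ht&H). rewrite <- (inj_om TM) in Hn. apply (in_inj TM) in Hn as (n'&<-&Hn). rewrite <- EF in Ht. apply (in_inj TM) in Ht as (t'&<-&Ht).
 rewrite apF in H by trivial. apply (opinj TM). apply in_sep;[def|]. rewrite in_prod2, pfst_eq, psnd_eq. now split. }
destruct (HS (F := ⌈f⌉)) as (S&HSh&SS&Dg).
{ apply is_fun_eq in HFu as (A&B&C). apply is_fun_eq. spa. intros p Hp. destruct (A p Hp) as (x&y&Hx&Hy&->). exists x, y. spa. now apply in_Ha in Hy. }
{ intros n Hn. now apply Fs. }
rewrite F0 in SS. assert (HS0' := proj1 (in_Ha S0) HS0).
destruct (@refl (opair (succ emp) emp) ⌈rM⌉ S0 S) as (t&Ht&RF).
{ apply in_prod2. split;[apply om_succ, om_emp|]. apply in_FB. split;[intros s Hs;now apply in_emp in Hs|].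
 split;[intros s u Hs;now apply in_emp in Hs|]. exists emp. split;[apply om_emp|]. intros s Hs. now apply in_emp in Hs. }
{ apply inj_V. } { apply HS0'. }
{ intros p Hp. apply (in_inj TM) in Hp as (p'&<-&Hp). pose proof Hp as Hp'. unfold rM in Hp'. apply in_sep in Hp' as [A _];[|def].
 apply in_prod in A as (n&u&Hn&Hu&->). rewrite (inj_opair TM). change (⌈n⌉ ∈ ⌈om⌉) in Hn. change (⌈u⌉ ∈ ⌈FM⌉) in Hu.
 rewrite (inj_om TM), <- (inj_om TV) in Hn. rewrite EF, <- (inj_FIN TV) in Hu.
 apply (in_inj TV) in Hn as (n'&<-&Hn), Hu as (u'&<-&Hu). rewrite <- (inj_opair TV). apply inj_mem, in_cup. right. apply in_cup. left. now apply in_prod2. }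
{ apply FIN_Z1, HF, HS0'. } { now apply FIN_Z1, HF. }
{ unfold Rf. rewrite (inj_opair TV), pfst_eq, psnd_eq, succ_inj_emp. split;[intro E;symmetry in E;destruct (e01 E)|]. split;[|intro E;destruct (e12 E)].
 intros _. spa. intros s u n Hs Hu L Hn. apply Hr. assert (HsF := HF HSh Hs). apply in_FIN in HsF as [_ (l&Hl&Sl)]. sp.
 - exact (om_mem Hl (Sl n Hn)). - exact (HF HSh Hu). - exact (Dg s u n Hs Hu L Hn). }
destruct RF as (_&RF&_). destruct RF as (B1&B2&B3);[now rewrite (inj_opair TV), pfst_eq, succ_inj_emp|].
exists ⌈f⌉, (img ⌊t⌋ g). spa.
- intros n Hn. now apply Fs.
- apply in_Ha. spt. now apply img_W.
- intros s u n Hs Hu L Hn. assert (H := B3 s u n Hs Hu L Hn). now apply Hr in H.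
Qed.

(** The open Ramsey theorem is applied in N and its homogeneous set is moved into V[G_alpha] by
    reflection. The boxes still range over all C of N, so this keeps its force outside the
    intermediate model. *)
Lemma ramsey_alpha U a A : a ∈ FB -> Wa U -> subset U FB -> A ∈ Ha -> exists B, B ∈ Ha /\ subset B A /\
 ((forall C, Box a B C -> hit U a C) \/ (forall C, Box a B C -> ~ hit U a C)).
Proof.
intros HaB HU SU HA. apply in_Ha in HA as [HA HAW]. destruct (open_ramsey ACN HF HT HC HS HaB SU HA) as (B&HB&SB&H).
pose proof HaB as Ha'. rewrite <- (inj_FB TV) in Ha'. apply (in_inj TV) in Ha' as (a'&Ea&Ha').
assert (E2 : ⌊succ (succ emp)⌋ = succ (succ emp)) by now rewrite (inj_succ TV), succ_inj_emp.
destruct (@refl (opair (succ (succ emp)) a') U A B) as (t&Ht&RF);trivial.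
{ apply in_prod2. spt. apply om_succ, om_succ, om_emp. }
{ now apply FB_Z1. } { now apply FIN_Z1, HF. } { now apply FIN_Z1, HF. }
{ unfold Rf. rewrite (inj_opair TV), pfst_eq, psnd_eq, E2, Ea. split;[intro E;symmetry in E;destruct (e02 E)|].
 split;[intro E;symmetry in E;destruct (e12 E)|]. intros _. spa. }
destruct RF as (_&_&RF). rewrite (inj_opair TV), pfst_eq, psnd_eq, E2, Ea in RF. destruct (RF eq_refl) as (B1&B2&B3).
exists (img ⌊t⌋ g). split;[|now split]. apply in_Ha. spt. now apply img_W.
Qed.

Definition tpl (p b t : VS) : VS := opair p (opair b t).
(** Conditions (p,b,t) of the iteration: p in the collapse below alpha, b a finite stem, and t a
    name that p forces into the coideal. *)
Definition TT : VS := sep (prod (coll al) (prod FB NS)) (fun r => hh (psnd (psnd r)) (pfst r)).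
Lemma in_TT p b t : tpl p b t ∈ TT <-> p ∈ coll al /\ b ∈ FB /\ t ∈ NS /\ hh t p.
Proof. unfold TT, tpl. rewrite in_sep by def. rewrite !in_prod2, !psnd_eq, pfst_eq. tauto. Qed.
Lemma TT_inv r : r ∈ TT -> exists p b t, r = tpl p b t /\ p ∈ coll al /\ b ∈ FB /\ t ∈ NS /\ hh t p.
Proof.
intro H. pose proof H as H'. unfold TT in H'. apply in_sep in H' as [H' _];[|def]. apply in_prod in H' as (p&z&Hp&Hz&->).
apply in_prod in Hz as (b&t&Hb&Ht&->). exists p, b, t. spt. now apply in_TT.
Qed.
Notation inA := (inn (coll al)).
(** The Mathias order with its inclusions forced: new blocks of the stem are forced into the old
    set, and beyond the new stem the new set is forced into the old one. *)
Definition leT r' r := subset (pfst r) (pfst r') /\ init (pfst (psnd r)) (pfst (psnd r')) /\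
 (forall s, s ∈ pfst (psnd r') -> s ∈ pfst (psnd r) \/ inA (pfst r') (psnd (psnd r)) s) /\
 forall s p, p ∈ coll al -> subset (pfst r') p -> bey (pfst (psnd r')) s -> inA p (psnd (psnd r')) s -> inA p (psnd (psnd r)) s.
Lemma leT_eq p' b' t' p b t : leT (tpl p' b' t') (tpl p b t) <-> subset p p' /\ init b b' /\ (forall s, s ∈ b' -> s ∈ b \/ inA p' t s) /\
 forall s q, q ∈ coll al -> subset p' q -> bey b' s -> inA q t' s -> inA q t s.
Proof. unfold leT, tpl. rewrite !pfst_eq, !psnd_eq, !pfst_eq. reflexivity. Qed.
Lemma leT_def : Def2 leT. Proof. unfold leT. def. Qed.
Lemma leT_refl r : leT r r.
Proof. split;[apply sub_refl|]. split;[split;[apply sub_refl|now left]|]. split;[now left|trivial]. Qed.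
Lemma leT_trans r1 r2 r3 : leT r1 r2 -> leT r2 r3 -> leT r1 r3.
Proof.
intros (A1&A2&A3&A4) (B1&B2&B3&B4). split;[exact (subT B1 A1)|]. split;[exact (init_trans B2 A2)|]. split.
- intros s Hs. destruct (proj2 A2 s Hs) as [H|H].
 + destruct (B3 s H) as [H'|H'];[now left|right;exact (inn_mono H' A1)].
 + destruct (A3 s Hs) as [H'|H'];[destruct (B3 s H') as [C|C];[now left|right;exact (inn_mono C A1)]|].
 right. apply inn_dense. intros q Hq S. exists q. spt. split;[apply sub_refl|].
 apply B4;trivial;[exact (subT A1 S)|exact (inn_mono H' S)].
- intros s p Hp S Hs H. apply B4;trivial;[exact (subT A1 S)| |now apply A4].
 intros t Ht. apply Hs. now apply A2.
Qed.
(** Posets are families of sets in which larger means stronger, so a condition is represented by the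
    set of all conditions weaker than it. *)
Definition UT r := sep TT (leT r).
Lemma UT_def : DF1 UT. Proof. unfold UT. pose proof leT_def. def. Qed.
Lemma in_UT r x : x ∈ UT r <-> x ∈ TT /\ leT r x.
Proof. unfold UT. pose proof leT_def. rewrite in_sep by def. reflexivity. Qed.
Lemma UT_le r r' : r ∈ TT -> (subset (UT r) (UT r') <-> leT r' r).
Proof.
intro Hr. split.
- intro S. assert (H : r ∈ UT r') by (apply S, in_UT;split;[trivial|apply leT_refl]). now apply in_UT in H.
- intros L x Hx. apply in_UT in Hx as [Hx L']. apply in_UT. spt. exact (leT_trans L L').
Qed.
Definition QT : VS := repl TT UT.
Lemma in_QT u : u ∈ QT <-> exists r, r ∈ TT /\ u = UT r.
Proof. unfold QT. rewrite in_repl by apply UT_def. reflexivity. Qed.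
Lemma TT_K : TT ∈ K.
Proof.
apply (K_sub (x := prod (coll al) (prod FB NS)));[|intros r Hr;unfold TT in Hr;now apply in_sep in Hr as [Hr _];[|def]].
apply (K_prod Hi);[now apply (coll_K Hi)|]. apply (K_prod Hi);trivial. now apply FB_K.
Qed.
Lemma QT_K : QT ∈ K.
Proof.
apply (K_sub (x := pow TT));[apply (K_pow Hi), TT_K|]. intros u Hu. apply in_QT in Hu as (r&_&->). apply in_pow. intros x Hx. now apply in_UT in Hx.
Qed.

(** C is compatible with r = (p,b,t): p is in the collapse generic and C is in the box of b and the
    value of t. The conditions satisfying this form the filter [yC C]. *)
Definition Yn (C r : N) := pfst r ∈ g /\ Box (pfst (psnd r)) (img (psnd (psnd r)) g) C.
Lemma Yn_eq C p b t : Yn C ⌊tpl p b t⌋ <-> ⌊p⌋ ∈ g /\ Box ⌊b⌋ (img ⌊t⌋ g) C.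
Proof. unfold Yn, tpl. rewrite !(inj_opair TV), !psnd_eq, !pfst_eq. reflexivity. Qed.
Definition yC C : N := sep ⌊QT⌋ (fun u => exists r, r ∈ ⌊TT⌋ /\ u = ap ⌊lam TT UT⌋ r /\ Yn C r).
Lemma ap_UT r : r ∈ TT -> ap ⌊lam TT UT⌋ ⌊r⌋ = ⌊UT r⌋.
Proof.
intro Hr. pose proof UT_def. rewrite (inj_ap TV (y := UT r));[now rewrite ap_lam|now apply lam_functional|now apply in_lam2].
Qed.
Lemma in_yC0 C u : u ∈ yC C <-> exists r, r ∈ TT /\ u = ⌊UT r⌋ /\ Yn C ⌊r⌋.
Proof.
unfold yC. rewrite in_sep by (unfold Yn;def). split.
- intros [_ (r&Hr&E&H)]. apply (in_inj TV) in Hr as (r'&<-&Hr). rewrite ap_UT in E by trivial. now exists r'.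
- intros (r&Hr&->&H). split;[apply inj_mem, in_QT;now exists r|]. exists ⌊r⌋. rewrite ap_UT by trivial. spa.
Qed.

Lemma g_coll p : ⌊p⌋ ∈ g -> p ∈ coll al. Proof. intro H. exact (gen_in HGa H). Qed.
Lemma leT_sem p' b' t' p b t : leT (tpl p' b' t') (tpl p b t) -> ⌊p'⌋ ∈ g ->
 (forall s, ⌊s⌋ ∈ img ⌊t'⌋ g -> bey b' s -> ⌊s⌋ ∈ img ⌊t⌋ g) /\ (forall s, s ∈ b' -> s ∈ b \/ ⌊s⌋ ∈ img ⌊t⌋ g).
Proof.
intros L Hp'. rewrite leT_eq in L. destruct L as (L1&L2&L3&L4). split.
- intros s Hs Hb. destruct (inn_cplV TV HGa Hs Hp') as (q&Hqg&Hq&S&I). exact (inn_snd TV HGa Hqg (L4 s q Hq S Hb I)).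
- intros s Hs. destruct (L3 s Hs) as [H|H];[now left|right;exact (inn_snd TV HGa Hp' H)].
Qed.
Lemma leT_snd C r' r : r ∈ TT -> r' ∈ TT -> leT r' r -> Yn C ⌊r'⌋ -> Yn C ⌊r⌋.
Proof.
intros Hr Hr' L HY. apply TT_inv in Hr as (p&b&t&->&Hp&Hb&Ht&_), Hr' as (p'&b'&t'&->&Hp'&Hb'&Ht'&_).
apply Yn_eq in HY as [Gp (Ci&Cb&Cs)]. apply Yn_eq. destruct (leT_sem L Gp) as [M1 M2]. rewrite leT_eq in L. destruct L as (L1&L2&_).
split;[apply (gen_up TV HGa Hp Gp L1)|]. spt. split;[apply (init_trans (b := ⌊b'⌋));trivial;now apply (inj_init TV)|].
intros s Hs. assert (HsF : s ∈ FIN) by now apply Ci. rewrite <- (inj_FIN TV) in HsF. apply (in_inj TV) in HsF as (s'&<-&_).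
destruct (proj2 Cb _ Hs) as [H|H];[now apply M2 in H|]. destruct (Cs _ Hs) as [H'|H'];[now apply M2 in H'|].
right. apply M1;trivial. now apply (inj_bey TV).
Qed.
Lemma in_yC C r : r ∈ TT -> (⌊UT r⌋ ∈ yC C <-> Yn C ⌊r⌋).
Proof.
intro Hr. rewrite in_yC0. split;[|intro H;now exists r].
intros (r'&Hr'&E&H). apply inj_inj in E. apply (leT_snd Hr Hr');trivial. apply UT_le;trivial. rewrite E. apply sub_refl.
Qed.

(** Inclusions that hold for the actual values are forced by some condition of the collapse generic:
    by genericity it contains a condition no extension of which forces a counterexample. *)
Lemma leT_cpl b1 b t1 t' p0 p1 : init b1 b -> (forall s, s ∈ b -> s ∈ b1 \/ ⌊s⌋ ∈ img ⌊t1⌋ g) ->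
 (forall s, ⌊s⌋ ∈ img ⌊t'⌋ g -> bey b s -> ⌊s⌋ ∈ img ⌊t1⌋ g) -> ⌊p0⌋ ∈ g -> ⌊p1⌋ ∈ g ->
 exists p', ⌊p'⌋ ∈ g /\ subset p0 p' /\ forall p, p ∈ coll al -> subset p' p -> leT (tpl p b t') (tpl p1 b1 t1).
Proof.
intros Hin Hb Ht G0 G1.
pose (X := fun p => (exists s, s ∈ b /\ ~ s ∈ b1 /\ forall q, q ∈ coll al -> subset p q -> ~ inA q t1 s) \/
 (exists s, bey b s /\ inA p t' s /\ forall q, q ∈ coll al -> subset p q -> ~ inA q t1 s)).
assert (HX : Def1 X) by (unfold X;def).
destruct (gen_dich HX HGa) as [(p&Hp&Gp&[(s&Hs&Ns&H)|(s&Hs&Is&H)])|(p&Hp&Gp&U)].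
- exfalso. destruct (Hb s Hs) as [C|C];[tauto|]. destruct (inn_cplV TV HGa C Gp) as (q&_&Hq&S&I). exact (H q Hq S I).
- exfalso. assert (C := Ht s (inn_snd TV HGa Gp Is) Hs). destruct (inn_cplV TV HGa C Gp) as (q&_&Hq&S&I). exact (H q Hq S I).
- destruct (gen_dir TV HGa G0 G1) as (r1&_&Gr1&S1&S2). destruct (gen_dir TV HGa Gr1 Gp) as (r&_&Gr&S3&S4).
 exists r. spt. split;[exact (subT S1 S3)|]. intros p2 Hp2 S. apply leT_eq. spa.
 + exact (subT S2 (subT S3 S)).
 + intros s Hs. destruct (classic (s ∈ b1)) as [|Ns];[now left|right]. apply inn_dense. intros q Hq Sq. apply NNPP. intro C.
 apply (U q Hq (subT S4 (subT S Sq))). left. exists s. spa. intros q2 Hq2 Sq2 I. apply C. now exists q2.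
 + intros s q1 Hq1 Sq1 Hs Is. apply inn_dense. intros q Hq Sq. apply NNPP. intro C.
 apply (U q Hq (subT S4 (subT S (subT Sq1 Sq)))). right. exists s. spa;[exact (inn_mono Is Sq)|].
 intros q2 Hq2 Sq2 I. apply C. now exists q2.
Qed.

Lemma Ha_F S : S ∈ Ha -> subset S FIN. Proof. intro H. apply in_Ha in H as [H _]. now apply HF. Qed.
Lemma Ha_T S b : S ∈ Ha -> b ∈ FB -> tl S b ∈ Ha.
Proof.
intros H Hb. apply in_Ha in H as [H W]. apply in_Ha. split;[now apply HT|].
destruct (inj_lift W) as (SM&<-). pose proof Hb as Hb'. rewrite <- (inj_FB TV) in Hb'. apply (in_inj TV) in Hb' as (b'&<-&_).
destruct (lift_V b') as (bM&<-). assert (E : ⌈tl SM bM⌉ = tl ⌈SM⌉ ⌈bM⌉);[|rewrite <- E;apply inj_V].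
symmetry. apply (inj_ext TM).
- intros z Hz. apply in_tl in Hz as [Hz _]. apply (in_inj TM) in Hz as (z'&<-&_). apply inj_V.
- intro z. rewrite !in_tl, (inj_bey TM). reflexivity.
Qed.

(** Pairs (b,S) such that S, beyond b, lies in the value of some t with (p,b,t) in [X] and p in the
    collapse generic. This turns a set of conditions into something that fusion in V[G_alpha] can
    decide. *)
Definition DS (X : VS) : N := sep (prod FB Ha) (fun z => exists p t, p ∈ g /\ t ∈ ⌊NS⌋ /\ opair p (opair (pfst z) t) ∈ ⌊X⌋ /\
 forall s, s ∈ psnd z -> bey (pfst z) s -> s ∈ img t g).
Lemma in_DS X b S : opair b S ∈ DS X <-> b ∈ FB /\ S ∈ Ha /\ exists p t, p ∈ g /\ t ∈ ⌊NS⌋ /\ opair p (opair b t) ∈ ⌊X⌋ /\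
 forall s, s ∈ S -> bey b s -> s ∈ img t g.
Proof. unfold DS. rewrite in_sep by def. rewrite in_prod2, pfst_eq, psnd_eq. tauto. Qed.
Lemma DS_mono X : mono Ha (DS X).
Proof.
intros b S S' H HS' St. apply in_DS in H as (Hb&HSa&p&t&Hp&Ht&Hin&H). apply in_DS. spa. exists p, t. spa.
intros s Hs Hbs. apply H;trivial. apply St, in_tl. now split.
Qed.
Lemma DS_W X : Wa (DS X).
Proof.
destruct (lift_V FB) as (BM&EB), (inj_lift Ha_W) as (HM&EH), (lift_V X) as (XM&EX), (lift_V NS) as (NM&EN), (inj_lift (PW_y TV HGa)) as (gM&Eg).
rewrite (inj_FB TV) in EB.
pose (P := fun z : MS => exists p t, p ∈ gM /\ t ∈ NM /\ opair p (opair (pfst z) t) ∈ XM /\ forall s, s ∈ psnd z -> bey (pfst z) s -> s ∈ img t gM).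
assert (HP : Def1 P) by (unfold P;def).
assert (E : ⌈sep (prod BM HM) P⌉ = DS X);[|rewrite <- E;apply inj_V]. symmetry.
assert (PE : forall b S, P (opair b S) <-> exists p t, p ∈ g /\ t ∈ ⌊NS⌋ /\ opair p (opair ⌈b⌉ t) ∈ ⌊X⌋ /\ forall s, s ∈ ⌈S⌉ -> bey ⌈b⌉ s -> s ∈ img t g).
{ intros b S. unfold P. rewrite pfst_eq, psnd_eq. split.
 - intros (p&t&Hp&Ht&Hin&H). exists ⌈p⌉, ⌈t⌉. rewrite <- EN, <- EX. sp.
 + change (⌈p⌉ ∈ ⌈gM⌉) in Hp. now rewrite Eg in Hp.
 + exact Ht.
 + rewrite <- !(inj_opair TM). exact Hin.
 + intros s Hs Hbs. apply (in_inj TM) in Hs as (s'&<-&Hs). apply (inj_bey TM) in Hbs. assert (Q := H s' Hs Hbs).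
 change (⌈s'⌉ ∈ ⌈img t gM⌉) in Q. now rewrite (inj_img TM), Eg in Q.
 - intros (p&t&Hp&Ht&Hin&H). assert (Hp' : p ∈ ⌈gM⌉) by (rewrite Eg;exact Hp). clear Hp. rename Hp' into Hp. rewrite <- EN in Ht. apply (in_inj TM) in Hp as (p'&<-&Hp), Ht as (t'&<-&Ht).
 exists p', t'. rewrite <- EX, <- !(inj_opair TM) in Hin. spa. intros s Hs Hbs. change (⌈s⌉ ∈ ⌈img t' gM⌉). rewrite (inj_img TM), Eg. apply H;[exact Hs|]. now apply (inj_bey TM). }
apply (inj_ext TM).
- intros z Hz. unfold DS in Hz. apply in_sep in Hz as [Hz _];[|def]. apply in_prod in Hz as (b&S&Hb&HSa&->).
 rewrite <- EB in Hb. rewrite <- EH in HSa. apply (in_inj TM) in Hb as (b'&<-&_), HSa as (S'&<-&_). rewrite <- (inj_opair TM). apply inj_V.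
- intro z. rewrite in_sep by trivial. rewrite in_prod. split.
 + intro Hz. pose proof Hz as Hz'. unfold DS in Hz'. apply in_sep in Hz' as [Hz' _];[|def]. apply in_prod in Hz' as (b&S&Hb&HSa&Ez).
 pose proof Hb as Hb'. pose proof HSa as HSa'. rewrite <- EB in Hb'. rewrite <- EH in HSa'. apply (in_inj TM) in Hb' as (b'&<-&Hb'), HSa' as (S'&<-&HSa').
 rewrite <- (inj_opair TM) in Ez. apply inj_inj in Ez. subst z. split;[now exists b', S'|]. apply PE. rewrite (inj_opair TM) in Hz. now apply in_DS in Hz.
 + intros [(b&S&Hb&HSa&->) H]. rewrite (inj_opair TM). apply in_DS. apply PE in H. spa.
 * rewrite <- EB. exact Hb. * rewrite <- EH. exact HSa.
Qed.
Lemma DS_U_W X B : B ∈ Ha -> Wa (sep FB (fun b => opair b B ∈ DS X)).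
Proof.
intro HB. apply in_Ha in HB as [_ HB]. destruct (lift_V FB) as (BM&EB), (inj_lift (DS_W X)) as (DM&ED), (inj_lift HB) as (B'&<-). rewrite (inj_FB TV) in EB.
assert (E : ⌈sep BM (fun b => opair b B' ∈ DM)⌉ = sep FB (fun b => opair b ⌈B'⌉ ∈ DS X));[|rewrite <- E;apply inj_V]. symmetry.
apply (inj_ext TM).
- intros z Hz. apply in_sep in Hz as [Hz _];[|def]. rewrite <- EB in Hz. apply (in_inj TM) in Hz as (z'&<-&_). apply inj_V.
- intro z. rewrite !in_sep by def. rewrite <- EB, <- ED, (opinj TM). reflexivity.
Qed.
Lemma step_alpha X a A : a ∈ FB -> A ∈ Ha -> exists B, B ∈ Ha /\ subset B A /\
 forall b A', b ∈ FB -> ok a B b -> A' ∈ Ha -> subset (tl A' b) B -> opair b A' ∈ DS X -> opair b B ∈ DS X.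
Proof. intros HaB HA. exact (step1 Ha_F Ha_T (DS_mono (X := X)) (chains_alpha (DS_W X)) HaB HA). Qed.

(** Fusion decides for each stem b whether (b,B) meets the dense set, and the open Ramsey property
    of those stems makes the answer uniform: either every C passes through such a stem, as required,
    or none does, which density refutes. *)
Lemma meet_dense E a A : dense QT E -> a ∈ FB -> A ∈ Ha -> exists B, B ∈ Ha /\ subset B A /\
 forall C, Box a B C -> exists r, r ∈ TT /\ UT r ∈ E /\ Yn C ⌊r⌋.
Proof.
intros [ES ED] HaB HA. pose proof UT_def as HUT.
pose (X := sep TT (fun r => UT r ∈ E)). assert (HX : forall r, r ∈ X <-> r ∈ TT /\ UT r ∈ E) by (intro r;unfold X;rewrite in_sep by def;reflexivity).
destruct (step_alpha X HaB HA) as (B&HB&SB&P).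
destruct (@ramsey_alpha (sep FB (fun b => opair b B ∈ DS X)) a B) as (B1&HB1&SB1&Dich);trivial.
{ now apply DS_U_W. } { intros b Hb. now apply in_sep in Hb as [Hb _];[|def]. }
exists B1. spt. split;[exact (subT SB1 SB)|]. destruct Dich as [H|H].
- intros C HBx. destruct (H C HBx) as (b&Hb&I1&I2). apply in_sep in Hb as [Hb HD];[|def]. apply in_DS in HD as (_&_&p&t&Hp&Ht&Hin&Ht').
 destruct (gen_lift TV HGa Hp) as (p'&<-&_). apply (in_inj TV) in Ht as (t'&<-&Ht).
 rewrite <- (inj_FB TV) in Hb. apply (in_inj TV) in Hb as (b'&<-&Hb). rewrite <- !(inj_opair TV) in Hin. change (tpl p' b' t' ∈ X) in Hin.
 apply HX in Hin as [Hr HE]. exists (tpl p' b' t'). spa. apply Yn_eq. spt. destruct HBx as (C1&C2&C3). spt. spt.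
 intros s Hs. destruct (proj2 I2 s Hs) as [|Hbs];[now left|]. right. apply Ht';trivial. destruct (C3 s Hs) as [Q|Q];[|now apply SB1].
 exfalso. assert (Q' := Hbs s (proj1 I1 s Q)). exact (lt_irr (proj1 C1 s Hs) Q').
(* The condition with stem [a] and a name of B1 has an extension (p,b,t') in the dense set with p in
   the collapse generic; any C in the box of b and the value of t' lies in the box of [a] and B1 and
   yet hits [U]. *)
- exfalso. pose proof HB1 as HB1'. apply in_Ha0 in HB1' as [HB1h (t&Ht&E1)].
 pose proof HaB as Ha'. rewrite <- (inj_FB TV) in Ha'. apply (in_inj TV) in Ha' as (a'&<-&Ha').
 rewrite E1 in HB1h. destruct (hh_cpl Ht HB1h) as (p0&Hp0&Gp0&Hh0).
 pose proof leT_def as Hle.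
 destruct (@gen_dich N V ZV (fun p => exists b t', tpl p b t' ∈ X /\ leT (tpl p b t') (tpl p0 a' t)) (coll al) g) as [(p&Hp&Gp&b&t'&Hin&L)|(p&Hp&Gp&U)];trivial.
 { unfold tpl. def. }
 { exact HGa. }
 + pose proof Hin as HinX. apply HX in Hin as [Hin _]. pose proof Hin as Hin'. apply in_TT in Hin' as (_&Hb&Ht'&Hh'). destruct (leT_sem L Gp) as [M1 M2]. rewrite leT_eq in L. destruct L as (_&L2&_).
 set (A3 := img ⌊t'⌋ g). assert (HA3 : A3 ∈ Hh) by exact (hh_snd Ht' Gp Hh'). assert (HbN : ⌊b⌋ ∈ FB) by (rewrite <- (inj_FB TV);exact Hb).
 assert (T3 : subset (tl A3 ⌊b⌋) B1).
 { intros s Hs. apply in_tl in Hs as [Hs Hbs]. assert (HsF := HF HA3 Hs). rewrite <- (inj_FIN TV) in HsF. apply (in_inj TV) in HsF as (s'&<-&_).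
 rewrite E1. apply M1;trivial. now apply (inj_bey TV). }
 destruct (HI HA3 HbN) as (C&HBx).
 assert (bB : forall s, s ∈ ⌊b⌋ -> s ∈ ⌊a'⌋ \/ s ∈ B1).
 { intros s Hs. apply (in_inj TV) in Hs as (s'&<-&Hs). rewrite E1. now apply M2. }
 assert (I1 : init ⌊a'⌋ ⌊b⌋) by now apply (inj_init TV).
 apply (H C).
 * destruct (Box_tl HBx T3) as (C1&C2&C3). spt. split;[exact (init_trans I1 C2)|]. intros s Hs. destruct (C3 s Hs) as [Q|Q];[now apply bB|now right].
 * exists ⌊b⌋. split;[|split;[trivial|apply HBx]]. apply in_sep;[def|]. spt. apply (P ⌊b⌋ A3);trivial.
 -- destruct (classic (⌊b⌋ = ⌊a'⌋)) as [Q|Q];[now left|]. destruct (last_ex HbN I1 Q) as (s&Hs&Ns&Ls). right. exists s. spa. apply SB1. destruct (bB s Hs);tauto.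
 -- apply in_Ha0. spt. now exists t'.
 -- exact (subT T3 SB1).
 -- apply in_DS. spt. split;[apply in_Ha0;spt;now exists t'|]. exists ⌊p⌋, ⌊t'⌋. spa.
 rewrite <- !(inj_opair TV). exact HinX.
 + destruct (gen_dir TV HGa Gp Gp0) as (p1&Hp1&Gp1&S1&S2).
 assert (Hr1 : tpl p1 a' t ∈ TT) by (apply in_TT;spa;exact (hh_mono Hp1 S2 Hh0)).
 destruct (ED (UT (tpl p1 a' t))) as (q&Hq&Sq);[apply in_QT;exists (tpl p1 a' t);now split|].
 pose proof (ES q Hq) as Hq'. apply in_QT in Hq' as (r&Hr&->). apply UT_le in Sq;trivial. pose proof Hr as Hr'. apply TT_inv in Hr' as (p2&b&t'&->&Hp2&_).
 apply (U p2 Hp2).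
 * rewrite leT_eq in Sq. destruct Sq as (Sq&_). exact (subT S1 Sq).
 * exists b, t'. split;[apply HX;now split|]. apply (leT_trans Sq). apply leT_eq. spa;[split;[apply sub_refl|now left]|now left].
Qed.

(** [ramsey_alpha] with the empty stem, applied to the singletons of members of [Y]: such a set is
    hit exactly when the least block of C is in [Y], and every member of B is the least block of
    some C. *)
Lemma coideal_alpha Y S : Wa Y -> S ∈ Ha -> exists S', S' ∈ Ha /\ subset S' S /\ ((forall s, s ∈ S' -> s ∈ Y) \/ (forall s, s ∈ S' -> ~ s ∈ Y)).
Proof.
intros HY HS'. destruct (inj_lift HY) as (YM&<-), (lift_V FIN) as (FM&EF). rewrite (inj_FIN TV) in EF.
pose (U := ⌈repl (sep YM (fun s => s ∈ FM)) sing⌉).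
assert (HU : forall u, u ∈ U <-> exists s, s ∈ ⌈YM⌉ /\ s ∈ FIN /\ u = sing s).
{ assert (Es : forall s, ⌈sing s⌉ = sing ⌈s⌉) by (intro s;apply (inj_upair TM)).
 intro u. unfold U. split.
 - intro Hu. apply (in_inj TM) in Hu as (u'&<-&Hu). apply in_repl in Hu as (s&Hs&->);[|def]. apply in_sep in Hs as [Hs HsF];[|def].
 exists ⌈s⌉. sp;[exact Hs|rewrite <- EF;exact HsF|apply Es].
 - intros (s&Hs&HsF&->). apply (in_inj TM) in Hs as (s'&<-&Hs). rewrite <- Es. apply inj_mem. apply in_repl;[def|]. exists s'. spt.
 apply in_sep;[def|]. spt. rewrite <- EF in HsF. exact HsF. }
assert (E0 : (emp : N) ∈ FB).
{ apply in_FB. split;[intros s Hs;now apply in_emp in Hs|]. split;[intros s t Hs;now apply in_emp in Hs|]. exists emp. split;[apply om_emp|]. intros s Hs. now apply in_emp in Hs. }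
assert (sB : forall s : N, s ∈ FIN -> sing s ∈ FB).
{ intros s Hs. apply in_FB. sp.
 - intros t Ht. apply in_sing in Ht. now subst. - intros t u Ht Hu. apply in_sing in Ht, Hu. left. now subst.
 - apply in_FIN in Hs as [_ (n&Hn&Sn)]. exists n. spt. intros t Ht. apply in_sing in Ht. now subst. }
destruct (@ramsey_alpha U emp S) as (B&HB&SB&Dich);trivial.
{ apply inj_V. } { intros u Hu. apply HU in Hu as (s&_&Hs&->). now apply sB. }
assert (BX : forall s, s ∈ B -> exists C, Box emp B C /\ init (sing s) C /\ s ∈ C).
{ intros s Hs. assert (HsF := Ha_F HB Hs). apply in_Ha in HB as [HBh _]. destruct (HI HBh (sB s HsF)) as (C&C1&C2&C3). exists C. spa.
 - spt. split;[split;[intros t Ht;now apply in_emp in Ht|];intros t Ht;right;intros u Hu;now apply in_emp in Hu|].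
 intros t Ht. right. destruct (C3 t Ht) as [Q|Q];trivial. apply in_sing in Q. now subst.
 - apply C2. now apply in_sing. }
exists B. spt. spt. destruct Dich as [H|H];[left|right];intros s Hs;destruct (BX s Hs) as (C&HBx&Is&HsC).
- destruct (H C HBx) as (b&Hb&_&Ib). apply HU in Hb as (s'&HsY&HsF&->). assert (Hs'C : s' ∈ C) by (apply Ib;now apply in_sing).
 destruct (proj2 Is s' Hs'C) as [Q|Q];[apply in_sing in Q;now subst|]. destruct (proj2 Ib s HsC) as [Q'|Q'];[apply in_sing in Q';now subst|].
 exfalso. apply (lt_asym (Ha_F HB Hs) HsF);[apply Q|apply Q'];now apply in_sing.
- intro HsY. apply (H C HBx). exists (sing s). split;[apply HU;exists s;spa;exact (Ha_F HB Hs)|]. spt.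
 split;[intros t Ht;now apply in_emp in Ht|]. intros t Ht. right. intros u Hu. now apply in_emp in Hu.
Qed.

(** Choose a block s of C above n0 and above all of [a]; b is the part of C up to s, and n is the
    maximum of s. *)
Lemma cut (C a n0 : N) : infb C -> a ∈ FB -> init a C -> n0 ∈ om -> exists s n b, s ∈ C /\ ~ s ∈ a /\ n ∈ s /\ n ∈ om /\ n0 ∈ n /\
 (forall m, m ∈ s -> n0 ∈ m) /\ b ∈ FB /\ init a b /\ init b C /\ s ∈ b /\ (forall t, t ∈ C -> subset t n0 -> t ∈ b) /\
 (forall t, t ∈ b -> subset t (succ n)) /\ forall t, t ∈ C -> bey b t -> ~ t ∈ a /\ lt s t.
Proof.
intros (CF&CB&CI) HaB Ia Hn0. apply in_FB in HaB as (aF&aB&n1&Hn1&aN).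
destruct (ord_max ord_om Hn0 Hn1) as (n2&Hn2&S0&S1). destruct (CI n2 Hn2) as (s&HsC&Hs). assert (HsF := CF s HsC).
assert (Om : forall m, m ∈ s -> ordinal m) by (intros m Hm;apply in_FIN in HsF as [_ (l&Hl&Sl)];exact (om_ord (om_mem Hl (Sl m Hm)))).
assert (low : forall t, subset t n2 -> lt t s) by (intros t Ht m j Hm Hj;exact (proj1 (Om j Hj) n2 (Hs j Hj) m (Ht m Hm))).
destruct (FIN_max HsF) as (n&Hn&Hno&Mx).
pose (b := sep C (fun t => t = s \/ lt t s)). assert (Hb : forall t, t ∈ b <-> t ∈ C /\ (t = s \/ lt t s)) by (intro t;unfold b;rewrite in_sep by def;reflexivity).
assert (bN : forall t, t ∈ b -> subset t (succ n)).
{ intros t Ht j Hj. apply Hb in Ht as [_ [->|L]];apply in_succ;[now apply Mx|left;exact (L j n Hj Hn)]. }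
assert (Nsa : ~ s ∈ a) by (intro Q;exact (lt_irr HsF (low s (subT (aN s Q) S1)))).
assert (Isb : init b C).
{ split;[intros t Ht;now apply Hb in Ht|]. intros t Ht. destruct (CB t s Ht HsC) as [E|[L|L]];[left;apply Hb;auto|left;apply Hb;auto|].
 right. intros u Hu. apply Hb in Hu as [HuC [->|L']];trivial. exact (lt_trans HsF (CF t Ht) L' L). }
assert (ab : subset a b) by (intros t Ht;apply Hb;split;[now apply Ia|right;apply low;exact (subT (aN t Ht) S1)]).
assert (lo : forall m, m ∈ s -> n0 ∈ m).
{ intros m Hm. destruct (ord_sub (om_ord Hn0) (om_ord Hn2) S0) as [Q| ->];[|now apply Hs]. exact (proj1 (Om m Hm) n2 (Hs m Hm) n0 Q). }
exists s, n, b. spa.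
- now apply lo.
- apply in_FB. split;[intros t Ht;apply Hb in Ht as [Ht _];auto|]. split;[intros t u Ht Hu;apply Hb in Ht as [Ht _], Hu as [Hu _];auto|].
 exists (succ n). split;[now apply om_succ|trivial].
- spt. intros t Ht. apply Ia. now apply Hb in Ht.
- apply Hb. auto.
- intros t Ht St. apply Hb. spt. right. apply low. exact (subT St S0).
- intros t Ht Hbt. split;[|apply Hbt, Hb;auto]. intro Q. exact (lt_irr (CF t Ht) (Hbt t (ab t Q))).
Qed.

(** A fusion in N along enumerations of the sets of conditions and of the names in [NS]. Meeting
    dense sets gives genericity; homogeneity for the value of every name makes the conditions
    compatible with C directed. The resulting B comes from selectivity in N and need not lie in
    V[G_alpha]. *)
Lemma generic_boxes a A : a ∈ FB -> A ∈ Ha -> exists B, B ∈ Hh /\ subset B A /\ forall C, Box a B C -> gen QT (yC C) /\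
 forall r1 r2, r1 ∈ TT -> r2 ∈ TT -> Yn C ⌊r1⌋ -> Yn C ⌊r2⌋ -> exists r3, r3 ∈ TT /\ Yn C ⌊r3⌋ /\ leT r3 r1 /\ leT r3 r2.
Proof.
intros HaB HA. pose proof HA as HA0. apply in_Ha0 in HA0 as [HAh (tA&HtA&EA)].
destruct (@countable_K N V ZN ZV TV ACV k G Hk hG (pow QT)) as (e1&He1);[apply (K_pow Hi), QT_K| |].
{ intro E. assert (Q : (emp : VS) ∈ pow QT) by (apply in_pow;intros z Hz;now apply in_emp in Hz). rewrite E in Q. now apply in_emp in Q. }
destruct (@countable_K N V ZN ZV TV ACV k G Hk hG NS NS_K) as (e2&He2);[intro E;rewrite E in HtA;now apply in_emp in HtA|].
apply is_surj_eq in He1 as [He1 Se1], He2 as [He2 Se2].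
pose (dn := fun E => forall p, p ∈ ⌊QT⌋ -> exists q, q ∈ E /\ subset p q).
pose (Hd := fun i b S => dn (ap e1 i) -> forall C, Box b S C -> exists r, r ∈ ⌊TT⌋ /\ ap ⌊lam TT UT⌋ r ∈ ap e1 i /\ Yn C r).
assert (DHd : Def3 Hd) by (unfold Hd, dn, Yn;def).
assert (PHd : forall i b S S', Hd i b S -> S' ∈ Ha -> subset S' S -> Hd i b S').
{ intros i b S S' H _ SS D C HBx. apply H;trivial. apply (Box_tl HBx). intros s Hs. apply in_tl in Hs as [Hs _]. auto. }
assert (EHd : forall i b S : N, i ∈ om -> b ∈ FB -> S ∈ Ha -> exists S', S' ∈ Ha /\ subset S' S /\ Hd i b S').
{ intros i b S Hi' Hb HSa. destruct (classic (dn (ap e1 i))) as [D|D];[|exists S;spa;[apply sub_refl|];now intros ? ?].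
 assert (Q := proj1 (fun_ap He1 Hi')). apply (in_inj TV) in Q as (E&EE&HE). apply in_pow in HE.
 destruct (@meet_dense E b S) as (B&HB&SB&H);trivial.
 { spt. intros p Hp. rewrite <- EE in D. destruct (D ⌊p⌋ Hp) as (q&Hq&Sq). apply (in_inj TV) in Hq as (q'&<-&Hq). exists q'. spt. now apply (inj_sub TV). }
 exists B. spa. intros _ C HBx. destruct (H C HBx) as (r&Hr&HrE&HY). exists ⌊r⌋. rewrite ap_UT, <- EE by trivial. spa. }
pose (Bn := fun n : N => sep FB (fun b => forall s, s ∈ b -> subset s (succ (succ n)))).
assert (HBn : forall n b : N, b ∈ Bn n <-> b ∈ FB /\ forall s, s ∈ b -> subset s (succ (succ n))) by (intros n b;unfold Bn;rewrite in_sep by def;reflexivity).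
(* Step n treats the sets of conditions with index at most n for all stems with blocks inside n+2,
   and makes S' homogeneous for the value of the n-th name. *)
pose (R := fun n S S' => subset S' S /\ (forall i, i ∈ succ n -> forall b, b ∈ Bn n -> Hd i b S') /\
 ((forall s, s ∈ S' -> s ∈ img (ap e2 n) g) \/ (forall s, s ∈ S' -> ~ s ∈ img (ap e2 n) g))).
destruct (@DC N ZN ACN R Ha A) as (F&HFu&F0&Fs);trivial.
{ unfold R, Bn. def. }
{ intros n S Hn HSa.
 destruct (@fin_handle N ZN Ha om (fun i S => forall b, b ∈ Bn n -> Hd i b S) (succ n) S) as (S1&HS1&SS1&H1).
 - unfold Bn. def.
 - intros i S1 S2 H HS2 S21 b Hb. exact (PHd _ _ _ _ (H b Hb) HS2 S21).
 - intros i S1 Hi' HS1. apply (@fin_handle N ZN Ha FB (fun b S => Hd i b S) (Bn n) S1);trivial.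
 + def. + intros b S2 S3 H. now apply PHd. + intros b S2 Hb HS2. now apply EHd.
 + apply (finite_sub (x := pow (pow (succ (succ n))))).
 * apply finite_pow, finite_pow, finite_om. now do 2 apply om_succ.
 * intros b Hb. apply HBn in Hb as [_ Hb]. apply in_pow. intros s Hs. apply in_pow. now apply Hb.
 + intros b Hb. now apply HBn in Hb.
 - now apply finite_om, om_succ.
 - intros i Hi'. exact (om_mem (om_succ Hn) Hi').
 - trivial.
 - assert (Q := proj1 (fun_ap He2 Hn)). apply (in_inj TV) in Q as (t&Et&Ht). 
 destruct (@coideal_alpha (img ⌊t⌋ g) S1 (img_W Ht) HS1) as (S2&HS2&SS2&H2). rewrite Et in H2.
 exists S2. spt. split;[exact (subT SS2 SS1)|]. spt. intros i Hi' b Hb. exact (PHd _ _ _ _ (H1 i Hi' b Hb) HS2 SS2). }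
assert (Fa : forall n, n ∈ om -> ap F n ∈ Ha) by (intros n Hn;exact (proj1 (fun_ap HFu Hn))).
assert (Fm : forall n, n ∈ om -> forall m, m ∈ n -> subset (ap F n) (ap F m)).
{ apply (om_ind (P := fun n => forall m, m ∈ n -> subset (ap F n) (ap F m)));[def|intros m Hm;now apply in_emp in Hm|].
 intros n Hn IH m Hm. apply in_succ in Hm as [Hm| ->];[|now apply Fs]. exact (subT (proj1 (Fs n Hn)) (IH m Hm)). }
destruct (HS (F := F)) as (B&HB&SB&Dg).
{ apply is_fun_eq in HFu as (Q1&Q2&Q3). apply is_fun_eq. spa. intros p Hp. destruct (Q1 p Hp) as (x&y&Hx&Hy&->). exists x, y. spa. now apply in_Ha in Hy. }
{ intros n Hn. now apply Fs. }
rewrite F0 in SB. exists B. spt. spt. intros C HBx. pose proof HBx as (Ci&Ca&Cs).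
assert (succ_le : forall i n : N, n ∈ om -> i ∈ n -> subset (ap F n) (ap F (succ i))).
{ intros i n Hn Hin. destruct (classic (succ i = n)) as [->|Q];[apply sub_refl|]. apply Fm;trivial.
 assert (Oi : ordinal (succ i)) by exact (om_ord (om_succ (om_mem Hn Hin))).
 destruct (ord_tri Oi (om_ord Hn)) as [|[|Q']];[trivial|tauto|]. exfalso. apply in_succ in Q' as [Q'|Q'].
 - exact (mem_asym Q' Hin). - subst. exact (mem_irrefl Hin). }
assert (c1 : forall n0 : N, n0 ∈ om -> exists s n b, s ∈ C /\ ~ s ∈ a /\ n ∈ s /\ n ∈ om /\ n0 ∈ n /\ (forall m, m ∈ s -> n0 ∈ m) /\
 b ∈ FB /\ init a b /\ init b C /\ s ∈ b /\ (forall t, t ∈ C -> subset t n0 -> t ∈ b) /\ (forall t, t ∈ b -> subset t (succ n)) /\ Box b (ap F n) C).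
{ intros n0 Hn0. destruct (cut Ci HaB Ca Hn0) as (s&n&b&H1&H2&H3&H4&H5&H6&H7&H8&H9&H10&H11&H12&H13).
 exists s, n, b. do 12 (split;[trivial|]). spt. spt. intros t Ht. destruct (proj2 H9 t Ht) as [Q|Q];[now left|right].
 destruct (H13 t Ht Q) as [Nt L]. apply (Dg s t n);trivial.
 - destruct (Cs s H1);tauto. - destruct (Cs t Ht);tauto. }
(* If (p,b,t) is compatible with C, far blocks of C lie both in the value of t and in every given
   F(n), so the homogeneous alternative in which the two are disjoint is impossible. *)
assert (c3 : forall p b t, tpl p b t ∈ TT -> Yn C ⌊tpl p b t⌋ -> exists i, i ∈ om /\ forall n, n ∈ om -> i ∈ n -> subset (ap F n) (img ⌊t⌋ g)).
{ intros p b t Hr HY. apply in_TT in Hr as (Hp&Hb&Ht&_). destruct (Se2 ⌊t⌋ Ht) as (i&Hi'&Ei). exists i. spt. intros n Hn Hin.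
 destruct (Fs i Hi') as (_&_&[Q|Q]);rewrite Ei in Q;[exact (subT (succ_le i n Hn Hin) Q)|]. exfalso.
 apply Yn_eq in HY as [_ (_&Cb&Cbs)]. assert (HbN : ⌊b⌋ ∈ FB) by (rewrite <- (inj_FB TV);exact Hb).
 pose proof HbN as HbN'. apply in_FB in HbN' as (bF&_&nb&Hnb&bN). destruct (ord_max ord_om Hnb Hi') as (n0&Hn0&S1&S2).
 destruct (c1 n0 Hn0) as (s&n1&b1&H1&H2&H3&H4&H5&H6&H7&H8&H9&H10&H11&H12&H13).
 destruct (next_ex H7 H13) as (u&HuC&HuF&Hbu&_).
 assert (On1 : ordinal n1) by exact (om_ord H4).
 assert (Hin1 : i ∈ n1). { destruct (ord_sub (om_ord Hi') (om_ord Hn0) S2) as [E|E];[exact (proj1 On1 n0 H5 i E)|now subst]. }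
 apply (Q u (succ_le i n1 H4 Hin1 u HuF)). destruct (Cbs u HuC) as [E|E];trivial. exfalso.
 assert (Eb : u ∈ b1) by (apply H11;trivial;exact (subT (bN u E) S1)). exact (lt_irr (bF u E) (Hbu u Eb)). }
(* A common extension has as stem a long initial piece of C and as side set a name of F(n) for large
   n, included in both values by [c3]; [leT_cpl] finds conditions forcing the inclusions. *)
assert (dirT : forall r1 r2, r1 ∈ TT -> r2 ∈ TT -> Yn C ⌊r1⌋ -> Yn C ⌊r2⌋ -> exists r3, r3 ∈ TT /\ Yn C ⌊r3⌋ /\ leT r3 r1 /\ leT r3 r2).
{ intros r1 r2 Hr1 Hr2 Y1 Y2. pose proof Hr1 as Hr1'. pose proof Hr2 as Hr2'.
 apply TT_inv in Hr1' as (p1&b1&t1&->&Hp1&Hb1&Ht1&Hh1), Hr2' as (p2&b2&t2&->&Hp2&Hb2&Ht2&Hh2).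
 destruct (c3 _ _ _ Hr1 Y1) as (i1&Hi1&K1), (c3 _ _ _ Hr2 Y2) as (i2&Hi2&K2).
 apply Yn_eq in Y1 as [G1 (_&C1&C1s)], Y2 as [G2 (_&C2&C2s)].
 assert (Hb1N : ⌊b1⌋ ∈ FB) by (rewrite <- (inj_FB TV);exact Hb1). assert (Hb2N : ⌊b2⌋ ∈ FB) by (rewrite <- (inj_FB TV);exact Hb2).
 apply in_FB in Hb1N as (_&_&m1&Hm1&B1), Hb2N as (_&_&m2&Hm2&B2).
 destruct (ord_max ord_om Hi1 Hi2) as (j1&Hj1&J1&J2), (ord_max ord_om Hm1 Hm2) as (j2&Hj2&J3&J4), (ord_max ord_om Hj1 Hj2) as (n0&Hn0&J5&J6).
 destruct (c1 n0 Hn0) as (s&n&b&H1&H2&H3&H4&H5&H6&H7&H8&H9&H10&H11&H12&H13).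
 assert (lower : forall i : N, i ∈ om -> subset i n0 -> i ∈ n).
 { intros i Hi' Si. destruct (ord_sub (om_ord Hi') (om_ord Hn0) Si) as [E|E];[exact (proj1 (om_ord H4) n0 H5 i E)|now subst]. }
 assert (KK1 := K1 n H4 (lower i1 Hi1 (subT J1 J5))). assert (KK2 := K2 n H4 (lower i2 Hi2 (subT J2 J5))).
 pose proof (Fa n H4) as HFn. apply in_Ha0 in HFn as [HFh (t&Ht&Et)]. rewrite Et in HFh. destruct (hh_cpl Ht HFh) as (p0&Hp0&Gp0&Hh0).
 rewrite <- (inj_FB TV) in H7. apply (in_inj TV) in H7 as (b'&<-&Hb').
 assert (Ini : forall bb m, init ⌊bb⌋ C -> (forall s, s ∈ ⌊bb⌋ -> subset s m) -> subset m n0 -> init bb b').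
 { intros bb m [X1 X2] X3 X4. apply (inj_init TV). split;[intros u Hu;apply H11;[now apply X1|exact (subT (X3 u Hu) X4)]|].
 intros u Hu. apply X2. now apply H9. }
 assert (cv : forall bb tt, (forall s, s ∈ C -> s ∈ ⌊bb⌋ \/ s ∈ img ⌊tt⌋ g) -> forall s, s ∈ b' -> s ∈ bb \/ ⌊s⌋ ∈ img ⌊tt⌋ g).
 { intros bb tt X u Hu. exact (X ⌊u⌋ (proj1 H9 _ Hu)). }
 destruct (@leT_cpl b1 b' t1 t p0 p1) as (q1&Gq1&Sq1&L1);trivial.
 { exact (Ini b1 m1 C1 B1 (subT J3 J6)). } { now apply cv. } { intros u Hu _. apply KK1. now rewrite Et. }
 destruct (@leT_cpl b2 b' t2 t q1 p2) as (q2&Gq2&Sq2&L2);trivial.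
 { exact (Ini b2 m2 C2 B2 (subT J4 J6)). } { now apply cv. } { intros u Hu _. apply KK2. now rewrite Et. }
 exists (tpl q2 b' t). sp.
 - apply in_TT. spa;[now apply g_coll|]. apply (hh_mono (p := p0));trivial;[now apply g_coll|exact (subT Sq1 Sq2)].
 - apply Yn_eq. spt. now rewrite <- Et.
 - apply L1;trivial. now apply g_coll.
 - apply L2;[now apply g_coll|apply sub_refl]. }
spt. split;[|split;[|split;[|split]]].
- intros u Hu. apply in_yC0 in Hu as (r&Hr&->&_). apply inj_mem, in_QT. now exists r.
- rewrite EA in HAh. destruct (hh_cpl HtA HAh) as (p0&Hp0&Gp0&Hh0). pose proof HaB as HaB'. rewrite <- (inj_FB TV) in HaB'. apply (in_inj TV) in HaB' as (a'&Ea&Ha').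
 exists ⌊UT (tpl p0 a' tA)⌋. apply in_yC;[now apply in_TT|]. apply Yn_eq. spt. rewrite Ea, <- EA. spt. spt.
 intros s Hs. destruct (Cs s Hs);auto.
- intros u w Hw Hu Sw. apply in_yC0 in Hu as (r&Hr&->&HY). apply (in_inj TV) in Hw as (w'&<-&Hw). apply in_QT in Hw as (r'&Hr'&->).
 apply in_yC;trivial. apply (leT_snd (r' := r));trivial. apply UT_le;trivial. now apply (inj_sub TV).
- intros u w Hu Hw. apply in_yC0 in Hu as (r1&Hr1&->&Y1), Hw as (r2&Hr2&->&Y2). destruct (dirT r1 r2 Hr1 Hr2 Y1 Y2) as (r3&Hr3&Y3&L1&L2).
 exists ⌊UT r3⌋. split;[now apply in_yC|]. rewrite !(inj_sub TV), !UT_le by trivial. now split.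
- intros E [ES ED]. destruct (Se1 ⌊E⌋) as (i&Hi'&Ei);[now apply inj_mem, in_pow|].
 destruct (c1 i Hi') as (s&n&b&H1&H2&H3&H4&H5&H6&H7&H8&H9&H10&H11&H12&H13).
 assert (Ex : exists m : N, m ∈ om /\ n = succ m).
 { assert (Nn : n <> emp) by (intros ->;now apply in_emp in H5). clear - H4 Nn ZN. revert Nn. revert n H4.
 apply (om_ind (P := fun n => n <> emp -> exists m, m ∈ om /\ n = succ m));[def|tauto|]. intros n Hn _ _. now exists n. }
 (* With n = m+1 > i the stem has its blocks inside m+2 and i is at most m, exactly what step m of
    the fusion has treated. *)
 destruct Ex as (m&Hm&->). destruct (Fs m Hm) as (_&Q&_).
 destruct (Q i H5 b) with (C := C) as (r&Hr&HrE&HY);trivial.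
 { apply HBn. now split. }
 { rewrite Ei. intros p Hp. apply (in_inj TV) in Hp as (p'&<-&Hp). destruct (ED p' Hp) as (q&Hq&Sq). exists ⌊q⌋. spt. now apply (inj_sub TV). }
 apply (in_inj TV) in Hr as (r'&<-&Hr). rewrite ap_UT, Ei in HrE by trivial. exists (UT r'). split;[exact HrE|]. now apply in_yC.
Qed.

(** After fusion for [X], a condition of [X] compatible with C can be replaced by one that depends
    only on its stem, so membership in [Xp] becomes hitting the set [U] of stems; the open Ramsey
    theorem in N finishes. *)
Lemma mathias_ramsey X Xp a A : subset X TT -> (forall r r', r ∈ X -> r' ∈ TT -> leT r' r -> r' ∈ X) ->
 (forall C r, gen QT (yC C) -> infb C -> r ∈ TT -> Yn C ⌊r⌋ -> (C ∈ Xp <-> exists r, r ∈ X /\ Yn C ⌊r⌋)) ->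
 a ∈ FB -> A ∈ Ha -> exists B, B ∈ Hh /\ subset B A /\ ((forall C, Box a B C -> C ∈ Xp) \/ (forall C, Box a B C -> ~ C ∈ Xp)).
Proof.
intros XT Xle HX HaB HA. destruct (step_alpha X HaB HA) as (A1&HA1&SA1&P).
destruct (generic_boxes HaB HA1) as (B&HB&SB&HGen).
pose (U := sep FB (fun b : N => opair b A1 ∈ DS X)).
assert (HU : forall b : N, b ∈ U <-> b ∈ FB /\ opair b A1 ∈ DS X) by (intro b;unfold U;rewrite in_sep by def;reflexivity).
pose proof HA1 as HA1'. apply in_Ha0 in HA1' as [HA1h (t1&Ht1&E1)]. rewrite E1 in HA1h. destruct (hh_cpl Ht1 HA1h) as (p1&Hp1&Gp1&Hh1).
pose proof HaB as Ha'. rewrite <- (inj_FB TV) in Ha'. apply (in_inj TV) in Ha' as (a'&Ea&Ha').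
assert (Hr1 : tpl p1 a' t1 ∈ TT) by now apply in_TT.
assert (KX : forall C, Box a B C -> (C ∈ Xp <-> hit U a C)).
{ intros C HBx. destruct (HGen C HBx) as [Gen dirT]. pose proof HBx as (Ci&Ca&Cs).
 assert (Y1 : Yn C ⌊tpl p1 a' t1⌋).
 { apply Yn_eq. spt. rewrite Ea, <- E1. spt. spt. intros s Hs. destruct (Cs s Hs);auto. }
 rewrite (HX C (tpl p1 a' t1)) by trivial. split.
 (* The given condition and the one with stem [a] and side set A1 have a common extension, still in
    [X]; its stem then belongs to [U] because A1 decides it. *)
 - intros (r&Hr&HY). destruct (dirT r (tpl p1 a' t1)) as (r3&Hr3&Y3&L&L1);trivial;[now apply XT|].
 assert (HrX := Xle r r3 Hr Hr3 L). pose proof Hr3 as Hr3'. apply TT_inv in Hr3' as (p3&b3&t3&->&Hp3&Hb3&Ht3&Hh3).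
 apply Yn_eq in Y3 as [G3 (_&C3&C3s)]. destruct (leT_sem L1 G3) as [M1 M2]. rewrite leT_eq in L1. destruct L1 as (_&I3&_).
 assert (Hb3N : ⌊b3⌋ ∈ FB) by (rewrite <- (inj_FB TV);exact Hb3). assert (I3N : init a ⌊b3⌋) by (rewrite <- Ea;now apply (inj_init TV)).
 exists ⌊b3⌋. split;[|now split]. apply HU. spt.
 assert (HA3h := hh_snd Ht3 G3 Hh3). assert (HA3 : img ⌊t3⌋ g ∈ Ha) by (apply in_Ha0;spt;now exists t3).
 apply (P ⌊b3⌋ (img ⌊t3⌋ g));trivial.
 + destruct (classic (⌊b3⌋ = a)) as [Q|Q];[now left|]. destruct (last_ex Hb3N I3N Q) as (s&Hs&Ns&Ls). right. exists s. spa.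
 apply SB. destruct (Cs s (proj1 C3 s Hs));tauto.
 + intros s Hs. apply in_tl in Hs as [Hs Hbs]. assert (HsF := HF HA3h Hs). rewrite <- (inj_FIN TV) in HsF. apply (in_inj TV) in HsF as (s'&<-&_).
 rewrite E1. apply M1;trivial. now apply (inj_bey TV).
 + apply in_DS. spt. spt. exists ⌊p3⌋, ⌊t3⌋. spa. rewrite <- !(inj_opair TV). exact HrX.
 - intros (b&Hb&I1&I2). apply HU in Hb as [Hb HD]. apply in_DS in HD as (_&_&p&t&Hp&Ht&Hin&Ht').
 destruct (gen_lift TV HGa Hp) as (p'&<-&_). apply (in_inj TV) in Ht as (t'&<-&Ht).
 rewrite <- (inj_FB TV) in Hb. apply (in_inj TV) in Hb as (b'&<-&Hb). rewrite <- !(inj_opair TV) in Hin. change (tpl p' b' t' ∈ X) in Hin.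
 exists (tpl p' b' t'). spt. apply Yn_eq. spt. spt. spt.
 intros s Hs. destruct (proj2 I2 s Hs) as [|Hbs];[now left|]. right. apply Ht';trivial. destruct (Cs s Hs) as [Q|Q];[|now apply SB].
 exfalso. exact (lt_irr (proj1 Ci s Hs) (Hbs s (proj1 I1 s Q))). }
assert (SU : subset U FB) by (intros b Hb;now apply HU in Hb).
destruct (open_ramsey ACN HF HT HC HS HaB SU HB) as (B'&HB'&SB'&Dich).
assert (sub : forall C, Box a B' C -> Box a B C).
{ intros C (X1&X2&X3). spt. spt. intros s Hs. destruct (X3 s Hs);auto. }
exists B'. spt. split;[exact (subT SB' (subT SB SA1))|].
destruct Dich as [D|D];[left|right];intros C HBx;rewrite (KX C (sub C HBx));now apply D.
Qed.
End Mathias.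

(** * The Ramsey property of sets in the model of values *)

Section SolovayRamsey.
Context {N : structure} {V : N -> Prop} {ZN : ZFm N} {ZV : ZFm (restrict V)}.
Notation VS := (restrict V).
Notation "'⌊' x '⌋'" := (@inj N V x).
Hypothesis TV : transitive_class V.
Hypothesis ACN : ax_choice N.
Hypothesis ACV : ax_choice VS.
Variables (k : VS) (G : N).
Hypothesis Hk : Mahlo k.
Hypothesis hG : collapse_generic k G.
Hypothesis hN : forall x : N, exists t : N, V t /\ is_val G t x.
Notation K := (Vr k).
Let Hi : inaccessible k := k_inacc Hk.
Notation SN := (SN TV ACN ACV Hk hG hN).
Notation SW := (SW TV ACN ACV Hk hG hN).

(** [Xp] is the value of a name at a stage reached from all large collapse stages. Over the stage of
    a generic C of the iteration, both C and [Xp] have names, so the conditions forcing membership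
    form the set [X] required by [mathias_ramsey]. *)
Lemma solovay_ramsey Hh Xp a A :
 (forall S, S ∈ Hh -> subset S FIN) ->
 (forall S b, S ∈ Hh -> b ∈ FB -> tl S b ∈ Hh) ->
 (forall Y S, S ∈ Hh -> exists S', S' ∈ Hh /\ subset S' S /\ ((forall s, s ∈ S' -> s ∈ Y) \/ (forall s, s ∈ S' -> ~ s ∈ Y))) ->
 (forall F, is_fun F om Hh -> (forall n, n ∈ om -> subset (ap F (succ n)) (ap F n)) ->
 exists S, S ∈ Hh /\ subset S (ap F emp) /\ diag F S) ->
 (forall S b, S ∈ Hh -> b ∈ FB -> exists C, Box b S C) ->
 SW Xp -> a ∈ FB -> A ∈ Hh ->
 exists B, B ∈ Hh /\ subset B A /\ ((forall C, Box a B C -> C ∈ Xp) \/ (forall C, Box a B C -> ~ C ∈ Xp)).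
Proof.
intros HF HT HC HS HI HX Ha HA. pose proof HX as (t'&z'&Hz'&EX).
destruct (stage_image TV ACV Hk hG hN Hz') as (b&s&Hb&Hs&Hact).
destruct (@small_image N V ZN ZV TV ACV k G Hk hG hN Z1 A (Z1_K Hk) (FIN_Z1 TV (HF A HA))) as (bA&rA&HbA&HrA&EA).
(* Taking alpha beyond both bounds makes the stage of [Xp] an image of the stage of alpha and puts A
   into the trace of the coideal. *)
destruct (ord_max (k_ord Hk) Hb HbA) as (g0&Hg0&S1&S2).
destruct (setup TV ACV Hk hG hN Hh Hg0) as (al&Hal&NS&hh&H). cbv zeta in H.
destruct H as (Hga&NS_K&NS_sub&hh_def&NS_in&nmE&hh_mono&hh_snd&hh_cpl&refl).
assert (Oal : ordinal al) by exact (ord_mem (k_ord Hk) Hal).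
set (g := Gb G al). assert (HGa := gen_Gb TV Hk hG (small_in Hk Hal)).
set (T := TT al NS hh). set (U := UT al NS hh). set (Q := QT al NS hh).
pose proof (UT_def al NS hh) as HU. pose proof (leT_def al) as Hle.
(* The relation through which the generic of the collapse below alpha is read off from the generic
   of the iteration; [rC] below does the same for C. *)
pose (rg := sep (prod (coll al) Q) (fun z => exists r, r ∈ T /\ psnd z = U r /\ subset (pfst z) (pfst r))).
assert (Hrg : forall p u, opair p u ∈ rg <-> p ∈ coll al /\ exists r, r ∈ T /\ u = U r /\ subset p (pfst r)).
{ intros p u. unfold rg. rewrite in_sep by (unfold U;def). rewrite in_prod2, pfst_eq, psnd_eq. split;[tauto|].
 intros [A1 (r&Hr&->&Sr)]. split;[spt;apply in_QT;now exists r|now exists r]. }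
pose (rC := sep (prod FIN Q) (fun z => exists r, r ∈ T /\ psnd z = U r /\ pfst z ∈ pfst (psnd r))).
assert (HrC : forall x u, opair x u ∈ rC <-> x ∈ FIN /\ exists r, r ∈ T /\ u = U r /\ x ∈ pfst (psnd r)).
{ intros x u. unfold rC. rewrite in_sep by (unfold U;def). rewrite in_prod2, pfst_eq, psnd_eq. split;[tauto|].
 intros [A1 (r&Hr&->&Sr)]. split;[spt;apply in_QT;now exists r|now exists r]. }
assert (HQK : Q ∈ K) by exact (QT_K Hk Hal NS_K hh_def).
assert (SrC : subset rC (prod FIN Q)) by (intros z Hz;unfold rC in Hz;now apply in_sep in Hz as [Hz _];[|unfold U;def]).
assert (Srg : subset rg (prod (coll al) Q)) by (intros z Hz;unfold rg in Hz;now apply in_sep in Hz as [Hz _];[|unfold U;def]).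
pose (sG := opair (coll al) rg).
assert (HsG : sG ∈ sAr k).
{ apply in_Ar. right. exists (coll al), rg. spa;[now apply (coll_K Hi)|]. apply (K_sub (x := prod (coll al) Q));trivial. apply (K_prod Hi);trivial. now apply (coll_K Hi). }
assert (Hcs : cmp s sG ∈ sAr k) by exact (in_comp (v := sv Hk) Hs HsG).
(* Variable 0 is C, read at the stage of the iteration itself; variable 1 is [Xp], read along the
   composite to the collapse stage of alpha and from there to the stage of its name. *)
pose (aa := fun i : nat => match i with 0 => emp | S _ => cmp s sG end : VS).
pose (tt := fun i : nat => match i with 0 => img_name Hk Q rC | S _ => t' end : VS).
assert (DF : Def1 (fun r => Frc (sv Hk) (fMem 0 1) (opair Q (U r)) aa tt)) by (refine (@Def_app1 _ (fun c => Frc (sv Hk) (fMem 0 1) c aa tt) (fun v => opair Q (U (v 0))) (F_def2 _ _ _ _) _);unfold U;def).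
pose (X := sep T (fun r => Frc (sv Hk) (fMem 0 1) (opair Q (U r)) aa tt)).
assert (HX' : forall r, r ∈ X <-> r ∈ T /\ Frc (sv Hk) (fMem 0 1) (opair Q (U r)) aa tt) by (intro r;unfold X;now rewrite in_sep).
assert (UQ : forall r, r ∈ T -> U r ∈ Q) by (intros r Hr;apply in_QT;now exists r).
assert (cC : forall r, r ∈ T -> opair Q (U r) ∈ sCs k) by (intros r Hr;apply in_Cs;exists Q, (U r);spa;now apply UQ).
apply (@mathias_ramsey N V ZN ZV TV ACN ACV k G Hk hG Hh HF HT HC HS HI al Hal NS hh NS_K NS_sub hh_def nmE hh_mono hh_snd hh_cpl refl X Xp a A);trivial.
- intros r Hr. now apply HX' in Hr.
- intros r r' Hr Hr' L. apply HX' in Hr as [Hr HFr]. apply HX'. spt.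
 apply (F_le (D := sv Hk) (c := opair Q (U r)));[exact (cC r' Hr')| |trivial]. cbn [le sv]. rewrite !pfst_eq, !psnd_eq. spa;[|now apply UQ|now apply UQ].
 now apply UT_le.
- intros C r0 Gen Ci Hr0 Y0.
 assert (yE : forall r, r ∈ T -> (⌊U r⌋ ∈ yC G al NS hh C <-> Yn G al C ⌊r⌋)) by (intros r Hr;now apply (in_yC TV Hk hG Hal hh_def)).
 pose proof Hr0 as Hr0'. apply (TT_inv hh_def) in Hr0' as (p0&b0&t0&->&Hp0&Hb0&Ht0&Hh0). pose proof Y0 as Y0'. apply (Yn_eq TV) in Y0' as [Gp0 (_&C0&C0s)].
 set (yc := yC G al NS hh C) in *.
 assert (Eg : img ⌊rg⌋ yc = g).
 { apply ext. intro p. rewrite in_img. split.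
 - intros (u&Hu&Hin). destruct (pinj TV Hin eq_refl) as (p'&u'&<-&<-&Hin'). apply Hrg in Hin' as [Hp' (r&Hr&->&Sr)].
 apply yE in Hu;trivial. apply (TT_inv hh_def) in Hr as (p&b1&t1&->&_). apply (Yn_eq TV) in Hu as [Gp _]. unfold tpl in Sr. rewrite pfst_eq in Sr.
 exact (gen_up TV HGa Hp' Gp Sr).
 - intro Hp. destruct (gen_lift TV HGa Hp) as (p'&<-&Hp'). destruct (gen_dir TV HGa Hp Gp0) as (p1&Hp1&Gp1&Q1&Q2).
 assert (Hr1 : tpl p1 b0 t0 ∈ T) by (apply (in_TT al NS hh_def);spa;exact (hh_mono _ _ _ Hp1 Q2 Hh0)).
 exists ⌊U (tpl p1 b0 t0)⌋. split;[apply yE;trivial;apply (Yn_eq TV);spt;now split|].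
 apply (opinj TV), Hrg. spt. exists (tpl p1 b0 t0). spa. unfold tpl. now rewrite pfst_eq. }
 assert (EC : img ⌊rC⌋ yc = C).
 { apply ext. intro x. rewrite in_img. split.
 - intros (u&Hu&Hin). destruct (pinj TV Hin eq_refl) as (x'&u'&<-&<-&Hin'). apply HrC in Hin' as [Hx' (r&Hr&->&Hxr)].
 apply yE in Hu;trivial. apply (TT_inv hh_def) in Hr as (p&b1&t1&->&_). apply (Yn_eq TV) in Hu as [_ (_&Cb&_)]. unfold tpl in Hxr. rewrite psnd_eq, pfst_eq in Hxr.
 apply Cb. exact Hxr.
 - intro Hx. assert (HxF : x ∈ FIN) by now apply Ci. pose proof HxF as HxF'. apply in_FIN in HxF' as [_ (n0&Hn0&Sx)].
 assert (Hb0N : ⌊b0⌋ ∈ FB) by (rewrite <- (inj_FB TV);exact Hb0).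
 destruct (cut Ci Hb0N C0 Hn0) as (s1&n&b1&H1&H2&H3&H4&H5&H6&H7&H8&H9&H10&H11&H12&H13).
 assert (Hxb := H11 x Hx Sx). rewrite <- (inj_FB TV) in H7. apply (in_inj TV) in H7 as (b'&<-&Hb'). rewrite <- (inj_FIN TV) in HxF. apply (in_inj TV) in HxF as (x'&<-&HxF).
 assert (Hr1 : tpl p0 b' t0 ∈ T) by now apply (in_TT al NS hh_def).
 exists ⌊U (tpl p0 b' t0)⌋. split.
 + apply yE;trivial. apply (Yn_eq TV). spt. spt. spt. intros u Hu. destruct (C0s u Hu) as [E|E];[left;now apply H8|now right].
 + apply (opinj TV), HrC. spt. exists (tpl p0 b' t0). spa. unfold tpl. rewrite psnd_eq, pfst_eq. exact Hxb. }
 assert (HSy : opair ⌊Q⌋ yc ∈ Sg SN) by (apply (Sg_pair TV);now split).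
 assert (VC := @val_img_name N V ZN ZV TV ACN ACV k G Hk hG hN Q yc FIN rC HQK Gen SrC).
 assert (WC : SW C). { exists (img_name Hk Q rC), (opair ⌊Q⌋ yc). spt. rewrite VC. now rewrite EC. }
 pose (uu := fun i : nat => match i with 0 => exist SW C WC | S _ => exist SW Xp HX end).
 assert (Ain : act SN ⌊cmp s sG⌋ (opair ⌊Q⌋ yc) z').
 { apply (act_comp (n := SN) (s := s) (t := sG) (y := opair ⌊Q⌋ yc) (y1 := opair ⌊coll al⌋ g));trivial.
 - apply (sact_eq TV);trivial. unfold sG. rewrite tq_pair, tr_pair, Eg. now split.
 - apply Hact;trivial. exact (subT S1 (proj1 Oal g0 Hga)). }
 destruct (@truth N V ZN ZV TV (sv Hk) SN (fMem 0 1) (opair ⌊Q⌋ yc) aa tt uu HSy) as [Tr1 Tr2].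
 { intros [|i];cbn [aa tt uu].
 - split;[apply in_Ar;now left|]. exists (opair ⌊Q⌋ yc). split;[exact (act_id (n := SN) HSy)|]. cbn [proj1_sig]. rewrite VC. now rewrite EC.
 - split;[exact Hcs|]. exists z'. split;[exact Ain|exact EX]. }
 split.
 + intro HCX. destruct (Tr2 HCX) as (c&Hc&h&HFc). apply in_Cs in Hc as (Q'&q&->&HQ'&Hq). apply (shold_eq TV) in h as [-> h].
 unfold yc in h. apply (in_yC0 TV) in h as (r&Hr&E&HY). apply inj_inj in E. subst q. exists r. spt. apply HX'. now split.
 + intros (r&Hr&HY). apply HX' in Hr as [Hr HFr]. apply (Tr1 (opair Q (U r)));trivial;[exact (cC r Hr)|]. apply (shold_eq TV). spt. now apply yE.
- apply (in_Ha0 TV). spt.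
 assert (HrA' : subset rA (prod Z1 (coll g0))).
 { intros z Hz. specialize (HrA z Hz). apply in_prod in HrA as (x&p&Hx&Hp&->). apply in_prod2. spt. now apply (coll_mono_set Hk HbA Hg0 S2). }
 exists rA. assert (HrN := NS_in g0 rA Hga HrA'). spt. rewrite EA. exact (img_Gb TV G (NS_sub rA HrN)).
Qed.
End SolovayRamsey.

(** * Vectors and supports *)
Section Vectors.
Context {M : structure} {Z : ZFm M}.
Variables E add e : M.
Hypothesis hE : F2_space E add.
Hypothesis he : hamel_basis E add e.
Implicit Types x y z s t n m u : M.

Definition pl x y := ap add (opair x y).
Lemma plus_eq x y z : plus add x y z <-> opair (opair x y) z ∈ add.
Proof.
unfold plus. split.
- intros (p&Hp&H). apply is_opair_eq in Hp. subst. now apply app_eq.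
- intro H. exists (opair x y). split;[now apply is_opair_eq|now apply app_eq].
Qed.
Lemma plus_pl x y z : plus add x y z <-> x ∈ E /\ y ∈ E /\ z = pl x y.
Proof.
destruct hE as (A&B&_). rewrite plus_eq. split.
- intro H. destruct (A _ H) as (x'&y'&q&z'&Hx&Hy&Hz&Hq&Hp). apply is_opair_eq in Hq, Hp. subst q.
 apply opair_inj in Hp as [Hp <-]. apply opair_inj in Hp as [<- <-]. spt. spt.
 destruct (B x y Hx Hy) as (w&Hw&U). symmetry. apply ap_val;trivial. intros z' H'.
 rewrite <- (U z'), <- (U z);[trivial|now apply plus_eq|now apply plus_eq].
- intros (Hx&Hy&->). destruct (B x y Hx Hy) as (w&Hw&U). assert (Ew : ap add (opair x y) = w).
 { apply ap_val;[now apply plus_eq|]. intros z' H'. symmetry. apply U. now apply plus_eq. }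
 unfold pl. rewrite Ew. now apply plus_eq.
Qed.
Lemma pl_E x y : x ∈ E -> y ∈ E -> pl x y ∈ E.
Proof.
intros Hx Hy. assert (H : plus add x y (pl x y)) by now apply plus_pl. apply plus_eq in H. destruct hE as (A&_).
destruct (A _ H) as (x'&y'&q&z'&_&_&Hz&Hq&Hp). apply is_opair_eq in Hq, Hp. subst. apply opair_inj in Hp as [_ <-]. trivial.
Qed.
Lemma pl_C x y : x ∈ E -> y ∈ E -> pl x y = pl y x.
Proof.
intros Hx Hy. destruct hE as (_&_&C&_). assert (H : plus add y x (pl x y)) by now apply C, plus_pl. now apply plus_pl in H as (_&_&H).
Qed.
Lemma pl_A x y z : x ∈ E -> y ∈ E -> z ∈ E -> pl (pl x y) z = pl x (pl y z).
Proof.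
intros Hx Hy Hz. destruct hE as (_&_&_&A&_). assert (Hxy := pl_E Hx Hy).
assert (H : plus add x (pl y z) (pl (pl x y) z)) by (apply (A x y z (pl x y));now apply plus_pl).
now apply plus_pl in H as (_&_&H).
Qed.
Lemma o_ex : exists o, o ∈ E /\ (forall x, x ∈ E -> pl x o = x) /\ forall x, x ∈ E -> pl x x = o.
Proof.
destruct hE as (_&_&_&_&o&Ho&A&B). exists o. spt. split;intros x Hx.
- specialize (A x Hx). apply plus_pl in A as (_&_&A). now symmetry.
- specialize (B x Hx). apply plus_pl in B as (_&_&B). now symmetry.
Qed.
Definition o := proj1_sig (cid _ o_ex).
Lemma o_E : o ∈ E. Proof. apply (proj2_sig (cid _ o_ex)). Qed.
Lemma pl_o x : x ∈ E -> pl x o = x. Proof. apply (proj2_sig (cid _ o_ex)). Qed.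
Lemma pl_self x : x ∈ E -> pl x x = o. Proof. apply (proj2_sig (cid _ o_ex)). Qed.
Lemma is_zero_eq z : is_zero E add z <-> z = o.
Proof.
unfold is_zero. rewrite plus_pl. split.
- intros (Hz&_&_&H). now rewrite pl_self in H.
- intros ->. pose proof o_E. spa. now rewrite pl_o.
Qed.
Lemma pl_swap x y z w : x ∈ E -> y ∈ E -> z ∈ E -> w ∈ E -> pl (pl x y) (pl z w) = pl (pl x z) (pl y w).
Proof.
intros Hx Hy Hz Hw. rewrite !pl_A by (trivial;now apply pl_E). f_equal. rewrite <- !pl_A by trivial. f_equal. now apply pl_C.
Qed.
Lemma e_fun : is_fun e om E.
Proof. destruct he as [(w&Hw&H) _]. apply is_omega_eq in Hw. now subst. Qed.
Lemma e_E n : n ∈ om -> ap e n ∈ E. Proof. intro Hn. exact (proj1 (fun_ap e_fun Hn)). Qed.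

(** A definable case distinction: of the two sets one is empty and the other the singleton of the
    next partial sum. *)
Definition st s n u := bU (cup (sep (sing (pl u (ap e n))) (fun _ => n ∈ s)) (sep (sing u) (fun _ => ~ n ∈ s))).
Lemma st_def s : DF2 (st s). Proof. unfold st, pl. def. Qed.
Lemma st_in s n u : n ∈ s -> st s n u = pl u (ap e n).
Proof.
intro H. apply ext. intro z. unfold st. rewrite in_bU. split.
- intros (y&Hy&Hz). apply in_cup in Hy as [Hy|Hy];(apply in_sep in Hy as [Hy H'];[|def]);[|tauto]. apply in_sing in Hy. now subst.
- intro Hz. exists (pl u (ap e n)). spt. apply in_cup. left. apply in_sep;[def|]. spt. now apply in_sing.
Qed.
Lemma st_out s n u : ~ n ∈ s -> st s n u = u.
Proof.
intro H. apply ext. intro z. unfold st. rewrite in_bU. split.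
- intros (y&Hy&Hz). apply in_cup in Hy as [Hy|Hy];(apply in_sep in Hy as [Hy H'];[|def]);[tauto|]. apply in_sing in Hy. now subst.
- intro Hz. exists u. spt. apply in_cup. right. apply in_sep;[def|]. spt. now apply in_sing.
Qed.
Definition ps s := om_rec (st s) o.
Lemma ps_def s : DF1 (ps s). Proof. apply DF_om_rec, st_def. Qed.
Lemma ps_0 s : ps s emp = o. Proof. apply om_rec_0. Qed.
Lemma ps_S s n : n ∈ om -> ps s (succ n) = st s n (ps s n). Proof. apply om_rec_S, st_def. Qed.
Lemma st_E s n u : n ∈ om -> u ∈ E -> st s n u ∈ E.
Proof. intros Hn Hu. destruct (classic (n ∈ s)) as [H|H];[rewrite st_in by trivial;apply pl_E;trivial;now apply e_E|now rewrite st_out]. Qed.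
Lemma ps_E s n : n ∈ om -> ps s n ∈ E.
Proof.
pose proof (ps_def s). revert n. apply (om_ind (P := fun n => ps s n ∈ E));[def|rewrite ps_0;apply o_E|]. intros n Hn IH. rewrite ps_S by trivial. now apply st_E.
Qed.
Lemma is_sum_eq s x : is_sum E add e s x <-> exists k, k ∈ om /\ subset s k /\ x = ps s k.
Proof.
pose proof (ps_def s) as Hps. split.
- intros (w&g&k&Hw&Hg&Hk&Sk&G0&GS&Gk). apply is_omega_eq in Hw. subst w. exists k. spt. spt.
 assert (Gap : forall n, n ∈ om -> app g n (ap g n)) by (intros n Hn;apply app_eq;now apply (fun_ap Hg)).
 assert (K : forall n, n ∈ om -> ap g n = ps s n).
 { apply (om_ind (P := fun n => ap g n = ps s n));[def| |].
 - rewrite ps_0. apply is_zero_eq. apply (G0 emp);[intros z Hz;now apply in_emp in Hz|]. apply Gap, om_emp.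
 - intros n Hn IH. rewrite ps_S by trivial. destruct (GS n (succ n) (ap g n) (ap g (succ n)) Hn) as [A B];[now apply is_succ_eq|now apply Gap|now apply Gap, om_succ|].
 destruct (classic (n ∈ s)) as [H|H].
 + destruct (A H) as (b&Hb&Hp). apply app_eq in Hb. rewrite st_in by trivial. apply plus_pl in Hp as (_&_&->). rewrite IH. f_equal.
 pose proof e_fun as He. symmetry. apply ap_fun;trivial. now apply is_fun_eq in He.
 + rewrite st_out, (B H) by trivial. exact IH. }
 apply app_eq in Gk. rewrite <- (K k Hk). symmetry. apply ap_fun;trivial. now apply is_fun_eq in Hg.
- intros (k&Hk&Sk&->). exists om, (lam om (ps s)), k. spa.
 + now apply is_omega_eq.
 + apply lam_fun;trivial. intros n Hn. now apply ps_E.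
 + intros n u Hn Hu. apply app_eq, in_lam2 in Hu as [_ ->];trivial. apply is_zero_eq. assert (n = emp) as ->;[|apply ps_0].
 apply ext. intro z. split;intro Hz;[now apply Hn in Hz|now apply in_emp in Hz].
 + intros n m u w Hn Hm Hu Hw. apply is_succ_eq in Hm. subst m. apply app_eq, in_lam2 in Hu as [_ ->];trivial. apply app_eq, in_lam2 in Hw as [_ ->];trivial.
 rewrite ps_S by trivial. split;intro H.
 * exists (ap e n). split;[apply app_eq;now apply (fun_ap e_fun)|]. rewrite st_in by trivial. apply plus_pl. spa;[now apply ps_E|now apply e_E].
 * now rewrite st_out.
 + apply app_eq, in_lam2;trivial. now split.
Qed.
Lemma ps_const s k n : k ∈ om -> subset s k -> n ∈ om -> subset k n -> ps s n = ps s k.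
Proof.
intros Hk Sk Hn. pose proof (ps_def s). revert n Hn. apply (om_ind (P := fun n => subset k n -> ps s n = ps s k));[def| |].
- intro S. assert (E0 : k = emp) by (apply ext;intro z;split;intro Hz;[now apply S|now apply in_emp in Hz]). now subst.
- intros n Hn IH S. destruct (ord_sub (om_ord Hk) (om_ord (om_succ Hn)) S) as [Q| ->];trivial. apply in_succ in Q.
 assert (Sn : subset k n) by (destruct Q as [Q| ->];[exact (proj1 (om_ord Hn) k Q)|apply sub_refl]).
 rewrite ps_S by trivial. rewrite st_out;[now apply IH|]. intro Hs. exact (mem_irrefl (Sn n (Sk n Hs))).
Qed.
Lemma sum_fun s x y : is_sum E add e s x -> is_sum E add e s y -> x = y.
Proof.
rewrite !is_sum_eq. intros (k&Hk&S&->) (k'&Hk'&S'&->). destruct (ord_max ord_om Hk Hk') as (n&Hn&A&B).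
rewrite <- (ps_const Hk S Hn A). now apply ps_const.
Qed.
Lemma sum_E s x : is_sum E add e s x -> x ∈ E.
Proof. rewrite is_sum_eq. intros (k&Hk&_&->). now apply ps_E. Qed.
Lemma sum_inj s t x : is_sum E add e s x -> is_sum E add e t x -> s = t.
Proof. intros H1 H2. destruct (proj2 he x (sum_E H1)) as (u&_&U). now rewrite <- (U s H1), <- (U t H2). Qed.
Lemma is_sum_def : Def2 (fun s x => is_sum E add e s x).
Proof. unfold is_sum, is_zero, plus. def. Qed.

(** [vec] and [sup] are inverse to each other between bounded sets of naturals and vectors; through
    them the later combinatorics concerns supports only. *)
Definition vec := pf (fun s x => is_sum E add e s x).
Definition sup := pf (fun x s => is_sum E add e s x).
Lemma vec_def : DF1 vec. Proof. apply DF_pf;[intros s x y;apply sum_fun|apply is_sum_def]. Qed.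
Lemma sup_def : DF1 sup. Proof. apply DF_pf;[intros x s t;apply sum_inj|]. pose proof is_sum_def. def. Qed.
Lemma vec_eq s x : is_sum E add e s x -> vec s = x. Proof. intro H. apply pf_eq;[apply sum_fun|trivial]. Qed.
Lemma sup_eq s x : is_sum E add e s x -> sup x = s. Proof. intro H. apply pf_eq;[intros;now apply (sum_inj (x := x))|trivial]. Qed.
Lemma sup_sum x : x ∈ E -> is_sum E add e (sup x) x.
Proof. intro Hx. destruct (proj2 he x Hx) as (s&Hs&_). now rewrite (sup_eq Hs). Qed.
Definition bdd s := exists k, k ∈ om /\ subset s k.
Lemma vec_sum s : bdd s -> is_sum E add e s (vec s).
Proof.
intros (k&Hk&S). assert (H : is_sum E add e s (ps s k)) by (apply is_sum_eq;now exists k). now rewrite (vec_eq H).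
Qed.
Lemma sup_bdd x : x ∈ E -> bdd (sup x).
Proof. intro Hx. assert (H := sup_sum Hx). apply is_sum_eq in H as (k&Hk&S&_). now exists k. Qed.
Lemma vec_E s : bdd s -> vec s ∈ E. Proof. intro H. exact (sum_E (vec_sum H)). Qed.
Lemma sup_vec s : bdd s -> sup (vec s) = s. Proof. intro H. exact (sup_eq (vec_sum H)). Qed.
Lemma vec_sup x : x ∈ E -> vec (sup x) = x. Proof. intro H. exact (vec_eq (sup_sum H)). Qed.
Lemma in_supp_eq n x : x ∈ E -> (in_supp E add e n x <-> n ∈ sup x).
Proof.
intro Hx. split;[intros (s&Hs&Hn);now rewrite (sup_eq Hs)|]. intro Hn. exists (sup x). spt. now apply sup_sum.
Qed.
Lemma sup_o : sup o = emp.
Proof.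
apply sup_eq, is_sum_eq. exists emp. split;[apply om_emp|]. split;[apply sub_refl|]. now rewrite ps_0.
Qed.
Lemma FIN_bdd s : s ∈ FIN -> bdd s. Proof. intro H. now apply in_FIN in H as [_ H]. Qed.
Lemma sup_FIN x : x ∈ E -> x <> o -> sup x ∈ FIN.
Proof.
intros Hx Nx. apply in_FIN. split;[|now apply sup_bdd]. apply NNPP. intro C. apply Nx.
rewrite <- (vec_sup Hx). replace (sup x) with (sup o);[now rewrite (vec_sup o_E)|]. rewrite sup_o. apply ext. intro z. split;intro Hz;[now apply in_emp in Hz|].
exfalso. apply C. now exists z.
Qed.
Lemma sup_ne x : x ∈ E -> sup x ∈ FIN -> x <> o.
Proof. intros Hx H ->. rewrite sup_o in H. apply in_FIN in H as [(m&Hm) _]. now apply in_emp in Hm. Qed.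

(** Symmetric difference, the support of a sum over F_2. *)
Definition sd s t := sep (cup s t) (fun n => ~ (n ∈ s /\ n ∈ t)).
Lemma in_sd s t n : n ∈ sd s t <-> (n ∈ s /\ ~ n ∈ t) \/ (n ∈ t /\ ~ n ∈ s).
Proof. unfold sd. rewrite in_sep by def. rewrite in_cup. destruct (classic (n ∈ s)), (classic (n ∈ t));tauto. Qed.
Lemma ps_add s t n : n ∈ om -> ps (sd s t) n = pl (ps s n) (ps t n).
Proof.
pose proof (ps_def s). pose proof (ps_def t). pose proof (ps_def (sd s t)). revert n. apply (om_ind (P := fun n => ps (sd s t) n = pl (ps s n) (ps t n))).
- unfold pl. def.
- rewrite !ps_0. symmetry. apply pl_o, o_E.
- intros n Hn IH. rewrite !ps_S, IH by trivial. assert (Hs := ps_E s Hn). assert (Ht := ps_E t Hn). assert (Hen := e_E Hn). assert (Hst := pl_E Hs Ht).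
 destruct (classic (n ∈ s)) as [A|A], (classic (n ∈ t)) as [B|B].
 + rewrite (st_in _ A), (st_in _ B), st_out by (rewrite in_sd;tauto). rewrite pl_swap by trivial. rewrite (pl_self Hen). symmetry. now apply pl_o.
 + rewrite (st_in _ A), (st_out _ B), st_in by (rewrite in_sd;tauto). rewrite !pl_A by trivial. f_equal. now apply pl_C.
 + rewrite (st_out _ A), (st_in _ B), st_in by (rewrite in_sd;tauto). now rewrite pl_A.
 + rewrite (st_out _ A), (st_out _ B), st_out by (rewrite in_sd;tauto). trivial.
Qed.
Lemma sup_pl x y : x ∈ E -> y ∈ E -> sup (pl x y) = sd (sup x) (sup y).
Proof.
intros Hx Hy. apply sup_eq. assert (A := sup_sum Hx). assert (B := sup_sum Hy). apply is_sum_eq in A as (k&Hk&S&Ex), B as (k'&Hk'&S'&Ey).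
destruct (ord_max ord_om Hk Hk') as (n&Hn&A&B). apply is_sum_eq. exists n. spt. split.
- intros m Hm. apply in_sd in Hm as [[Hm _]|[Hm _]];auto.
- rewrite ps_add by trivial. now rewrite (ps_const Hk S Hn A), (ps_const Hk' S' Hn B), <- Ex, <- Ey.
Qed.

(** The elements of [FIN] that are unions of members of [T]; for a block set these are the supports
    of the non-zero vectors in the span. *)
Definition Spn T := sep FIN (fun s => forall n, n ∈ s -> exists t, t ∈ T /\ n ∈ t /\ subset t s).
Lemma in_Spn T s : s ∈ Spn T <-> s ∈ FIN /\ forall n, n ∈ s -> exists t, t ∈ T /\ n ∈ t /\ subset t s.
Proof. unfold Spn. rewrite in_sep by def. reflexivity. Qed.
Lemma block_meet T t u n : block T -> t ∈ T -> u ∈ T -> n ∈ t -> n ∈ u -> t = u.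
Proof. intros HB Ht Hu A B. destruct (HB t u Ht Hu) as [|[L|L]];trivial;destruct (mem_irrefl (L n n ltac:(assumption) ltac:(assumption))). Qed.

Lemma span_eq T (P : M -> Prop) x : subset T FIN -> block T -> (forall y, P y <-> y ∈ E /\ sup y ∈ T) ->
 (span E add P x <-> x ∈ E /\ (x = o \/ sup x ∈ Spn T)).
Proof.
intros TF TB HP. pose proof sup_def as Hsup. split.
- intro H. pose (Y0 := sep E (fun x => x = o \/ sup x ∈ Spn T)).
 assert (HY : forall y, y ∈ Y0 <-> y ∈ E /\ (y = o \/ sup y ∈ Spn T)) by (intro y;unfold Y0;rewrite in_sep by def;reflexivity).
 apply HY, H.
 + split;[intros y Hy;now apply HY in Hy|]. split;[intros z Hz;apply is_zero_eq in Hz;subst;apply HY;split;[apply o_E|now left]|].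
 intros y z w Hy Hz Hw. apply HY in Hy as [Hy Sy], Hz as [Hz Sz]. apply plus_pl in Hw as (_&_&->). apply HY. assert (Hp := pl_E Hy Hz). spt.
 destruct Sy as [->|Sy];[rewrite pl_C by (trivial;apply o_E);now rewrite pl_o|]. destruct Sz as [->|Sz];[rewrite pl_o by trivial;now right|].
 destruct (classic (pl y z = o)) as [|Np];[now left|right]. apply in_Spn. split;[now apply sup_FIN|]. rewrite sup_pl by trivial.
 apply in_Spn in Sy as [_ Sy], Sz as [_ Sz].
 (* Members of a block set that meet are equal, so a member of [T] inside s1 that leaves s2 at one
    point is disjoint from s2. *)
 assert (half : forall s1 s2, (forall n, n ∈ s1 -> exists t, t ∈ T /\ n ∈ t /\ subset t s1) -> (forall n, n ∈ s2 -> exists t, t ∈ T /\ n ∈ t /\ subset t s2) ->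
 forall n, n ∈ s1 -> ~ n ∈ s2 -> exists t, t ∈ T /\ n ∈ t /\ forall m, m ∈ t -> m ∈ s1 /\ ~ m ∈ s2).
 { intros s1 s2 K1 K2 n Hn1 Hn2. destruct (K1 n Hn1) as (t&Ht&Hnt&St). exists t. spt. spt. intros m Hm. split;[auto|]. intro Hm2.
 destruct (K2 m Hm2) as (t2&Ht2&Hmt&St2). assert (E1 := block_meet TB Ht Ht2 Hm Hmt). subst. auto. }
 intros n Hn. apply in_sd in Hn as [[A B]|[A B]].
 * destruct (half _ _ Sy Sz n A B) as (t&Ht&Hnt&K). exists t. spt. spt. intros m Hm. apply in_sd. left. auto.
 * destruct (half _ _ Sz Sy n A B) as (t&Ht&Hnt&K). exists t. spt. spt. intros m Hm. apply in_sd. right. auto.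
 + intros y Hy. apply HP in Hy as [Hy Ty]. apply HY. spt. right. apply in_Spn. split;[auto|]. intros n Hn. exists (sup y). spt. spt. apply sub_refl.
- intros [Hx D] Y (YE&Y0&YP) HY. destruct D as [->|D];[apply Y0;now apply is_zero_eq|].
 pose proof vec_def as Hvec.
 (* Induction on a bound for s: when n belongs to s, splitting off the member of [T] that contains n
    leaves a smaller union or nothing. *)
 assert (K : forall n, n ∈ om -> forall s, s ∈ Spn T -> subset s n -> vec s ∈ Y).
 { apply (om_ind (P := fun n => forall s, s ∈ Spn T -> subset s n -> vec s ∈ Y));[def| |].
 - intros s Hs S. apply in_Spn in Hs as [Hs _]. apply in_FIN in Hs as [(m&Hm) _]. apply S in Hm. now apply in_emp in Hm.
 - intros n Hn IH s Hs S. destruct (classic (n ∈ s)) as [Hns|Hns].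
 + pose proof Hs as Hs0. apply in_Spn in Hs as [HsF Hs]. destruct (Hs n Hns) as (t&Ht&Hnt&St).
 pose (s' := sep s (fun m => ~ m ∈ t)). assert (Hs' : forall m, m ∈ s' <-> m ∈ s /\ ~ m ∈ t) by (intro m;unfold s';rewrite in_sep by def;reflexivity).
 assert (Bt := FIN_bdd (TF t Ht)). assert (Yt : vec t ∈ Y) by (apply HY, HP;split;[now apply vec_E|now rewrite sup_vec]).
 assert (Bs' : bdd s') by (destruct (FIN_bdd HsF) as (l&Hl&Sl);exists l;spt;intros m Hm;apply Hs' in Hm as [Hm _];auto).
 assert (Es : s = sd s' t).
 { apply ext. intro m. rewrite in_sd, Hs'. destruct (classic (m ∈ t));split;try tauto. intros _. now apply St. }
 assert (Ev : vec s = pl (vec s') (vec t)).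
 { rewrite <- (vec_sup (x := pl (vec s') (vec t))) by (apply pl_E;now apply vec_E). rewrite sup_pl, !sup_vec by (trivial;now apply vec_E). now rewrite <- Es. }
 destruct (classic (exists m, m ∈ s')) as [Ne|Ne].
 * rewrite Ev. apply (YP (vec s') (vec t));trivial;[|apply plus_pl;spa;now apply vec_E]. apply IH.
 -- apply in_Spn. split;[apply in_FIN;now split|]. intros m Hm. apply Hs' in Hm as [Hm Nm]. destruct (Hs m Hm) as (u&Hu&Hmu&Su). exists u. spt. spt.
 intros j Hj. apply Hs'. split;[auto|]. intro Hjt. assert (E1 := block_meet TB Hu Ht Hj Hjt). rewrite E1 in Hmu. tauto.
 -- intros m Hm. apply Hs' in Hm as [Hm Nm]. specialize (S m Hm). apply in_succ in S as [|E1];trivial. rewrite E1 in Nm. tauto.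
 * assert (E1 : s = t). { apply ext. intro m. split;[|auto]. intro Hm. apply NNPP. intro Q. apply Ne. exists m. now apply Hs'. } now rewrite E1.
 + apply IH;trivial. intros m Hm. specialize (S m Hm). apply in_succ in S as [|E1];trivial. rewrite E1 in Hm. tauto. }
 rewrite <- (vec_sup Hx). destruct (sup_bdd Hx) as (n&Hn&S). now apply (K n).
Qed.
End Vectors.

(** * Block sequences as block sets, and the coideal of supports *)

Section Sequences.
Context {M : structure} {Z : ZFm M}.
Variables E add e : M.
Hypothesis hE : F2_space E add.
Hypothesis he : hamel_basis E add e.
Hypothesis AC : ax_choice M.
Implicit Types x y z s t n m u A B C : M.
Notation sup := (sup E add e).
Notation vec := (vec E add e).
Let sdef : DF1 sup := sup_def hE he.
Let vdef : DF1 vec := vec_def hE he.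

Definition bs d A := is_fun A d E /\ (forall n, n ∈ d -> sup (ap A n) ∈ FIN) /\
 forall m n, m ∈ d -> n ∈ d -> m ∈ n -> lt (sup (ap A m)) (sup (ap A n)).
Lemma bs_E d A n : bs d A -> n ∈ d -> ap A n ∈ E. Proof. intros (H&_) Hn. exact (proj1 (fun_ap H Hn)). Qed.
Lemma bs_app d A n x : bs d A -> (opair n x ∈ A <-> n ∈ d /\ x = ap A n).
Proof.
intros (H&_). split.
- intro Hp. pose proof H as H'. apply is_fun_eq in H' as (P&Q&_). destruct (P _ Hp) as (n'&x'&Hn&Hx&E1). apply opair_inj in E1 as [<- <-].
 spt. symmetry. now apply ap_fun.
- intros [Hn ->]. now apply (fun_ap H).
Qed.
Lemma block_seq_eq d A : block_seq E add e d A <-> bs d A.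
Proof.
split.
- intros (H1&H2&H3). assert (Ap : forall n, n ∈ d -> app A n (ap A n)) by (intros n Hn;apply app_eq;now apply (fun_ap H1)).
 assert (Ex : forall n, n ∈ d -> ap A n ∈ E) by (intros n Hn;now apply (fun_ap H1)). spt. split.
 + intros n Hn. apply (sup_FIN (hE := hE) he);auto. intro E1. apply (H2 n (ap A n) (Ap n Hn)). now apply (is_zero_eq hE).
 + intros m n Hm Hn L i j Hi Hj. apply (H3 m n (ap A m) (ap A n) L (Ap m Hm) (Ap n Hn));apply (in_supp_eq hE he);auto.
- intro H. split;[apply H|]. split.
 + intros n x Hx Zx. apply app_eq in Hx. apply (bs_app n x H) in Hx as [Hn ->]. apply (is_zero_eq hE) in Zx. apply (sup_ne (hE := hE) he (bs_E H Hn));trivial. now apply H.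
 + intros m n x y L Hx Hy. apply app_eq in Hx, Hy. apply (bs_app m x H) in Hx as [Hm ->]. apply (bs_app n y H) in Hy as [Hn ->]. intros i j Hi Hj.
 rewrite (in_supp_eq hE he) in Hi, Hj by now apply (bs_E H). destruct H as (_&_&H). exact (H m n Hm Hn L i j Hi Hj).
Qed.
Lemma inf_block_eq A : inf_block E add e A <-> bs om A.
Proof.
split;[intros (w&Hw&H);apply is_omega_eq in Hw;subst;now apply block_seq_eq|]. intro H. exists om. split;[now apply is_omega_eq|now apply block_seq_eq].
Qed.

Definition TSk A k := sep FIN (fun s => exists n x, ~ n ∈ k /\ opair n x ∈ A /\ s = sup x).
Definition TS A := TSk A emp.
Lemma in_TSk d A k s : bs d A -> (s ∈ TSk A k <-> exists n, n ∈ d /\ ~ n ∈ k /\ s = sup (ap A n)).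
Proof.
intro H. unfold TSk. rewrite in_sep by def. split.
- intros [_ (n&x&Hn&Hp&->)]. apply (bs_app n x H) in Hp as [Hd ->]. now exists n.
- intros (n&Hd&Hn&->). split;[now apply H|]. exists n, (ap A n). spa. now apply (bs_app n _ H).
Qed.
Lemma in_TS d A s : bs d A -> (s ∈ TS A <-> exists n, n ∈ d /\ s = sup (ap A n)).
Proof.
intro H. unfold TS. rewrite (in_TSk _ _ H). split;[intros (n&A1&_&A2);now exists n|]. intros (n&A1&A2). exists n. spa. intro Q. now apply in_emp in Q.
Qed.
Lemma TSk_FIN A k : subset (TSk A k) FIN.
Proof. intros s Hs. unfold TSk in Hs. now apply in_sep in Hs as [Hs _];[|def]. Qed.
Lemma TSk_TS A k : subset (TSk A k) (TS A).
Proof.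
intros s Hs. unfold TS, TSk in *. apply in_sep in Hs as [Hs (n&x&A1&A2)];[|def]. apply in_sep;[def|]. spt. exists n, x. spt. intro Q. now apply in_emp in Q.
Qed.
Lemma TS_block d A : ordinal d -> bs d A -> block (TS A).
Proof.
intros Od H s t Hs Ht. apply (in_TS _ H) in Hs as (m&Hm&->), Ht as (n&Hn&->). destruct (ord_tri (ord_mem Od Hm) (ord_mem Od Hn)) as [L|[->|L]];[right;left|now left|right;right];now apply H.
Qed.
Lemma TSk_block d A k : ordinal d -> bs d A -> block (TSk A k).
Proof. intros Od H s t Hs Ht. apply (TS_block Od H);now apply (@TSk_TS A k). Qed.
Lemma tail_eq d A k y : bs d A -> (tail A k y <-> y ∈ E /\ sup y ∈ TSk A k).
Proof.
intro H. rewrite (in_TSk _ _ H). split.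
- intros (n&Hn&Hy). apply app_eq in Hy. apply (bs_app n y H) in Hy as [Hd ->]. split;[now apply (bs_E H)|now exists n].
- intros [Hy (n&Hd&Hn&E1)]. exists n. spt. apply app_eq, (bs_app n y H). spt.
 rewrite <- (vec_sup hE he Hy), E1. now apply (vec_sup hE he), (bs_E H).
Qed.
Lemma terms_tail A y : terms A y <-> tail A emp y.
Proof. split;[intros (n&H);exists n;spt;intro Q;now apply in_emp in Q|intros (n&_&H);now exists n]. Qed.
Lemma Spn_sub T T' : subset T (Spn T') -> subset (Spn T) (Spn T').
Proof.
intros H s Hs. apply in_Spn in Hs as [HsF Hs]. apply in_Spn. spt. intros n Hn. destruct (Hs n Hn) as (t&Ht&Hnt&St).
apply H, in_Spn in Ht as [_ Ht]. destruct (Ht n Hnt) as (u&Hu&Hnu&Su). exists u. spa. exact (subT Su St).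
Qed.
Lemma sub_Spn T : subset T FIN -> subset T (Spn T).
Proof. intros H s Hs. apply in_Spn. split;[auto|]. intros n Hn. exists s. spa. apply sub_refl. Qed.
Lemma span_tail d A k x : ordinal d -> bs d A -> (span E add (tail A k) x <-> x ∈ E /\ (x = o hE \/ sup x ∈ Spn (TSk A k))).
Proof. intros Od H. apply (span_eq hE he);[apply TSk_FIN|exact (@TSk_block d A k Od H)|]. intro y. now apply (tail_eq _ _ H). Qed.
Lemma span_le_eq d d' A B k l : ordinal d -> ordinal d' -> bs d A -> bs d' B ->
 (span_le E add (tail A k) (tail B l) <-> subset (TSk A k) (Spn (TSk B l))).
Proof.
intros Od Od' HA HB. split.
- intros H s Hs. pose proof Hs as Hs'. apply (in_TSk _ _ HA) in Hs' as (n&Hn&Nk&->). assert (Hx := bs_E HA Hn).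
 assert (Q : span E add (tail B l) (ap A n)).
 { apply H. apply (span_tail _ _ Od HA). spt. right. now apply (sub_Spn (@TSk_FIN A k)). }
 apply (span_tail _ _ Od' HB) in Q as [_ [Q|Q]];trivial. destruct (sup_ne (hE := hE) he Hx (TSk_FIN Hs)). exact Q.
- intros H x Hx. apply (span_tail _ _ Od HA) in Hx as [Hx D]. apply (span_tail _ _ Od' HB). spt. destruct D as [D|D];[now left|right]. now apply (Spn_sub H).
Qed.
Lemma terms_pe A : terms A = tail A emp.
Proof. apply fext. intro y. apply propositional_extensionality, terms_tail. Qed.
Lemma le_eq d d' A B : ordinal d -> ordinal d' -> bs d A -> bs d' B -> (span_le E add (terms A) (terms B) <-> subset (TS A) (Spn (TS B))).
Proof. rewrite !terms_pe. apply span_le_eq. Qed.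

(** Each term starts above the preceding one, so the n-th starts at n or later; this converts bounds
    on indices into bounds on supports. *)
Lemma idx_le A n m : bs om A -> n ∈ om -> m ∈ sup (ap A n) -> subset n m.
Proof.
intros H Hn. revert m. revert n Hn. apply (om_ind (P := fun n => forall m, m ∈ sup (ap A n) -> subset n m));[def|intros m _ z Hz;now apply in_emp in Hz|].
intros n Hn IH m Hm. pose proof H as (_&H1&H2). assert (Hn' := om_succ Hn). destruct (FIN_ne (H1 n Hn)) as (j&Hj&Hjo).
assert (Hjm : j ∈ m) by (apply (H2 n (succ n)) ;trivial;apply in_succ;now right).
assert (Om : ordinal m) by (assert (Q := H1 _ Hn');apply in_FIN in Q as [_ (l&Hl&Sl)];exact (om_ord (om_mem Hl (Sl m Hm)))).
assert (Snj := IH j Hj). intros z Hz. apply in_succ in Hz as [Hz| ->];[exact (proj1 Om j Hjm z (Snj z Hz))|].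
destruct (ord_sub (om_ord Hn) (om_ord Hjo) Snj) as [Q| ->];trivial. exact (proj1 Om j Hjm n Q).
Qed.
Lemma infb_TS A : bs om A -> infb (TS A).
Proof.
intro H. split;[apply TSk_FIN|]. split;[exact (TS_block ord_om H)|]. intros n Hn. exists (sup (ap A (succ n))). assert (Hn' := om_succ Hn). split;[apply (in_TS _ H);now exists (succ n)|].
intros m Hm. apply (idx_le H Hn' Hm). apply in_succ. now right.
Qed.
Lemma om_case n : n ∈ om -> n = emp \/ exists m, m ∈ om /\ n = succ m.
Proof. revert n. apply (om_ind (P := fun n => n = emp \/ exists m, m ∈ om /\ n = succ m));[def|now left|]. intros n Hn _. right. now exists n. Qed.
Lemma ord_succ_emp n : n ∈ om -> emp ∈ succ n.
Proof. intro Hn. destruct (ord_tri ord_emp (om_ord (om_succ Hn))) as [|[Q|Q]];trivial;[|now apply in_emp in Q]. exfalso. apply (@in_emp M Z n). rewrite Q. apply in_succ. now right. Qed.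
Lemma TS_FB n A : n ∈ om -> bs n A -> TS A ∈ FB.
Proof.
intros Hn H. apply in_FB. split;[apply TSk_FIN|]. split;[exact (TS_block (om_ord Hn) H)|]. destruct (om_case Hn) as [->|(m&Hm&->)].
- exists emp. spt. intros s Hs. apply (in_TS _ H) in Hs as (i&Hi&_). now apply in_emp in Hi.
- assert (Hmm : m ∈ succ m) by (apply in_succ;now right). pose proof H as (_&H1&H2). assert (Q := H1 m Hmm). apply in_FIN in Q as [(q&Hq) (l&Hl&Sl)]. exists l. spt.
 intros s Hs. apply (in_TS _ H) in Hs as (i&Hi&->). pose proof Hi as Hi'. apply in_succ in Hi as [Hi| ->];trivial.
 intros j Hj. exact (proj1 (om_ord Hl) q (Sl q Hq) j (H2 i m Hi' Hmm Hi j q Hj Hq)).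
Qed.

Lemma least_block C (P : M -> Prop) : Def1 P -> subset C FIN -> block C -> (exists t, t ∈ C /\ P t) ->
 exists s, s ∈ C /\ P s /\ forall t, t ∈ C -> P t -> t = s \/ lt s t.
Proof.
intros HP CF CB (t0&Ht0&Pt0). destruct (FIN_ne (CF t0 Ht0)) as (m0&Hm0&Hmo).
destruct (ord_least (P := fun m => exists t, t ∈ C /\ P t /\ m ∈ t) (a := m0)) as (m&Om&(s&Hs&Ps&Hms)&Lm);[def|exact (om_ord Hmo)|now exists t0|].
exists s. spa. intros t Ht Pt. destruct (CB s t Hs Ht) as [->|[L|L]];[now left|now right|]. exfalso.
destruct (FIN_ne (CF t Ht)) as (j&Hj&Hjo). assert (Hjm := L j m Hj Hms). destruct (Lm j (om_ord Hjo)) as [->|Q];[now exists t|exact (mem_irrefl Hjm)|exact (mem_asym Q Hjm)].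
Qed.
(** Iterate the immediate successor from the least block. A block bounded by l is reached before
    index l, since the l-th block starts at l or later. *)
Lemma enum C : infb C -> exists A, bs om A /\ TS A = C.
Proof.
intros (CF&CB&CI). destruct (@least_block C (fun _ => True)) as (s0&Hs0&_&L0);trivial;[def|destruct (CI emp om_emp) as (s&Hs&_);now exists s|].
destruct (@DC M Z AC (fun n s s' => lt s s' /\ forall t, t ∈ C -> lt s t -> t = s' \/ lt s' t) C s0) as (f&Hf&f0&fS);trivial;[def| |].
{ intros n s Hn Hs. destruct (@least_block C (fun t => lt s t)) as (s'&Hs'&L&LL);trivial;[def| |exists s';now split].
 assert (Q := CF s Hs). apply in_FIN in Q as [_ (l&Hl&Sl)]. destruct (CI l Hl) as (t&Ht&K). exists t. spt. intros i j Hi Hj.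
 assert (Oj : ordinal j) by (assert (Q := CF t Ht);apply in_FIN in Q as [_ (l'&Hl'&Sl')];exact (om_ord (om_mem Hl' (Sl' j Hj)))).
 exact (proj1 Oj l (K j Hj) i (Sl i Hi)). }
assert (fC : forall n, n ∈ om -> ap f n ∈ C) by (intros n Hn;exact (proj1 (fun_ap Hf Hn))).
assert (fF : forall n, n ∈ om -> ap f n ∈ FIN) by auto.
assert (mo : forall n, n ∈ om -> forall m, m ∈ n -> lt (ap f m) (ap f n)).
{ apply (om_ind (P := fun n => forall m, m ∈ n -> lt (ap f m) (ap f n)));[def|intros m Hm;now apply in_emp in Hm|].
 intros n Hn IH m Hm. destruct (fS n Hn) as [L _]. apply in_succ in Hm as [Hm| ->];trivial. exact (lt_trans (fF n Hn) (fF _ (om_succ Hn)) (IH m Hm) L). }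
pose (A := lam om (fun n => vec (ap f n))). assert (HvF : DF1 (fun n => vec (ap f n))) by def.
assert (apA : forall n, n ∈ om -> ap A n = vec (ap f n)) by (intros n Hn;unfold A;now rewrite ap_lam).
assert (sA : forall n, n ∈ om -> sup (ap A n) = ap f n) by (intros n Hn;rewrite apA by trivial;apply (sup_vec hE he), FIN_bdd;auto).
assert (HA : bs om A).
{ split;[apply lam_fun;trivial;intros n Hn;apply (vec_E hE he), FIN_bdd;auto|]. split;[intros n Hn;rewrite sA by trivial;auto|]. intros m n Hm Hn L. rewrite !sA by trivial. now apply mo. }
assert (cov : forall n, n ∈ om -> forall t, t ∈ C -> (exists m, m ∈ om /\ t = ap f m) \/ lt (ap f n) t).
{ apply (om_ind (P := fun n => forall t, t ∈ C -> (exists m, m ∈ om /\ t = ap f m) \/ lt (ap f n) t));[def| |].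
 - intros t Ht. destruct (L0 t Ht I) as [E1|L];[left;exists emp;split;[apply om_emp|now rewrite f0]|right;now rewrite f0].
 - intros n Hn IH t Ht. destruct (IH t Ht) as [|L];[now left|]. destruct (proj2 (fS n Hn) t Ht L) as [E1|L'];[left;exists (succ n);split;[now apply om_succ|trivial]|now right]. }
exists A. spt. apply ext. intro t. rewrite (in_TS _ HA). split.
- intros (n&Hn&->). rewrite sA by trivial. auto.
- intro Ht. assert (Q := CF t Ht). apply in_FIN in Q as [(j&Hj) (l&Hl&Sl)]. destruct (cov l Hl t Ht) as [(m&Hm&E1)|L];[exists m;spt;now rewrite sA|].
 exfalso. destruct (FIN_ne (fF l Hl)) as (q&Hq&Hqo). assert (S1 : subset l q) by (apply (idx_le HA Hl);now rewrite sA).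
 exact (mem_asym (S1 j (Sl j Hj)) (L q j Hq Hj)).
Qed.

(** Induction on i: the i-th support of [a] occurs in C at some index m. With m < i a term of [a]
    would be repeated, and with m > i the i-th term of C would be missing from an initial
    segment. *)
Lemma agree d a C : ordinal d -> subset d om -> bs d a -> bs om C -> init (TS a) (TS C) -> forall i, i ∈ d -> ap a i = ap C i.
Proof.
intros Od Sd Ha HC [I1 I2].
assert (K : forall n, n ∈ om -> forall i, i ∈ n -> i ∈ d -> ap a i = ap C i).
{ apply (om_ind (P := fun n => forall i, i ∈ n -> i ∈ d -> ap a i = ap C i));[def|intros i Hi;now apply in_emp in Hi|].
 intros n Hn IH i Hi Hd. apply in_succ in Hi as [Hi|Ei];[auto|]. rewrite <- Ei in *. clear n Ei. rename Hn into Hio.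
 pose proof Ha as (_&a1&a2). pose proof HC as (_&C1&C2).
 assert (Q : sup (ap a i) ∈ TS C) by (apply I1, (in_TS _ Ha);now exists i). apply (in_TS _ HC) in Q as (m&Hm&Em).
 assert (Low : forall j, j ∈ i -> j ∈ d /\ ap a j = ap C j) by (intros j Hj;assert (j ∈ d) by exact (proj1 Od i Hd j Hj);auto).
 destruct (ord_tri (om_ord Hm) (om_ord Hio)) as [L|[->|L]].
 - exfalso. destruct (Low m L) as [Hmd E1]. assert (Q := a2 m i Hmd Hd L). rewrite E1, <- Em in Q. exact (lt_irr (a1 i Hd) Q).
 - rewrite <- (vec_sup hE he (bs_E Ha Hd)), Em. now apply (vec_sup hE he), (bs_E HC).
 - exfalso. assert (LC := C2 i m Hio Hm L). rewrite <- Em in LC.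
 assert (Q : sup (ap C i) ∈ TS C) by (apply (in_TS _ HC);now exists i). destruct (I2 _ Q) as [Q'|Q'].
 + apply (in_TS _ Ha) in Q' as (l&Hl&El). destruct (ord_tri (ord_mem Od Hl) (om_ord Hio)) as [Li|[->|Li]].
 * destruct (Low l Li) as [_ E1]. rewrite E1 in El. assert (W := C2 l i (Sd l Hl) Hio Li). rewrite <- El in W. exact (lt_irr (C1 i Hio) W).
 * rewrite <- El in LC. exact (lt_irr (C1 i Hio) LC).
 * assert (W := a2 i l Hd Hl Li). rewrite <- El in W. exact (lt_asym (C1 i Hio) (a1 i Hd) LC W).
 + assert (W : lt (sup (ap a i)) (sup (ap C i))) by (apply Q', (in_TS _ Ha);now exists i). exact (lt_asym (C1 i Hio) (a1 i Hd) LC W). }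
intros i Hi. apply (K (succ i));trivial;[apply om_succ;auto|apply in_succ;now right].
Qed.
Lemma TS_inj A C : bs om A -> bs om C -> TS A = TS C -> A = C.
Proof.
intros HA HC E1. assert (K := agree ord_om (sub_refl om) HA HC). rewrite E1 in K. specialize (K (conj (sub_refl _) (fun s Hs => or_introl Hs))).
apply ext. intro p. split;intro Hp.
- pose proof HA as (F&_). apply is_fun_eq in F as (P&_). destruct (P p Hp) as (n&x&Hn&_&->). apply (bs_app n x HA) in Hp as [_ ->]. apply (bs_app n _ HC). spt. now apply K.
- pose proof HC as (F&_). apply is_fun_eq in F as (P&_). destruct (P p Hp) as (n&x&Hn&_&->). apply (bs_app n x HC) in Hp as [_ ->]. apply (bs_app n _ HA). spt. symmetry. now apply K.
Qed.
Lemma initial_eq n a C : n ∈ om -> bs n a -> bs om C -> ((exists n', natural n' /\ is_initial a C n') <-> init (TS a) (TS C)).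
Proof.
intros Hn Ha HC. split.
- intros (n'&Hn'&H).
 assert (In : forall p, p ∈ a <-> p ∈ C /\ exists i x, i ∈ n' /\ p = opair i x).
 { intro p. rewrite (H p). split;intros [A1 (i&x&Hi&Hp)];(split;[trivial|]);exists i, x;(split;[trivial|now apply is_opair_eq]). }
 assert (ag : forall i, i ∈ n -> ap a i = ap C i).
 { intros i Hi. assert (Q : opair i (ap a i) ∈ a) by (apply (bs_app i _ Ha);now split). apply In in Q as [Q _]. now apply (bs_app i _ HC) in Q. }
 split.
 + intros s Hs. apply (in_TS _ Ha) in Hs as (i&Hi&->). apply (in_TS _ HC). exists i. split;[exact (om_mem Hn Hi)|now rewrite ag].
 + intros s Hs. apply (in_TS _ HC) in Hs as (m&Hm&->). destruct (classic (m ∈ n)) as [Hmn|Hmn];[left;apply (in_TS _ Ha);exists m;spt;now rewrite ag|].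
 right. intros t Ht. apply (in_TS _ Ha) in Ht as (i&Hi&->). rewrite ag by trivial. assert (Hio := om_mem Hn Hi). apply HC;trivial.
 destruct (ord_tri (om_ord Hio) (om_ord Hm)) as [|[->|L]];trivial;[tauto|]. destruct Hmn. exact (proj1 (om_ord Hn) i Hi m L).
- intro I. assert (ag := agree (om_ord Hn) (fun i Hi => om_mem Hn Hi) Ha HC I). exists n. split;[now apply natural_eq|]. intro p. split.
 + intro Hp. pose proof Ha as (F&_). apply is_fun_eq in F as (P&_). destruct (P p Hp) as (i&x&Hi&_&->). apply (bs_app i x Ha) in Hp as [_ ->]. split.
 * apply (bs_app i _ HC). split;[exact (om_mem Hn Hi)|now apply ag].
 * exists i, (ap a i). spt. now apply is_opair_eq.
 + intros [Hp (i&x&Hi&E1)]. apply is_opair_eq in E1. subst p. apply (bs_app i x HC) in Hp as [_ ->]. apply (bs_app i _ Ha). spt. now rewrite ag.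
Qed.

Section Coideal.
Variable H : M.
Hypothesis hH : selective_coideal E add e H.
Lemma H_bs A : A ∈ H -> bs om A.
Proof. intro HA. destruct hH as (((K&_)&_)&_). now apply inf_block_eq, K. Qed.
Lemma H_up A B k : A ∈ H -> bs om B -> k ∈ om -> subset (TSk A k) (Spn (TS B)) -> B ∈ H.
Proof.
intros HA HB Hk S. destruct hH as (((_&K)&_)&_). apply (K A B HA);[now apply inf_block_eq|]. exists k. split;[now apply natural_eq|].
rewrite terms_pe. apply (span_le_eq _ _ ord_om ord_om (H_bs HA) HB). exact S.
Qed.
Lemma TS_def : DF1 TS. Proof. unfold TS, TSk. def. Qed.
Lemma Spn_def : DF1 (@Spn M Z). Proof. unfold Spn. def. Qed.
(** The coideal seen on supports: each A in H is replaced by the set of supports of the non-zero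
    vectors of its span. *)
Definition Hh := repl H (fun A => Spn (TS A)).
Lemma in_Hh S : S ∈ Hh <-> exists A, A ∈ H /\ S = Spn (TS A).
Proof. unfold Hh. pose proof TS_def. pose proof Spn_def. rewrite in_repl by def. reflexivity. Qed.
Lemma Hh_F S : S ∈ Hh -> subset S FIN.
Proof. intros HS s Hs. apply in_Hh in HS as (A&_&->). now apply in_Spn in Hs. Qed.
Lemma infb_tl C b : infb C -> b ∈ FB -> infb (tl C b) /\ exists l, l ∈ om /\ forall s, s ∈ C -> (forall m, m ∈ s -> subset l m) -> bey b s.
Proof.
intros (CF&CB&CI) Hb. apply in_FB in Hb as (_&_&l&Hl&Bl).
assert (K : forall s, s ∈ C -> (forall m, m ∈ s -> subset l m) -> bey b s) by (intros s Hs Q t Ht i j Hi Hj;exact (Q j Hj i (Bl t Ht i Hi))).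
split;[|now exists l]. split;[intros s Hs;apply in_tl in Hs as [Hs _];auto|]. split;[intros s t Hs Ht;apply in_tl in Hs as [Hs _], Ht as [Ht _];auto|].
intros n Hn. destruct (ord_max ord_om Hn Hl) as (c&Hc&S1&S2). destruct (CI c Hc) as (s&Hs&Q).
assert (Os : forall m, m ∈ s -> ordinal m) by (intros m Hm;assert (W := CF s Hs);apply in_FIN in W as [_ (l'&Hl'&Sl')];exact (om_ord (om_mem Hl' (Sl' m Hm)))).
exists s. split.
- apply in_tl. spt. apply K;trivial. intros m Hm z Hz. exact (proj1 (Os m Hm) c (Q m Hm) z (S2 z Hz)).
- intros m Hm. destruct (ord_sub (om_ord Hn) (om_ord Hc) S1) as [W| ->];[exact (proj1 (Os m Hm) c (Q m Hm) n W)|auto].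
Qed.
(** A tail of A is below the sequence enumerating the blocks beyond b, and closure of H under
    almost-inclusion upward puts that sequence into H. *)
Lemma Hh_T S b : S ∈ Hh -> b ∈ FB -> tl S b ∈ Hh.
Proof.
intros HS Hb. apply in_Hh in HS as (A&HA&->). assert (BA := H_bs HA). destruct (infb_tl (infb_TS BA) Hb) as (Ci&l&Hl&K). destruct (enum Ci) as (A'&BA'&EA').
apply in_Hh. exists A'. split.
- apply (H_up HA BA' Hl). rewrite EA'. intros s Hs. apply sub_Spn;[intros u Hu;apply in_tl in Hu as [Hu _];now apply TSk_FIN in Hu|].
 apply in_tl. assert (HsT := TSk_TS Hs). spt. apply K;trivial. apply (in_TSk _ _ BA) in Hs as (n&Hn&Nl&->). intros m Hm.
 assert (S1 : subset l n). { destruct (ord_tri (om_ord Hl) (om_ord Hn)) as [L|[->|L]];[exact (proj1 (om_ord Hn) l L)|apply sub_refl|tauto]. }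
 exact (subT S1 (idx_le BA Hn Hm)).
- rewrite EA'. apply ext. intro s. rewrite in_tl, !in_Spn. split.
 + intros [[HsF Hs] Hbs]. spt. intros n Hn. destruct (Hs n Hn) as (t&Ht&Hnt&St). exists t. spa. apply in_tl. spt.
 intros u Hu i j Hi Hj. apply (Hbs u Hu);auto.
 + intros [HsF Hs]. split;[spt|].
 * intros n Hn. destruct (Hs n Hn) as (t&Ht&Hnt&St). apply in_tl in Ht as [Ht _]. now exists t.
 * intros u Hu i j Hi Hj. destruct (Hs j Hj) as (t&Ht&Hjt&_). apply in_tl in Ht as [_ Ht]. now apply (Ht u Hu).
Qed.
Lemma join_infb C b : infb C -> b ∈ FB -> infb (cup b (tl C b)) /\ init b (cup b (tl C b)).
Proof.
intros HC Hb. destruct (infb_tl HC Hb) as ((TF&TB&TI)&_). apply in_FB in Hb as (bF&bB&_).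
assert (I : init b (cup b (tl C b))).
{ split;[intros s Hs;apply in_cup;now left|]. intros s Hs. apply in_cup in Hs as [Hs|Hs];[now left|right;now apply in_tl in Hs]. }
spt. split;[intros s Hs;apply in_cup in Hs as [Hs|Hs];auto|]. split.
- intros s t Hs Ht. apply in_cup in Hs as [Hs|Hs], Ht as [Ht|Ht];auto;[apply in_tl in Ht as [_ Ht];auto|apply in_tl in Hs as [_ Hs];auto].
- intros n Hn. destruct (TI n Hn) as (s&Hs&Q). exists s. spt. apply in_cup. now right.
Qed.
Lemma Hh_I S b : S ∈ Hh -> b ∈ FB -> exists C, Box b S C.
Proof.
intros HS Hb. apply in_Hh in HS as (A&HA&->). destruct (join_infb (infb_TS (H_bs HA)) Hb) as [I1 I2]. exists (cup b (tl (TS A) b)). spt. spt.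
intros s Hs. apply in_cup in Hs as [Hs|Hs];[now left|right]. apply in_tl in Hs as [Hs _]. apply sub_Spn;trivial. apply TSk_FIN.
Qed.
Lemma Hh_C Y S : S ∈ Hh -> exists S', S' ∈ Hh /\ subset S' S /\ ((forall s, s ∈ S' -> s ∈ Y) \/ (forall s, s ∈ S' -> ~ s ∈ Y)).
Proof.
intro HS. apply in_Hh in HS as (A&HA&->). destruct hH as ((_&K)&_).
destruct (K (sep E (fun x => sup x ∈ Y)) A) as (B&HB&L&D);trivial;[intros x Hx;now apply in_sep in Hx as [Hx _];[|def]|].
assert (BB := H_bs HB). exists (Spn (TS B)). split;[apply in_Hh;now exists B|]. split;[apply Spn_sub;now apply (le_eq ord_om ord_om BB (H_bs HA))|].
assert (V : forall s, s ∈ Spn (TS B) -> span E add (terms B) (vec s) /\ ~ is_zero E add (vec s) /\ vec s ∈ E /\ sup (vec s) = s).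
{ intros s Hs. assert (HsF : s ∈ FIN) by now apply in_Spn in Hs. assert (Bs := FIN_bdd HsF). assert (Ev := sup_vec hE he Bs). assert (HvE := vec_E hE he Bs : vec s ∈ E). spa.
 - rewrite terms_pe. apply (span_tail _ _ ord_om BB). spt. right. now rewrite Ev.
 - intro Zv. apply (is_zero_eq hE) in Zv. apply (sup_ne (hE := hE) he HvE);trivial. now rewrite Ev. }
destruct D as [D|D];[left|right];intros s Hs;destruct (V s Hs) as (V1&V2&V3&V4).
- assert (Q := D _ V1 V2). apply in_sep in Q as [_ Q];[|def]. now rewrite V4 in Q.
- intro Hy. apply (D _ V1 V2). apply in_sep;[def|]. now rewrite V4.
Qed.

(* The k-th set handed to selectivity is F(m_k) with m_k in the support of A(k): terms of B beyond
 depth k of A lie in F(m_k), and m_k exceeds every number already used by B. *)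
Lemma Hh_S F : is_fun F om Hh -> (forall n, n ∈ om -> subset (ap F (succ n)) (ap F n)) -> exists S, S ∈ Hh /\ subset S (ap F emp) /\ diag F S.
Proof.
intros HF Fd. pose proof TS_def. pose proof Spn_def.
assert (Fm : forall n, n ∈ om -> forall m, m ∈ n -> subset (ap F n) (ap F m)).
{ apply (om_ind (P := fun n => forall m, m ∈ n -> subset (ap F n) (ap F m)));[def|intros m Hm;now apply in_emp in Hm|].
 intros n Hn IH m Hm. apply in_succ in Hm as [Hm| ->];[|auto]. exact (subT (Fd n Hn) (IH m Hm)). }
destruct (@AC_rel M Z AC (fun n A => ap F n = Spn (TS A)) om H) as (F'&HF'&EF');[def| |].
{ intros n Hn. assert (Q := proj1 (fun_ap HF Hn)). now apply in_Hh in Q as (A&HA&E1);exists A. }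
assert (HFi : forall n, n ∈ om -> ap F' n ∈ H) by (intros n Hn;exact (proj1 (fun_ap HF' Hn))).
set (A := ap F' emp). assert (HA : A ∈ H) by (apply HFi, om_emp). assert (BA := H_bs HA).
destruct (@AC_rel M Z AC (fun k m => m ∈ sup (ap A k)) om om) as (mu&Hmu&Emu);[def| |].
{ intros n Hn. pose proof BA as (_&Q&_). destruct (FIN_ne (Q n Hn)) as (j&Hj&Hjo). now exists j. }
assert (muo : forall n, n ∈ om -> ap mu n ∈ om) by (intros n Hn;exact (proj1 (fun_ap Hmu Hn))).
pose (F2 := lam om (fun k => ap F' (ap mu k))). assert (DF2' : DF1 (fun k => ap F' (ap mu k))) by def.
assert (F2a : forall k C, app F2 k C <-> k ∈ om /\ C = ap F' (ap mu k)) by (intros k C;rewrite app_eq;unfold F2;now rewrite in_lam2).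
assert (leF : forall n m, n ∈ om -> m ∈ om -> subset (ap F n) (ap F m) -> span_le E add (terms (ap F' n)) (terms (ap F' m))).
{ intros n m Hn Hm S. apply (le_eq ord_om ord_om (H_bs (HFi n Hn)) (H_bs (HFi m Hm))). intros s Hs. rewrite <- EF' by trivial. apply S. rewrite EF' by trivial. apply sub_Spn;trivial. apply TSk_FIN. }
destruct hH as (_&Sel). destruct (Sel A F2) as (B&HB&LB&DB);trivial.
{ exists om. split;[now apply is_omega_eq|]. apply lam_fun;trivial. intros k Hk. auto. }
{ intros m n B C L HB HC. apply F2a in HB as [Hm ->], HC as [Hn ->]. apply leF;auto. apply Fm;auto. pose proof BA as (_&_&Q). apply (Q m n Hm Hn L);auto. }
{ intros n B Hn HB. apply F2a in HB as [Hno ->]. apply leF;auto;[apply om_emp|]. destruct (om_case (muo n Hno)) as [->|(j&Hj&Ej)];[apply sub_refl|]. apply Fm;auto.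
 rewrite Ej. apply (ord_succ_emp Hj). }
assert (BB := H_bs HB). exists (Spn (TS B)). split;[apply in_Hh;now exists B|]. split.
{ rewrite EF' by apply om_emp. apply Spn_sub. now apply (le_eq ord_om ord_om BB BA). }
intros s t m Hs Ht L Hm. apply in_Spn in Hs as [HsF Hs], Ht as [HtF Ht]. destruct (Hs m Hm) as (t1&Ht1&Hmt&St1). apply (in_TS _ BB) in Ht1 as (i&Hi&->).
(* This is r_{i+1}(B), which includes the term with m in its support; as s lies before t, the terms
   of B making up t all have index at least i+1. *)
pose (a := sep B (fun p => exists j x, j ∈ succ i /\ p = opair j x)).
assert (Ini : is_initial a B (succ i)).
{ intro p. unfold a. rewrite in_sep by def. split;intros [A1 (j&x&A2&A3)];(split;[trivial|]);exists j, x;(split;[trivial|now apply is_opair_eq]). }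
pose proof BB as (_&B1&B2). assert (Q := B1 i Hi). apply in_FIN in Q as [_ (l&Hl&Sl)].
assert (Hsi : succ i ∈ om) by now apply om_succ.
assert (ta : forall x, terms a x -> x ∈ E /\ subset (sup x) l).
{ intros x (j&Hj). apply app_eq in Hj. unfold a in Hj. apply in_sep in Hj as [Hj (j'&x'&Hji&E1)];[|def]. apply opair_inj in E1 as [<- <-].
 apply (bs_app j x BB) in Hj as [Hjo ->]. split;[now apply (bs_E BB)|]. apply in_succ in Hji as [Hji| ->];trivial.
 intros q Hq. exact (proj1 (om_ord Hl) m (Sl m Hmt) q (B2 j i Hjo Hi Hji q m Hq Hmt)). }
assert (Bey : beyond E add e A a l).
{ split;[now apply natural_eq|]. intros x y Hx Hy. destruct (ta x Hx) as [Hx' Sx]. apply (tail_eq l y BA) in Hy as [Hy' Hy]. apply (in_TSk _ _ BA) in Hy as (n&Hn&Nl&E1).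
 intros p q Hp Hq. rewrite (in_supp_eq hE he) in Hp, Hq by trivial. rewrite E1 in Hq. apply (idx_le BA Hn Hq).
 destruct (ord_tri (om_ord Hl) (om_ord Hn)) as [W|[<-|W]];[exact (proj1 (om_ord Hn) l W p (Sx p Hp))|auto|tauto]. }
destruct (ord_least (P := fun k => beyond E add e A a k) (a := l)) as (k&Ok&Bk&Lk);trivial;[|exact (om_ord Hl)|].
{ pose proof (is_sum_def E add e). unfold beyond, terms, tail, block_lt, in_supp. def. }
assert (Hk : k ∈ om) by (destruct Bk as [Bk _];now apply natural_eq).
assert (W : span_le E add (tail B (succ i)) (terms (ap F' (ap mu k)))).
{ apply (DB (succ i) a k);trivial;[now apply natural_eq| |now apply F2a]. spt. intros c Bc Hc. assert (Oc : ordinal c) by (destruct Bc as [Bc _];apply natural_eq in Bc;exact (om_ord Bc)).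
 destruct (Lk c Oc Bc) as [E1|E1];[rewrite E1 in Hc;exact (mem_irrefl Hc)|exact (mem_asym E1 Hc)]. }
assert (Hmk := muo k Hk). rewrite terms_pe in W. apply (span_le_eq _ _ ord_om ord_om BB (H_bs (HFi _ Hmk))) in W.
apply (Fm (ap mu k) Hmk m).
- destruct Bk as [_ Bk]. apply (Bk (ap B i) (ap A k)).
 + exists i. apply app_eq. unfold a. apply in_sep;[def|]. split;[apply (bs_app i _ BB);now split|]. exists i, (ap B i). spt. apply in_succ. now right.
 + exists k. split;[apply mem_irrefl|]. apply app_eq, (bs_app k _ BA). now split.
 + apply (in_supp_eq hE he);trivial. now apply (bs_E BB).
 + apply (in_supp_eq hE he);[now apply (bs_E BA)|]. now apply Emu.
- rewrite EF' by trivial. apply (Spn_sub W). apply in_Spn. spt. intros q Hq. destruct (Ht q Hq) as (u&Hu&Hqu&Su). exists u. spa.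
 apply (in_TS _ BB) in Hu as (j&Hj&->). apply (in_TSk _ _ BB). exists j. spa. intro Hji.
 assert (Hmq : m ∈ q) by exact (L m q Hm Hq). apply in_succ in Hji as [Hji|Hji].
 + exact (mem_asym Hmq (B2 j i Hj Hi Hji q m Hqu Hmt)).
 + rewrite Hji in Hqu. exact (mem_irrefl (L q q (St1 q Hqu) Hq)).
Qed.
End Coideal.
End Sequences.

(** * From block sequences to block sets inside the model of values *)

Section Transfer.
Context {N : structure} {V : N -> Prop} {ZN : ZFm N} {ZV : ZFm (restrict V)}.
Notation VS := (restrict V).
Notation "'⌊' x '⌋'" := (@inj N V x).
Hypothesis TV : transitive_class V.
Hypothesis ACN : ax_choice N.
Hypothesis ACV : ax_choice VS.
Variables (k : VS) (G : N).
Hypothesis Hk : Mahlo k.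
Hypothesis hG : collapse_generic k G.
Hypothesis hN : forall x : N, exists t : N, V t /\ is_val G t x.
Variables E add e : N.
Hypothesis hE : F2_space E add.
Hypothesis he : hamel_basis E add e.
Notation SW := (SW TV ACN ACV Hk hG hN).
Notation "'⌈' x '⌉'" := (@inj N SW x).
Notation TS := (TS E add e).
Local Instance ZW : ZFm (restrict SW) := SW_ZF TV ACN ACV Hk hG hN.
Let TM : transitive_class SW := @SW_trans N V ZN ZV TV ACN ACV k G Hk hG hN.

Definition blocks_of (X : N) : N := sep (pow FIN) (fun T => exists C, C ∈ X /\ T = TS C).
Lemma in_blocks_of X T : T ∈ blocks_of X <-> exists C, C ∈ X /\ T = TS C.
Proof.
unfold blocks_of. pose proof (TS_def hE he). rewrite in_sep by def. rewrite in_pow. split;[tauto|]. intros (C&HC&->). split;[|now exists C].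
intros s Hs. exact (TSk_FIN hE he Hs).
Qed.
(* The vectors occurring in X, paired with their supports, form a countable subset of a set of
 SW; such sets lie in SW, so the passage from C to its blocks can be computed there. *)
Lemma blocks_of_SW X : (forall A, A ∈ X -> inf_block E add e A) -> SW X -> SW (blocks_of X).
Proof.
intros HX HXW. destruct (inj_lift HXW) as (XM&EX), (inj_lift (SW_V TV ACN ACV Hk hG hN FIN)) as (FM&EF). rewrite (inj_FIN TV) in EF.
destruct (@countable_K N V ZN ZV TV ACV k G Hk hG FIN (FIN_K Hk)) as (e0&He0).
{ intro Q. assert (W : (sing emp : VS) ∈ FIN).
 { apply in_FIN. split;[exists emp;now apply in_sing|]. exists (succ emp). split;[apply om_succ, om_emp|]. intros z Hz. apply in_sing in Hz. subst. apply in_succ. now right. }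
 rewrite Q in W. now apply in_emp in W. }
rewrite (inj_FIN TV) in He0. apply is_surj_eq in He0 as [He0 Se0].
pose (PM := prod FM (bU (bU (bU XM)))).
pose (J := sep ⌈PM⌉ (fun z => is_sum E add e (pfst z) (psnd z))). pose proof (is_sum_def E add e) as Hsum. pose proof (vec_def hE he) as Hvec.
assert (HJ : forall s x, opair s x ∈ J <-> opair s x ∈ ⌈PM⌉ /\ is_sum E add e s x).
{ intros s x. unfold J. rewrite in_sep by def. now rewrite pfst_eq, psnd_eq. }
assert (HJW : SW J).
{ apply (@SW_countable N V ZN ZV TV ACN ACV k G Hk hG hN ⌈PM⌉ J (lam om (fun n => opair (ap e0 n) (vec E add e (ap e0 n))))).
 - apply inj_V.
 - intros z Hz. unfold J in Hz. now apply in_sep in Hz as [Hz _];[|def].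
 - intros u Hu. assert (Hu' : u ∈ ⌈PM⌉) by (unfold J in Hu;now apply in_sep in Hu as [Hu _];[|def]).
 apply (in_inj TM) in Hu' as (u'&<-&Hu'). apply in_prod in Hu' as (s&x&Hs&Hx&->). rewrite (inj_opair TM) in *. apply HJ in Hu as [_ Hu].
 change (⌈s⌉ ∈ ⌈FM⌉) in Hs. rewrite EF in Hs. destruct (Se0 _ Hs) as (n&Hn&En). exists n. spt.
 rewrite ap_lam by (trivial;def). rewrite En. f_equal. exact (vec_eq hE he Hu). }
destruct (inj_lift HJW) as (JM&EJ).
pose (P := fun T : restrict SW => exists C, C ∈ XM /\ forall s, s ∈ FM -> (s ∈ T <-> exists n x, opair n x ∈ C /\ opair s x ∈ JM)).
assert (HP : Def1 P) by (unfold P;def).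
assert (key : forall C s, C ∈ XM -> s ∈ FM -> (⌈s⌉ ∈ TS ⌈C⌉ <-> exists n x, opair n x ∈ C /\ opair s x ∈ JM)).
{ intros C s HC Hs. assert (HC' : ⌈C⌉ ∈ X) by (rewrite <- EX;exact HC). assert (BC := proj1 (inf_block_eq hE he _) (HX _ HC')). split.
 - intro H. apply (in_TS hE he _ BC) in H as (n&Hn&E1). assert (Q : opair n (ap ⌈C⌉ n) ∈ ⌈C⌉) by (apply (bs_app n _ BC);now split).
 destruct (pinj TM Q eq_refl) as (n'&x'&En&Ex&Q'). exists n', x'. spt. apply (opinj TM). rewrite EJ. apply HJ. split.
 + apply (opinj TM). apply in_prod2. spt. apply in_bU. exists (upair n' x'). split;[|apply in_upair;now right].
 apply in_bU. exists (opair n' x'). split;[|unfold opair;apply in_upair;now right]. apply in_bU. now exists C.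
 + rewrite E1, Ex. apply (sup_sum hE he). now apply (bs_E BC).
 - intros (n&x&H1&H2). apply (opinj TM) in H1, H2. rewrite EJ in H2. apply HJ in H2 as [_ H2]. apply (bs_app _ _ BC) in H1 as [Hn Ex].
 apply (in_TS hE he _ BC). exists ⌈n⌉. spt. rewrite <- Ex. symmetry. exact (sup_eq hE he H2). }
assert (E1 : ⌈sep (pow FM) P⌉ = blocks_of X);[|rewrite <- E1;apply inj_V]. symmetry. apply (inj_ext TM).
- intros T HT. apply in_blocks_of in HT as (C&_&->). apply (@SW_countable N V ZN ZV TV ACN ACV k G Hk hG hN FIN (TS C) e0).
 + rewrite <- (inj_FIN TV). apply SW_V.
 + intros s Hs. exact (TSk_FIN hE he Hs).
 + intros s Hs. destruct (Se0 s (TSk_FIN hE he Hs)) as (n&Hn&En). now exists n.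
- intro T. rewrite in_sep by trivial. rewrite in_pow, in_blocks_of. split.
 + intros (C&HC&E2). pose proof HC as HC0. rewrite <- EX in HC. apply (in_inj TM) in HC as (C'&<-&HC). split.
 * intros s Hs. change (⌈s⌉ ∈ ⌈FM⌉). rewrite EF. apply (TSk_FIN hE he (A := ⌈C'⌉) (k := emp)). change (⌈s⌉ ∈ TS ⌈C'⌉). rewrite <- E2. exact Hs.
 * exists C'. spt. intros s Hs. rewrite <- key by trivial. rewrite <- E2. reflexivity.
 + intros [HT (C&HC&H)]. exists ⌈C⌉. split;[rewrite <- EX;exact HC|]. symmetry. apply (inj_ext TM).
 * intros s Hs. assert (HsF := TSk_FIN hE he Hs). rewrite <- EF in HsF. apply (in_inj TM) in HsF as (s'&<-&_). apply inj_V.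
 * intro s. split.
 -- intro Hs. assert (HsF : s ∈ FM) by (change (⌈s⌉ ∈ ⌈FM⌉);rewrite EF;exact (TSk_FIN hE he Hs)). apply H;trivial. now apply key.
 -- intro Hs. apply key;trivial;[now apply HT|]. apply H;trivial. now apply HT.
Qed.
End Transfer.

Theorem theorem1p7 (N : structure) (V : N -> Prop) (kappa : restrict V) (G : N)
 (hkappa : Mahlo kappa)
 (hG : collapse_generic kappa G)
 (hN : is_extension V G)
 (E add e : N)
 (hE : F2_space E add)
 (he : hamel_basis E add e)
 (H X : N)
 (hH : selective_coideal E add e H)
 (hXsub : forall A : N, A ∈ X -> inf_block E add e A)
 (hX : in_LR X) :
 is_Ramsey E add e H X.
Proof.
destruct hN as ((ZN&ACN)&TV&(ZV&ACV)&hval).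
pose (ZN' := ZN : ZFm N). pose (ZV' := ZV : ZFm (restrict V)).
intros A a HA (n&Hn&Ha) Hspan. apply natural_eq in Hn. apply (block_seq_eq hE he) in Ha.
assert (BA := H_bs hE he hH HA). assert (FBa := TS_FB hE he Hn Ha).
assert (HXW := blocks_of_SW hE he hXsub (in_LR_SW TV ACN ACV hkappa hG hval hX)).
destruct (solovay_ramsey (Hh := Hh E add e H) (a := TS E add e a) (A := Spn (TS E add e A))
 (fun S HS z Hz => Hh_F hE he HS Hz) (fun S b => Hh_T hE he ACN hH (S := S) (b := b)) (fun Y S => Hh_C hE he hH Y (S := S))
 (fun F => Hh_S hE he ACN hH (F := F)) (fun S b => Hh_I hE he hH (S := S) (b := b)) HXW FBa) as (S&HS&SS&Dich).
{ apply (in_Hh hE he). now exists A. }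
apply (in_Hh hE he) in HS as (B'&HB'&ES). assert (BB' := H_bs hE he hH HB').
(* The sequence B' need not start with [a]. Its blocks beyond [a], preceded by those of [a], are
   enumerated by B, which is in H because B' is almost below it. *)
destruct (join_infb (infb_TS hE he BB') FBa) as [I1 I2]. destruct (enum hE he ACN I1) as (B&BB&EB).
destruct (infb_tl (infb_TS hE he BB') FBa) as (_&l&Hl&Kl).
assert (HB : B ∈ H).
{ apply (H_up hE he hH HB' BB Hl). intros s Hs. apply sub_Spn;[intros u Hu;exact (TSk_FIN hE he Hu)|]. rewrite EB. apply in_cup. right. apply in_tl.
 assert (HsT := TSk_TS hE he Hs). spt. apply Kl;trivial. apply (in_TSk hE he _ _ BB') in Hs as (i&Hi&Nl&->). intros m Hm.
 assert (S1 : subset l i). { destruct (ord_tri (om_ord Hl) (om_ord Hi)) as [L|[->|L]];[exact (proj1 (om_ord Hi) l L)|apply sub_refl|tauto]. }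
 intros z Hz. exact (idx_le hE he BB' Hi Hm (S1 z Hz)). }
exists B. spt. split.
- split;[now apply (inf_block_eq hE he)|]. split.
 + apply (le_eq hE he ord_om ord_om BB BA). rewrite EB. intros s Hs. apply in_cup in Hs as [Hs|Hs].
 * apply (le_eq hE he (om_ord Hn) ord_om Ha BA) in Hspan. now apply Hspan.
 * apply SS. rewrite ES. apply in_tl in Hs as [Hs _]. apply sub_Spn;trivial. intros u Hu. exact (TSk_FIN hE he Hu).
 + apply (initial_eq hE he Hn Ha BB). now rewrite EB.
(* Blocks of C outside [a] lie beyond [a], so only the part of B that comes from B' can occur in
   them; hence they belong to S. *)
- assert (KC : forall C, in_box E add e a B C -> Box (TS E add e a) S (TS E add e C) /\ (C ∈ X <-> TS E add e C ∈ blocks_of E add e X)).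
 { intros C (C1&C2&C3). apply (inf_block_eq hE he) in C1. apply (initial_eq hE he Hn Ha C1) in C3. apply (le_eq hE he ord_om ord_om C1 BB) in C2. split.
 - split;[now apply (infb_TS hE he)|]. spt. intros s Hs. destruct (proj2 C3 s Hs) as [|Hb];[now left|right]. rewrite ES.
 specialize (C2 s Hs). apply in_Spn in C2 as [HsF C2]. apply in_Spn. spt. intros i Hi. destruct (C2 i Hi) as (t&Ht&Hit&St). exists t. split;[|now split].
 rewrite EB in Ht. apply in_cup in Ht as [Ht|Ht];[|now apply in_tl in Ht]. destruct (mem_irrefl (Hb t Ht i i Hit Hi)).
 - rewrite (in_blocks_of hE he). split;[intro HC;now exists C|]. intros (C'&HC'&E1). assert (BC' := proj1 (inf_block_eq hE he _) (hXsub _ HC')).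
 now rewrite (TS_inj hE he C1 BC' E1). }
 destruct Dich as [D|D];[left|right];intros C HC;destruct (KC C HC) as [K1 K2];rewrite K2;now apply D.
Qed.
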